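(* Let $(L,e)$ be a Nijenhuis operator with a unity on a manifold $\mathsf M^n$ such that $L$ is $\mathrm{gl}$-regular. Let $\mathsf p\in\mathsf M^n$ be an algebraically generic point for $L$ such that $L(\mathsf p)$ has either one real eigenvalue or two complex conjugate eigenvalues. (a) If $L(\mathsf p)$ has a single real eigenvalue $\lambda_0$, then in a neighbourhood of $\mathsf p$ there exists a unique local coordinate system $(u^1,\dots,u^n)$ centred at $\mathsf p$ such that $e=\frac{\partial}{\partial u^1}$ and $$L=\begin{pmatrix} u^1+\lambda_0&&&&& \\ 1&u^1+\lambda_0&&&& \\ -u^3&1&\ddots&&& \\ \vdots&&\ddots&\ddots&& \\ -(n-3)u^{n-1}&&&1&u^1+\lambda_0& \\ -(n-2)u^n&&&&1&u^1+\lambda_0 \end{pmatrix},$$ that is: $L^i_i=u^1+\lambda_0$ for $1\le i\le n$, $L^{i}_{i-1}=1$ for $2\le i\le n$, $L^i_1=-(i-2)u^i$ for $3\le i\le n$, and all other entries vanish. (b) If $L(\mathsf p)$ has two complex conjugate eigenvalues $\mu_0,\bar\mu_0$, $\mu_0=a_0+ib_0$, then, with $n=2s$, in a neighbourhood of $\mathsf p$ there exists a unique local coordinate system $(x^1,y^1,\dots,x^s,y^s)$ centred at $\mathsf p$ such that $e=\frac{\partial}{\partial x^1}$ and $$L=\begin{pmatrix} C^1+\Lambda_0&&&&& \\ I&C^1+\Lambda_0&&&& \\ -C^3&I&\ddots&&& \\ \vdots&&\ddots&\ddots&& \\ -(s-3)C^{s-1}&&&I&C^1+\Lambda_0& \\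 -(s-2)C^s&&&&I&C^1+\Lambda_0 \end{pmatrix},$$ that is, $L$ is an $s\times s$ block matrix of $2\times2$ blocks with diagonal blocks $C^1+\Lambda_0$, blocks $I$ in positions $(i,i-1)$ for $2\le i\le s$, blocks $-(i-2)C^i$ in positions $(i,1)$ for $3\le i\le s$, and all other blocks zero, where $$C^p=\begin{pmatrix} x^p&-y^p \\ y^p&x^p \end{pmatrix}\ (1\le p\le s),\qquad\Lambda_0=\begin{pmatrix} a_0&-b_0 \\ b_0&a_0 \end{pmatrix},\qquad I=\begin{pmatrix} 1&0 \\ 0&1 \end{pmatrix}.$$
   Context: Smooth or real-analytic category. For an operator field (field of endomorphisms of $T\mathsf M^n$) $L$, the Nijenhuis torsion is $\mathcal N_L(\xi,\eta)=[L\xi,L\eta]+L^2[\xi,\eta]-L[L\xi,\eta]-L[\xi,L\eta]$; $L$ is a Nijenhuis operator if $\mathcal N_L=0$. A pair $(L,e)$ is a Nijenhuis operator with a unity if $L$ is Nijenhuis and the vector field $e$ satisfies $\mathcal L_eL=\mathrm{Id}$. A linear operator is $\mathrm{gl}$-regular if each of its (complex) eigenvalues has exactly one Jordan block; an operator field is $\mathrm{gl}$-regular if it is so at every point. A point is algebraically generic for $L$ if the Segre characteristic of $L$ (number of distinct eigenvalues and sizes of the Jordan blocks belonging to each) is constant in a neighbourhood of it. Matrices: $L\frac{\partial}{\partial u^j}=\sum_iL^i_j\frac{\partial}{\partial u^i}$, $i$ = row, $j$ = column. A coordinate system is centred at $\mathsf p$ if all coordinates vanish at $\mathsf p$; uniqueness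 is understood for germs at $\mathsf p$. *)

(* Defs.v *)
From mathcomp Require Import all_boot all_order all_algebra.
From mathcomp Require Import all_classical all_reals all_analysis.
From mathcomp.real_closed Require Import complex.

Set Implicit Arguments.
Unset Strict Implicit.
Unset Printing Implicit Defensive.

Import Order.TTheory GRing.Theory Num.Theory.
Import numFieldNormedType.Exports.

Local Open Scope classical_set_scope.
Local Open Scope ring_scope.

(* The model space of an n-dimensional manifold is 'cV[R]_n, so that operators *)
(* act by A *m v and the first index of a matrix is the row (upper) one.       *)
(* All indices start at 0: the coordinate u^k is the entry of index k-1.       *)

Inductive category := Smooth | RealAnalytic.

Section Regularity.
Context {R : realType} {n : nat}.
Implicit Types (U : set 'cV[R]_n) (f : 'cV[R]_n -> R).

Definition basis_vec (j : 'I_n) : 'cV[R]_n := delta_mx j 0.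

Definition partial (j : 'I_n) f : 'cV[R]_n -> R :=
  fun x => 'D_(basis_vec j) f x.

(* Only used for open U; values of f outside U are then irrelevant. *)
Fixpoint Ck (k : nat) U f : Prop :=
  (forall x, U x -> {for x, continuous f}) /\
  (if k is k'.+1 then
     forall j, (forall x, U x -> derivable f x (basis_vec j)) /\
               Ck k' U (partial j f)
   else True).

Definition power_term (a : ('I_n -> nat) -> R) (h : 'cV[R]_n)
    (alpha : 'I_n -> nat) : R :=
  a alpha * \prod_(i < n) h i 0 ^+ alpha i.

Definition box_sum (t : ('I_n -> nat) -> R) (N : nat) : R :=
  \sum_(alpha : {ffun 'I_n -> 'I_N}) t (fun i => nat_of_ord (alpha i)).

(* f is, near x0, the sum of an absolutely convergent power series in x - x0 *)
Definition analytic_at f (x0 : 'cV[R]_n) : Prop :=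
  exists a : ('I_n -> nat) -> R, \forall x \near x0,
    cvgn (box_sum (fun alpha => `|power_term a (x - x0) alpha|)) /\
    box_sum (power_term a (x - x0)) @ \oo --> f x.

Definition regular (c : category) U f : Prop :=
  match c with
  | Smooth => forall k, Ck k U f
  | RealAnalytic => forall x, U x -> analytic_at f x
  end.

Definition regular_mx (c : category) {m k : nat} U
    (F : 'cV[R]_n -> 'M[R]_(m, k)) : Prop :=
  forall i j, regular c U (fun x => F x i j).

Definition jacobian_mx (F : 'cV[R]_n -> 'cV[R]_n) (x : 'cV[R]_n) : 'M[R]_n :=
  \matrix_(i, j) partial j (fun y => F y i 0) x.

End Regularity.

(* A chart is a homeomorphism from an open set of T onto an open set of R^n;   *)
(* both maps are total functions, with junk values outside these sets.         *)
Record chart (R : realType) (T : topologicalType) (n : nat) := Chart {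
  cdom : set T;
  cmap :> T -> 'cV[R]_n;
  cinv : 'cV[R]_n -> T;
  _ : open cdom;
  _ : open (cmap @` cdom);
  _ : forall q, cdom q -> cinv (cmap q) = q;
  _ : forall q, cdom q -> {for q, continuous cmap};
  _ : forall x, (cmap @` cdom) x -> {for x, continuous cinv}
}.

Definition cimg (R : realType) (T : topologicalType) (n : nat)
  (u : chart R T n) : set 'cV[R]_n := u @` cdom u.

Definition transition (R : realType) (T : topologicalType) (n : nat)
  (u v : chart R T n) : 'cV[R]_n -> 'cV[R]_n := v \o cinv u.

Definition compatible (R : realType) (T : topologicalType) (n : nat)
    (c : category) (u v : chart R T n) : Prop :=
  regular_mx c (u @` (cdom u `&` cdom v)) (transition u v) /\
  regular_mx c (v @` (cdom u `&` cdom v)) (transition v u).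

Record manifold (R : realType) (c : category) (n : nat) := Manifold {
  msp :> topologicalType;
  atlas : set (chart R msp n);
  _ : hausdorff_space msp;
  _ : @second_countable msp;
  _ : forall q : msp, exists2 u, atlas u & cdom u q;
  _ : forall u v, atlas u -> atlas v -> compatible c u v
}.

Section Fields.
Context {R : realType} {c : category} {n : nat}.
Variable M : manifold R c n.

(* Local coordinate systems: the charts of the maximal atlas. *)
Definition coords (u : chart R M n) : Prop :=
  forall v, atlas v -> compatible c u v.

(* A tensor field is given by its components in every local coordinate         *)
(* system, as functions of the coordinates, with the usual transformation law. *)
Record vector_field := VectorField {
  vcomp :> chart R M n -> 'cV[R]_n -> 'cV[R]_n;
  _ : forall u, coords u -> regular_mx c (cimg u) (vcomp u);
  _ : forall u v, coords u -> coords v -> forall q, cdom u q -> cdom v q ->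
      vcomp v (v q) = jacobian_mx (transition u v) (u q) *m vcomp u (u q)
}.

Record operator_field := OperatorField {
  ocomp :> chart R M n -> 'cV[R]_n -> 'M[R]_n;
  _ : forall u, coords u -> regular_mx c (cimg u) (ocomp u);
  _ : forall u v, coords u -> coords v -> forall q, cdom u q -> cdom v q ->
      ocomp v (v q) *m jacobian_mx (transition u v) (u q) =
      jacobian_mx (transition u v) (u q) *m ocomp u (u q)
}.

Definition at_point (L : operator_field) (q : M) (P : 'M[R]_n -> Prop) : Prop :=
  forall u, coords u -> cdom u q -> P (L u (u q)).

End Fields.

Section Nijenhuis.
Context {R : realType} {n : nat}.
Implicit Types (X Y : 'cV[R]_n -> 'cV[R]_n) (A : 'cV[R]_n -> 'M[R]_n).

Definition lie_bracket X Y : 'cV[R]_n -> 'cV[R]_n :=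
  fun x => 'D_(X x) Y x - 'D_(Y x) X x.

Definition op_app A X : 'cV[R]_n -> 'cV[R]_n := fun x => A x *m X x.

Definition nijenhuis_torsion A X Y : 'cV[R]_n -> 'cV[R]_n := fun x =>
  lie_bracket (op_app A X) (op_app A Y) x
  + op_app A (op_app A (lie_bracket X Y)) x
  - op_app A (lie_bracket (op_app A X) Y) x
  - op_app A (lie_bracket X (op_app A Y)) x.

(* (Lie_E A) X, by the Leibniz rule for the Lie derivative *)
Definition lie_derivative_op (E : 'cV[R]_n -> 'cV[R]_n) A X :
    'cV[R]_n -> 'cV[R]_n :=
  fun x => lie_bracket E (op_app A X) x - op_app A (lie_bracket E X) x.

End Nijenhuis.

Section NijenhuisFields.
Context {R : realType} {c : category} {n : nat} {M : manifold R c n}.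

Definition is_nijenhuis (L : operator_field M) : Prop :=
  forall u, coords u -> forall X Y : 'cV[R]_n -> 'cV[R]_n,
  regular_mx c (cimg u) X -> regular_mx c (cimg u) Y ->
  forall x, cimg u x -> nijenhuis_torsion (L u) X Y x = 0.

Definition is_unity (L : operator_field M) (e : vector_field M) : Prop :=
  forall u, coords u -> forall X : 'cV[R]_n -> 'cV[R]_n,
  regular_mx c (cimg u) X ->
  forall x, cimg u x -> lie_derivative_op (e u) (L u) X x = X x.

End NijenhuisFields.

Section Jordan.
Context {R : realType} {n : nat}.
Implicit Type A : 'M[R]_n.

Definition complexify A : 'M[R[i]]_n := map_mx (real_complex R) A.

Definition jordan_block (z : R[i]) (k : nat) : 'M[R[i]]_k :=
  \matrix_(i, j) (if i == j then z else if i.+1 == j :> nat then 1 else 0).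

(* The complexification of A is conjugate to the block diagonal matrix with    *)
(* Jordan blocks of eigenvalues z i and sizes k i.  P and Q are mutually       *)
(* inverse rectangular matrices, which forces \sum_i k i = n.                  *)
Definition jordan_form A (m : nat) (z : 'I_m -> R[i]) (k : 'I_m -> nat) : Prop :=
  (forall i, (0 < k i)%N) /\
  exists (P : 'M[R[i]]_(n, \sum_(i < m) k i))
         (Q : 'M[R[i]]_(\sum_(i < m) k i, n)),
    [/\ P *m Q = 1%:M, Q *m P = 1%:M &
        complexify A = P *m (\mxdiag_(i < m) jordan_block (z i) (k i)) *m Q].

Definition gl_regular A : Prop :=
  exists m (z : 'I_m -> R[i]) (k : 'I_m -> nat), jordan_form A z k /\
  forall w, eigenvalue (complexify A) w -> #|[pred i | z i == w]| = 1%N.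

(* One entry for each distinct eigenvalue: the sorted list of the sizes of     *)
(* the Jordan blocks belonging to it.                                          *)
Definition segre_list (m : nat) (z : 'I_m -> R[i]) (k : 'I_m -> nat) :
    seq (seq nat) :=
  [seq sort geq [seq k i | i <- enum 'I_m & z i == w] | w <- undup (codom z)].

Definition has_segre A (sigma : seq (seq nat)) : Prop :=
  exists m (z : 'I_m -> R[i]) (k : 'I_m -> nat),
    jordan_form A z k /\ perm_eq (segre_list z k) sigma.

Definition has_spectrum A (s : seq R[i]) : Prop :=
  forall w, eigenvalue (complexify A) w = (w \in s).

End Jordan.

Section PointConditions.
Context {R : realType} {c : category} {n : nat} {M : manifold R c n}.

Definition gl_regular_field (L : operator_field M) : Prop :=
  forall q : M, at_point L q gl_regular.

Definition algebraically_generic (L : operator_field M) (p : M) : Prop :=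
  exists sigma, \forall q \near p, at_point L q (has_segre^~ sigma).

End PointConditions.

Section NormalForms.
Context {R : realType} {n : nat}.

Definition d_first : 'cV[R]_n := \col_i (if i == 0%N :> nat then 1 else 0).

(* coordinate number k (from 0), with the default 0 when k >= n *)
Definition coord (x : 'cV[R]_n) (k : nat) : R :=
  if insub k is Some i then x i 0 else 0.

Definition real_normal_form (lambda0 : R) (x : 'cV[R]_n) : 'M[R]_n :=
  \matrix_(i, j)
    if i == j then coord x 0 + lambda0
    else if i == j.+1 :> nat then 1
    else if (j == 0%N :> nat) && (2 <= i)%N then - (i.-1)%:R * coord x i
    else 0.

Definition cblock (a b : R) : 'M[R]_2 :=
  \matrix_(i, j) if i == j then a else if (i < j)%N then - b else b.

(* C^(p+1); the coordinates are ordered as x^1, y^1, x^2, y^2, etc. *)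
Definition Cmx (x : 'cV[R]_n) (p : nat) : 'M[R]_2 :=
  cblock (coord x p.*2) (coord x p.*2.+1).

Definition normal_block (a0 b0 : R) (x : 'cV[R]_n) (p q : nat) : 'M[R]_2 :=
  if p == q then Cmx x 0 + cblock a0 b0
  else if p == q.+1 then 1%:M
  else if (q == 0%N) && (2 <= p)%N then - (p.-1)%:R *: Cmx x p
  else 0.

Definition complex_normal_form (a0 b0 : R) (x : 'cV[R]_n) : 'M[R]_n :=
  \matrix_(i, j)
    normal_block a0 b0 x i./2 j./2 (inord (odd i)) (inord (odd j)).

End NormalForms.

Section NormalCoordinates.
Context {R : realType} {c : category} {n : nat} {M : manifold R c n}.

(* u is a coordinate system near p, centred at p, in which e = d/du^1 and the  *)
(* matrix of L at the point with coordinates x is NF x.                        *)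
Definition normal_coords (L : operator_field M) (e : vector_field M) (p : M)
    (NF : 'cV[R]_n -> 'M[R]_n) (u : chart R M n) : Prop :=
  [/\ coords u, cdom u p, u p = 0,
      forall x, cimg u x -> e u x = d_first &
      forall x, cimg u x -> L u x = NF x].

Definition unique_normal_coords (L : operator_field M) (e : vector_field M)
    (p : M) (NF : 'cV[R]_n -> 'M[R]_n) : Prop :=
  (exists u, normal_coords L e p NF u) /\
  (forall u v, normal_coords L e p NF u -> normal_coords L e p NF v ->
     \forall q \near p, u q = v q).

End NormalCoordinates.

(* Main.v *)
(* Let mu be the eigenvalue of L (of positive or negative imaginary part in the  *)
(* complex case), and let N = L - mu, of rank n-1.  The traces of the powers of *)
(* L satisfy L^* d(tr L^k)/k = d(tr L^(k+1))/(k+1), whence dmu.N = 0 and        *)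
(* dmu.e = 1.  Reading L in complex coordinates z_0, z_1, ..., z_(s-1) (real    *)
(* ones when mu is real), the normal form amounts to                            *)
(*   dz_0.N = 0,  dz_(i+1).N = dz_i - i z_(i+1) dz_0,  dz_i.e = delta_(i,0).    *)
(* Existence: z_0 = mu - mu(p).  With the integrating factor g = exp(i z_1) the *)
(* next equation is th.N = g dz_i, th.e = 0, to be solved for an exact 1-form   *)
(* th = d(g z_(i+1)).  It is uniquely solvable because dz_i kills ker N, and th *)
(* is closed: the vanishing of the Nijenhuis torsion expresses dth on im N, and *)
(* Lie_e L = Id on e, and both values vanish.  The Jacobian is invertible since *)
(* applying powers of N shows the dz_i to be independent.                       *)
(* Uniqueness: z_0 is an eigenvalue up to a constant, so it is determined; the  *)
(* difference w of two candidates for z_(i+1) satisfies d(w exp(i z_1)) = 0.    *)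
(* Analytic functions are handled as smooth functions satisfying Cauchy bounds. *)

From HB Require Import structures.
Require Import Defs.
From mathcomp Require Import all_boot all_order all_algebra.
From mathcomp Require Import all_classical all_reals all_analysis.
From mathcomp.real_closed Require Import complex.
From mathcomp Require Import ring lra zify.

Set Implicit Arguments.
Unset Strict Implicit.
Unset Printing Implicit Defensive.

Import Order.TTheory GRing.Theory Num.Theory.
Import numFieldNormedType.Exports.
Local Open Scope classical_set_scope.
Local Open Scope ring_scope.

(** * Differential calculus on column vectors *)

(** Near the point, one eigenvalue [mu] of the complexified operator is singled out and N = L - mu
    is formed. When the real coordinates are read in pairs as complex ones (in the complex case),
    both normal forms become one and the same triangular system for the differentials of functions
    z_0, ..., z_(s-1) ([chain_nf], [rd_nform]): dz_0.N = 0, dz_(i+1).N = dz_i - i z_(i+1) dz_0,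
    together with dz_i.e = delta_(i,0). The theorem is the unique solvability of this system with
    all z_i vanishing at the point, plus the independence of the solutions.

    The eigenvalue is a regular function: algebraic genericity keeps the number of distinct
    eigenvalues constant, so that [mu] is an explicit function of tr L and tr L^2 ([spectral_real],
    [spectral_complex]). Vanishing torsion gives dmu.L = mu dmu and the unity gives dmu.e = 1; hence
    z_0 = mu - mu(p) starts the chain.

    gl-regularity gives N rank n-1. Then covectors killed by a low power of N lie in the image of N
    ([kermx_exp_sub]), and e together with im N spans the tangent space ([frame_unit]). So d(exp(i
    z_1) z_(i+1)) is determined pointwise by linear algebra ([frame_solve]); it is closed because
    its exterior derivative vanishes on im N, by the torsion ([om_transport], [alpha_closed]), and
    on pairs containing e, by the unity ([theta_closed]). The Poincare lemma integrates it
    ([solution_step]). Powers of N show the differentials to be independent ([chain_free],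
    [rd_unit]), and [inverse_function] with [make_coords] produces the chart.

    For uniqueness, z_0 plus a constant is an eigenvalue, hence equals [mu] ([chart_solution]); the
    remaining z_i follow one at a time, because a 1-form killing e and im N is zero
    ([local_uniqueness]).

    Both categories are treated at once through [reg]: smoothness and, in the analytic case, local
    bounds C A^k k! on the derivatives of order k. These bounds pass through products, compositions,
    primitives and inverse maps ([regM], [reg_comp], [reg_prim], [reg_flow]), and [regularE]
    identifies [reg] with the regularity of the definitions. *)

Section Calculus.
Context {R : realType} {n : nat}.
Implicit Types (U : set 'cV[R]_n) (f g : 'cV[R]_n -> R) (x y z w h : 'cV[R]_n).

Lemma norm_coord h i : `|h i 0| <= `|h|.
Proof. by rewrite [leRHS]/Num.Def.normr/= mx_normrE; exact: (le_bigmax _ _ (i, 0)). Qed.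

Lemma norm_cV_le h (e : R) : 0 <= e -> (forall i, `|h i 0| <= e) -> `|h| <= e.
Proof.
move=> e0 he; rewrite /Num.Def.normr/= mx_normrE; apply: bigmax_le => // -[i j] _ /=.
by rewrite ord1.
Qed.

Lemma norm_basis_vec (j : 'I_n) : `|basis_vec j : 'cV[R]_n| = 1.
Proof.
apply/eqP; rewrite eq_le; apply/andP; split.
  by apply: norm_cV_le => // i; rewrite mxE; case: eqP; rewrite /= ?normr0 ?normr1.
by have := norm_coord (basis_vec j) j; rewrite mxE !eqxx normr1.
Qed.

Lemma cV_sum_basis h : h = \sum_j h j 0 *: basis_vec j.
Proof.
apply/colP => i; rewrite summxE (bigD1 i) //= !mxE !eqxx mulr1 big1 ?addr0 // => j ji.
by rewrite !mxE eq_sym (negbTE ji) mulr0.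
Qed.

Lemma diff_partialE f x h :
  differentiable f x -> 'd f x h = \sum_j h j 0 * partial j f x.
Proof.
move=> df; rewrite {1}(cV_sum_basis h) linear_sum; apply: eq_bigr => j _.
by rewrite linearZ /= /partial deriveE.
Qed.

Lemma derive_partialE f x h :
  differentiable f x -> 'D_h f x = \sum_j h j 0 * partial j f x.
Proof. by move=> df; rewrite deriveE // diff_partialE. Qed.

(** The linear form with coefficients [l], used as a candidate differential. *)
Definition dotl (l : 'I_n -> R) (h : 'cV[R]_n) : R := \sum_j h j 0 * l j.

Lemma dotl_linear l : linear (dotl l).
Proof.
move=> a u v; rewrite /dotl scaler_sumr -big_split; apply: eq_bigr => j _ /=.
by rewrite !mxE mulrDl -mulrA.
Qed.
HB.instance Definition _ l :=
  @GRing.isLinear.Build R 'cV[R]_n R *:%R (dotl l) (dotl_linear l).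

Lemma dotl_le l h (K : R) :
  (forall j, `|l j| <= K) -> `|dotl l h| <= n%:R * K * `|h|.
Proof.
move=> lK; apply: (le_trans (ler_norm_sum _ _ _)).
apply: (@le_trans _ _ (\sum_(j < n) K * `|h|)).
  by apply: ler_sum => j _; rewrite normrM mulrC ler_pM // norm_coord.
by rewrite sumr_const card_ord -mulrA mulr_natl.
Qed.

Lemma dotl_continuous l : continuous (dotl l).
Proof.
apply: continuous_big => [|j _ x]; first exact: add_continuous.
exact: (cvgM (@coord_continuous R n 1 j 0 x) (cvg_cst _)).
Qed.

(** Differentials of limits, of radial primitives and of inverse maps are all found by guessing [l]
    and proving this estimate; the partial derivatives come along by uniqueness of the
    differential. *)
Lemma differentiable_eps f x (l : 'I_n -> R) :
  (forall e : R, 0 < e -> \forall h \near (0 : 'cV[R]_n),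
      `|f (x + h) - f x - dotl l h| <= e * `|h|) ->
  differentiable f x /\ forall j, partial j f x = l j.
Proof.
move=> H.
have E : f \o shift x = cst (f x) + (dotl l : 'cV[R]_n -> R) +o_ (0 : 'cV[R]_n) id.
  apply/eqaddoP => e e0 /=; near=> h.
  have -> : (f \o shift x - (cst (f x) + (dotl l : 'cV[R]_n -> R))) h
     = f (x + h) - f x - dotl l h.
    by rewrite !fctE /= [h + x]addrC opprD addrA.
  by near: h; exact: H.
have D := diff_unique (@dotl_continuous l) E.
have df : differentiable f x.
  apply/diff_locallyP; split; rewrite D //; exact: dotl_continuous.
split=> // j; rewrite /partial deriveE // D /= /dotl (bigD1 j) //= big1 => [|i ij].
  by rewrite mxE !eqxx mul1r addr0.
by rewrite mxE (negbTE ij) mul0r.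
Unshelve. all: by end_near. Qed.

Lemma eps_differentiable f x : differentiable f x ->
  forall e : R, 0 < e -> \forall h \near (0 : 'cV[R]_n),
      `|f (x + h) - f x - dotl (fun j => partial j f x) h| <= e * `|h|.
Proof.
move=> df e e0; have /diff_locally /eqaddoP /(_ e e0) H := df.
near=> h; rewrite /dotl -diff_partialE //.
have -> : f (x + h) - f x - 'd f x h = (f \o shift x - (cst (f x) + 'd f x)) h.
  by rewrite !fctE /= [h + x]addrC opprD addrA.
by near: h.
Unshelve. all: by end_near. Qed.

Lemma is_derive_line_dir f x h (t : R) : derivable f (x + t *: h) h ->
  is_derive t 1 (fun s : R => f (x + s *: h)) ('D_h f (x + t *: h)).
Proof.
have E : (fun s : R => s^-1 *: ((f \o shift (x + t *: h)) (s *: h) - f (x + t *: h)))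
   = (fun s : R => s^-1 *: (((fun s : R => f (x + s *: h)) \o shift t) (s *: 1)
        - f (x + t *: h))).
  apply/funext => s /=; congr (_ *: (f _ - _)).
  by rewrite scaler1 scalerDl addrCA addrA.
rewrite /derivable E => D; apply: DeriveDef; first exact: D.
by rewrite /derive E.
Qed.

Lemma is_derive_line f x h (t : R) : differentiable f (x + t *: h) ->
  is_derive t 1 (fun s : R => f (x + s *: h)) (dotl (fun j => partial j f (x + t *: h)) h).
Proof.
move=> df; rewrite -[X in is_derive _ _ _ X](derive_partialE h df).
by apply: is_derive_line_dir; exact: diff_derivable.
Qed.

Lemma mvt_coord f j y (c : R) :
  (forall t : R, `|t| <= `|c| -> derivable f (y + t *: basis_vec j) (basis_vec j)) ->
  exists2 t : R, `|t| <= `|c| &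
    f (y + c *: basis_vec j) - f y = partial j f (y + t *: basis_vec j) * c.
Proof.
move=> df.
have D (t : R) : `|t| <= `|c| -> is_derive t 1 (fun s : R => f (y + s *: basis_vec j))
   (partial j f (y + t *: basis_vec j)).
  by move=> tc; apply: is_derive_line_dir; exact: df.
have [c0|c0] := leP 0 c.
  have [t tc||t] := @MVT_segment R (fun s => f (y + s *: basis_vec j))
     (fun t => partial j f (y + t *: basis_vec j)) 0 c c0.
  - apply: D; move: tc; rewrite in_itv /= => /andP[t0 tc].
    by rewrite !ger0_norm // ltW.
  - apply: derivable_within_continuous => t; rewrite in_itv /= => /andP[t0 tc].
    by have [|//] := D t; rewrite !ger0_norm.
  rewrite in_itv /= scale0r addr0 subr0 => /andP[t0 tc] E.
  by exists t => //; rewrite !ger0_norm.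
have [t tc||t] := @MVT_segment R (fun s => f (y + s *: basis_vec j))
     (fun t => partial j f (y + t *: basis_vec j)) c 0 (ltW c0).
- apply: D; move: tc; rewrite in_itv /= => /andP[t0 tc].
  by rewrite (ltr0_norm c0) (ltr0_norm tc) lerN2 ltW.
- apply: derivable_within_continuous => t; rewrite in_itv /= => /andP[t0 tc].
  by have [|//] := D t; rewrite (ltr0_norm c0) (ler0_norm tc) lerN2.
rewrite in_itv /= scale0r addr0 sub0r => /andP[t0 tc] E.
exists t; first by rewrite (ltr0_norm c0) (ler0_norm tc) lerN2.
by rewrite -opprB E mulrN opprK.
Qed.

Lemma ballE x (r : R) y : ball x r y = (`|y - x| < r) :> Prop.
Proof. by rewrite -ball_normE /ball_ /= distrC. Qed.

Lemma ball_addE x (r : R) h : ball x r (x + h) = (`|h| < r) :> Prop.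
Proof. by rewrite ballE [x + h]addrC addrK. Qed.

Lemma ball_line x (r : R) y z (t : R) : ball x r y -> ball x r z -> 0 <= t <= 1 ->
  ball x r (y + t *: (z - y)).
Proof.
rewrite !ballE => yr zr /andP[t0 t1].
have -> : y + t *: (z - y) - x = (1 - t) *: (y - x) + t *: (z - x).
  by apply/colP => i; rewrite !mxE; ring.
apply: le_lt_trans (ler_normD _ _) _; rewrite !normrZ ger0_norm ?subr_ge0 // (ger0_norm t0).
have [->|tn0] := eqVneq t 0; first by rewrite subr0 mul1r mul0r addr0.
have : 0 < t by rewrite lt_neqAle eq_sym tn0.
nra.
Qed.

Lemma mvt_seg f y z :
  (forall t : R, 0 <= t <= 1 -> differentiable f (y + t *: (z - y))) ->
  exists2 t : R, 0 <= t <= 1 &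
    f z - f y = dotl (fun j => partial j f (y + t *: (z - y))) (z - y).
Proof.
move=> df.
have D (t : R) : 0 <= t <= 1 -> is_derive t 1 (fun s : R => f (y + s *: (z - y)))
    (dotl (fun j => partial j f (y + t *: (z - y))) (z - y)).
  by move=> t01; apply: is_derive_line; exact: df.
have [||c] := @MVT R (fun s => f (y + s *: (z - y)))
   (fun t => dotl (fun j => partial j f (y + t *: (z - y))) (z - y)) 0 1 ltr01.
- by move=> t; rewrite in_itv /= => /andP[t0 t1]; apply: D; rewrite !ltW.
- apply: derivable_within_continuous => t; rewrite in_itv /= => t01.
  by have [] := D t t01.
rewrite in_itv /= => /andP[c0 c1]; rewrite subr0 mulr1 scale1r scale0r addr0 [y + _]addrC subrK.
by move=> E; exists c => //; rewrite !ltW.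
Qed.

Lemma mvt_ball f x (r : R) y z :
  (forall w, ball x r w -> differentiable f w) -> ball x r y -> ball x r z ->
  exists2 w, ball x r w & f z - f y = dotl (fun j => partial j f w) (z - y).
Proof.
move=> df yr zr; have [t t01|t t01 E] := @mvt_seg f y z.
  by apply: df; exact: ball_line.
by exists (y + t *: (z - y)) => //; exact: ball_line.
Qed.

Lemma mvi_ball f x (r K : R) y z :
  (forall w, ball x r w -> differentiable f w) ->
  (forall w j, ball x r w -> `|partial j f w| <= K) -> ball x r y -> ball x r z ->
  `|f z - f y| <= n%:R * K * `|z - y|.
Proof.
move=> df bf yr zr; have [w wr ->] := mvt_ball df yr zr.
by apply: dotl_le => j; exact: bf.
Qed.

Lemma const_ball f x (r : R) y z :
  (forall w, ball x r w -> differentiable f w) ->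
  (forall w j, ball x r w -> partial j f w = 0) -> ball x r y -> ball x r z ->
  f y = f z.
Proof.
move=> df bf yr zr; apply/eqP; rewrite eq_sym -subr_eq0 -normr_le0.
have := @mvi_ball f x r 0 y z df _ yr zr; rewrite mulr0 mul0r; apply.
by move=> w j /(bf w j) ->; rewrite normr0.
Qed.

Lemma partial_cst (c : R) j x : partial j (fun _ => c) x = 0.
Proof. exact: derive_cst. Qed.

Lemma partialD f g j x : differentiable f x -> differentiable g x ->
  partial j (fun y => f y + g y) x = partial j f x + partial j g x.
Proof. by move=> df dg; rewrite /partial deriveD //; exact: diff_derivable. Qed.

Lemma partialN f j x : differentiable f x ->
  partial j (fun y => - f y) x = - partial j f x.
Proof. by move=> df; rewrite /partial deriveN //; exact: diff_derivable. Qed.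

Lemma partialM f g j x : differentiable f x -> differentiable g x ->
  partial j (fun y => f y * g y) x = partial j f x * g x + f x * partial j g x.
Proof.
move=> df dg; rewrite /partial deriveM; [|exact: diff_derivable..].
by rewrite addrC /GRing.scale /= [g x * _]mulrC.
Qed.

Lemma partial_coord i j x : partial j (fun y => y i 0) x = (i == j)%:R.
Proof.
rewrite /partial deriveE; last exact: differentiable_coord.
have -> : 'd (fun y : 'cV[R]_n => y i 0) x = (dotl (fun k => (k == i)%:R)) :> (_ -> R).
  have E : (fun y : 'cV[R]_n => y i 0) = dotl (fun k => (k == i)%:R).
    apply/funext => y; rewrite /dotl (bigD1 i) //= eqxx mulr1 big1 ?addr0 // => k ki.
    by rewrite (negbTE ki) mulr0.
  by rewrite E diff_lin //; exact: dotl_continuous.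
rewrite /dotl (bigD1 j) //= !mxE !eqxx mul1r big1 ?addr0 => [|k kj]; first by rewrite eq_sym.
by rewrite mxE (negbTE kj) mul0r.
Qed.

Lemma open_ballP U x : open U -> U x -> exists2 r : R, 0 < r & ball x r `<=` U.
Proof.
move=> oU Ux; have /nbhs_ballP[r r0 rU] : nbhs x U by exact: open_nbhs_nbhs.
by exists r.
Qed.

Lemma partial_near f g j x : (\forall y \near x, f y = g y) ->
  partial j f x = partial j g x.
Proof. by move=> fg; rewrite /partial; exact: near_eq_derive. Qed.

Lemma differentiable_near f g x : (\forall y \near x, f y = g y) ->
  differentiable f x -> differentiable g x.
Proof.
move=> fg df; apply: (@differentiable_eps _ _ (fun j => partial j f x) _).1 => e e0.
have fgx := nbhs_singleton fg.
have H := eps_differentiable df e0.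
have fg' : \forall h \near (0 : 'cV[R]_n), f (x + h) = g (x + h).
  move: fg; rewrite (near_shift 0 x) => fg; near=> h.
  have -> : x + h = (shift (x - 0) h) by rewrite /= subr0 addrC.
  by near: h.
near=> h; have <- : f (x + h) = g (x + h) by near: h.
by rewrite -fgx; near: h.
Unshelve. all: by end_near. Qed.

(** The increment is telescoped along a path that changes one coordinate at a time. The mean value
    theorem evaluates each step, and continuity of the partial derivatives at [x] bounds the
    errors. *)
Lemma C1_differentiable f x (r : R) : 0 < r ->
  (forall y j, ball x r y -> derivable f y (basis_vec j)) ->
  (forall j, {for x, continuous (partial j f)}) -> differentiable f x.
Proof.
move=> r0 df cf.
apply: (@differentiable_eps _ _ (fun j => partial j f x) _).1 => e e0.
(* Each of the [n] steps may err by this share of [e]; the successor avoids a division by zero when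
   [n = 0]. *)
have n1 : 0 < n.+1%:R :> R by rewrite ltr0n.
have e1 : 0 < e / n.+1%:R by rewrite divr_gt0.
have : exists2 d : R, 0 < d & forall y j, ball x d y -> `|partial j f x - partial j f y| <= e / n.+1%:R.
  have : \forall y \near x, forall j, `|partial j f x - partial j f y| <= e / n.+1%:R.
    have H j : \forall y \near x, `|partial j f x - partial j f y| <= e / n.+1%:R.
      by have /cvgrPdist_le /(_ _ e1) := cf j.
    exact: (filter_forall (nbhs_filter x) H).
  move=> /nbhs_ballP[d /= d0 dP]; exists d => // y j yd; exact: dP.
move=> [d d0 dP].
have : \forall h \near (0 : 'cV[R]_n), `|h| < Num.min r d.
  by apply: nbhs0_lt; rewrite lt_min r0.
apply: filterS => h; rewrite lt_min => /andP[hr hd].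
pose hk (k : nat) : 'cV[R]_n := \col_i (if (i < k)%N then h i 0 else 0).
have hkS (k : 'I_n) : hk k.+1 = hk k + h k 0 *: basis_vec k.
  apply/colP => i; rewrite !mxE ltnS leq_eqVlt.
  have [->|ik] := eqVneq i k; first by rewrite !eqxx ltnn /= mulr1 add0r.
  by rewrite -val_eqE /= in ik; rewrite (negbTE ik) /= mulr0 addr0.
have -> : f (x + h) - f x = \sum_(k < n) (f (x + hk k.+1) - f (x + hk k)).
  rewrite -(big_mkord xpredT (fun k => f (x + hk k.+1) - f (x + hk k))).
  rewrite telescope_sumr //; congr (f (_ + _) - f _); apply/colP => i; rewrite !mxE.
    by rewrite ltn_ord.
  by rewrite ltn0 addr0.
have hkt (k : 'I_n) (t : R) : `|t| <= `|h k 0| -> `|hk k + t *: basis_vec k| <= `|h|.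
  move=> tk; apply: norm_cV_le => // i; rewrite !mxE.
  case: ltnP => [ik|ki]; last first.
    rewrite andbT add0r; case: (i == k); rewrite ?mulr1 ?mulr0 ?normr0 //.
    by apply: (le_trans tk); exact: norm_coord.
  rewrite -val_eqE /= (ltn_eqF ik) /= mulr0 addr0; exact: norm_coord.
rewrite /dotl -sumrB; apply: (le_trans (ler_norm_sum _ _ _)).
apply: (@le_trans _ _ (\sum_(k < n) e / n.+1%:R * `|h|)).
  apply: ler_sum => k _; rewrite hkS addrA.
  have [t tk|t tk ->] := @mvt_coord f k (x + hk k) (h k 0).
    apply: df; rewrite -addrA ball_addE.
    exact: le_lt_trans (hkt _ _ tk) hr.
  rewrite [h k 0 * _]mulrC -mulrBl normrM ler_pM // ?norm_coord // distrC; apply: dP.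
  rewrite -addrA ball_addE; exact: le_lt_trans (hkt _ _ tk) hd.
rewrite sumr_const card_ord -mulrnAl ler_wpM2r // -mulr_natr -mulrA ler_piMr // ?(ltW e0) //.
by rewrite mulrC ler_pdivrMr // mul1r ler_nat.
Qed.

(** The second difference is an increment in direction [i] of the increment in direction [j]. The
    mean value theorem turns it into a difference of two values of [partial i f], which
    differentiability at [x] evaluates. *)
Lemma second_difference f i j x (r : R) : 0 < r ->
  (forall y, ball x r y -> differentiable f y) ->
  differentiable (partial i f) x ->
  forall e : R, 0 < e -> exists2 d : R, 0 < d & forall t, 0 < t < d ->
  `|f (x + t *: basis_vec i + t *: basis_vec j) - f (x + t *: basis_vec i)
     - f (x + t *: basis_vec j) + f x - t ^+ 2 * partial j (partial i f) x| <= e * t ^+ 2.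
Proof.
move=> r0 df dif e e0.
(* The two values are taken at distance at most [2 * t] and [t] from [x], so their errors add up to
   [3 * t] times this number. *)
have e1 : 0 < e / 3 by rewrite divr_gt0.
have := eps_differentiable dif e1.
move=> /nbhs_ballP[d /= d0 dP].
exists (Num.min r d / 2); first by rewrite divr_gt0 // lt_min r0.
move=> t /andP[t0]; rewrite ltr_pdivlMr // lt_min => /andP[tr td].
pose g y := f (y + t *: basis_vec j) - f y.
have nb (a b : R) : `|a| <= t -> `|b| <= t ->
    `|a *: (basis_vec i : 'cV[R]_n) + b *: basis_vec j| <= t * 2.
  move=> at_ bt; apply: (le_trans (ler_normD _ _)).
  by rewrite !normrZ !norm_basis_vec !mulr1 mulrDr mulr1 lerD.
have tt : `|t| <= t by rewrite ger0_norm // ltW.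
have t00 : `|0 : R| <= t by rewrite normr0 ltW.
have dsh y : differentiable f (y + t *: basis_vec j) ->
    differentiable (fun y => f (y + t *: basis_vec j)) y /\
    forall k, partial k (fun y => f (y + t *: basis_vec j)) y
      = partial k f (y + t *: basis_vec j).
  move=> dfy; apply: differentiable_eps => e' e'0; have := eps_differentiable dfy e'0.
  by apply: filterS => h; rewrite [y + h + _]addrAC.
have dfl (s b : R) : `|s| <= t -> `|b| <= t ->
    differentiable f (x + s *: basis_vec i + b *: basis_vec j).
  by move=> st bt; apply: df; rewrite -addrA ball_addE; apply: le_lt_trans tr; exact: nb.
have dfl0 (s : R) : `|s| <= t -> differentiable f (x + s *: basis_vec i).
  by move=> st; have := dfl _ _ st t00; rewrite scale0r addr0.
have [s st|s st] := @mvt_coord g i x t.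
  rewrite (ger0_norm (ltW t0)) in st.
  apply: diff_derivable; apply: differentiableB; last exact: dfl0.
  by apply: (dsh _ _).1; exact: dfl.
rewrite (ger0_norm (ltW t0)) in st.
have -> : partial i g (x + s *: basis_vec i) =
    partial i f (x + s *: basis_vec i + t *: basis_vec j) - partial i f (x + s *: basis_vec i).
  have [D1 D2] := dsh _ (dfl _ _ st tt); have D3 := dfl0 _ st.
  by rewrite /g partialD ?partialN ?D2 //; exact: differentiableN.
rewrite /g => E.
have -> : f (x + t *: basis_vec i + t *: basis_vec j) - f (x + t *: basis_vec i)
     - f (x + t *: basis_vec j) + f x =
  f (x + t *: basis_vec i + t *: basis_vec j) - f (x + t *: basis_vec i)
    - (f (x + t *: basis_vec j) - f x) by ring.
rewrite E.
have B (b : R) : `|b| <= t -> ball 0 d (s *: (basis_vec i : 'cV[R]_n) + b *: basis_vec j).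
  by move=> bt; rewrite ballE subr0; apply: le_lt_trans td; exact: nb.
have B1 := dP _ (B _ tt); have B2 := dP _ (B _ t00); rewrite scale0r addr0 in B2.
rewrite addrA linearD /= in B1.
have l1 : dotl (fun k => partial k (partial i f) x) (t *: basis_vec j)
    = t * partial j (partial i f) x.
  rewrite linearZ /= /dotl (bigD1 j) //= big1 => [|k kj].
    by rewrite mxE !eqxx mul1r addr0.
  by rewrite mxE (negbTE kj) mul0r.
rewrite l1 in B1.
set P1 := partial i f (_ + _ + _) in B1 *; set P2 := partial i f (x + s *: _) in B1 B2 *.
set D2 := partial j _ _ in B1 *.
set P0 := partial i f x in B1 B2; set L := dotl _ _ in B1 B2.
have C1 : `|P1 - P0 - (L + t * D2)| <= e / 3 * (t * 2).
  apply: (le_trans B1); apply: ler_wpM2l; [exact: ltW|exact: nb].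
have C2 : `|P2 - P0 - L| <= e / 3 * t.
  apply: (le_trans B2); apply: ler_wpM2l; first exact: ltW.
  by rewrite normrZ norm_basis_vec mulr1.
have -> : (P1 - P2) * t - t ^+ 2 * D2 = t * ((P1 - P0 - (L + t * D2)) - (P2 - P0 - L)).
  by ring.
rewrite normrM (ger0_norm (ltW t0)).
have : `|P1 - P0 - (L + t * D2) - (P2 - P0 - L)| <= e * t.
  apply: (le_trans (ler_normB _ _)); apply: (le_trans (lerD C1 C2)).
  by have -> : e / 3 * (t * 2) + e / 3 * t = e * t by field.
move=> H; have -> : e * t ^+ 2 = t * (e * t) by ring.
by apply: ler_wpM2l => //; exact: ltW.
Qed.

(** The second difference is symmetric in [i] and [j], and after division by t^2 it tends to either
    mixed derivative. *)
Lemma partialC f i j x (r : R) : 0 < r ->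
  (forall y, ball x r y -> differentiable f y) ->
  (forall k, differentiable (partial k f) x) ->
  partial i (partial j f) x = partial j (partial i f) x.
Proof.
move=> r0 df dpf; apply/eqP; rewrite -subr_eq0 -normr_le0; apply/ler_addgt0Pr => e e0.
rewrite add0r.
have e2 : 0 < e / 2 by rewrite divr_gt0.
have [d1 d10 D1] := second_difference j r0 df (dpf i) e2.
have [d2 d20 D2] := second_difference i r0 df (dpf j) e2.
pose t := Num.min d1 d2 / 2.
have m0 : 0 < Num.min d1 d2 by rewrite lt_min d10.
have t0 : 0 < t by rewrite divr_gt0.
have : t < Num.min d1 d2 by rewrite /t; lra.
rewrite lt_min => /andP[t1 t2].
have := D1 t; rewrite t0 t1 => /(_ isT); have := D2 t; rewrite t0 t2 => /(_ isT).
rewrite [x + t *: basis_vec j + _]addrAC.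
set F := f (_ + _ + _); set F1 := f (x + t *: basis_vec i); set F2 := f (x + _ *: basis_vec j).
set P := partial i _ _; set Q := partial j _ _ => H1 H2.
have : `|t ^+ 2 * (P - Q)| <= e * t ^+ 2.
  have -> : t ^+ 2 * (P - Q) = (F - F1 - F2 + f x - t ^+ 2 * Q) - (F - F2 - F1 + f x - t ^+ 2 * P).
    by ring.
  apply: (le_trans (ler_normB _ _)); apply: (le_trans (lerD H2 H1)).
  by rewrite -mulrDl -splitr.
have t20 : 0 < t ^+ 2 by rewrite exprn_gt0.
by rewrite normrM (gtr0_norm t20) mulrC ler_pM2r.
Qed.

Lemma eq_on_near U f g x : open U -> U x -> (forall y, U y -> f y = g y) ->
  \forall y \near x, f y = g y.
Proof.
move=> oU Ux fg; have : nbhs x U by exact: open_nbhs_nbhs.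
by apply: filterS => y /fg.
Qed.

End Calculus.

Lemma differentiable_comp_cV {R : realType} {n m : nat} (H : 'cV[R]_m -> R)
    (psi : 'cV[R]_n -> 'cV[R]_m) x :
  differentiable H (psi x) -> (forall i, differentiable (fun y => psi y i 0) x) ->
  differentiable (H \o psi) x /\
  forall j, partial j (H \o psi) x =
    \sum_i partial i H (psi x) * partial j (fun y => psi y i 0) x.
Proof.
move=> dH dpsi.
have P : differentiable psi x.
  have -> : psi = (fun y => \sum_(i < m) psi y i 0 *: (basis_vec i : 'cV[R]_m)).
    by apply/funext => y; rewrite -cV_sum_basis.
  have -> : (fun y => \sum_(i < m) psi y i 0 *: (basis_vec i : 'cV[R]_m)) =
     \sum_(i < m) (fun y => psi y i 0 *: (basis_vec i : 'cV[R]_m)).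
    by apply/funext => y; rewrite fct_sumE.
  by apply: differentiable_sum => i; exact: differentiableZl.
split=> [|j]; first exact: differentiable_comp.
rewrite /partial deriveE; last exact: differentiable_comp.
rewrite diff_comp //= diff_partialE //; apply: eq_bigr => i _.
rewrite mulrC; congr (_ * _); rewrite -deriveE // derive_mx ?mxE //.
exact: diff_derivable.
Qed.

(** * Smooth and Gevrey-1 functions *)

Section Smooth.
Context {R : realType} {n : nat}.
Implicit Types (U V : set 'cV[R]_n) (f g : 'cV[R]_n -> R) (x y : 'cV[R]_n) (w : seq 'I_n).

(* Partial derivatives along words; keeping words instead of multi-indices avoids *)
(* any use of symmetry in the estimates.                                           *)
Definition pd w f : 'cV[R]_n -> R := foldr partial f w.

Definition diff_upto (k : nat) U f := forall w x, (size w <= k)%N -> U x ->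
  differentiable (pd w f) x.

Definition smooth_on U f := forall w x, U x -> differentiable (pd w f) x.

(* Cauchy estimates: equivalent to analyticity, but manifestly stable under *)
(* differentiation, products and flows.                                      *)
Definition gevrey_at f x := exists C A : R, [/\ 0 <= C, 0 <= A &
  \forall y \near x, forall w, `|pd w f y| <= C * A ^+ size w * (size w)`!%:R].

Definition reg (c : category) U f := smooth_on U f /\
  (c = RealAnalytic -> forall x, U x -> gevrey_at f x).

Lemma pd_rcons w j f : pd (rcons w j) f = pd w (partial j f).
Proof. by rewrite /pd foldr_rcons. Qed.

Lemma pd_ext U f g w x : open U -> (forall y, U y -> f y = g y) -> U x ->
  pd w f x = pd w g x.
Proof.
move=> oU fg; elim: w x => [|j w IH] x Ux /=; first exact: fg.
by apply: partial_near; exact: eq_on_near oU Ux IH.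
Qed.

Lemma pd_near f g w x : (\forall y \near x, f y = g y) ->
  \forall y \near x, pd w f y = pd w g y.
Proof.
move=> fg; elim: w => [|j w IH] //=.
have := near_join IH; apply: filterS => y; exact: partial_near.
Qed.

Lemma differentiable_ext U f g x : open U -> (forall y, U y -> f y = g y) -> U x ->
  differentiable f x -> differentiable g x.
Proof. by move=> oU fg Ux; apply: differentiable_near; exact: eq_on_near oU Ux fg. Qed.

Lemma smooth_upto U f : smooth_on U f <-> forall k, diff_upto k U f.
Proof. by split=> [H k w x _|H w x]; [exact: H|exact: (H (size w))]. Qed.

Lemma diff_uptoS k U f : diff_upto k.+1 U f <->
  (forall x, U x -> differentiable f x) /\ forall j, diff_upto k U (partial j f).
Proof.
split=> [H|[H1 H2] w x].
  split=> [x Ux|j w x wk Ux]; first exact: (H [::]).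
  by rewrite -pd_rcons; apply: H; rewrite ?size_rcons.
case/lastP: w => [|w j]; first by move=> _; exact: H1.
by rewrite size_rcons pd_rcons ltnS; exact: H2.
Qed.

Lemma diff_upto_le k l U f : (k <= l)%N -> diff_upto l U f -> diff_upto k U f.
Proof. by move=> kl H w x wk; apply: H; exact: leq_trans kl. Qed.

Lemma diff_upto_ext k U f g : open U -> (forall x, U x -> f x = g x) ->
  diff_upto k U f -> diff_upto k U g.
Proof.
move=> oU fg H w x wk Ux; apply: (differentiable_ext oU _ Ux (H w x wk Ux)) => y Uy.
exact: pd_ext oU fg Uy.
Qed.

Lemma smooth_partial U f j : smooth_on U f -> smooth_on U (partial j f).
Proof. by move=> H w x Ux; rewrite -pd_rcons; exact: H. Qed.

Lemma smooth_pd U f w : smooth_on U f -> smooth_on U (pd w f).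
Proof. by move=> H v x Ux; rewrite /pd -foldr_cat; exact: H. Qed.

Lemma smooth_diff U f x : smooth_on U f -> U x -> differentiable f x.
Proof. by move=> H; exact: (H [::]). Qed.

Lemma smooth_sub U V f : V `<=` U -> smooth_on U f -> smooth_on V f.
Proof. by move=> VU H w x /VU; exact: H. Qed.

Lemma partial_const c (j : 'I_n) : partial j (fun _ : 'cV[R]_n => c) = fun _ => 0.
Proof. by apply/funext => x; exact: partial_cst. Qed.

Lemma pd_const c w (x : 'cV[R]_n) : pd w (fun _ => c) x = if w is [::] then c else 0.
Proof.
elim/last_ind: w => [|w j IH] //; rewrite pd_rcons partial_const.
suff -> : pd w (fun _ => 0) x = 0 by case: (w).
elim: (w) (x) => [|i v IHv] //= y.
have -> : pd v (fun _ : 'cV[R]_n => 0 : R) = fun _ => 0 by apply/funext.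
exact: partial_cst.
Qed.

Lemma smooth_const U (c : R) : smooth_on U (fun _ => c).
Proof.
move=> w x _; have -> : pd w (fun _ => c) = fun _ => (if w is [::] then c else 0).
  by apply/funext => y; rewrite pd_const.
exact: differentiable_cst.
Qed.

Lemma diff_uptoD k U f g : open U -> diff_upto k U f -> diff_upto k U g ->
  diff_upto k U (fun y => f y + g y).
Proof.
move=> oU; elim: k f g => [|k IH] f g df dg.
  case=> // x _ Ux; apply: differentiableD; [exact: (df [::])|exact: (dg [::])].
have [df0 df1] := (diff_uptoS _ _ _).1 df; have [dg0 dg1] := (diff_uptoS _ _ _).1 dg.
apply/diff_uptoS; split=> [x Ux|j].
  by apply: differentiableD; [exact: df0|exact: dg0].
apply: (diff_upto_ext oU _ (IH _ _ (df1 j) (dg1 j))) => x Ux.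
by rewrite partialD //; [exact: df0|exact: dg0].
Qed.

Lemma diff_uptoM k U f g : open U -> diff_upto k U f -> diff_upto k U g ->
  diff_upto k U (fun y => f y * g y).
Proof.
move=> oU; elim: k f g => [|k IH] f g df dg.
  case=> // x _ Ux; apply: differentiableM; [exact: (df [::])|exact: (dg [::])].
have [df0 df1] := (diff_uptoS _ _ _).1 df; have [dg0 dg1] := (diff_uptoS _ _ _).1 dg.
apply/diff_uptoS; split=> [x Ux|j].
  by apply: differentiableM; [exact: df0|exact: dg0].
have lf := diff_upto_le (leqnSn k) df; have lg := diff_upto_le (leqnSn k) dg.
apply: (diff_upto_ext oU _ (diff_uptoD oU (IH _ _ (df1 j) lg) (IH _ _ lf (dg1 j)))) => x Ux.
by rewrite partialM //; [exact: df0|exact: dg0].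
Qed.

Lemma smoothD U f g : open U -> smooth_on U f -> smooth_on U g ->
  smooth_on U (fun y => f y + g y).
Proof.
by move=> oU /smooth_upto df /smooth_upto dg; apply/smooth_upto => k; exact: diff_uptoD.
Qed.

Lemma smoothM U f g : open U -> smooth_on U f -> smooth_on U g ->
  smooth_on U (fun y => f y * g y).
Proof.
by move=> oU /smooth_upto df /smooth_upto dg; apply/smooth_upto => k; exact: diff_uptoM.
Qed.

Lemma smooth_sum (I : Type) (r : seq I) (P : pred I) U (F : I -> 'cV[R]_n -> R) : open U ->
  (forall i, smooth_on U (F i)) -> smooth_on U (fun y => \sum_(i <- r | P i) F i y).
Proof.
move=> oU H; elim: r => [|i r IH].
  by under eq_fun do rewrite big_nil; exact: smooth_const.
under eq_fun do rewrite big_cons; case: (P i) => //; exact: smoothD.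
Qed.

Lemma pdD U f g w x : open U -> smooth_on U f -> smooth_on U g -> U x ->
  pd w (fun y => f y + g y) x = pd w f x + pd w g x.
Proof.
move=> oU df dg; elim: w x => [|j w IH] x Ux //=.
have -> : partial j (pd w (fun y => f y + g y)) x = partial j (fun y => pd w f y + pd w g y) x.
  by apply: partial_near; apply: (eq_on_near oU Ux) => y Uy; exact: IH.
by rewrite partialD //; [exact: df|exact: dg].
Qed.

Lemma pd_sum (I : Type) (r : seq I) (P : pred I) U (F : I -> 'cV[R]_n -> R) w x : open U ->
  (forall i, smooth_on U (F i)) -> U x ->
  pd w (fun y => \sum_(i <- r | P i) F i y) x = \sum_(i <- r | P i) pd w (F i) x.
Proof.
move=> oU H Ux; elim: r => [|i r IH].
  under eq_fun do rewrite big_nil; rewrite big_nil pd_const; by case: w.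
under eq_fun do rewrite big_cons; rewrite big_cons; case: (P i) => //.
rewrite (pdD _ oU) ?IH //; exact: smooth_sum.
Qed.

(** The innermost derivative of the word splits the product into two products differentiated [k]
    times, and Pascal's rule merges the two sums. As the bounds depend on lengths only, binomials
    replace the sum over subwords. *)
Lemma leibniz_bound k U f g (a b : nat -> R) : open U -> smooth_on U f -> smooth_on U g ->
  (forall w x, U x -> (size w <= k)%N -> `|pd w f x| <= a (size w)) ->
  (forall w x, U x -> (size w <= k)%N -> `|pd w g x| <= b (size w)) ->
  forall w x, U x -> size w = k ->
  `|pd w (fun y => f y * g y) x| <= \sum_(i < k.+1) 'C(k, i)%:R * a i * b (k - i)%N.
Proof.
move=> oU; elim: k f g a b => [|k IH] f g a b sf sg fa gb w x Ux.
  case: w => // _; rewrite big_ord1 /= normrM mul1r.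
  by apply: ler_pM => //; [exact: (fa [::])|exact: (gb [::])].
case/lastP: w => // w j; rewrite size_rcons => -[wk]; rewrite pd_rcons.
have sfj := smooth_partial j sf; have sgj := smooth_partial j sg.
rewrite (@pd_ext U _ (fun y => partial j f y * g y + f y * partial j g y)) //; last first.
  by move=> y Uy; rewrite partialM //; [exact: smooth_diff sf Uy|exact: smooth_diff sg Uy].
rewrite (pdD _ oU) //; [|exact: smoothM..].
apply: (le_trans (ler_normD _ _)).
have H1 := IH _ _ (fun i => a i.+1) b sfj sg _ _ w x Ux wk.
have H2 := IH _ _ a (fun i => b i.+1) sf sgj _ _ w x Ux wk.
apply: (le_trans (lerD (H1 _ _) (H2 _ _))).
- by move=> v z Uz vk; rewrite -pd_rcons -(size_rcons v j); apply: fa; rewrite ?size_rcons.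
- by move=> v z Uz vk; apply: gb => //; exact: leqW.
- by move=> v z Uz vk; apply: fa => //; exact: leqW.
- by move=> v z Uz vk; rewrite -pd_rcons -(size_rcons v j); apply: gb; rewrite ?size_rcons.
rewrite [leRHS]big_ord_recl /= bin0.
under [X in _ <= _ + X]eq_bigr => i _ do
  rewrite /bump /= add1n binS natrD !mulrDl subSS.
rewrite big_split /= [leRHS]addrA [leRHS]addrC lerD2l.
have -> : \sum_(i < k.+1) 'C(k, i)%:R * a i * b (k - i).+1 =
   \sum_(i < k.+2) 'C(k, i)%:R * a i * b (k.+1 - i)%N.
  rewrite [RHS]big_ord_recr /= bin_small // !mul0r addr0.
  by apply: eq_bigr => i _; rewrite subSn // -ltnS.
rewrite big_ord_recl /= bin0; apply: lerD => //.
Qed.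

End Smooth.

(** * Factorial and geometric inequalities for Cauchy estimates *)

Lemma leq_fact_ratio p d m : ((p + d)`! * (p + m)`! <= p`! * (p + d + m)`!)%N.
Proof.
elim: d => [|d IH]; first by rewrite addn0.
rewrite addnS addSn !factS -mulnA [leqRHS]mulnCA.
by apply: leq_mul => //; rewrite ltnS leq_addr.
Qed.

Section GevreyAux.
Context {R : realType}.

Lemma geom_le (a K : R) k : 0 <= a -> 2 * a <= K ->
  \sum_(p < k.+1) K ^+ p * a ^+ (k - p)%N <= 2 * K ^+ k.
Proof.
move=> a0 aK; have K0 : 0 <= K by lra.
elim: k => [|k IH]; first by rewrite big_ord1 !expr0 mulr1; lra.
rewrite big_ord_recr /= subnn expr0 mulr1.
have -> : \sum_(i < k.+1) K ^+ i * a ^+ (k.+1 - i)%N = a * \sum_(p < k.+1) K ^+ p * a ^+ (k - p)%N.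
  rewrite mulr_sumr; apply: eq_bigr => i _; rewrite subSn -1?ltnS // exprS; ring.
have Kk : 0 <= K ^+ k by exact: exprn_ge0.
have : a * \sum_(p < k.+1) K ^+ p * a ^+ (k - p)%N <= a * (2 * K ^+ k) by exact: ler_wpM2l.
move=> H; apply: (le_trans (lerD H (lexx _))).
have -> : a * (2 * K ^+ k) + K ^+ k.+1 = (2 * a + K) * K ^+ k by rewrite exprS; ring.
rewrite exprS mulrA; apply: ler_wpM2r => //; lra.
Qed.

(** The hockey-stick identity in factorial form; it sums the Leibniz terms of [push_bound]
    exactly. *)
Lemma fact_sum M l :
  ((M.+1) * \sum_(p < l.+1) 'C(l, p) * p`! * (M + l - p)`! = (M.+1 + l)`!)%N.
Proof.
elim: l => [|l IH]; first by rewrite big_ord1 /= addn0 subn0 !mul1n addn0 -factS.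
rewrite big_ord_recl /= bin0 !mul1n subn0.
under eq_bigr => i _.
  rewrite /bump /= add1n.
  have -> : ('C(l.+1, i.+1) * i.+1`! * (M + l.+1 - i.+1)`! =
     l.+1 * ('C(l, i) * i`! * (M + l - i)`!))%N.
    rewrite addnS subSS factS mulnA [('C(_, _) * _)%N]mulnC.
    by rewrite -mul_bin_diag -!mulnA.
  over.
rewrite -big_distrr /= mulnDr mulnCA IH !addSn !addnS -addSn !factS; nia.
Qed.

(** The central binomial coefficient is one of the terms of (1 + 1)^(2k). *)
Lemma fact_double_le k : ((2 * k)`! <= 4 ^ k * (k`! * k`!))%N.
Proof.
have kk : (k <= 2 * k)%N by rewrite leq_pmull.
rewrite -(bin_fact kk); have -> : (2 * k - k = k)%N by lia.
rewrite leq_mul2r; apply/orP; right.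
have := expnDn 1 1 (2 * k); rewrite (bigD1 (inord k)) //= !exp1n !muln1 inordK ?ltnS // => E.
by rewrite -[4%N]/(2 ^ 2)%N -expnM E leq_addr.
Qed.

End GevreyAux.

(** * Stability of the Cauchy estimates *)

Section GevreyBasics.
Context {R : realType} {n : nat}.
Implicit Types (U V : set 'cV[R]_n) (f g : 'cV[R]_n -> R) (x y : 'cV[R]_n) (w : seq 'I_n).

Lemma gevrey_le (C A C' A' : R) k : 0 <= C -> 0 <= A -> C <= C' -> A <= A' ->
  C * A ^+ k * k`!%:R <= C' * A' ^+ k * k`!%:R.
Proof.
move=> C0 A0 CC AA; apply: ler_wpM2r => //; apply: ler_pM => //; first exact: exprn_ge0.
by apply: lerXn2r => //; rewrite nnegrE //; exact: le_trans AA.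
Qed.

Lemma gevrey_common m (f : 'I_m -> 'cV[R]_n -> R) x :
  (forall i, gevrey_at (f i) x) -> exists C A : R, [/\ 0 <= C, 0 <= A &
  \forall y \near x, forall i w, `|pd w (f i) y| <= C * A ^+ size w * (size w)`!%:R].
Proof.
move=> H.
have [C HC] := choice H; have [A HA] := choice HC.
have C0 i : 0 <= C i by case: (HA i).
have A0 i : 0 <= A i by case: (HA i).
exists (\sum_i C i), (\sum_i A i); split; [exact: sumr_ge0|exact: sumr_ge0|].
have H' i : \forall y \near x, forall w,
   `|pd w (f i) y| <= (\sum_i C i) * (\sum_i A i) ^+ size w * (size w)`!%:R.
  have [_ _] := HA i; apply: filterS => y hy w; apply: (le_trans (hy w)).
  apply: gevrey_le => //; rewrite (bigD1 i) //= lerDl; exact: sumr_ge0.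
exact: (filter_forall (nbhs_filter x) H').
Qed.

Lemma gevrey_near f g x : (\forall y \near x, f y = g y) -> gevrey_at f x -> gevrey_at g x.
Proof.
move=> fg [C [A [C0 A0 H]]]; exists C, A; split => //.
have fg2 := near_join fg.
near=> y.
have fy : \forall z \near y, f z = g z by near: y.
move=> w; rewrite -(nbhs_singleton (pd_near w fy)).
by move: w; near: y.
Unshelve. all: by end_near. Qed.

(** Passing from k! to (k+1)! costs a factor k+1 <= 2^k, which doubles [A]. *)
Lemma gevrey_partial f x j : gevrey_at f x -> gevrey_at (partial j f) x.
Proof.
move=> [C [A [C0 A0 H]]]; exists (C * A), (2 * A); split; [exact: mulr_ge0|lra|].
apply: filterS H => y H w; rewrite -pd_rcons; apply: (le_trans (H _)).
rewrite size_rcons exprS factS natrM exprMn.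
have -> : C * (A * A ^+ size w) * ((size w).+1%:R * (size w)`!%:R)
  = C * A * ((size w).+1%:R * A ^+ size w) * (size w)`!%:R by ring.
apply: ler_wpM2r => //; apply: ler_wpM2l; first exact: mulr_ge0.
apply: ler_wpM2r; first exact: exprn_ge0.
by rewrite -natrX ler_nat; exact: ltn_expl.
Qed.

Lemma gevrey_bounded_partials f x : {for x, continuous f} ->
  (forall j, gevrey_at (partial j f) x) -> gevrey_at f x.
Proof.
move=> cf /gevrey_common[C [A [C0 A0 H]]].
exists (C + (`|f x| + 1)), (A + 1); split; [by rewrite addr_ge0|lra|].
have B : \forall y \near x, `|f y| <= `|f x| + 1.
  have /cvgrPdist_le /(_ 1 ltr01) := cf; apply: filterS => y h.
  rewrite -[f y](subKr (f x)); apply: (le_trans (ler_normB _ _)); lra.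
near=> y; move=> w; case/lastP: w => [|w j].
  rewrite /= expr0 !mulr1; have : `|f y| <= `|f x| + 1 by near: y.
  by move=> h; apply: (le_trans h); rewrite lerDr.
rewrite pd_rcons.
have Hy : forall i w, `|pd w (partial i f) y| <= C * A ^+ size w * (size w)`!%:R by near: y.
apply: (le_trans (Hy j w)).
apply: (@le_trans _ _ ((C + (`|f x| + 1)) * (A + 1) ^+ size w * (size w)`!%:R)).
  apply: gevrey_le => //; last by lra.
  by rewrite lerDl.
have CC : 0 <= C + (`|f x| + 1) by rewrite addr_ge0.
rewrite size_rcons -!mulrA; apply: ler_wpM2l => //.
apply: ler_pM => //.
- by apply: exprn_ge0; lra.
- by rewrite exprS ler_peMl //; [apply: exprn_ge0|]; lra.
- by rewrite ler_nat factS leq_pmull.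
Unshelve. all: by end_near. Qed.

Lemma gevrey_ballP f x U : open U -> U x -> gevrey_at f x ->
  exists r C A : R, [/\ 0 < r, 0 <= C, 0 <= A, ball x r `<=` U &
   forall w y, ball x r y -> `|pd w f y| <= C * A ^+ size w * (size w)`!%:R].
Proof.
move=> oU Ux [C [A [C0 A0 H]]].
have : \forall y \near x, U y /\ forall w, `|pd w f y| <= C * A ^+ size w * (size w)`!%:R.
  near=> y; split; first by near: y; exact: open_nbhs_nbhs.
  by near: y.
move=> /nbhs_ballP[r /= r0 rH]; exists r, C, A; split=> // [y /rH[]|w y /rH[] //].
by [].
Unshelve. all: by end_near. Qed.

Lemma gevreyM U f g x : open U -> U x -> smooth_on U f -> smooth_on U g ->
  gevrey_at f x -> gevrey_at g x -> gevrey_at (fun y => f y * g y) x.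
Proof.
move=> oU Ux sf sg gf gg.
have [C [A [C0 A0 H]]] : exists C A : R, [/\ 0 <= C, 0 <= A &
  \forall y \near x, forall (i : 'I_2) w,
    `|pd w (if i == 0 then f else g) y| <= C * A ^+ size w * (size w)`!%:R].
  by apply: gevrey_common => i; case: eqP.
have : \forall y \near x, U y /\ forall (i : 'I_2) w,
    `|pd w (if i == 0 then f else g) y| <= C * A ^+ size w * (size w)`!%:R.
  near=> y; split; first by near: y; exact: open_nbhs_nbhs.
  by near: y.
move=> /nbhs_ballP[r /= r0 rH].
have rU : ball x r `<=` U by move=> y /rH[].
exists (C * C), (2 * A); split; [exact: mulr_ge0|lra|].
apply/nbhs_ballP; exists r => //= y yr w.
have := @leibniz_bound _ _ (size w) (ball x r) f g (fun k => C * A ^+ k * k`!%:R)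
  (fun k => C * A ^+ k * k`!%:R) (ball_open x r) (smooth_sub rU sf) (smooth_sub rU sg) _ _ w y yr erefl.
move=> LB; apply: (le_trans (LB _ _)).
- by move=> v z zr _; have [_ /(_ 0 v)] := rH _ zr.
- by move=> v z zr _; have [_ /(_ 1 v)] := rH _ zr.
rewrite (eq_bigr (fun=> C * C * A ^+ size w * (size w)`!%:R)); last first.
  move=> i _; have iw : (i <= size w)%N by rewrite -ltnS.
  have -> : A ^+ size w = A ^+ i * A ^+ (size w - i)%N by rewrite -exprD subnKC.
  rewrite -(bin_fact iw) !natrM; ring.
(* All [size w + 1] Leibniz terms have the same bound, and their number is at most [2 ^ size w];
   this is where [2 * A] comes from. *)
rewrite sumr_const card_ord exprMn -[leLHS]mulr_natl.
have -> : C * C * (2 ^+ size w * A ^+ size w) * (size w)`!%:R =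
   2 ^+ size w * (C * C * A ^+ size w * (size w)`!%:R) by ring.
apply: ler_wpM2r; first by rewrite !mulr_ge0 // exprn_ge0.
by rewrite -natrX ler_nat; exact: ltn_expl.
Unshelve. all: by end_near. Qed.

Lemma gevreyD U f g x : open U -> U x -> smooth_on U f -> smooth_on U g ->
  gevrey_at f x -> gevrey_at g x -> gevrey_at (fun y => f y + g y) x.
Proof.
move=> oU Ux sf sg gf gg.
have [C [A [C0 A0 H]]] : exists C A : R, [/\ 0 <= C, 0 <= A &
  \forall y \near x, forall (i : 'I_2) w,
    `|pd w (if i == 0 then f else g) y| <= C * A ^+ size w * (size w)`!%:R].
  by apply: gevrey_common => i; case: eqP.
exists (C + C), A; split => //; first by rewrite addr_ge0.
near=> y; move=> w.
have Uy : U y by near: y; exact: open_nbhs_nbhs.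
have Hy : forall (i : 'I_2) w,
    `|pd w (if i == 0 then f else g) y| <= C * A ^+ size w * (size w)`!%:R by near: y.
rewrite (pdD _ oU) // !mulrDl; apply: (le_trans (ler_normD _ _)).
by apply: lerD; [exact: (Hy 0)|exact: (Hy 1)].
Unshelve. all: by end_near. Qed.

Lemma gevrey_const c x : gevrey_at (fun _ => c) x.
Proof.
exists `|c|, 1; split => //; near=> y; move=> w; rewrite pd_const expr1n mulr1.
case: w => [|j w]; first by rewrite mulr1.
by rewrite normr0 mulr_ge0.
Unshelve. all: by end_near. Qed.

Lemma reg_smooth c U f : reg c U f -> smooth_on U f. Proof. by case. Qed.

Lemma reg_sub c U V f : V `<=` U -> reg c U f -> reg c V f.
Proof.
by move=> VU [sf gf]; split; [exact: smooth_sub sf|move=> ca x /VU; exact: gf].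
Qed.

Lemma reg_ext c U f g : open U -> (forall y, U y -> f y = g y) -> reg c U f -> reg c U g.
Proof.
move=> oU fg [sf gf]; split.
  apply/smooth_upto => k; apply: (diff_upto_ext oU fg); exact: (smooth_upto _ _).1.
move=> ca x Ux; apply: gevrey_near (gf ca x Ux); exact: eq_on_near oU Ux fg.
Qed.

Lemma reg_const c U (a : R) : reg c U (fun _ => a).
Proof. by split; [exact: smooth_const|move=> _ x _; exact: gevrey_const]. Qed.

Lemma regD c U f g : open U -> reg c U f -> reg c U g -> reg c U (fun y => f y + g y).
Proof.
move=> oU [sf gf] [sg gg]; split; first exact: smoothD.
by move=> ca x Ux; apply: (gevreyD oU Ux) => //; [exact: gf|exact: gg].
Qed.

Lemma regM c U f g : open U -> reg c U f -> reg c U g -> reg c U (fun y => f y * g y).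
Proof.
move=> oU [sf gf] [sg gg]; split; first exact: smoothM.
by move=> ca x Ux; apply: (gevreyM oU Ux) => //; [exact: gf|exact: gg].
Qed.

Lemma regN c U f : open U -> reg c U f -> reg c U (fun y => - f y).
Proof.
move=> oU rf; apply: (reg_ext oU _ (regM oU (reg_const c U (-1)) rf)) => y _.
by rewrite mulN1r.
Qed.

Lemma regB c U f g : open U -> reg c U f -> reg c U g -> reg c U (fun y => f y - g y).
Proof. by move=> oU rf rg; apply: regD => //; exact: regN. Qed.

Lemma reg_partial c U f j : reg c U f -> reg c U (partial j f).
Proof.
move=> [sf gf]; split; first exact: smooth_partial.
by move=> ca x Ux; apply: gevrey_partial; exact: gf.
Qed.

Lemma reg_sum c (I : Type) (r : seq I) (P : pred I) U (F : I -> 'cV[R]_n -> R) : open U ->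
  (forall i, reg c U (F i)) -> reg c U (fun y => \sum_(i <- r | P i) F i y).
Proof.
move=> oU H; elim: r => [|i r IH].
  by under eq_fun do rewrite big_nil; exact: reg_const.
by under eq_fun do rewrite big_cons; case: (P i) => //; exact: regD.
Qed.

Lemma reg_of_partials c U f : open U -> (forall x, U x -> differentiable f x) ->
  (forall j, reg c U (partial j f)) -> reg c U f.
Proof.
move=> oU df H; split.
  move=> w x Ux; case/lastP: w => [|w j]; first exact: df.
  by rewrite pd_rcons; exact: (H j).1.
move=> ca x Ux; apply: gevrey_bounded_partials.
  by apply: differentiable_continuous; exact: df.
by move=> j; exact: (H j).2.
Qed.

(** A primitive inherits the regularity of its differential, analyticity included: only the empty
    word is not a derivative of some partial derivative, and there continuity gives a bound. *)
Lemma reg_prim c U f (th : 'I_n -> 'cV[R]_n -> R) : open U ->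
  (forall x, U x -> differentiable f x) ->
  (forall j x, U x -> partial j f x = th j x) ->
  (forall j, reg c U (th j)) -> reg c U f.
Proof.
move=> oU df fth H; apply: reg_of_partials => // j.
by apply: (reg_ext oU _ (H j)) => y Uy; rewrite fth.
Qed.

Lemma reg_coord c U (i : 'I_n) : open U -> reg c U (fun y => y i 0).
Proof.
move=> oU; apply: (@reg_prim _ _ _ (fun j _ => (i == j)%:R)) => // [x _|j x _|j].
- exact: differentiable_coord.
- exact: partial_coord.
- exact: reg_const.
Qed.

End GevreyBasics.

Section ContinuousCoords.
Context {R : realType} {n m : nat}.

Lemma continuous_coords (psi : 'cV[R]_n -> 'cV[R]_m) (x : 'cV[R]_n) :
  (forall i, {for x, continuous (fun y => psi y i 0)}) -> {for x, continuous psi}.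
Proof.
move=> dp; apply/(@cvgrPdist_le _ _ _ _ (nbhs_filter x)) => e e0.
have H i : \forall y \near x, `|psi x i 0 - psi y i 0| <= e.
  by have /cvgrPdist_le /(_ e e0) := dp i.
have := filter_forall (nbhs_filter x) H; apply: filterS => y h.
by apply: norm_cV_le => [|i]; [exact: ltW|rewrite !mxE].
Qed.

End ContinuousCoords.

(** * Regularity of composed maps *)

Section Composition.
Context {R : realType} {n m : nat}.
Variables (U : set 'cV[R]_n) (V : set 'cV[R]_m) (psi : 'cV[R]_n -> 'cV[R]_m).
Hypotheses (oU : open U) (psiUV : forall x, U x -> V (psi x)).
Local Notation psic i := (fun y => psi y i 0).

Lemma diff_upto_comp k (H : 'cV[R]_m -> R) :
  (forall i, diff_upto k U (psic i)) -> diff_upto k V H -> diff_upto k U (H \o psi).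
Proof.
elim: k H => [|k IH] H dp dH.
  case=> // x _ Ux; apply: (differentiable_comp_cV _ _).1.
    by apply: (dH [::]) => //; exact: psiUV.
  by move=> i; exact: (dp i [::]).
have dp' i := (diff_uptoS _ _ _).1 (dp i); have [dH0 dH1] := (diff_uptoS _ _ _).1 dH.
have D x : U x -> differentiable (H \o psi) x /\ forall j, partial j (H \o psi) x =
    \sum_i partial i H (psi x) * partial j (psic i) x.
  move=> Ux; apply: differentiable_comp_cV; first by apply: dH0; exact: psiUV.
  by move=> i; exact: (dp' i).1.
apply/diff_uptoS; split=> [x /D[]//|j].
apply: (@diff_upto_ext _ _ k U (fun x => \sum_i (partial i H \o psi) x * partial j (psic i) x)) => //.
  by move=> x /D[_ ->].
have dpk i := diff_upto_le (leqnSn k) (dp i).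
elim: (index_enum _) => [|i r IHr].
  by under eq_fun do rewrite big_nil; move=> w x _ _; exact: smooth_const.
under eq_fun do rewrite big_cons; apply: diff_uptoD => //; apply: diff_uptoM => //.
  by apply: IH => //; exact: dH1.
exact: (dp' i).2.
Qed.

Lemma smooth_comp (H : 'cV[R]_m -> R) :
  (forall i, smooth_on U (psic i)) -> smooth_on V H -> smooth_on U (H \o psi).
Proof.
move=> dp dH; apply/smooth_upto => k; apply: diff_upto_comp => [i|].
  exact: (smooth_upto _ _).1.
exact: (smooth_upto _ _).1.
Qed.

(** The induction treats all [pd v H \o psi] together, because the chain rule expresses a derivative
    of one of them by [pd (i :: v) H \o psi] and derivatives of [psi]. The factorial sees only the
    total order [k + size v], and [K] absorbs both the geometric sum over Leibniz terms and the [m]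
    terms of the chain rule. *)
Lemma comp_bound (H : 'cV[R]_m -> R) (C A C1 A1 K : R) :
  (forall i, smooth_on U (psic i)) -> smooth_on V H ->
  0 <= C -> 0 <= A -> 0 <= C1 -> 0 <= A1 -> 2 * A1 <= K -> 2 * (m%:R * C1 * A) <= K ->
  (forall v z, V z -> `|pd v H z| <= C * A ^+ size v * (size v)`!%:R) ->
  (forall w x i j, U x -> `|pd w (partial j (psic i)) x| <= C1 * A1 ^+ size w * (size w)`!%:R) ->
  forall k w v x, U x -> size w = k ->
  `|pd w (pd v H \o psi) x| <= C * K ^+ k * A ^+ size v * (k + size v)`!%:R.
Proof.
move=> dp dH C0 A0 C10 A10 K1 K2 bH bp k; elim/ltn_ind: k => -[_|k IH] w v x Ux wk.
  by case: w wk => //= _; rewrite mulr1 add0n; apply: bH; exact: psiUV.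
case/lastP: w wk => // w j; rewrite size_rcons => -[wk]; rewrite pd_rcons.
have K0 : 0 <= K by lra.
have sHv := smooth_pd v dH.
have D y : U y -> partial j (pd v H \o psi) y =
    \sum_i (pd (i :: v) H \o psi) y * partial j (psic i) y.
  move=> Uy; apply: (differentiable_comp_cV _ _).2; first exact: (smooth_diff sHv (psiUV Uy)).
  by move=> i; exact: smooth_diff (dp i) Uy.
rewrite (pd_ext w oU D Ux).
have s1 i : smooth_on U (pd (i :: v) H \o psi).
  by apply: smooth_comp => //; exact: smooth_pd.
have s2 i : smooth_on U (partial j (psic i)) by exact: smooth_partial.
rewrite (pd_sum _ _ _ oU) //; last by move=> i; exact: smoothM.
apply: (le_trans (ler_norm_sum _ _ _)).
pose l := size v.
apply: (@le_trans _ _ (\sum_(i < m) C * C1 * A ^+ l.+1 * (2 * K ^+ k) * (k + l.+1)`!%:R)).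
  apply: ler_sum => i _.
  have := @leibniz_bound _ _ k U _ _ (fun p => C * K ^+ p * A ^+ l.+1 * (p + l.+1)`!%:R)
    (fun q => C1 * A1 ^+ q * q`!%:R) oU (s1 i) (s2 i) _ _ w x Ux wk.
  move=> LB; apply: (le_trans (LB _ _)).
  - by move=> u z Uz uk; rewrite -/(size (i :: v)); apply: IH.
  - by move=> u z Uz uk; exact: bp.
  apply: (@le_trans _ _ (\sum_(p < k.+1) C * C1 * A ^+ l.+1 * (k + l.+1)`!%:R * (K ^+ p * A1 ^+ (k - p)%N))).
    apply: ler_sum => p _; have pk : (p <= k)%N by rewrite -ltnS.
    have -> : 'C(k, p)%:R * (C * K ^+ p * A ^+ l.+1 * (p + l.+1)`!%:R) *
        (C1 * A1 ^+ (k - p) * (k - p)`!%:R) =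
      ('C(k, p) * (k - p)`! * (p + l.+1)`!)%:R * (C * C1 * A ^+ l.+1 * (K ^+ p * A1 ^+ (k - p)%N)).
      by rewrite !natrM; ring.
    have -> : C * C1 * A ^+ l.+1 * (k + l.+1)`!%:R * (K ^+ p * A1 ^+ (k - p)) =
      (k + l.+1)`!%:R * (C * C1 * A ^+ l.+1 * (K ^+ p * A1 ^+ (k - p)%N)) by ring.
    apply: ler_wpM2r; first by rewrite !mulr_ge0 // exprn_ge0.
    (* After multiplication by p! the claim is k! (p+l+1)! <= p! (k+l+1)!, an instance of
       [leq_fact_ratio]. *)
    rewrite ler_nat -(leq_pmul2l (fact_gt0 p)).
    have := leq_fact_ratio p (k - p) l.+1; rewrite subnKC // => /(leq_trans _); apply.
    by rewrite -(bin_fact pk); apply: eq_leq; ring.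
  rewrite -mulr_sumr.
  have -> : C * C1 * A ^+ l.+1 * (2 * K ^+ k) * (k + l.+1)`!%:R =
     C * C1 * A ^+ l.+1 * (k + l.+1)`!%:R * (2 * K ^+ k) by ring.
  apply: ler_wpM2l; first by rewrite !mulr_ge0 // exprn_ge0.
  exact: geom_le.
rewrite sumr_const card_ord -[leLHS]mulr_natl addnS -addSn.
have -> : m%:R * (C * C1 * A ^+ l.+1 * (2 * K ^+ k) * (k.+1 + l)`!%:R) =
   2 * (m%:R * C1 * A) * (C * K ^+ k * A ^+ l * (k.+1 + l)`!%:R) by rewrite exprS; ring.
have -> : C * K ^+ k.+1 * A ^+ l * (k.+1 + l)`!%:R = K * (C * K ^+ k * A ^+ l * (k.+1 + l)`!%:R).
  by rewrite exprS; ring.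
by apply: ler_wpM2r => //; rewrite !mulr_ge0 // exprn_ge0.
Qed.

Lemma psi_continuous (x : 'cV[R]_n) : U x -> (forall i, smooth_on U (psic i)) -> {for x, continuous psi}.
Proof.
move=> Ux dp; apply: continuous_coords => i.
exact: differentiable_continuous (smooth_diff (dp i) Ux).
Qed.

End Composition.

Section RegComposition.
Context {R : realType} {n m : nat}.
Variables (c : category) (U : set 'cV[R]_n) (V : set 'cV[R]_m) (psi : 'cV[R]_n -> 'cV[R]_m).
Hypotheses (oU : open U) (oV : open V) (psiUV : forall x, U x -> V (psi x)).
Local Notation psic i := (fun y => psi y i 0).

Lemma reg_comp (H : 'cV[R]_m -> R) :
  (forall i, reg c U (psic i)) -> reg c V H -> reg c U (H \o psi).
Proof.
move=> rp [sH gH]; have sp i := reg_smooth (rp i).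
split; first exact: (smooth_comp oU psiUV).
move=> ca x Ux; have [r1 [C [A [r10 C0 A0 rV bH]]]] := gevrey_ballP oV (psiUV Ux) (gH ca _ (psiUV Ux)).
have [C1 [A1 [C10 A10 bp]]] : exists C A : R, [/\ 0 <= C, 0 <= A &
  \forall y \near x, forall (ij : 'I_(#|{: 'I_m * 'I_n}|)) w,
    `|pd w (partial (enum_val ij).2 (psic (enum_val ij).1)) y| <= C * A ^+ size w * (size w)`!%:R].
  by apply: gevrey_common => ij; apply: gevrey_partial; exact: (rp _).2.
have cp := psi_continuous Ux sp.
have : \forall y \near x, [/\ U y, ball (psi x) r1 (psi y) & forall (ij : 'I_(#|{: 'I_m * 'I_n}|)) w,
    `|pd w (partial (enum_val ij).2 (psic (enum_val ij).1)) y| <= C1 * A1 ^+ size w * (size w)`!%:R].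
  near=> y; split; last by near: y.
    by near: y; exact: open_nbhs_nbhs.
  by near: y; apply: cp; exact: nbhsx_ballx.
move=> /nbhs_ballP[r /= r0 rH].
have rU : ball x r `<=` U by move=> y /rH[].
pose K := 2 * A1 + 2 * (m%:R * C1 * A).
have mC : 0 <= m%:R * C1 * A by rewrite !mulr_ge0.
exists C, K; split=> //; first by rewrite /K; lra.
apply/nbhs_ballP; exists r => //= y yr w.
have := @comp_bound _ _ _ (ball x r) (ball (psi x) r1) psi (ball_open x r)
  _ H C A C1 A1 K _ _ C0 A0 C10 A10 _ _ _ _ (size w) w [::] y yr erefl.
rewrite expr0 mulr1 addn0; apply.
- by move=> z /rH[].
- by move=> i; exact: smooth_sub rU (sp i).
- exact: smooth_sub sH.
- by rewrite /K; lra.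
- by rewrite /K; lra.
- by move=> v z zr; exact: bH.
- move=> u z i j zr; have [_ _ /(_ (enum_rank (i, j)) u)] := rH _ zr.
  by rewrite enum_rankK.
Unshelve. all: by end_near. Qed.

(** * Maps whose partial derivatives are functions of their values *)

Section Flow.
Variable (G : 'I_n -> 'I_m -> 'cV[R]_m -> R).
Hypotheses (dpsi : forall i x, U x -> differentiable (psic i) x)
  (psiG : forall i j x, U x -> partial j (psic i) x = G j i (psi x)).

(* If the partial derivatives of psi are functions G of psi itself, those of H \o psi *)
(* are obtained by iterating the first order operators [push j] on the target side.   *)
Definition push j (H : 'cV[R]_m -> R) : 'cV[R]_m -> R := fun z => \sum_i G j i z * partial i H z.

Lemma push_smooth w (H : 'cV[R]_m -> R) :
  (forall j i, smooth_on V (G j i)) -> smooth_on V H -> smooth_on V (foldr push H w).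
Proof.
move=> sG sH; elim: w => [|j w IH] //=; apply: smooth_sum => // i.
by apply: smoothM => //; exact: smooth_partial.
Qed.

Lemma push_pd w (H : 'cV[R]_m -> R) x :
  (forall j i, smooth_on V (G j i)) -> smooth_on V H -> U x ->
  pd w (H \o psi) x = foldr push H w (psi x).
Proof.
move=> sG sH; elim: w x => [|j w IH] x Ux //=.
rewrite (@partial_near _ _ _ (foldr push H w \o psi)); last first.
  exact: eq_on_near oU Ux IH.
rewrite (differentiable_comp_cV _ _).2 //; last by move=> i; exact: dpsi.
  by apply: eq_bigr => i _; rewrite psiG // mulrC.
exact: smooth_diff (push_smooth w sG sH) (psiUV Ux).
Qed.

(** Each [push] is followed by further derivatives that also hit its coefficients, so k applications
    cost about (2k)!/k!; this is why [(size w)!] stands on the left. In the induction step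
    [fact_sum] yields (2k+2+l)!/(2k+2), and the new factor k+1 is below 2k+2. *)
Lemma push_bound (W : set 'cV[R]_m) (H : 'cV[R]_m -> R) (C D A K : R) : open W ->
  (forall j i, smooth_on W (G j i)) -> smooth_on W H ->
  (forall w, smooth_on W (foldr push H w)) ->
  0 <= C -> 0 <= D -> 0 <= A -> m%:R * C * A <= K ->
  (forall v j i z, W z -> `|pd v (G j i) z| <= C * A ^+ size v * (size v)`!%:R) ->
  (forall v z, W z -> `|pd v H z| <= D * A ^+ size v * (size v)`!%:R) ->
  forall w v z, W z -> `|pd v (foldr push H w) z| * (size w)`!%:R <=
    D * K ^+ size w * A ^+ size v * (2 * size w + size v)`!%:R.
Proof.
move=> oW sG sH sW C0 D0 A0 KC bG bH; elim=> [|j w IH] v z Wz /=.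
  by rewrite !mulr1 muln0 add0n; exact: bH.
have K0 : 0 <= K by apply: le_trans KC; rewrite !mulr_ge0.
set k := size w; set l := size v.
have kf : 0 < (k`!%:R : R) by rewrite ltr0n fact_gt0.
rewrite (pd_sum _ _ _ oW) //; last by move=> i; apply: smoothM => //; exact: smooth_partial.
apply: (@le_trans _ _ ((\sum_(i < m) (C * D * K ^+ k * A ^+ l.+1 / k`!%:R) *
   (\sum_(p < l.+1) 'C(l, p) * p`! * (2 * k + 1 + l - p)`!)%:R) * (k.+1)`!%:R)).
  apply: ler_wpM2r => //; apply: (le_trans (ler_norm_sum _ _ _)); apply: ler_sum => i _.
  have := @leibniz_bound _ _ l W _ _ (fun p => C * A ^+ p * p`!%:R)
    (fun q => D * K ^+ k * A ^+ q.+1 * (2 * k + q.+1)`!%:R / k`!%:R)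
    oW (sG j i) (smooth_partial i (sW w)) _ _ v z Wz erefl.
  move=> LB; apply: (le_trans (LB _ _)).
  - by move=> u y Wy _; exact: bG.
  - move=> u y Wy _; rewrite -pd_rcons ler_pdivlMr // -/k.
    by have := IH (rcons u i) y Wy; rewrite size_rcons.
  rewrite natr_sum mulr_sumr; apply: ler_sum => p _.
  have pl : (p <= l)%N by rewrite -ltnS.
  have -> : (2 * k + (l - p).+1 = 2 * k + 1 + l - p)%N by lia.
  have -> : A ^+ l.+1 = A ^+ p * A ^+ (l - p).+1 by rewrite -exprD; congr (_ ^+ _); lia.
  rewrite !natrM le_eqVlt; apply/orP; left; apply/eqP; ring.
rewrite sumr_const card_ord -[X in X * _]mulr_natl.
have S := fact_sum (2 * k + 1) l.
set T := (\sum_(p < l.+1) _)%N in S *.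
have -> : m%:R * (C * D * K ^+ k * A ^+ l.+1 / k`!%:R * T%:R) * k.+1`!%:R =
  (m%:R * C * A) * (D * K ^+ k * A ^+ l) * (k.+1%:R * T%:R).
  rewrite factS natrM exprS; field; exact: lt0r_neq0.
have -> : D * K ^+ k.+1 * A ^+ l * (2 * k.+1 + l)`!%:R =
  K * (D * K ^+ k * A ^+ l) * (2 * k.+1 + l)`!%:R by rewrite exprS; ring.
have P0 : 0 <= D * K ^+ k * A ^+ l by rewrite !mulr_ge0 // exprn_ge0.
apply: ler_pM => //.
- by rewrite !mulr_ge0 // exprn_ge0.
- by apply: ler_wpM2r.
rewrite -natrM ler_nat; have -> : (2 * k.+1 + l = (2 * k + 1).+1 + l)%N by lia.
by rewrite -S leq_mul2r; apply/orP; right; lia.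
Qed.

(** This is the source of the analyticity of inverse maps. Derivatives of [H \o psi] are iterated
    [push] of [H] read at [psi], and (2k)! <= 4^k k! k! turns [push_bound] into a Cauchy estimate
    with constant [4 * K]. *)
Lemma reg_flow (H : 'cV[R]_m -> R) :
  (forall j i, reg c V (G j i)) -> reg c V H -> reg c U (H \o psi).
Proof.
move=> rG [sH gH]; have sG j i := reg_smooth (rG j i).
split.
  move=> w x Ux; apply: (@differentiable_ext _ _ U (foldr push H w \o psi)) => //.
    by move=> y Uy; rewrite push_pd.
  apply: (differentiable_comp_cV _ _).1; last by move=> i; exact: dpsi.
  exact: smooth_diff (push_smooth w sG sH) (psiUV Ux).
move=> ca x Ux; have Vx := psiUV Ux.
have [r1 [D [A1 [r10 D0 A10 rV bH]]]] := gevrey_ballP oV Vx (gH ca _ Vx).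
have [C [A2 [C0 A20 bG]]] : exists C A : R, [/\ 0 <= C, 0 <= A &
  \forall y \near psi x, forall (ij : 'I_(#|{: 'I_n * 'I_m}|)) w,
    `|pd w (G (enum_val ij).1 (enum_val ij).2) y| <= C * A ^+ size w * (size w)`!%:R].
  by apply: gevrey_common => ij; exact: (rG _ _).2.
move: bG => /nbhs_ballP[r2 /= r20 bG].
pose r := Num.min r1 r2; have r0 : 0 < r by rewrite lt_min r10.
pose A := A1 + A2; have A0 : 0 <= A by rewrite /A addr_ge0.
have br y : ball (psi x) r y -> ball (psi x) r1 y /\ ball (psi x) r2 y.
  by rewrite !ballE lt_min => /andP.
pose W := ball (psi x) r.
have WV : W `<=` V by move=> y /br[/rV].
pose K := m%:R * C * A; have K0 : 0 <= K by rewrite /K !mulr_ge0.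
have cp : {for x, continuous psi}.
  by apply: continuous_coords => i; apply: differentiable_continuous; exact: dpsi.
exists D, (4 * K); split => //; first by rewrite mulr_ge0.
near=> y; move=> w.
have Uy : U y by near: y; exact: open_nbhs_nbhs.
have Wy : W (psi y) by near: y; apply: cp; exact: nbhsx_ballx.
rewrite push_pd // -/(pd [::] _).
have wf : 0 < ((size w)`!%:R : R) by rewrite ltr0n fact_gt0.
rewrite -(ler_pM2r wf).
apply: (le_trans (@push_bound W H C D A K _ _ _ _ _ _ _ _ _ _ w [::] (psi y) Wy)) => //.
- exact: ball_open.
- by move=> j i; exact: smooth_sub WV (sG j i).
- exact: smooth_sub WV sH.
- by move=> v; apply: smooth_sub WV _; exact: push_smooth.
- move=> v j i z /br[_ z2]; have := bG z z2 (enum_rank (j, i)) v; rewrite enum_rankK /= => h.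
  by apply: (le_trans h); apply: gevrey_le => //; rewrite /A lerDr.
- move=> v z /br[z1 _]; apply: (le_trans (bH v z z1)).
  by apply: gevrey_le => //; rewrite /A lerDl.
rewrite /= expr0 mulr1 addn0 [(4 * K) ^+ _]exprMn.
set k := size w.
have -> : D * (4 ^+ k * K ^+ k) * k`!%:R * k`!%:R = D * K ^+ k * (4 ^ k * (k`! * k`!))%:R.
  by rewrite !natrM natrX; ring.
apply: ler_wpM2l; first by rewrite mulr_ge0 // exprn_ge0.
rewrite ler_nat.
exact: fact_double_le.
Unshelve. all: by end_near. Qed.

End Flow.
End RegComposition.

Lemma is_derive_shift1 {R : realType} (g : R -> R) (a t d : R) :
  is_derive (t + a) 1 g d -> is_derive t 1 (fun s => g (s + a)) d.
Proof.
have E : (fun h : R => h^-1 *: ((g \o shift (t + a)) (h *: 1) - g (t + a))) =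
    (fun h : R => h^-1 *: (((fun s => g (s + a)) \o shift t) (h *: 1) - g (t + a))).
  by apply/funext => h /=; rewrite addrA.
by case; rewrite /derivable /derive E => D V; apply: DeriveDef.
Qed.

(** * Elementary functions *)

Section OneVariable.
Context {R : realType} {n : nat}.
Implicit Types (U : set 'cV[R]_n) (f : 'cV[R]_n -> R).

Lemma chain1 m (g : R -> R) (dg : R) (f : 'cV[R]_m -> R) x :
  is_derive (f x) 1 g dg -> differentiable f x ->
  differentiable (fun y => g (f y)) x /\
  forall j, partial j (fun y => g (f y)) x = dg * partial j f x.
Proof.
move=> [dg1 gv] df.
have dG : differentiable g (f x) by apply/derivable1_diffP.
have dc : differentiable (g \o f) x by apply: differentiable_comp.
split => // j; rewrite /partial deriveE // diff_comp //= -[X in 'd g _ X]mulr1.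
rewrite -[X in 'd g _ X]/(_ *: (1 : R)) linearZ /= -(deriveE _ dG) gv -deriveE //.
by rewrite /GRing.scale /= mulrC.
Qed.

(** The sequence [g] lists the successive derivatives of the scalar function [g 0], which is
    regarded as a function of a column of height one so that [reg_comp] applies. *)
Lemma reg_fun1 c U f (D : set R) (g : nat -> R -> R) : open U -> open D ->
  (forall k t, D t -> is_derive t 1 (g k) (g k.+1 t)) ->
  (forall t0, D t0 -> exists C A : R, [/\ 0 <= C, 0 <= A &
     \forall t \near t0, forall k, `|g k t| <= C * A ^+ k * k`!%:R]) ->
  reg c U f -> (forall x, U x -> D (f x)) -> reg c U (fun x => g 0%N (f x)).
Proof.
move=> oU oD dg bg rf fD.
pose V : set 'cV[R]_1 := [set z | D (z 0 0)].
have cc : continuous (fun z : 'cV[R]_1 => z 0 0) by move=> z; exact: coord_continuous.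
have oV : open V by apply: (open_comp _ oD) => z _; exact: cc.
have P w k z : V z -> pd w (fun z => g k (z 0 0)) z = g (k + size w)%N (z 0 0).
  elim: w z => [|j w IH] z Vz /=; first by rewrite addn0.
  rewrite (@partial_near _ _ _ (fun z => g (k + size w)%N (z 0 0))); last first.
    exact: eq_on_near oV Vz IH.
  have [_ ->] := @chain1 1 _ _ (fun z => z 0 0) z (dg (k + size w)%N _ Vz)
    (differentiable_coord _ _ _).
  by rewrite partial_coord (ord1 j) mulr1 addnS.
have rg : reg c V (fun z => g 0%N (z 0 0)).
  split=> [w z Vz|_ z Vz].
    apply: (@differentiable_ext _ _ V (fun z => g (size w) (z 0 0))) => //.
      by move=> y Vy; rewrite P.
    by have [] := @chain1 1 _ _ (fun z => z 0 0) z (dg (size w)%N _ Vz)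
      (differentiable_coord _ _ _).
  have [C [A [C0 A0 H]]] := bg _ Vz; exists C, A; split => //.
  have H' : \forall y \near z, forall k, `|g k ((y : 'cV[R]_1) 0 0)| <= C * A ^+ k * k`!%:R.
    exact: (cc z _ H).
  near=> y => w; rewrite P ?add0n; last by near: y; exact: open_nbhs_nbhs.
  by move: (size w); near: y.
have := @reg_comp _ n 1 c U V (fun x => \col_i f x) oU oV _ (fun z => g 0%N (z 0 0)) _ rg.
have E : (fun z : 'cV[R]_1 => g 0%N (z 0 0)) \o (fun x => \col_i f x) = fun x => g 0%N (f x).
  by apply/funext => x /=; rewrite mxE.
rewrite E; apply.
  by move=> x Ux; rewrite /V /= mxE; exact: fD.
by move=> i; under eq_fun do rewrite mxE.
Unshelve. all: by end_near. Qed.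

Lemma reg_expR c U f : open U -> reg c U f -> reg c U (fun x => expR (f x)).
Proof.
move=> oU rf; apply: (@reg_fun1 c U f setT (fun=> expR)) => //; first exact: openT.
move=> t0 _; exists (expR (t0 + 1)), 1; split => //.
have : \forall t \near t0, `|t0 - t| <= 1.
  by have := (@cvg_id _ (nbhs t0)); move/cvgrPdist_le; exact.
apply: filterS => t; rewrite ler_norml => /andP[t1 t2] k.
rewrite expr1n mulr1 ger0_norm ?expR_ge0 //.
apply: (@le_trans _ _ (expR (t0 + 1))); first by rewrite ler_expR; lra.
by rewrite ler_peMr ?expR_ge0 // ler1n fact_gt0.
Qed.

(** Each differentiation advances the phase by a quarter turn, so every derivative is again a
    cosine, bounded by 1. *)
Lemma reg_cos c U f : open U -> reg c U f -> reg c U (fun x => cos (f x)).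
Proof.
move=> oU rf; have -> : (fun x => cos (f x)) = (fun x => cos (f x + 0%:R * (pi / 2))).
  by apply/funext => x; rewrite mul0r addr0.
apply: (@reg_fun1 c U f setT (fun k t => cos (t + k%:R * (pi / 2)))) => //.
- exact: openT.
- move=> k t _; have -> : cos (t + k.+1%:R * (pi / 2)) = - sin (t + k%:R * (pi / 2)).
    by rewrite -natr1 mulrDl mul1r addrA cosD cos_pihalf sin_pihalf mulr0 mulr1 sub0r.
  exact: is_derive_shift1.
- move=> t0 _; exists 1, 1; split => //; near=> t => k; rewrite expr1n mulr1 mul1r.
  apply: (@le_trans _ _ 1); last by rewrite ler1n fact_gt0.
  by rewrite ler_norml cos_geN1 cos_le1.
Unshelve. all: by end_near. Qed.

Lemma reg_sin c U f : open U -> reg c U f -> reg c U (fun x => sin (f x)).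
Proof.
move=> oU rf; have -> : (fun x => sin (f x)) = (fun x => cos (f x - pi / 2)).
  by apply/funext => x; rewrite cosB cos_pihalf sin_pihalf mulr0 mulr1 add0r.
by apply: reg_cos => //; apply: regB => //; exact: reg_const.
Qed.

Lemma reg_inv c U f : open U -> reg c U f -> (forall x, U x -> f x != 0) ->
  reg c U (fun x => (f x)^-1).
Proof.
move=> oU rf f0.
pose g (k : nat) (t : R) := (-1) ^+ k * k`!%:R * (t ^+ k.+1)^-1.
have -> : (fun x => (f x)^-1) = (fun x => g 0%N (f x)).
  by apply/funext => x; rewrite /g expr0 !mul1r expr1.
apply: (@reg_fun1 c U f [set t | t != 0] g) => //.
- move=> k t /= t0.
  have t1 : t ^+ k.+1 != 0 by rewrite expf_neq0.
  have dX : is_derive t 1 (fun s : R => s ^+ k.+1) (k.+1%:R * t ^+ k).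
    apply: DeriveDef; first exact: exprn_derivable.
    by rewrite exp_derive /= scaler1 -mulr_natl.
  have dV : is_derive t 1 (fun s : R => (s ^+ k.+1)^-1) (- (t ^+ k.+1) ^- 2 * (k.+1%:R * t ^+ k)).
    apply: DeriveDef; first by apply: derivableV => //; exact: ex_derive.
    by rewrite deriveV //; rewrite derive_val.
  have dC := @is_deriveZ _ _ _ (fun s : R => (s ^+ k.+1)^-1) ((-1) ^+ k * k`!%:R) t 1 _ dV.
  apply: (is_derive_eq dC); rewrite /g /GRing.scale /= factS natrM !exprS; field.
  by rewrite t0 expf_neq0.
(* Where |t - t0| <= |t0|/2 one has |t| >= |t0|/2, so each of the k+1 factors of the power of 1/t is
   at most 2/|t0|. *)
- move=> t0 /= t00; exists (2 / `|t0|), (2 / `|t0|).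
  have t0p : 0 < `|t0| by rewrite normr_gt0.
  split; [by rewrite divr_ge0|by rewrite divr_ge0|].
  have : \forall t \near t0, `|t0 - t| <= `|t0| / 2.
    have := (@cvg_id _ (nbhs t0)); move/cvgrPdist_le; apply; by rewrite divr_gt0.
  apply: filterS => t ht k.
  have tp : `|t0| / 2 <= `|t|.
    have := ler_normD (t0 - t) t; rewrite subrK; lra.
  rewrite !normrM normrX normrN1 expr1n mul1r normfV normrX.
  rewrite ger0_norm // mulrC; apply: ler_wpM2r => //.
  rewrite -exprS -exprVn; apply: lerXn2r; rewrite ?nnegrE ?invr_ge0 ?divr_ge0 //.
  have -> : 2 / `|t0| = (`|t0| / 2)^-1 by rewrite invf_div.
  rewrite lef_pV2 // posrE; last by rewrite divr_gt0.
  apply: lt_le_trans tp; by rewrite divr_gt0.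
Qed.

Lemma reg_ln c U f : open U -> reg c U f -> (forall x, U x -> 0 < f x) ->
  reg c U (fun x => ln (f x)).
Proof.
move=> oU rf f0.
have D x : U x -> differentiable (fun y => ln (f y)) x /\
    forall j, partial j (fun y => ln (f y)) x = (f x)^-1 * partial j f x.
  move=> Ux; apply: chain1; first exact: (is_derive1_ln (f0 _ Ux)).
  exact: smooth_diff (reg_smooth rf) Ux.
apply: (@reg_prim _ _ c U _ (fun j x => (f x)^-1 * partial j f x)) => // [x /D[]//|j x /D[]//|j].
apply: regM => //; last exact: reg_partial.
by apply: reg_inv => // x /f0; exact: lt0r_neq0.
Qed.

Lemma reg_sqrt c U f : open U -> reg c U f -> (forall x, U x -> 0 < f x) ->
  reg c U (fun x => Num.sqrt (f x)).
Proof.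
move=> oU rf f0.
have := reg_expR oU (regM oU (reg_const c U 2^-1) (reg_ln oU rf f0)).
apply: reg_ext => // x /f0 fx.
apply/eqP; rewrite -(@eqrXn2 _ 2) ?expR_ge0 ?sqrtr_ge0 // sqr_sqrtr ?ltW //.
by rewrite -expRM_natl mulrA divff // mul1r lnK.
Qed.

End OneVariable.

(** * Comparison with the regularity of the definitions *)

Section SmoothRegular.
Context {R : realType} {n : nat}.
Implicit Types (U : set 'cV[R]_n) (f : 'cV[R]_n -> R) (x : 'cV[R]_n).

Lemma Ck_smooth U f : open U -> (forall k, Ck k U f) -> smooth_on U f.
Proof.
move=> oU H w; elim/last_ind: w f H => [|w j IH] f H x Ux; last first.
  by rewrite pd_rcons; apply: IH => // k; have [_ /(_ j)[]] := H k.+1.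
have [r r0 rU] := open_ballP oU Ux.
apply: (C1_differentiable r0) => [y j /rU Uy|j].
  by have [_ /(_ j)[D _]] := H 1%N; exact: D.
by have [_ /(_ j)[_ [D _]]] := H 1%N; exact: D.
Qed.

Lemma smooth_Ck U f : smooth_on U f -> forall k, Ck k U f.
Proof.
have cf g : smooth_on U g -> forall x, U x -> {for x, continuous g}.
  by move=> sg x Ux; exact: differentiable_continuous (smooth_diff sg Ux).
move=> sf k; elim: k f sf => [|k IH] f sf; split; [exact: cf|by []|exact: cf|move=> j].
split=> [x Ux|]; first exact: diff_derivable (smooth_diff sf Ux).
by apply: IH; exact: smooth_partial.
Qed.

End SmoothRegular.

(** * Sums over words and Taylor's formula *)

Section Words.
Context {R : realType} {I : finType}.
Implicit Types (F G : seq I -> R).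

Fixpoint wsum (k : nat) F : R :=
  if k is k'.+1 then \sum_j wsum k' (fun w => F (j :: w)) else F [::].

Lemma eq_wsum k F G : (forall w, size w = k -> F w = G w) -> wsum k F = wsum k G.
Proof.
elim: k F G => [|k IH] F G H /=; first exact: H.
by apply: eq_bigr => j _; apply: IH => w wk; apply: H; rewrite /= wk.
Qed.

Lemma wsum_sum (J : Type) (r : seq J) (P : pred J) k (F : J -> seq I -> R) :
  \sum_(a <- r | P a) wsum k (F a) = wsum k (fun w => \sum_(a <- r | P a) F a w).
Proof.
elim: k F => [|k IH] F //=; rewrite exchange_big; apply: eq_bigr => j _ /=.
by rewrite IH.
Qed.

Lemma wsumZ k (c : R) F : wsum k (fun w => c * F w) = c * wsum k F.
Proof. by elim: k F => [|k IH] F //=; rewrite mulr_sumr; apply: eq_bigr. Qed.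

Lemma wsumD k F G : wsum k (fun w => F w + G w) = wsum k F + wsum k G.
Proof.
elim: k F G => [|k IH] F G //=; rewrite -big_split /=; apply: eq_bigr => j _.
exact: IH.
Qed.

Lemma wsum_le k F G : (forall w, size w = k -> F w <= G w) -> wsum k F <= wsum k G.
Proof.
elim: k F G => [|k IH] F G H /=; first exact: H.
by apply: ler_sum => j _; apply: IH => w wk; apply: H; rewrite /= wk.
Qed.

Lemma wsum_norm k F : `|wsum k F| <= wsum k (fun w => `|F w|).
Proof.
elim: k F => [|k IH] F //=; apply: (le_trans (ler_norm_sum _ _ _)).
by apply: ler_sum => j _; exact: IH.
Qed.

Lemma wsum_const k (c : R) : wsum k (fun _ => c) = #|I|%:R ^+ k * c.
Proof.
elim: k => [|k IH] /=; first by rewrite expr0 mul1r.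
by rewrite IH sumr_const exprS -[LHS]mulr_natl mulrA.
Qed.

Lemma wsum_bound k F (c : R) : (forall w, size w = k -> `|F w| <= c) ->
  `|wsum k F| <= #|I|%:R ^+ k * c.
Proof.
move=> H; apply: (le_trans (wsum_norm _ _)); rewrite -wsum_const.
exact: wsum_le.
Qed.

End Words.

Section Taylor.
Context {R : realType}.
Implicit Types s t : R.

(** Induction on the order: the derivative of the remainder is a remainder of lower order for the
    sequence [g] shifted by one. For both signs [e], the function M t^(K+1)/(K+1)! - e D(t) vanishes
    at 0 and has nonnegative derivative. *)
Lemma taylor_1d K (g : nat -> R -> R) (M : R) :
  (forall k t, 0 <= t <= 1 -> is_derive t 1 (g k) (g k.+1 t)) ->
  (forall t, 0 <= t <= 1 -> `|g K t| <= M) ->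
  forall t, 0 <= t <= 1 ->
  `|g 0%N t - \sum_(k < K) g k 0 * t ^+ k / k`!%:R| <= M * t ^+ K / K`!%:R.
Proof.
elim: K g => [|K IH] g dg bg t t01.
  by rewrite big_ord0 subr0 expr0 mulr1 invr1 mulr1; exact: bg.
have f0 k : (k`!%:R : R) != 0 by rewrite pnatr_eq0 -lt0n fact_gt0.
have k0 k : (k.+1%:R : R) != 0 by rewrite pnatr_eq0.
have dpow k s : is_derive s 1 (fun t : R => t ^+ k.+1 / k.+1`!%:R) (s ^+ k / k`!%:R).
  have dX : is_derive s 1 (fun s : R => s ^+ k.+1) (k.+1%:R * s ^+ k).
    apply: DeriveDef; first exact: exprn_derivable.
    by rewrite exp_derive /= scaler1 -mulr_natl.
  have := @is_deriveZ _ _ _ (fun s : R => s ^+ k.+1) (k.+1`!%:R^-1) s 1 _ dX.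
  have -> : k.+1`!%:R^-1 \*: (fun s : R => s ^+ k.+1) = (fun t : R => t ^+ k.+1 / k.+1`!%:R).
    by apply/funext => u /=; rewrite /GRing.scale /= mulrC.
  move=> D; apply: (is_derive_eq D); rewrite /GRing.scale /= factS natrM.
  by rewrite invfM mulrACA mulVf // mul1r mulrC.
pose D t := g 0%N t - \sum_(k < K.+1) g k 0 * t ^+ k / k`!%:R.
pose D' t := g 1%N t - \sum_(k < K) g k.+1 0 * t ^+ k / k`!%:R.
have dD s : 0 <= s <= 1 -> is_derive s 1 D (D' s).
  move=> s01; have -> : D = g 0%N - (\sum_(k < K.+1) (fun t => g k 0 * t ^+ k / k`!%:R)).
    by apply/funext => u; rewrite /D !fctE fct_sumE.
  apply: is_deriveB; first exact: dg.
  rewrite big_ord_recl /=.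
  have dS : is_derive s 1 (\sum_(i < K) (fun t => g (bump 0 i) 0 * t ^+ bump 0 i / (bump 0 i)`!%:R))
      (\sum_(k < K) g k.+1 0 * (s ^+ k / k`!%:R)).
    apply: is_derive_sum => i.
    have := @is_deriveZ _ _ _ _ (g i.+1 0) s 1 _ (dpow i s).
    have -> : g i.+1 0 \*: (fun t0 : R => t0 ^+ i.+1 / i.+1`!%:R) =
      (fun t0 : R => g (bump 0 i) 0 * t0 ^+ bump 0 i / (bump 0 i)`!%:R).
      by apply/funext => u /=; rewrite /GRing.scale /= mulrA.
    by [].
  have dc : is_derive s 1 (fun t : R => g 0%N 0 * t ^+ 0 / 0`!%:R) 0.
    have -> : (fun t : R => g 0%N 0 * t ^+ 0 / 0`!%:R) = cst (g 0%N 0 * 1 / 0`!%:R).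
      by apply/funext => u; rewrite expr0.
    exact: is_derive_cst.
  apply: (is_derive_eq (is_deriveD dc dS)); rewrite add0r.
  by apply: eq_bigr => i _; rewrite mulrA.
have bD' s : 0 <= s <= 1 -> `|D' s| <= M * s ^+ K / K`!%:R.
  by move=> s01; apply: (IH (fun k => g k.+1)) => // k; exact: (dg k.+1).
have D0 : D 0 = 0.
  rewrite /D big_ord_recl /= expr0 mulr1 invr1 mulr1 big1 ?addr0 ?subrr // => i _.
  by rewrite expr0n /= mulr0 mul0r.
have E (e : R) : e = 1 \/ e = -1 -> e * D t <= M * t ^+ K.+1 / K.+1`!%:R.
  move=> ee; pose F := M \*: (fun t : R => t ^+ K.+1 / K.+1`!%:R) - e \*: D.
  have dF s : 0 <= s <= 1 -> is_derive s 1 F (M *: (s ^+ K / K`!%:R) - e *: D' s).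
    by move=> s01; apply: is_deriveB; apply: is_deriveZ => //; exact: dD.
  have /andP[t0 t1] := t01.
  have [s||s] := @MVT_segment R F (fun s => M *: (s ^+ K / K`!%:R) - e *: D' s) 0 t t0.
  - rewrite in_itv /= => /andP[s0 st]; apply: dF; rewrite (ltW s0) /=; lra.
  - apply: derivable_within_continuous => s; rewrite in_itv /= => /andP[s0 st].
    have s01 : 0 <= s <= 1 by rewrite s0 /=; lra.
    by have [] := dF s s01.
  rewrite in_itv /= subr0 => /andP[s0 st].
  have Fu u : F u = M * (u ^+ K.+1 / K.+1`!%:R) - e * D u by [].
  rewrite !Fu D0 expr0n /= mul0r !mulr0 !subr0 /GRing.scale /= => FE.
  have s01 : 0 <= s <= 1 by rewrite s0 /=; lra.
  have := bD' s s01; rewrite ler_norml => /andP[b1 b2].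
  rewrite -subr_ge0 -mulrA FE mulr_ge0 //.
  by case: ee => ->; rewrite mulrA; lra.
rewrite -/(D t) ler_norml; apply/andP; split.
  by have := E (-1) (or_intror erefl); lra.
by have := E 1 (or_introl erefl); lra.
Qed.

End Taylor.

(** * Power series summed over boxes of exponents *)

Section BoxSums.
Context {R : realType} {n : nat}.
Implicit Types (t : ('I_n -> nat) -> R) (h : 'cV[R]_n) (w : seq 'I_n).

Definition ffval N (al : {ffun 'I_n -> 'I_N}) : 'I_n -> nat := fun i => al i.

Definition ffwiden N (al : {ffun 'I_n -> 'I_N}) : {ffun 'I_n -> 'I_N.+1} :=
  [ffun i => widen_ord (leqnSn N) (al i)].

Lemma ffwiden_inj N : injective (@ffwiden N).
Proof.
move=> a b /ffunP E; apply/ffunP => i; have := E i; rewrite !ffunE.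
by move=> /(congr1 val) /= H; exact: val_inj.
Qed.

Lemma ffval_widen N al : ffval (@ffwiden N al) = ffval al.
Proof. by apply/funext => i; rewrite /ffval ffunE. Qed.

Lemma mem_ffwiden N (be : {ffun 'I_n -> 'I_N.+1}) :
  (be \in [set ffwiden al | al : {ffun 'I_n -> 'I_N}]) = [forall i, (be i < N)%N].
Proof.
apply/imsetP/forallP => [[al _ ->] i|H]; first by rewrite ffunE /=.
exists [ffun i => Ordinal (H i)] => //; apply/ffunP => i; rewrite !ffunE.
exact: val_inj.
Qed.

Lemma box_sumS t N : box_sum t N.+1 = box_sum t N +
  \sum_(be : {ffun 'I_n -> 'I_N.+1} | [exists i, be i == N :> nat]) t (ffval be).
Proof.
rewrite /box_sum (bigID (mem [set ffwiden al | al : {ffun 'I_n -> 'I_N}])) /=.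
congr (_ + _).
  rewrite big_imset /=; last by move=> a b _ _; exact: ffwiden_inj.
  by apply: eq_bigr => al _; rewrite -/(ffval _) ffval_widen.
apply: eq_bigl => be; rewrite mem_ffwiden negb_forall; apply: eq_existsb => i.
by rewrite -leqNgt eqn_leq -[(be i <= N)%N]ltnS ltn_ord.
Qed.

Lemma box_sum_homo t : (forall al, 0 <= t al) -> nondecreasing_seq (box_sum t).
Proof.
move=> t0; apply/nondecreasing_seqP => N; rewrite box_sumS lerDl.
exact: sumr_ge0.
Qed.

Lemma box_sum_ge t (al : 'I_n -> nat) N : (forall al, 0 <= t al) ->
  (forall i, al i < N)%N -> t al <= box_sum t N.
Proof.
move=> t0 aN; rewrite /box_sum (bigD1 [ffun i => Ordinal (aN i)]) //=.
have -> : (fun i => nat_of_ord ([ffun i => Ordinal (aN i)] i)) = al.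
  by apply/funext => i; rewrite ffunE.
by rewrite lerDl; exact: sumr_ge0.
Qed.

Lemma box_sum_prod N (F : 'I_n -> nat -> R) :
  box_sum (fun al => \prod_i F i (al i)) N = \prod_i \sum_(m < N) F i m.
Proof. by rewrite bigA_distr_bigA. Qed.

Lemma geom_half N : \sum_(m < N) (2^-1 : R) ^+ m = 2 - 2 * 2^-1 ^+ N.
Proof.
elim: N => [|N IH]; first by rewrite big_ord0 expr0 mulr1 subrr.
by rewrite big_ord_recr /= IH exprS; field.
Qed.

Lemma geom_half_le N : \sum_(m < N) (2^-1 : R) ^+ m <= 2.
Proof. by rewrite geom_half gerBl mulr_ge0 // exprn_ge0 // invr_ge0. Qed.

Lemma box_half_le N : box_sum (fun al => \prod_(i < n) (2^-1 : R) ^+ al i) N <= 2 ^+ n.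
Proof.
rewrite (box_sum_prod N (fun i m => 2^-1 ^+ m)).
have -> : (2 : R) ^+ n = \prod_(i < n) 2 by rewrite prodr_const card_ord.
apply: ler_prod => i _; rewrite geom_half_le andbT.
by apply: sumr_ge0 => m _; rewrite exprn_ge0 // invr_ge0.
Qed.

(** The shell is covered by the [n] faces on which one entry of the exponent equals [N], and on each
    face the sum factorizes over the coordinates. *)
Lemma shell_half_le N :
  \sum_(be : {ffun 'I_n -> 'I_N.+1} | [exists i, be i == N :> nat])
     \prod_(i < n) (2^-1 : R) ^+ be i <= n%:R * 2 ^+ n * 2^-1 ^+ N.
Proof.
have h0 m : 0 <= (2^-1 : R) ^+ m by rewrite exprn_ge0 // invr_ge0.
apply: (@le_trans _ _ (\sum_(k < n) \sum_(be : {ffun 'I_n -> 'I_N.+1} | be k == N :> nat)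
   \prod_(i < n) (2^-1 : R) ^+ be i)).
  have E (be : {ffun 'I_n -> 'I_N.+1}) : [exists i, be i == N :> nat] ->
    \prod_(i < n) (2^-1 : R) ^+ be i <=
    \sum_(k < n) if be k == N :> nat then \prod_(i < n) (2^-1 : R) ^+ be i else 0.
    move=> /existsP[k kN]; rewrite [leRHS](bigD1 k) //= kN lerDl; apply: sumr_ge0 => i _.
    by case: ifP => // _; exact: prodr_ge0.
  apply: (le_trans (ler_sum _ E)).
  rewrite exchange_big /=; apply: ler_sum => k _; rewrite -big_mkcondr /=.
  rewrite [leLHS]big_mkcond [leRHS]big_mkcond /=; apply: ler_sum => be _.
  case: eqP => [bk|_]; rewrite ?andbF // andbT.
  by case: ifP => // _; exact: prodr_ge0.
rewrite -mulrA; have -> : n%:R * (2 ^+ n * 2^-1 ^+ N) = \sum_(k < n) (2 ^+ n * 2^-1 ^+ N) :> R.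
  by rewrite sumr_const card_ord -[RHS]mulr_natl.
apply: ler_sum => k _; rewrite big_mkcond /=.
apply: (@le_trans _ _ (box_sum (fun al => 2^-1 ^+ N * \prod_(i < n)
    (if i == k then (al i == N)%:R else 2^-1 ^+ al i)) N.+1)).
  rewrite /box_sum; apply: ler_sum => be _.
  rewrite [in leRHS](bigD1 k) //= eqxx; case: eqP => [bk|_] /=; last by rewrite mul0r mulr0.
  rewrite mul1r (bigD1 k) //= bk; apply: ler_wpM2l => //.
  by apply: ler_prod => i ik; rewrite (negbTE ik) h0 lexx.
rewrite /box_sum -mulr_sumr mulrC; apply: ler_wpM2r => //.
have := box_sum_prod N.+1 (fun i m => if i == k then (m == N)%:R else (2^-1 : R) ^+ m).
rewrite /box_sum => ->.
have -> : (2 : R) ^+ n = \prod_(i < n) 2 by rewrite prodr_const card_ord.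
apply: ler_prod => i _; case: eqP => _.
  rewrite big_ord_recr /= eqxx big1 ?add0r ?ler01 ?ler1n // => m _.
  by rewrite (ltn_eqF (ltn_ord m)).
by rewrite geom_half_le andbT; exact: sumr_ge0.
Qed.

Lemma cvg_box_abs t (B : R) : (forall al, 0 <= t al) ->
  (forall N, box_sum t N <= B) -> cvgn (box_sum t).
Proof.
move=> t0 tB; apply: nondecreasing_is_cvgn; first exact: box_sum_homo.
by exists B => _ [N _ <-].
Qed.

Definition content_eq w (al : 'I_n -> nat) := [forall i, count_mem i w == al i].

Definition hprod h w := \prod_(j <- w) h j 0.

Lemma hprod_content h w : hprod h w = \prod_i h i 0 ^+ count_mem i w.
Proof.
rewrite /hprod; elim: w => [|j w IH]; first by rewrite big_nil big1.
rewrite big_cons IH; under [RHS]eq_bigr do rewrite /= exprD.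
rewrite big_split /=; congr (_ * _).
rewrite (bigD1 j) //= eqxx expr1 big1 ?mulr1 // => i ij.
by rewrite eq_sym (negbTE ij) expr0.
Qed.

Lemma sum_content w : (\sum_i count_mem i w = size w)%N.
Proof.
elim: w => [|j w IH] /=; first by rewrite big1.
rewrite big_split /= IH -[RHS]add1n; congr addn.
rewrite (bigD1 j) //= eqxx big1 ?addn0 // => i ij.
by rewrite eq_sym (negbTE ij).
Qed.

(** Taylor polynomials are sums over words, power series are sums over exponents; this regroups the
    words of length below [M] by their letter counts [al]. *)
Definition box_words (c : seq 'I_n -> R) (M : nat) (al : 'I_n -> nat) : R :=
  \sum_(k < M) wsum k (fun w => if content_eq w al then c w else 0) / k`!%:R.

Lemma box_sum_words c M N : box_sum (box_words c M) N =
  \sum_(k < M) wsum k (fun w => if [forall i, (count_mem i w < N)%N] then c w else 0) / k`!%:R.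
Proof.
rewrite /box_sum /box_words exchange_big; apply: eq_bigr => k _ /=.
rewrite -mulr_suml wsum_sum; congr (_ / _); apply: eq_wsum => w _.
case: ifPn => [/forallP H|H].
  rewrite (bigD1 [ffun i => Ordinal (H i)]) //= big1 ?addr0 => [|al].
    by rewrite ifT //; apply/forallP => i; rewrite ffunE.
  move=> /eqP na; case: ifP => // /forallP E; case: na; apply/ffunP => i; rewrite ffunE.
  by apply: val_inj; rewrite /= (eqP (E i)).
rewrite big1 // => al _; case: ifP => // /forallP E.
by case/negP: H; apply/forallP => i; rewrite (eqP (E i)) ltn_ord.
Qed.

Lemma box_words_term c M (al : 'I_n -> nat) : (\sum_i al i < M)%N ->
  box_words c M al = wsum (\sum_i al i) (fun w => if content_eq w al then c w else 0)
     / (\sum_i al i)`!%:R.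
Proof.
move=> aM; rewrite /box_words (bigD1 (Ordinal aM)) //= [X in _ + X]big1 ?addr0 // => k /eqP ka.
rewrite (@eq_wsum _ _ _ _ (fun _ => 0)) ?wsum_const ?mulr0 ?mul0r // => w wk.
case: ifP => // /forallP E; case: ka; apply: val_inj; rewrite /= -wk -sum_content.
by apply: eq_bigr => i _; rewrite (eqP (E i)).
Qed.

End BoxSums.

(** * Cauchy estimates imply analyticity *)

Section GevreyAnalytic.
Context {R : realType} {n : nat}.
Implicit Types (U : set 'cV[R]_n) (f : 'cV[R]_n -> R) (x h : 'cV[R]_n) (w : seq 'I_n).

Lemma is_derive_wsum k (F : seq 'I_n -> R -> R) (G : seq 'I_n -> R) (t : R) :
  (forall w, is_derive t 1 (F w) (G w)) ->
  is_derive t 1 (fun s => wsum k (fun w => F w s)) (wsum k G).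
Proof.
elim: k F G => [|k IH] F G dF; first exact: dF.
have -> : (fun s => wsum k.+1 (fun w => F w s)) =
   \sum_(i < n) (fun s => wsum k (fun w => F (i :: w) s)).
  by apply/funext => s; rewrite fct_sumE.
by apply: is_derive_sum => i; apply: IH.
Qed.

Lemma norm_hprod h w : `|hprod h w| <= `|h| ^+ size w.
Proof.
rewrite /hprod; elim: w => [|j w IH]; first by rewrite big_nil normr1 expr0.
by rewrite big_cons normrM exprS ler_pM // norm_coord.
Qed.

(** The k-th derivative of t -> f(x + t h) is a sum over the n^k words of length k, each controlled
    by the Cauchy estimate; the K! of the estimate cancels the one of the remainder. *)
Lemma taylor_nd f x (r : R) h (C A : R) K :
  smooth_on (ball x r) f -> ball x r (x + h) -> 0 < r ->
  (forall w y, ball x r y -> `|pd w f y| <= C * A ^+ size w * (size w)`!%:R) ->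
  `|f (x + h) - \sum_(k < K) wsum k (fun w => pd w f x * hprod h w) / k`!%:R|
     <= C * (n%:R * A * `|h|) ^+ K.
Proof.
move=> sf xh r0 bf.
pose g k (t : R) := wsum k (fun w => pd w f (x + t *: h) * hprod h w).
have bt (t : R) : 0 <= t <= 1 -> ball x r (x + t *: h).
  by move=> t01; have := ball_line (ballxx x r0) xh t01; rewrite [x + h]addrC addrK.
have dg k (t : R) : 0 <= t <= 1 -> is_derive t 1 (g k) (g k.+1 t).
  move=> t01.
  have dw w : is_derive t 1 (fun s : R => pd w f (x + s *: h) * hprod h w)
      (\sum_j pd (j :: w) f (x + t *: h) * hprod h (j :: w)).
    have D := is_derive_line (sf w _ (bt t t01)).
    have D2 := @is_deriveZ _ _ _ _ (hprod h w) t 1 _ D.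
    have E : hprod h w \*: (fun s : R => pd w f (x + s *: h)) =
        (fun s : R => pd w f (x + s *: h) * hprod h w).
      by apply/funext => s /=; rewrite /GRing.scale /= mulrC.
    rewrite E in D2; apply: (is_derive_eq D2); rewrite /dotl scaler_sumr; apply: eq_bigr => j _.
    rewrite /GRing.scale /= /hprod big_cons; ring.
  rewrite /g [wsum k.+1 _]/= wsum_sum; exact: is_derive_wsum.
have E k : g k 0 = wsum k (fun w => pd w f x * hprod h w).
  by apply: eq_wsum => w _; rewrite scale0r addr0.
have G0 : g 0%N 1 = f (x + h) by rewrite /g /= /hprod big_nil mulr1 scale1r.
have F0 : (K`!%:R : R) != 0 by rewrite pnatr_eq0 -lt0n fact_gt0.
have := @taylor_1d _ K g (C * (n%:R * A * `|h|) ^+ K * K`!%:R) dg _ 1 _.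
rewrite G0 !expr1n mulr1 mulfK //; under eq_bigr do rewrite E expr1n mulr1.
apply; last by rewrite ler01 lexx.
move=> t t01; have -> : C * (n%:R * A * `|h|) ^+ K * K`!%:R =
    #|'I_n|%:R ^+ K * (C * A ^+ K * K`!%:R * `|h| ^+ K).
  by rewrite card_ord !exprMn; ring.
apply: wsum_bound => w wK; rewrite normrM; apply: ler_pM => //.
  by rewrite -wK; apply: bf; exact: bt.
by rewrite -wK; exact: norm_hprod.
Qed.

(** The coefficient of an exponent [al] collects the derivatives along all words with letter counts
    [al]. The box of side N contains every word of length below N and no word of length (n+1)N+1 or
    more; its sum therefore differs from a Taylor polynomial by a geometric tail starting at N. *)
Lemma gevrey_analytic f x U : open U -> smooth_on U f -> U x -> gevrey_at f x ->
  analytic_at f x.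
Proof.
move=> oU sf Ux gf; have [r [C [A [r0 C0 A0 rU bf]]]] := gevrey_ballP oU Ux gf.
pose a (al : 'I_n -> nat) := wsum (\sum_i al i)
  (fun w => if content_eq w al then pd w f x else 0) / (\sum_i al i)`!%:R.
exists a.
have sf' := smooth_sub rU sf.
have NM N : (N <= n.+1 * N + 1)%N by rewrite mulSn -addnA leq_addr.
have A1 : 0 < 2 * (n%:R * A + 1) by rewrite mulr_gt0 // ltr_wpDl // mulr_ge0.
(* This makes the ratio [q], that is n A |h|, at most one half; the added 1 keeps the denominator
   positive when n A = 0. *)
pose d := Num.min r (2 * (n%:R * A + 1))^-1.
have d0 : 0 < d by rewrite lt_min r0 invr_gt0.
apply/nbhs_ballP; exists d => //= y; rewrite -[y](subrK x) [y - x + x]addrC.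
set h := y - x; have -> : x + h - x = h by rewrite [x + h]addrC addrK.
rewrite ball_addE lt_min => /andP[hr hd].
have xh : ball x r (x + h) by rewrite ball_addE.
pose q := n%:R * A * `|h|.
have q0 : 0 <= q by rewrite !mulr_ge0.
have q2 : q <= 2^-1.
  have : (n%:R * A + 1) * `|h| <= 2^-1.
    by rewrite -ler_pdivlMl; [rewrite -invfM mulrC; exact: ltW|rewrite ltr_wpDl // mulr_ge0].
  by apply: le_trans; rewrite mulrDl /q lerDl mul1r.
pose c w := pd w f x * hprod h w.
have cb w : `|c w| <= C * A ^+ size w * (size w)`!%:R * `|h| ^+ size w.
  by rewrite normrM; apply: ler_pM => //; [apply: bf; exact: ballxx|exact: norm_hprod].
have term M al : (\sum_i al i < M)%N -> power_term a h al = box_words c M al.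
  move=> aM; rewrite box_words_term // /power_term /a mulrAC; congr (_ / _).
  rewrite mulrC -wsumZ; apply: eq_wsum => w _; case: ifP => [/forallP E|_]; last by rewrite mulr0.
  rewrite /c hprod_content mulrC; congr (_ * _); apply: eq_bigr => i _.
  by rewrite (eqP (E i)).
have wb k (F : seq 'I_n -> R) : (forall w, size w = k -> `|F w| <= `|c w|) ->
    `|wsum k F / k`!%:R| <= C * q ^+ k.
  move=> H; have kf : 0 < (k`!%:R : R) by rewrite ltr0n fact_gt0.
  rewrite normrM normfV (gtr0_norm kf) ler_pdivrMr //.
  have -> : C * q ^+ k * k`!%:R = #|'I_n|%:R ^+ k * (C * A ^+ k * k`!%:R * `|h| ^+ k).
    by rewrite card_ord /q !exprMn; ring.
  apply: wsum_bound => w wk; apply: (le_trans (H w wk)); rewrite -wk; exact: cb.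
have qh k : q ^+ k <= 2^-1 ^+ k.
  by apply: lerXn2r => //; rewrite nnegrE // invr_ge0.
have boxM N (al : {ffun 'I_n -> 'I_N}) : (\sum_(i < n) al i < n.+1 * N + 1)%N.
  rewrite addn1 ltnS; apply: (@leq_trans (\sum_(i < n) N)).
    by apply: leq_sum => i _; exact: ltnW.
  by rewrite sum_nat_const card_ord leq_mul2r leqnSn orbT.
split.
  apply: (@cvg_box_abs _ _ _ (2 * C)) => // N.
  apply: (@le_trans _ _ (box_sum (box_words (fun w => `|c w|) (n.+1 * N + 1)) N)).
    rewrite /box_sum; apply: ler_sum => al _; rewrite (term (n.+1 * N + 1)%N) //.
    rewrite /box_words; apply: (le_trans (ler_norm_sum _ _ _)); apply: ler_sum => k _.
    rewrite normrM normfV (@ger0_norm _ (k`!%:R)) //; apply: ler_wpM2r; first by rewrite invr_ge0.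
    apply: (le_trans (wsum_norm _ _)); apply: wsum_le => w _.
    by case: ifP; rewrite // normr0.
  rewrite box_sum_words; apply: (@le_trans _ _ (\sum_(k < n.+1 * N + 1) C * 2^-1 ^+ k)).
    apply: ler_sum => k _; apply: le_trans (ler_norm _) _; apply: le_trans (wb _ _ _) _.
      by move=> w _; case: ifP; rewrite ?normr_id // normr0.
    by apply: ler_wpM2l.
  rewrite -mulr_sumr mulrC; apply: ler_wpM2r => //; exact: geom_half_le.
apply/cvgrPdist_le => e e0.
have bnd N : `|f (x + h) - box_sum (power_term a h) N| <= 3 * C * 2^-1 ^+ N.
  pose M := (n.+1 * N + 1)%N.
  have T := taylor_nd M sf' xh r0 bf.
  have -> : box_sum (power_term a h) N = box_sum (box_words c M) N.
    by apply: eq_bigr => al _; exact: term.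
  rewrite box_sum_words.
  set S1 := \sum_(k < M) _ in T; set S2 := \sum_(k < M) _.
  have : `|S1 - S2| <= 2 * C * 2^-1 ^+ N.
    rewrite /S1 /S2 -sumrB; apply: (le_trans (ler_norm_sum _ _ _)).
    apply: (@le_trans _ _ (\sum_(k < M) if (k < N)%N then 0 else C * 2^-1 ^+ k)).
      apply: ler_sum => k _.
      have -> : wsum k (fun w => pd w f x * hprod h w) / k`!%:R -
          wsum k (fun w => if [forall i, (count_mem i w < N)%N] then c w else 0) / k`!%:R =
          wsum k (fun w => if [forall i, (count_mem i w < N)%N] then 0 else c w) / k`!%:R.
        rewrite -mulrBl; congr (_ / _); apply/eqP; rewrite subr_eq; apply/eqP.
        rewrite -wsumD; apply: eq_wsum => w _; case: ifP; by rewrite ?add0r ?addr0.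
      case: ltnP => kN; last first.
        apply: le_trans (wb _ _ _) _; last exact: ler_wpM2l.
        by move=> w _; case: ifP; rewrite // normr0.
      rewrite (@eq_wsum _ _ _ _ (fun _ => 0)) ?wsum_const ?mulr0 ?mul0r ?normr0 // => w wk.
      rewrite ifT //; apply/forallP => i; apply: leq_ltn_trans kN; rewrite -wk; exact: count_size.
    rewrite -(big_mkord xpredT (fun k => if (k < N)%N then 0 else C * 2^-1 ^+ k)).
    rewrite (big_cat_nat (leq0n N) (NM N)) //= big_nat big1 ?add0r => [|k /andP[_ ->]//].
    rewrite -{1}[N]add0n big_addn big_mkord.
    apply: (@le_trans _ _ (\sum_(i < M - N) C * 2^-1 ^+ N * 2^-1 ^+ i)).
      by apply: ler_sum => i _; rewrite ltnNge leq_addl /= exprD; lra.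
    rewrite -mulr_sumr; have -> : 2 * C * 2^-1 ^+ N = C * 2^-1 ^+ N * 2 by ring.
    by apply: ler_wpM2l; [rewrite mulr_ge0 // exprn_ge0 // invr_ge0|exact: geom_half_le].
  have : C * q ^+ M <= C * 2^-1 ^+ N.
    apply: ler_wpM2l => //; apply: (le_trans (qh M)); apply: ler_wiXn2l.
    - by rewrite invr_ge0.
    - by rewrite invf_le1 // ler1n.
    - exact: NM.
  rewrite -/q in T => H1 H2; rewrite -[f _ - _](subrKA S1).
  apply: (le_trans (ler_normD _ _)); lra.
have : (fun N => 3 * C * 2^-1 ^+ N) @ \oo --> (0 : R).
  by apply: cvg_geometric; rewrite ger0_norm ?invr_ge0 // invf_lt1 // ltr1n.
move=> /cvgrPdist_le /(_ e e0); apply: filterS => N; rewrite sub0r normrN => H.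
apply: (le_trans (bnd N)); apply: le_trans H; exact: ler_norm.
Qed.

End GevreyAnalytic.

(** * Analytic functions are smooth with Cauchy estimates *)

Section AnalyticGevrey.
Context {R : realType} {n : nat}.
Implicit Types (U : set 'cV[R]_n) (f : 'cV[R]_n -> R) (x y h : 'cV[R]_n) (w : seq 'I_n)
  (al : 'I_n -> nat).

Lemma lim_norm_le (u : nat -> R) (l b : R) (N0 : nat) :
  u N @[N --> \oo] --> l -> (forall M, (N0 <= M)%N -> `|u M| <= b) -> `|l| <= b.
Proof.
move=> ul ub; apply/ler_addgt0Pr => e e0.
have /cvgrPdist_le /(_ e e0) H := ul.
have : \forall N \near \oo, `|l| <= b + e.
  near=> N; rewrite -[l](subrK (u N)); apply: (le_trans (ler_normD _ _)).
  rewrite addrC; apply: lerD; last by near: N.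
  by apply: ub; near: N; exact: nbhs_infty_ge.
by move=> [N _ /(_ N (leqnn N))].
Unshelve. all: by end_near. Qed.

(** The sequence is squeezed between the monotone sequences u_N - 2K 2^-N and u_N + 2K 2^-N. *)
Lemma cvg_geom_steps (u : nat -> R) (K : R) :
  (forall N, `|u N.+1 - u N| <= K * 2^-1 ^+ N) ->
  exists l, u N @[N --> \oo] --> l /\ forall N, `|u N - l| <= 2 * K * 2^-1 ^+ N.
Proof.
move=> uK.
have h0 m : 0 <= (2^-1 : R) ^+ m by rewrite exprn_ge0 // invr_ge0.
have K0 : 0 <= K by have := le_trans (normr_ge0 _) (uK 0%N); rewrite expr0 mulr1.
pose v N := u N - 2 * K * 2^-1 ^+ N.
have vn : nondecreasing_seq v.
  apply/nondecreasing_seqP => N; rewrite /v exprS.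
  have := uK N; rewrite ler_norml => /andP[a b].
  set t := K * _ in a b *; have -> : 2 * K * 2^-1 ^+ N = 2 * t by rewrite /t mulrA.
  have -> : 2 * K * (2^-1 * 2^-1 ^+ N) = t by rewrite /t; field.
  lra.
pose v' N := u N + 2 * K * 2^-1 ^+ N.
have v'n : nonincreasing_seq v'.
  apply/nonincreasing_seqP => N; rewrite /v' exprS.
  have := uK N; rewrite ler_norml => /andP[a b].
  set t := K * _ in a b *; have -> : 2 * K * 2^-1 ^+ N = 2 * t by rewrite /t mulrA.
  have -> : 2 * K * (2^-1 * 2^-1 ^+ N) = t by rewrite /t; field.
  lra.
have vv' N M : v N <= v' M.
  apply: (@le_trans _ _ (v (maxn N M))); first by apply: vn; exact: leq_maxl.
  apply: (@le_trans _ _ (v' (maxn N M))); last by apply: v'n; exact: leq_maxr.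
  by rewrite /v /v' lerD2l ge0_cp // !mulr_ge0.
have vc : cvgn v.
  by apply: nondecreasing_is_cvgn => //; exists (v' 0%N) => _ [N _ <-].
pose l := limn v.
have vl N : v N <= l by exact: nondecreasing_cvgn_le.
have lv' N : l <= v' N by apply: limr_le => //; apply: nearW => M; exact: vv'.
exists l.
have B N : `|u N - l| <= 2 * K * 2^-1 ^+ N.
  have := vl N; have := lv' N; rewrite /v /v' ler_norml => a b; lra.
split => //; apply/cvgrPdist_le => e e0.
have : (fun N => 2 * K * 2^-1 ^+ N) @ \oo --> (0 : R).
  by apply: cvg_geometric; rewrite ger0_norm ?invr_ge0 // invf_lt1 // ltr1n.
move=> /cvgrPdist_le /(_ e e0); apply: filterS => N; rewrite sub0r normrN distrC => H.
apply: (le_trans (B N)); apply: le_trans H; exact: ler_norm.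
Qed.

(** Termwise differentiation. The partial derivatives are uniformly Cauchy, the mean value
    inequality carries this over to the increments of [g M - g N], and a single sufficiently late
    [g N] supplies the differentiability. *)
Lemma differentiable_limit x (r : R) (g : nat -> 'cV[R]_n -> R) f (K : R) : 0 < r ->
  (forall N y, ball x r y -> differentiable (g N) y) ->
  (forall y, ball x r y -> g N y @[N --> \oo] --> f y) ->
  (forall N j y, ball x r y -> `|partial j (g N.+1) y - partial j (g N) y| <= K * 2^-1 ^+ N) ->
  forall y, ball x r y -> differentiable f y /\
    forall j, partial j (g N) y @[N --> \oo] --> partial j f y.
Proof.
move=> r0 dg gf gK y yr.
have /choice[l Hl] j : exists l, partial j (g N) y @[N --> \oo] --> l /\
    forall N, `|partial j (g N) y - l| <= 2 * K * 2^-1 ^+ N.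
  by apply: cvg_geom_steps => N; exact: gK.
have h0 m : 0 <= (2^-1 : R) ^+ m by rewrite exprn_ge0 // invr_ge0.
suff [df pf] : differentiable f y /\ forall j, partial j f y = l j.
  by split => // j; rewrite pf; exact: (Hl j).1.
(* With [n = 0] there is no index [j] from which to read off [0 <= K], but the space is then a
   point. *)
case: (posnP n) => n0.
  apply: differentiable_eps => e e0; near=> h.
  have -> : h = 0 by apply/matrixP => i; have := ltn_ord i; rewrite {2}n0.
  by rewrite addr0 subrr raddf0 subr0 !normr0 mulr0.
have K0 : 0 <= K.
  by have := le_trans (normr_ge0 _) (gK 0%N (Ordinal n0) y yr); rewrite expr0 mulr1.
apply: differentiable_eps => e e0.
(* The two tail errors below add up to [6 * n * d] times |h|; with [12 * n * d <= e] they take half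
   of [e] and leave the other half to [g N]. *)
have c0 : 0 < e / (12 * n%:R * (K + 1)).
  by rewrite divr_gt0 // !mulr_gt0 // ?ltr0n // ltr_wpDl.
have [N HN] : exists N, 2^-1 ^+ N <= e / (12 * n%:R * (K + 1)).
  have : (fun N => 1 * 2^-1 ^+ N) @ \oo --> (0 : R).
    by apply: cvg_geometric; rewrite ger0_norm ?invr_ge0 // invf_lt1 // ltr1n.
  move=> /cvgrPdist_le /(_ _ c0) [N _ /(_ N (leqnn N))]; rewrite /= sub0r normrN mul1r => H.
  by exists N; apply: le_trans H; exact: ler_norm.
pose d := K * 2^-1 ^+ N.
have d0 : 0 <= d by rewrite mulr_ge0.
have nd : 12 * n%:R * d <= e.
  rewrite /d; have : 12 * n%:R * (K + 1) * 2^-1 ^+ N <= e.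
    rewrite mulrC -ler_pdivlMr // !mulr_gt0 // ?ltr0n //; exact: ltr_wpDl.
  apply: le_trans; rewrite mulrA; apply: ler_wpM2r => //; apply: ler_wpM2l.
    by rewrite mulr_ge0.
  by rewrite lerDl.
have steps z j M : ball x r z -> (N <= M)%N -> `|partial j (g M) z - partial j (g N) z| <= 4 * d.
  move=> zr NM; have [m [_ mP]] : exists m, partial j (g N) z @[N --> \oo] --> m /\
      forall N, `|partial j (g N) z - m| <= 2 * K * 2^-1 ^+ N.
    by apply: cvg_geom_steps => N'; exact: gK.
  have a := mP M; have b := mP N.
  have c : 2 * K * 2^-1 ^+ M <= 2 * d.
    rewrite /d mulrA; apply: ler_wpM2l; first by rewrite mulr_ge0.
    by apply: ler_wiXn2l => //; rewrite ?invr_ge0 // invf_le1 // ler1n.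
  have b' : `|partial j (g N) z - m| <= 2 * d by rewrite /d mulrA.
  rewrite -[X in `|X|](subrKA m); apply: (le_trans (ler_normD _ _)).
  rewrite [`|m - _|]distrC; lra.
have e3 : 0 < e / 2 by rewrite divr_gt0.
have := eps_differentiable (dg N y yr) e3.
have : \forall h \near (0 : 'cV[R]_n), ball x r (y + h).
  move: yr; rewrite ballE => yr; have yr' : 0 < r - `|y - x| by rewrite subr_gt0.
  have : \forall h \near (0 : 'cV[R]_n), `|h| < r - `|y - x| by exact: nbhs0_lt.
  apply: filterS => h hh; rewrite ballE addrAC.
  by apply: (le_lt_trans (ler_normD _ _)); rewrite -ltrBrDl.
apply: filterS2 => h yh gh.
have S1 : `|(f (y + h) - f y) - (g N (y + h) - g N y)| <= n%:R * (4 * d) * `|h|.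
  have C1 : (g M (y + h) - g M y) - (g N (y + h) - g N y) @[M --> \oo] -->
       (f (y + h) - f y) - (g N (y + h) - g N y).
    by apply: cvgB; [apply: cvgB; exact: gf|exact: cvg_cst].
  apply: (lim_norm_le C1 (N0 := N)) => M NM.
  have := @mvi_ball _ _ (fun z => g M z - g N z) x r (4 * d) y (y + h) _ _ yr yh.
  rewrite [y + h - y]addrC addKr => H.
  have -> : g M (y + h) - g M y - (g N (y + h) - g N y) =
     g M (y + h) - g N (y + h) - (g M y - g N y) by ring.
  apply: H => [z zr|z j zr]; first by apply: differentiableB; exact: dg.
  rewrite partialD ?partialN; [exact: steps|exact: dg..|].
  by apply: differentiableN; exact: dg.
have S2 : `|dotl (fun j => partial j (g N) y) h - dotl l h| <= n%:R * (2 * d) * `|h|.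
  have -> : dotl (fun j => partial j (g N) y) h - dotl l h =
     dotl (fun j => partial j (g N) y - l j) h.
    by rewrite /dotl -sumrB; apply: eq_bigr => j _; rewrite mulrBr.
  by apply: dotl_le => j; have := (Hl j).2 N; rewrite /d mulrA.
have -> : f (y + h) - f y - dotl l h = ((f (y + h) - f y) - (g N (y + h) - g N y)) +
   (g N (y + h) - g N y - dotl (fun j => partial j (g N) y) h) +
   (dotl (fun j => partial j (g N) y) h - dotl l h) by ring.
apply: (le_trans (ler_normD _ _)).
have hn := normr_ge0 h.
have T2 : `|f (y + h) - f y - (g N (y + h) - g N y) +
   (g N (y + h) - g N y - dotl (fun j => partial j (g N) y) h)| <=
   n%:R * (4 * d) * `|h| + e / 2 * `|h|.
  by apply: (le_trans (ler_normD _ _)); exact: lerD.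
apply: (le_trans (lerD T2 S2)).
have -> : n%:R * (4 * d) * `|h| + e / 2 * `|h| + n%:R * (2 * d) * `|h| =
  (12 * n%:R * d / 2 + e / 2) * `|h| by field.
by apply: ler_wpM2r => //; lra.
Unshelve. all: by end_near. Qed.

Lemma smooth_limit x (r : R) (g : nat -> 'cV[R]_n -> R) f : 0 < r ->
  (forall N, smooth_on (ball x r) (g N)) ->
  (forall y, ball x r y -> g N y @[N --> \oo] --> f y) ->
  (forall w, exists K : R, forall N y, ball x r y ->
     `|pd w (g N.+1) y - pd w (g N) y| <= K * 2^-1 ^+ N) ->
  smooth_on (ball x r) f /\
  forall w y, ball x r y -> pd w (g N) y @[N --> \oo] --> pd w f y.
Proof.
move=> r0 sg gf gK.
have gK' w : exists K : R, forall N j y, ball x r y ->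
    `|partial j (pd w (g N.+1)) y - partial j (pd w (g N)) y| <= K * 2^-1 ^+ N.
  have H (k : 'I_n) : exists K : R, forall N y, ball x r y ->
     `|partial k (pd w (g N.+1)) y - partial k (pd w (g N)) y| <= K * 2^-1 ^+ N.
    exact: (gK (k :: w)).
  have [K HK] := choice H; exists (\sum_k `|K k|) => N k z zr.
  apply: (le_trans (HK k N z zr)); apply: ler_wpM2r.
    by rewrite exprn_ge0 // invr_ge0.
  by rewrite (bigD1 k) //=; apply: (le_trans (ler_norm _)); rewrite lerDl; exact: sumr_ge0.
have C w y : ball x r y -> pd w (g N) y @[N --> \oo] --> pd w f y.
  elim: w y => [|j w IH] y yr /=; first exact: gf.
  have [K HK] := gK' w.
  by have [_] := differentiable_limit r0 (fun N y => sg N w y) IH HK yr; apply.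
split=> // w y yr; have [K HK] := gK' w.
by have [] := differentiable_limit r0 (fun N y => sg N w y) (C w) HK yr.
Qed.

Definition monomial x al : 'cV[R]_n -> R := fun y => \prod_i (y - x) i 0 ^+ al i.

Lemma smoothX U f k : open U -> smooth_on U f -> smooth_on U (fun y => f y ^+ k).
Proof.
move=> oU sf; elim: k => [|k IH]; first by under eq_fun do rewrite expr0; exact: smooth_const.
by under eq_fun do rewrite exprS; exact: smoothM.
Qed.

Lemma smooth_monomial x al : smooth_on setT (monomial x al).
Proof.
rewrite /monomial; elim: (index_enum _) => [|i s IH].
  by under eq_fun do rewrite big_nil; exact: smooth_const.
under eq_fun do rewrite big_cons; apply: smoothM => //; first exact: openT.
apply: smoothX; first exact: openT.
under eq_fun do rewrite !mxE; apply: smoothD; [exact: openT| |exact: smooth_const].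
exact: (reg_smooth (reg_coord Smooth i openT)).
Qed.

Lemma pdZ U (a : R) f w y : open U -> smooth_on U f -> U y ->
  pd w (fun z => a * f z) y = a * pd w f y.
Proof.
move=> oU sf; elim: w y => [|j w IH] y Uy //=.
have -> : partial j (pd w (fun z => a * f z)) y = partial j (fun z => a * pd w f z) y.
  by apply: partial_near; exact: eq_on_near oU Uy IH.
rewrite partialM; [|exact: differentiable_cst|exact: sf].
by rewrite partial_cst mul0r add0r.
Qed.

Definition dec_at (j : 'I_n) al : 'I_n -> nat := fun i => (al i - (i == j))%N.

Lemma partial_monomial x al j y :
  partial j (monomial x al) y = (al j)%:R * monomial x (dec_at j al) y.
Proof.
pose b := \prod_(i | i != j) (y - x) i 0 ^+ al i.
have D : is_derive (0 : R) 1 (fun s : R => monomial x al (y + s *: basis_vec j))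
    (partial j (monomial x al) y).
  rewrite -{2}[y]addr0 -(scale0r (basis_vec j)); apply: is_derive_line_dir.
  by apply: diff_derivable; apply: (smooth_monomial x al [::]).
have E : (fun s : R => monomial x al (y + s *: basis_vec j)) =
    (fun s => b * ((s + (y - x) j 0) ^+ al j)).
  apply/funext => s; rewrite /monomial (bigD1 j) //= mulrC; congr (_ * _).
    apply: eq_bigr => i ij; rewrite !mxE (negbTE ij) /= mulr0 addr0 //.
  by rewrite !mxE !eqxx mulr1 addrAC addrC addrA.
have D2 : is_derive (0 : R) 1 (fun s => b * ((s + (y - x) j 0) ^+ al j))
    (b *: ((al j)%:R * (y - x) j 0 ^+ (al j).-1)).
  apply: is_deriveZ; apply: (@is_derive_shift1 _ (fun t => t ^+ al j)); rewrite add0r.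
  apply: DeriveDef; first exact: exprn_derivable.
  by rewrite exp_derive [LHS]mulr1.
rewrite E in D; rewrite -(derive_val (is_derive := D)) (derive_val (is_derive := D2)).
rewrite /GRing.scale /= mulrCA; congr (_ * _); rewrite /monomial (bigD1 j) //= mulrC.
rewrite /dec_at eqxx subn1; congr (_ * _); apply: eq_bigr => i ij.
by rewrite (negbTE ij) subn0.
Qed.

Lemma pd_monomial_bound x (s : R) al w y : 0 <= s -> `|y - x| <= s ->
  `|pd w (monomial x al) y| <= ((\sum_i al i) ^_ (size w))%:R * s ^+ (\sum_i al i - size w).
Proof.
move=> s0 ys; elim/last_ind: w al => [|w j IH] al.
  rewrite /pd /= ffactn0 mul1r subn0 /monomial normr_prod -prodrXr.
  apply: ler_prod => i _; rewrite normr_ge0 /= normrX; apply: lerXn2r => //.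
  by apply: le_trans ys; exact: norm_coord.
rewrite pd_rcons size_rcons.
have -> : partial j (monomial x al) = (fun z => (al j)%:R * monomial x (dec_at j al) z).
  by apply/funext => z; exact: partial_monomial.
rewrite (@pdZ setT) //; [|exact: openT|exact: smooth_monomial].
rewrite normrM normr_nat.
case: (posnP (al j)) => aj; first by rewrite aj mul0r mulr_ge0 // exprn_ge0.
apply: (le_trans (ler_wpM2l _ (IH _))) => //.
have S : (\sum_i al i = (\sum_i dec_at j al i).+1)%N.
  rewrite [in LHS](bigD1 j) // [in RHS](bigD1 j) //= /dec_at eqxx subn1.
  rewrite -addSn prednK //; congr (_ + _)%N; apply: eq_bigr => i ij.
  by rewrite (negbTE ij) subn0.
rewrite S subSS ffactSS natrM -mulrA; apply: ler_wpM2r.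
  by rewrite mulr_ge0 // exprn_ge0.
rewrite ler_nat -S (bigD1 j) //=; exact: leq_addr.
Qed.

(** Absolute convergence at the point with all coordinates [rho] bounds the coefficients by C
    rho^-m, m the degree. On the ball of radius s = rho/4, a term differentiated k times is at most
    C s^-k k! binom(m, k) 4^-m: one factor 2^-m absorbs the binomial, the other is summable over the
    box. The derivatives of the partial sums thus converge geometrically, with the Cauchy bound in
    the limit. *)
Lemma analytic_gevrey f x : analytic_at f x ->
  exists2 r : R, 0 < r & smooth_on (ball x r) f /\ gevrey_at f x.
Proof.
move=> [a /nbhs_ballP[d /= d0 H]].
pose rho := d / 2; have rho0 : 0 < rho by rewrite divr_gt0.
pose h1 : 'cV[R]_n := \col_i rho.
have h1d : `|h1| < d.
  apply: (@le_lt_trans _ _ rho); last by rewrite /rho; lra.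
  by apply: norm_cV_le => [|i]; rewrite ?mxE ?ger0_norm // ltW.
have [cv _] : cvgn (box_sum (fun al => `|power_term a h1 al|)) /\ True.
  by split => //; have [] := H (x + h1); rewrite ?ball_addE // [x + h1]addrC addrK.
pose C := limn (box_sum (fun al => `|power_term a h1 al|)).
have aC al : `|a al| * rho ^+ (\sum_i al i) <= C.
  have -> : `|a al| * rho ^+ (\sum_i al i) = `|power_term a h1 al|.
    rewrite /power_term normrM; congr (_ * _); rewrite -prodrXr.
    by rewrite normr_prod; apply: eq_bigr => i _; rewrite mxE ger0_norm // exprn_ge0 // ltW.
  apply: (@le_trans _ _ (box_sum (fun al => `|power_term a h1 al|) (\sum_i al i).+1)).
    by apply: box_sum_ge => // i; rewrite ltnS (bigD1 i) //= leq_addr.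
  by apply: nondecreasing_cvgn_le => //; exact: box_sum_homo.
have C0 : 0 <= C.
  by apply: le_trans (aC (fun=> 0%N)); rewrite mulr_ge0 // exprn_ge0 // ltW.
pose s := rho / 4; have s0 : 0 < s by rewrite divr_gt0.
have term w al y : ball x s y -> `|a al * pd w (monomial x al) y| <=
    C * s^-1 ^+ size w * (size w)`!%:R * \prod_i 2^-1 ^+ al i.
  rewrite ballE => /ltW ys; rewrite normrM.
  apply: (le_trans (ler_wpM2l (normr_ge0 _) (pd_monomial_bound al w (ltW s0) ys))).
  rewrite prodrXr; set m := (\sum_i al i)%N; set k := size w.
  have Am : `|a al| <= C * rho^-1 ^+ m.
    by rewrite exprVn ler_pdivlMr ?exprn_gt0 //; exact: aC.
  apply: (@le_trans _ _ (C * rho^-1 ^+ m * ((m ^_ k)%:R * s ^+ (m - k)))).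
    by apply: ler_wpM2r => //; rewrite mulr_ge0 // exprn_ge0 // ltW.
  case: (leqP k m) => km; last first.
    rewrite ffact_small // mul0r mulr0 !mulr_ge0 // ?exprn_ge0 ?invr_ge0 //; exact: ltW.
  have sk : s ^+ (m - k) = s ^+ m * s^-1 ^+ k.
    rewrite -{2}(subnK km) exprD -mulrA -exprMn divff ?expr1n ?mulr1 //; exact: lt0r_neq0.
  have rs : rho^-1 ^+ m * s ^+ m = 2^-1 ^+ m * 2^-1 ^+ m.
    by rewrite -!exprMn; congr (_ ^+ _); rewrite /s; field; exact: lt0r_neq0.
  rewrite sk -bin_ffact natrM.
  have -> : C * rho^-1 ^+ m * ('C(m, k)%:R * k`!%:R * (s ^+ m * s^-1 ^+ k)) =
    (C * s^-1 ^+ k * k`!%:R * 2^-1 ^+ m) * ('C(m, k)%:R * 2^-1 ^+ m).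
    have -> : C * rho^-1 ^+ m * ('C(m, k)%:R * k`!%:R * (s ^+ m * s^-1 ^+ k)) =
      C * ('C(m, k)%:R * k`!%:R * s^-1 ^+ k) * (rho^-1 ^+ m * s ^+ m) by ring.
    by rewrite rs; ring.
  apply: ler_piMr.
    by rewrite !mulr_ge0 // exprn_ge0 // invr_ge0 // ltW.
  rewrite exprVn ler_pdivrMr ?exprn_gt0 // mul1r -natrX ler_nat.
  have := expnDn 1 1 m; have km' : (k < m.+1)%N by rewrite ltnS.
  rewrite (bigD1 (Ordinal km')) //= !exp1n !muln1 => E.
  by rewrite -[X in (_ <= X ^ _)%N]/(1 + 1)%N E leq_addr.
pose P N y := box_sum (power_term a (y - x)) N.
have PE N : P N = (fun y => \sum_(al : {ffun 'I_n -> 'I_N}) a (ffval al) * monomial x (ffval al) y).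
  by [].
have sm b al : smooth_on setT (fun y => b * monomial x al y).
  by apply: smoothM; [exact: openT|exact: smooth_const|exact: smooth_monomial].
have sP N : smooth_on setT (P N) by rewrite PE; apply: smooth_sum => //; exact: openT.
have pdP w N y : pd w (P N) y = box_sum (fun al => a al * pd w (monomial x al) y) N.
  rewrite PE (@pd_sum _ _ _ _ _ setT) //; last exact: openT.
  apply: eq_bigr => al _; rewrite (@pdZ setT) //; [exact: openT|exact: smooth_monomial].
have sd : s <= d by rewrite /s /rho; lra.
have [sf cf] : smooth_on (ball x s) f /\
  forall w y, ball x s y -> pd w (P N) y @[N --> \oo] --> pd w f y.
  apply: (smooth_limit s0) => [N|y ys|w].
  - exact: smooth_sub (sP N).
  - have [] // := H y; move: ys; rewrite !ballE => ys; exact: lt_le_trans sd.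
  exists (C * s^-1 ^+ size w * (size w)`!%:R * (n%:R * 2 ^+ n)) => N y ys.
  rewrite !pdP box_sumS addrC addKr; apply: (le_trans (ler_norm_sum _ _ _)).
  apply: (le_trans (ler_sum _ (fun be _ => term w (ffval be) y ys))).
  rewrite -mulr_sumr -[leRHS]mulrA; apply: ler_wpM2l.
    by rewrite !mulr_ge0 // exprn_ge0 // invr_ge0 // ltW.
  exact: shell_half_le.
exists s => //; split => //.
exists (C * 2 ^+ n), s^-1; split; [by rewrite mulr_ge0 // exprn_ge0|by rewrite invr_ge0 ltW|].
apply/nbhs_ballP; exists s => //= y ys w.
apply: (lim_norm_le (cf w y ys) (N0 := 0)) => N _; rewrite pdP.
apply: (le_trans (ler_norm_sum _ _ _)).
apply: (le_trans (ler_sum _ (fun be _ => term w (ffval be) y ys))).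
have -> : C * 2 ^+ n * s^-1 ^+ size w * (size w)`!%:R =
  C * s^-1 ^+ size w * (size w)`!%:R * 2 ^+ n by ring.
rewrite -mulr_sumr; apply: ler_wpM2l; last exact: box_half_le.
by rewrite !mulr_ge0 // exprn_ge0 // invr_ge0 // ltW.
Qed.

(** Lets all arguments run with [reg], where differentiation and composition are controlled, and
    return to [regular] only at charts and tensor fields. *)
Lemma regularE c U f : open U -> regular c U f <-> reg c U f.
Proof.
move=> oU; case: c => /=; split.
- by move=> H; split => //; exact: Ck_smooth.
- by case=> sf _; exact: smooth_Ck.
- move=> H; split=> [w x Ux|_ x Ux].
    have [r r0 [sf _]] := analytic_gevrey (H x Ux).
    by apply: sf; exact: ballxx.
  by have [r r0 [_ gf]] := analytic_gevrey (H x Ux).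
- by case=> sf gf x Ux; apply: (gevrey_analytic oU) => //; exact: gf.
Qed.

End AnalyticGevrey.

(** * Poincare lemma *)

Section Poincare.
Context {R : realType} {n : nat}.
Implicit Types (x y v h : 'cV[R]_n) (t : R).

(** The integral starts at -1 and the integrand is continuous up to 2, so every [t] in [0, 1] is
    interior and the derivative is two-sided. *)
Lemma antiderivative (g : R -> R) :
  (forall t, -1 <= t <= 2 -> {for t, continuous g}) ->
  exists G : R -> R, forall t, 0 <= t <= 1 -> is_derive t 1 G (g t).
Proof.
move=> cg.
have ig : (@lebesgue_measure R).-integrable `[(-1 : R), 2] (EFin \o g).
  apply: continuous_compact_integrable; first exact: segment_compact.
  apply: continuous_in_subspaceT => t; rewrite inE /= in_itv /=; exact: cg.
exists (fun x : R => \int[lebesgue_measure]_(t in `[-1, x]) g t)%R => t /andP[t0 t1].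
have [h1 h2 h3] : [/\ t < 2, -1 < t & -1 <= t <= 2] by split; lra.
have [D DE] := continuous_FTC1_closed h1 ig h2 (cg t h3).
refine (DeriveDef D _); rewrite -derive1E; exact: DE.
Qed.

Lemma first_order_taylor (f : 'cV[R]_n -> R) x (r K : R) y h : smooth_on (ball x r) f ->
  (forall i k w, ball x r w -> `|partial i (partial k f) w| <= K) ->
  ball x r y -> ball x r (y + h) ->
  `|f (y + h) - f y - dotl (fun j => partial j f y) h| <= n%:R * (n%:R * K * `|h|) * `|h|.
Proof.
move=> sf bf yr yhr.
have hy : y + h - y = h by rewrite addrC addKr.
have [t t01|t t01] := @mvt_seg _ _ f y (y + h).
  by apply: (smooth_diff sf); exact: ball_line.
rewrite hy => ->.
have -> : dotl (fun j => partial j f (y + t *: h)) h - dotl (fun j => partial j f y) h =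
   dotl (fun j => partial j f (y + t *: h) - partial j f y) h.
  by rewrite /dotl -sumrB; apply: eq_bigr => j _; rewrite mulrBr.
apply: dotl_le => j.
have yt : ball x r (y + t *: h) by have := ball_line yr yhr t01; rewrite hy.
apply: (le_trans (mvi_ball _ _ yr yt)).
- by move=> w wr; exact: smooth_diff (smooth_partial j sf) wr.
- by move=> w i wr; apply: bf.
have K0 : 0 <= K by apply: le_trans (bf j j y yr).
rewrite [y + _]addrC addrK normrZ; apply: ler_wpM2l; first by rewrite mulr_ge0.
by case/andP: t01 => t0 t1; rewrite ger0_norm // ler_piMl.
Qed.

Lemma near_bound (m : nat) (f : 'I_m -> 'cV[R]_n -> R) x :
  (forall i, {for x, continuous (f i)}) ->
  exists2 K : R, 0 <= K & \forall y \near x, forall i, `|f i y| <= K.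
Proof.
move=> cf; exists (\sum_i (`|f i x| + 1)); first by apply: sumr_ge0 => i _; rewrite addr_ge0.
have H i : \forall y \near x, `|f i y| <= \sum_i (`|f i x| + 1).
  have /cvgrPdist_le /(_ 1 ltr01) := cf i; apply: filterS => y hy.
  apply: (@le_trans _ _ (`|f i x| + 1)).
    by rewrite -[f i y](subKr (f i x)); apply: (le_trans (ler_normB _ _)); lra.
  by rewrite (bigD1 i) //= lerDl; apply: sumr_ge0 => k _; rewrite addr_ge0.
exact: (filter_forall (nbhs_filter x) H).
Qed.

(** The primitive is the radial integral of sum_i v_i th_i(x + t v) over t in [0, 1], with v = y -
    x, expressed through chosen antiderivatives [G v]. Differentiation under the integral sign is
    replaced by the mean value theorem for [Phi]. *)
Lemma poincare x (r : R) (th : 'I_n -> 'cV[R]_n -> R) : 0 < r ->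
  (forall j, smooth_on (ball x r) (th j)) ->
  (forall i j y, ball x r y -> partial i (th j) y = partial j (th i) y) ->
  exists r' : R, [/\ 0 < r', r' <= r & exists F : 'cV[R]_n -> R, F x = 0 /\
    forall y, ball x r' y -> differentiable F y /\ forall j, partial j F y = th j y].
Proof.
move=> r0 sth cth.
have [K1 K10 B1] : exists2 K : R, 0 <= K &
    \forall y \near x, forall ij : 'I_(#|{: 'I_n * 'I_n}|),
     `|partial (enum_val ij).1 (th (enum_val ij).2) y| <= K.
  apply: near_bound => ij; apply: differentiable_continuous.
  by apply: (smooth_diff (smooth_partial _ (sth _))); exact: ballxx.
have [K2 K20 B2] : exists2 K : R, 0 <= K &
    \forall y \near x, forall ij : 'I_(#|{: 'I_n * 'I_n * 'I_n}|),
     `|partial (enum_val ij).1.1 (partial (enum_val ij).1.2 (th (enum_val ij).2)) y| <= K.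
  apply: near_bound => ij; apply: differentiable_continuous.
  by apply: (smooth_diff (smooth_partial _ (smooth_partial _ (sth _)))); exact: ballxx.
have : \forall y \near x, [/\ ball x r y, forall i j, `|partial i (th j) y| <= K1 &
     forall i j k, `|partial i (partial j (th k)) y| <= K2].
  have B0 : \forall y \near x, ball x r y by exact: nbhsx_ballx.
  apply: filterS3 B0 B1 B2 => y yr b1 b2; split => // [i j|i j k].
    by have := b1 (enum_rank (i, j)); rewrite enum_rankK.
  by have := b2 (enum_rank (i, j, k)); rewrite enum_rankK.
move=> /nbhs_ballP[r1 /= r10 H].
have rr y : ball x r1 y -> ball x r y by move=> /H[].
have sth1 j : smooth_on (ball x r1) (th j) by exact: smooth_sub rr (sth j).
(* The antiderivatives use [t] up to 2, and [x + t *: v] has to stay in the ball of radius [r1]. *)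
pose r2 := Num.min r (r1 / 2).
have r20 : 0 < r2 by rewrite lt_min r0 divr_gt0.
pose S v t := \sum_i v i 0 * th i (x + t *: v).
have inb v t : `|v| < r2 -> -1 <= t <= 2 -> ball x r1 (x + t *: v).
  rewrite ball_addE normrZ lt_min => /andP[_ v1] t1.
  apply: (@le_lt_trans _ _ (2 * `|v|)); last by lra.
  by apply: ler_wpM2r => //; rewrite ler_norml; lra.
have /choice[G HG] v : exists G : R -> R, `|v| < r2 ->
    forall t, 0 <= t <= 1 -> is_derive t 1 G (S v t).
  have [vr|vr] := boolP (`|v| < r2); last by exists (fun=> 0).
  have [t t1|G HG] := @antiderivative (S v); last by exists G.
  apply: cvg_big => [|i _]; first exact: add_continuous.
  apply: cvgM; first exact: cvg_cst.
  have D := is_derive_line (smooth_diff (sth1 i) (inb v t vr t1)).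
  by apply: differentiable_continuous; apply/derivable1_diffP; exact: ex_derive.
exists r2; split=> //; first by rewrite ge_min lexx.
exists (fun y => G (y - x) 1 - G (y - x) 0); split.
  rewrite subrr; have z : `|0 : 'cV[R]_n| < r2 by rewrite normr0.
  have D t : 0 <= t <= 1 -> is_derive t 1 (G 0) 0.
    move=> t01; apply: (is_derive_eq (HG 0 z t t01)); rewrite /S big1 // => i _.
    by rewrite mxE mul0r.
  have [c|t|c _] := @MVT R (G 0) (fun=> 0) 0 1 ltr01.
  - by rewrite in_itv /= => /andP[c0 c1]; apply: D; rewrite !ltW.
  - by apply: derivable_within_continuous => s; rewrite in_itv /= => /D[].
  by rewrite mul0r.
move=> y yr; apply: differentiable_eps => e e0.
have M0 : 0 < n%:R * (n%:R * (n%:R * K2)) * r2 + n%:R * (n%:R * K1) + 1.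
  by rewrite ltr_wpDl // addr_ge0 // !mulr_ge0 // ltW.
set M := _ + _ + 1 in M0.
pose v := y - x.
have vr : `|v| < r2 by move: yr; rewrite ballE.
have Nh : \forall h \near (0 : 'cV[R]_n), `|h| < Num.min (r2 - `|v|) (e / M).
  by apply: nbhs0_lt; rewrite lt_min subr_gt0 vr divr_gt0.
apply: filterS Nh => h; rewrite lt_min => /andP[h1 h2].
have vhr : `|v + h| < r2.
  by apply: (le_lt_trans (ler_normD _ _)); rewrite -ltrBrDl.
have -> : y + h - x = v + h by rewrite /v addrAC.
rewrite -/v.
(* [Phi 1 - Phi 0] is the increment of the primitive minus its expected linear part, so it suffices
   that the derivative of [Phi] is quadratic in [h]. *)
pose Phi t := G (v + h) t - G v t - t * \sum_i h i 0 * th i (x + t *: v).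
pose Phi' t := S (v + h) t - S v t - (\sum_i h i 0 * th i (x + t *: v) +
   t * \sum_i h i 0 * dotl (fun l => partial l (th i) (x + t *: v)) v).
have D t : 0 <= t <= 1 -> is_derive t 1 Phi (Phi' t).
  move=> t01; have t1 : -1 <= t <= 2 by case/andP: t01 => *; lra.
  have D1 := HG _ vhr t t01; have D2 := HG _ vr t t01.
  have D3 : is_derive t 1 (fun t => \sum_i h i 0 * th i (x + t *: v))
      (\sum_i h i 0 * dotl (fun l => partial l (th i) (x + t *: v)) v).
    have -> : (fun t => \sum_i h i 0 * th i (x + t *: v)) =
       \sum_(i < n) (fun t => h i 0 * th i (x + t *: v)).
      by apply/funext => s; rewrite fct_sumE.
    apply: is_derive_sum => i.
    exact: (@is_deriveZ _ _ _ (fun t => th i (x + t *: v)) (h i 0) t 1 _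
      (is_derive_line (smooth_diff (sth1 i) (inb v t vr t1)))).
  have D4 := is_deriveM (is_derive_id t 1) D3.
  have D5 := is_deriveB (is_deriveB D1 D2) D4.
  apply: (is_derive_eq D5); rewrite /Phi' /GRing.scale /= mulr1; congr (_ - _).
  by rewrite addrC.
have [c|t|c] := @MVT R Phi Phi' 0 1 ltr01.
- by rewrite in_itv /= => /andP[c0 c1]; apply: D; rewrite !ltW.
- by apply: derivable_within_continuous => s; rewrite in_itv /= => /D[].
rewrite in_itv /= => /andP[c0 c1]; rewrite subr0 mulr1 /Phi scale1r mul1r mul0r subr0.
have -> : x + v = y by rewrite /v addrC subrK.
have -> : G (v + h) 1 - G v 1 - \sum_i h i 0 * th i y - (G (v + h) 0 - G v 0) =
   G (v + h) 1 - G (v + h) 0 - (G v 1 - G v 0) - dotl (th^~ y) h.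
  by rewrite /dotl; ring.
move=> ->.
have c01 : -1 <= c <= 2 by lra.
have zr := inb v c vr c01; have zhr := inb _ c vhr c01.
set z := x + c *: v in zr.
have zh : x + c *: (v + h) = z + c *: h by rewrite /z scalerDr addrA.
rewrite zh in zhr.
have -> : Phi' c = \sum_i v i 0 * (th i (z + c *: h) - th i z - dotl (fun l => partial l (th i) z) (c *: h))
   + \sum_i h i 0 * (th i (z + c *: h) - th i z).
  (* Closedness exchanges [v] and [h]; after that the terms of [Phi' c] of first order in [h]
     cancel. *)
  have E : \sum_i h i 0 * dotl (fun l => partial l (th i) z) v =
     \sum_i v i 0 * dotl (fun l => partial l (th i) z) h.
    rewrite /dotl; under eq_bigr do rewrite mulr_sumr; rewrite exchange_big /=.
    apply: eq_bigr => i _; rewrite mulr_sumr; apply: eq_bigr => l _.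
    by rewrite (cth i l z) 1?mulrCA //; exact: rr.
  rewrite /Phi' /S zh -/z E mulr_sumr -!sumrB -big_split -sumrB -big_split /=.
  have Lz l : dotl l (c *: h) = c * dotl l h by rewrite linearZ.
  by apply: eq_bigr => i _; rewrite Lz mxE; ring.
have ch : `|c *: h| <= `|h|.
  by rewrite normrZ (ger0_norm (ltW c0)) ler_piMl // ltW.
have vle := ltW vr.
apply: (@le_trans _ _ (M * `|h| * `|h|)); last first.
  apply: ler_wpM2r => //; rewrite mulrC -ler_pdivlMr //; exact: ltW.
rewrite /M !mulrDl; apply: (le_trans (ler_normD _ _)); rewrite -[leLHS]addr0.
apply: lerD; last by rewrite mul1r mulr_ge0.
apply: lerD.
  rewrite -/(dotl (fun i => th i (z + c *: h) - th i z - dotl (fun l => partial l (th i) z) (c *: h)) v).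
  apply: (@le_trans _ _ (n%:R * (n%:R * (n%:R * K2 * `|h|) * `|h|) * `|v|)).
    apply: dotl_le => i.
    apply: (le_trans (first_order_taylor (sth1 i) _ zr zhr)).
      by move=> a b w /H[_ _]; apply.
    apply: ler_pM => //; first by rewrite !mulr_ge0.
    by apply: ler_wpM2l => //; apply: ler_wpM2l => //; rewrite mulr_ge0.
  have -> : n%:R * (n%:R * (n%:R * K2)) * r2 * `|h| * `|h| =
    n%:R * (n%:R * (n%:R * K2 * `|h|) * `|h|) * r2 by ring.
  by apply: ler_wpM2l => //; rewrite !mulr_ge0.
rewrite -/(dotl (fun i => th i (z + c *: h) - th i z) h).
have -> : n%:R * (n%:R * K1) * `|h| * `|h| = n%:R * (n%:R * K1 * `|h|) * `|h| by ring.
apply: dotl_le => i.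
apply: (le_trans (mvi_ball (K := K1) _ _ zr zhr)).
- by move=> w wr; exact: smooth_diff (sth1 i) wr.
- by move=> w j /H[_ + _]; apply.
rewrite [z + _]addrC addrK; apply: ler_wpM2l => //; by rewrite mulr_ge0.
Qed.

End Poincare.

(** * Complex-valued functions of real variables *)

Section ComplexCalculus.
Context {R : realType} {n : nat}.
Local Notation C := R[i].
Local Notation Re := (@complex.Re R).
Local Notation Im := (@complex.Im R).
Implicit Types (U : set 'cV[R]_n) (f g : 'cV[R]_n -> C) (x y : 'cV[R]_n).

Lemma cReD (a b : C) : Re (a + b) = Re a + Re b. Proof. by case: a b => [? ?] []. Qed.
Lemma cImD (a b : C) : Im (a + b) = Im a + Im b. Proof. by case: a b => [? ?] []. Qed.
Lemma cReM (a b : C) : Re (a * b) = Re a * Re b - Im a * Im b.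
Proof. by case: a b => [? ?] []. Qed.
Lemma cImM (a b : C) : Im (a * b) = Re a * Im b + Im a * Re b.
Proof. by case: a b => [? ?] []. Qed.
Lemma cReN (a : C) : Re (- a) = - Re a. Proof. by case: a. Qed.
Lemma cImN (a : C) : Im (- a) = - Im a. Proof. by case: a. Qed.
Lemma cReV (a : C) : Re a^-1 = Re a / (Re a ^+ 2 + Im a ^+ 2). Proof. by case: a. Qed.
Lemma cImV (a : C) : Im a^-1 = - (Im a / (Re a ^+ 2 + Im a ^+ 2)). Proof. by case: a. Qed.
Lemma eq_ReIm (a b : C) : Re a = Re b -> Im a = Im b -> a = b.
Proof. by case: a b => [? ?] [? ?] /= -> ->. Qed.
Definition cdiff f x :=
  differentiable (fun y => Re (f y)) x /\ differentiable (fun y => Im (f y)) x.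

(** A derivative along a real coordinate, taken componentwise; no holomorphy is meant. *)
Definition cpartial (j : 'I_n) f : 'cV[R]_n -> C :=
  fun x => (partial j (fun y => Re (f y)) x +i* partial j (fun y => Im (f y)) x)%C.

Definition regC c U f := reg c U (fun y => Re (f y)) /\ reg c U (fun y => Im (f y)).

Lemma regC_diff c U f x : regC c U f -> U x -> cdiff f x.
Proof. by move=> [[sr _] [si _]] Ux; split; [exact: smooth_diff sr Ux|exact: smooth_diff si Ux]. Qed.

Lemma cdiff_cst (a : C) x : cdiff (fun=> a) x.
Proof. by split; exact: differentiable_cst. Qed.

Lemma cdiffD f g x : cdiff f x -> cdiff g x -> cdiff (fun y => f y + g y) x.
Proof.
move=> [fr fi] [gr gi]; split.
  by under eq_fun do rewrite cReD; exact: differentiableD.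
by under eq_fun do rewrite cImD; exact: differentiableD.
Qed.

Lemma cdiffN f x : cdiff f x -> cdiff (fun y => - f y) x.
Proof.
move=> [fr fi]; split.
  by under eq_fun do rewrite cReN; exact: differentiableN.
by under eq_fun do rewrite cImN; exact: differentiableN.
Qed.

Lemma cdiffM f g x : cdiff f x -> cdiff g x -> cdiff (fun y => f y * g y) x.
Proof.
move=> [fr fi] [gr gi]; split.
  by under eq_fun do rewrite cReM; apply: differentiableB; exact: differentiableM.
by under eq_fun do rewrite cImM; apply: differentiableD; exact: differentiableM.
Qed.

Lemma cdiff_sum (I : Type) (r : seq I) (P : pred I) (F : I -> 'cV[R]_n -> C) x :
  (forall i, cdiff (F i) x) -> cdiff (fun y => \sum_(i <- r | P i) F i y) x.
Proof.
move=> dF; elim: r => [|i r IH].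
  by under eq_fun do rewrite big_nil; exact: cdiff_cst.
by under eq_fun do rewrite big_cons; case: (P i) => //; exact: cdiffD.
Qed.

Lemma cpartial_cst (a : C) j x : cpartial j (fun=> a) x = 0.
Proof. by rewrite /cpartial !partial_cst. Qed.

Lemma cpartialD f g j x : cdiff f x -> cdiff g x ->
  cpartial j (fun y => f y + g y) x = cpartial j f x + cpartial j g x.
Proof.
move=> [fr fi] [gr gi]; apply: eq_ReIm.
  rewrite cReD /=; under eq_fun do rewrite cReD; exact: partialD.
rewrite cImD /=; under eq_fun do rewrite cImD; exact: partialD.
Qed.

Lemma cpartialN f j x : cdiff f x -> cpartial j (fun y => - f y) x = - cpartial j f x.
Proof.
move=> [fr fi]; apply: eq_ReIm.
  rewrite cReN /=; under eq_fun do rewrite cReN; exact: partialN.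
rewrite cImN /=; under eq_fun do rewrite cImN; exact: partialN.
Qed.

Lemma cpartialM f g j x : cdiff f x -> cdiff g x ->
  cpartial j (fun y => f y * g y) x = cpartial j f x * g x + f x * cpartial j g x.
Proof.
move=> [fr fi] [gr gi]; apply: eq_ReIm.
  rewrite cReD !cReM /=; under eq_fun do rewrite cReM.
  rewrite partialD ?partialN ?partialM //; first ring.
  - exact: differentiableM.
  - exact: differentiableM.
  - by apply: differentiableN; exact: differentiableM.
rewrite cImD !cImM /=; under eq_fun do rewrite cImM.
rewrite partialD ?partialM //; first ring.
- exact: differentiableM.
- exact: differentiableM.
Qed.

Lemma cpartial_sum (I : Type) (r : seq I) (P : pred I) (F : I -> 'cV[R]_n -> C) j x :
  (forall i, cdiff (F i) x) ->
  cpartial j (fun y => \sum_(i <- r | P i) F i y) x = \sum_(i <- r | P i) cpartial j (F i) x.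
Proof.
move=> dF; elim: r => [|i r IH].
  by under eq_fun do rewrite big_nil; rewrite big_nil cpartial_cst.
under eq_fun do rewrite big_cons; rewrite big_cons; case: (P i) => //.
by rewrite cpartialD ?IH //; exact: cdiff_sum.
Qed.

Lemma cpartial_real (f : 'cV[R]_n -> R) j x :
  cpartial j (fun y => (f y)%:C%C) x = (partial j f x)%:C%C.
Proof. by rewrite /cpartial /= partial_cst. Qed.

Lemma cpartial_near f g j x : (\forall y \near x, f y = g y) ->
  cpartial j f x = cpartial j g x.
Proof.
move=> fg; rewrite /cpartial; congr (_ +i* _)%C; apply: partial_near;
  by apply: filterS fg => y ->.
Qed.

Lemma cpartial_on U f g j x : open U -> U x -> (forall y, U y -> f y = g y) ->
  cpartial j f x = cpartial j g x.
Proof.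
move=> oU Ux fg; apply: cpartial_near; have : nbhs x U by exact: open_nbhs_nbhs.
by apply: filterS => y /fg.
Qed.

Lemma cdiff_real (f : 'cV[R]_n -> R) x : differentiable f x -> cdiff (fun y => (f y)%:C%C) x.
Proof. by move=> df; split => //; exact: differentiable_cst. Qed.

Lemma regC_ext c U f g : open U -> (forall y, U y -> f y = g y) -> regC c U f -> regC c U g.
Proof.
move=> oU fg [fr fi]; split; [apply: reg_ext oU _ fr|apply: reg_ext oU _ fi] => y Uy;
  by rewrite fg.
Qed.

Lemma regC_sub c U V f : V `<=` U -> regC c U f -> regC c V f.
Proof. by move=> VU [fr fi]; split; [exact: reg_sub VU fr|exact: reg_sub VU fi]. Qed.

Lemma regC_const c U (a : C) : regC c U (fun=> a).
Proof. by split; exact: reg_const. Qed.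

Lemma regC_real c U (f : 'cV[R]_n -> R) : reg c U f -> regC c U (fun y => (f y)%:C%C).
Proof. by move=> rf; split => //; exact: reg_const. Qed.

Lemma regCD c U f g : open U -> regC c U f -> regC c U g -> regC c U (fun y => f y + g y).
Proof.
move=> oU [fr fi] [gr gi]; split.
  by under eq_fun do rewrite cReD; exact: regD.
by under eq_fun do rewrite cImD; exact: regD.
Qed.

Lemma regCN c U f : open U -> regC c U f -> regC c U (fun y => - f y).
Proof.
move=> oU [fr fi]; split.
  by under eq_fun do rewrite cReN; exact: regN.
by under eq_fun do rewrite cImN; exact: regN.
Qed.

Lemma regCM c U f g : open U -> regC c U f -> regC c U g -> regC c U (fun y => f y * g y).
Proof.
move=> oU [fr fi] [gr gi]; split.
  by under eq_fun do rewrite cReM; apply: regB => //; exact: regM.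
by under eq_fun do rewrite cImM; apply: regD => //; exact: regM.
Qed.

Lemma regC_sum c U (I : Type) (r : seq I) (P : pred I) (F : I -> 'cV[R]_n -> C) : open U ->
  (forall i, regC c U (F i)) -> regC c U (fun y => \sum_(i <- r | P i) F i y).
Proof.
move=> oU dF; elim: r => [|i r IH].
  by under eq_fun do rewrite big_nil; exact: regC_const.
by under eq_fun do rewrite big_cons; case: (P i) => //; exact: regCD.
Qed.

Lemma regC_prod c U (I : Type) (r : seq I) (P : pred I) (F : I -> 'cV[R]_n -> C) : open U ->
  (forall i, regC c U (F i)) -> regC c U (fun y => \prod_(i <- r | P i) F i y).
Proof.
move=> oU dF; elim: r => [|i r IH].
  by under eq_fun do rewrite big_nil; exact: regC_const.
by under eq_fun do rewrite big_cons; case: (P i) => //; exact: regCM.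
Qed.

Lemma regC_inv c U f : open U -> regC c U f -> (forall x, U x -> f x != 0) ->
  regC c U (fun y => (f y)^-1).
Proof.
move=> oU [fr fi] f0.
have N0 x : U x -> Re (f x) * Re (f x) + Im (f x) * Im (f x) != 0.
  move=> /f0; apply: contra; rewrite -!expr2 paddr_eq0 ?sqr_ge0 // !sqrf_eq0.
  by move=> /andP[/eqP a /eqP b]; apply/eqP; exact: eq_ReIm.
have rN := reg_inv oU (regD oU (regM oU fr fr) (regM oU fi fi)) N0.
split.
  by under eq_fun do rewrite cReV !expr2; exact: regM.
by under eq_fun do rewrite cImV !expr2; apply: regN => //; exact: regM.
Qed.

Lemma regC_partial c U f j : regC c U f -> regC c U (cpartial j f).
Proof. by move=> [fr fi]; split; exact: reg_partial. Qed.

Lemma cpartialC c U f i j x : open U -> regC c U f -> U x ->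
  cpartial i (cpartial j f) x = cpartial j (cpartial i f) x.
Proof.
move=> oU [[sr _] [si _]] Ux; have [r r0 rU] := open_ballP oU Ux.
have H (g : 'cV[R]_n -> R) : smooth_on U g -> partial i (partial j g) x = partial j (partial i g) x.
  move=> sg; apply: (@partialC R n g i j x r r0) => [y /rU Uy|k]; first exact: smooth_diff sg Uy.
  exact: smooth_diff (smooth_partial k sg) Ux.
by apply: eq_ReIm; [exact: (H _ sr)|exact: (H _ si)].
Qed.

Definition cexp (a : C) : C := (expR (Re a) * cos (Im a) +i* (expR (Re a) * sin (Im a)))%C.

Lemma cexp0 : cexp 0 = 1.
Proof. by rewrite /cexp /= expR0 cos0 sin0 mulr1 mulr0. Qed.

Lemma cexpD (a b : C) : cexp (a + b) = cexp a * cexp b.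
Proof.
apply: eq_ReIm; rewrite ?cReM ?cImM /= cReD cImD expRD ?cosD ?sinD; ring.
Qed.

Lemma cexpN (a : C) : cexp (- a) * cexp a = 1.
Proof. by rewrite -cexpD addNr cexp0. Qed.

Lemma cexp_neq0 (a : C) : cexp a != 0.
Proof.
by apply/eqP => E; have := cexpN a; rewrite E mulr0 => /eqP; rewrite eq_sym oner_eq0.
Qed.

Lemma regC_exp c U f : open U -> regC c U f -> regC c U (fun y => cexp (f y)).
Proof.
move=> oU [fr fi]; split => /=.
  by apply: regM => //; [exact: reg_expR|exact: reg_cos].
by apply: regM => //; [exact: reg_expR|exact: reg_sin].
Qed.

Lemma cpartial_exp f j x : cdiff f x ->
  cpartial j (fun y => cexp (f y)) x = cexp (f x) * cpartial j f x.
Proof.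
move=> [fr fi]; have [e pe] := chain1 (is_derive_expR (Re (f x))) fr.
have [c pc] := chain1 (is_derive_cos (Im (f x))) fi.
have [s ps] := chain1 (is_derive_sin (Im (f x))) fi.
apply: eq_ReIm; rewrite ?cReM ?cImM /= partialM // pe ?pc ?ps; ring.
Qed.

Lemma regC_det c U m (A : 'cV[R]_n -> 'M[C]_m) : open U ->
  (forall i j, regC c U (fun x => A x i j)) -> regC c U (fun x => \det (A x)).
Proof.
move=> oU rA; apply: regC_sum => // s; apply: regCM => //; first exact: regC_const.
exact: regC_prod.
Qed.

Lemma regC_mulmx c U m k l (A : 'cV[R]_n -> 'M[C]_(m, k)) (B : 'cV[R]_n -> 'M[C]_(k, l)) i j :
  open U -> (forall i j, regC c U (fun x => A x i j)) ->
  (forall i j, regC c U (fun x => B x i j)) -> regC c U (fun x => (A x *m B x) i j).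
Proof.
move=> oU rA rB; under eq_fun do rewrite mxE.
by apply: regC_sum => // a; exact: regCM.
Qed.

Lemma regC_invmx c U m (A : 'cV[R]_n -> 'M[C]_m) i j : open U ->
  (forall i j, regC c U (fun x => A x i j)) -> (forall x, U x -> A x \in unitmx) ->
  regC c U (fun x => invmx (A x) i j).
Proof.
move=> oU rA uA; apply: (@regC_ext c U (fun x => (\det (A x))^-1 * \adj (A x) i j)) => //.
  by move=> x Ux; rewrite /invmx uA // !mxE.
have d0 x : U x -> \det (A x) != 0 by move=> /uA; rewrite unitmxE unitfE.
apply: regCM => //; first by apply: regC_inv => //; exact: regC_det.
under eq_fun do rewrite mxE /cofactor; apply: regCM => //; first exact: regC_const.
by apply: regC_det => // a b; under eq_fun do rewrite !mxE.
Qed.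

Lemma near_gt0 (g : 'cV[R]_n -> R) x : {for x, continuous g} -> 0 < g x ->
  \forall y \near x, 0 < g y.
Proof.
move=> cg g0; have /cvgrPdist_lt /(_ _ g0) := cg; apply: filterS => y.
by rewrite ltr_norml => /andP[_]; rewrite ltrBlDr ltrDl.
Qed.

Lemma near_neq0 f x : cdiff f x -> f x != 0 -> \forall y \near x, f y != 0.
Proof.
move=> df f0.
have N0 : 0 < Re (f x) * Re (f x) + Im (f x) * Im (f x).
  rewrite lt_neqAle -!expr2 addr_ge0 ?sqr_ge0 // andbT eq_sym paddr_eq0 ?sqr_ge0 // !sqrf_eq0.
  by apply: contra f0 => /andP[/eqP a /eqP b]; apply/eqP; exact: eq_ReIm.
have c : {for x, continuous (fun y => Re (f y) * Re (f y) + Im (f y) * Im (f y))}.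
  by case: df => fr fi; apply: differentiable_continuous;
     apply: differentiableD; exact: differentiableM.
have : \forall y \near x, 0 < Re (f y) * Re (f y) + Im (f y) * Im (f y).
  exact: (near_gt0 c N0).
by apply: filterS => y; apply: contraL => /eqP ->; rewrite /= !mulr0 addr0 ltxx.
Qed.

Lemma near_unitmx c U m (A : 'cV[R]_n -> 'M[C]_m) x : open U -> U x ->
  (forall i j, regC c U (fun x => A x i j)) -> A x \in unitmx ->
  \forall y \near x, A y \in unitmx.
Proof.
move=> oU Ux rA; rewrite unitmxE unitfE => uA.
have := near_neq0 (regC_diff (regC_det oU rA) Ux) uA.
by apply: filterS => y; rewrite unitmxE unitfE.
Qed.

End ComplexCalculus.

Section RealMatrices.
Context {R : realType} {n : nat}.
Implicit Types (U : set 'cV[R]_n).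

Lemma regC_complexify c U m (A : 'cV[R]_n -> 'M[R]_m) i j :
  (forall i j, reg c U (fun x => A x i j)) -> regC c U (fun x => complexify (A x) i j).
Proof. by move=> rA; under eq_fun do rewrite mxE; exact: regC_real. Qed.

Lemma reg_invmx c U m (A : 'cV[R]_n -> 'M[R]_m) i j : open U ->
  (forall i j, reg c U (fun x => A x i j)) -> (forall x, U x -> A x \in unitmx) ->
  reg c U (fun x => invmx (A x) i j).
Proof.
move=> oU rA uA.
have [] := @regC_invmx R n c U m (fun x => complexify (A x)) i j oU.
- by move=> a b; exact: regC_complexify.
- by move=> x Ux; rewrite map_unitmx; exact: uA.
by move=> + _; under eq_fun do rewrite -map_invmx mxE.
Qed.

Lemma near_unitmx_real c U m (A : 'cV[R]_n -> 'M[R]_m) x : open U -> U x ->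
  (forall i j, reg c U (fun x => A x i j)) -> A x \in unitmx ->
  \forall y \near x, A y \in unitmx.
Proof.
move=> oU Ux rA uA.
have := @near_unitmx R n c U m (fun x => complexify (A x)) x oU Ux.
rewrite map_unitmx => /(_ _ uA) H.
have : \forall y \near x, complexify (A y) \in unitmx.
  by apply: H => i j; exact: regC_complexify.
by apply: filterS => y; rewrite map_unitmx.
Qed.

End RealMatrices.

(** * Inverse function theorem *)

Section InverseFunction.
Context {R : realType} {n : nat}.
HB.instance Definition _ := Complete.on (matrix R n 1).
Implicit Types (U W : set 'cV[R]_n) (x y v h : 'cV[R]_n).

Lemma mulmx_bound (B : 'M[R]_n) :
  exists2 b : R, 0 <= b & forall v, `|B *m v| <= b * `|v|.
Proof.
pose K := \sum_i \sum_j `|B i j|.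
have K0 : 0 <= K by apply: sumr_ge0 => i _; exact: sumr_ge0.
exists (n%:R * K) => [|v]; first by rewrite mulr_ge0.
apply: norm_cV_le => [|i]; first by rewrite !mulr_ge0.
have -> : (B *m v) i 0 = dotl (B i) v.
  by rewrite mxE; apply: eq_bigr => j _; rewrite mulrC.
apply: dotl_le => j; rewrite /K (bigD1 i) //= (bigD1 j) //= -addrA lerDl.
by rewrite addr_ge0 // sumr_ge0 // => k _; exact: sumr_ge0.
Qed.

(** With [B] the inverse Jacobian at [x0], the map k(x) = x - B phi(x) has zero derivative at [x0],
    hence contracts by 1/2 on a small ball. This makes [phi] injective with Lipschitz inverse, and a
    nearby [y] is reached at the fixed point of x -> k(x) + B y. The derivatives of [psi] are
    returned as entries of the inverse Jacobian, the form that [reg_flow] takes. *)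
Lemma inverse_function U (phi : 'cV[R]_n -> 'cV[R]_n) x0 :
  open U -> U x0 -> (forall i, smooth_on U (fun y => phi y i 0)) ->
  jacobian_mx phi x0 \in unitmx ->
  exists W (psi : 'cV[R]_n -> 'cV[R]_n),
    [/\ open W, W x0, W `<=` U, open (phi @` W) &
     [/\ forall x, W x -> psi (phi x) = x,
         forall x, W x -> jacobian_mx phi x \in unitmx,
         forall x i, W x -> differentiable (fun y => psi y i 0) (phi x) &
         forall x i j, W x -> partial j (fun y => psi y i 0) (phi x) =
            invmx (jacobian_mx phi x) i j]].
Proof.
move=> oU Ux0 sphi J0.
have rJ i j : reg Smooth U (fun x => jacobian_mx phi x i j).
  by under eq_fun do rewrite mxE; split => //; exact: smooth_partial.
pose B := invmx (jacobian_mx phi x0).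
have [b b0 Bb] := mulmx_bound B.
pose k x := x - B *m phi x.
have kE i x : k x i 0 = x i 0 - \sum_j B i j * phi x j 0 by rewrite !mxE.
have sk i : smooth_on U (fun x => k x i 0).
  under eq_fun do rewrite kE.
  apply: (reg_smooth (c := Smooth)); apply: regB => //; first exact: reg_coord.
  have rphi j : reg Smooth U (fun y => phi y j 0) by split.
  by apply: reg_sum => // j; apply: (regM oU (reg_const _ _ _) (rphi j)).
have dk0 i j : partial j (fun x => k x i 0) x0 = 0.
  under eq_fun do rewrite kE.
  have dphi l : differentiable (fun x => phi x l 0) x0 := smooth_diff (sphi l) Ux0.
  have ds (s : seq 'I_n) : differentiable (fun x => \sum_(l <- s) B i l * phi x l 0) x0 /\
     partial j (fun x => \sum_(l <- s) B i l * phi x l 0) x0 =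
       \sum_(l <- s) B i l * partial j (fun x => phi x l 0) x0.
    elim: s => [|l s [IH1 IH2]].
      under eq_fun do rewrite big_nil; rewrite big_nil; split; first exact: differentiable_cst.
      exact: partial_cst.
    under eq_fun do rewrite big_cons; rewrite big_cons.
    have d1 : differentiable (fun x => B i l * phi x l 0) x0.
      by apply: differentiableM => //; exact: differentiable_cst.
    split; first exact: differentiableD.
    by rewrite partialD // IH2 partialM // partial_cst mul0r add0r.
  have [ds1 ds2] := ds (index_enum 'I_n).
  have dc : differentiable (fun y : 'cV[R]_n => y i 0) x0 by exact: differentiable_coord.
  rewrite partialD //; last exact: differentiableN.
  rewrite partialN // partial_coord ds2.
  have -> : \sum_l B i l * partial j (fun x => phi x l 0) x0 = (B *m jacobian_mx phi x0) i j.
    by rewrite mxE; apply: eq_bigr => l _; rewrite mxE.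
  by rewrite mulVmx // mxE subrr.
(* The mean value inequality multiplies this bound by [n], which leaves the contraction ratio
   1/2. *)
have [r r0 H] : exists2 r : R, 0 < r & forall x, ball x0 r x -> [/\ U x,
    jacobian_mx phi x \in unitmx &
    forall i j, `|partial j (fun x => k x i 0) x| <= (2 * n.+1%:R)^-1].
  have e0 : 0 < (2 * n.+1%:R)^-1 :> R by rewrite invr_gt0 mulr_gt0.
  have H1 : \forall y \near x0, U y by exact: open_nbhs_nbhs.
  have H2 := near_unitmx_real oU Ux0 rJ J0.
  have H3 (ij : 'I_#|{: 'I_n * 'I_n}|) : \forall y \near x0,
      `|partial (enum_val ij).2 (fun x => k x (enum_val ij).1 0) y| <= (2 * n.+1%:R)^-1.
    have /differentiable_continuous := smooth_diff (smooth_partial (enum_val ij).2 (sk (enum_val ij).1)) Ux0.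
    move=> /cvgrPdist_le /(_ _ e0); apply: filterS => y; by rewrite dk0 sub0r normrN.
  have H4 := filter_forall (nbhs_filter x0) H3.
  have : \forall y \near x0, [/\ U y, jacobian_mx phi y \in unitmx &
    forall i j, `|partial j (fun x => k x i 0) y| <= (2 * n.+1%:R)^-1].
    apply: filterS3 H1 H2 H4 => y h1 h2 h4; split => // i j.
    by have := h4 (enum_rank (i, j)); rewrite enum_rankK.
  by move=> /nbhs_ballP[r r0 rP]; exists r.
have kc x y : ball x0 r x -> ball x0 r y -> `|k x - k y| <= 2^-1 * `|x - y|.
  move=> xr yr; apply: norm_cV_le => [|i]; first by rewrite mulr_ge0 // invr_ge0.
  have -> : (k x - k y) i 0 = k x i 0 - k y i 0 by rewrite !mxE.
  have H1 w : ball x0 r w -> differentiable (fun x => k x i 0) w.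
    by case/H => Uw _ _; exact: smooth_diff (sk i) Uw.
  have H2 w j : ball x0 r w -> `|partial j (fun x => k x i 0) w| <= (2 * n.+1%:R)^-1.
    by case/H.
  apply: (le_trans (mvi_ball H1 H2 yr xr)); apply: ler_wpM2r => //.
  by rewrite invfM mulrCA ler_piMr ?invr_ge0 // ler_pdivrMr // mul1r ler_nat.
have kd x y : x - y = (k x - k y) + B *m (phi x - phi y).
  by rewrite /k mulmxBr; apply/colP => i; rewrite !mxE; ring.
have Lip x y : ball x0 r x -> ball x0 r y -> `|x - y| <= 2 * b * `|phi x - phi y|.
  move=> xr yr; have := kc x y xr yr; have := Bb (phi x - phi y).
  have : `|x - y| <= `|k x - k y| + `|B *m (phi x - phi y)|.
    by rewrite {1}(kd x y); exact: ler_normD.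
  move=> h1 h2 h3; rewrite -mulrA; lra.
have inj x y : ball x0 r x -> ball x0 r y -> phi x = phi y -> x = y.
  move=> xr yr E; have := Lip x y xr yr; rewrite E subrr normr0 mulr0 normr_le0 subr_eq0.
  by move/eqP.
pose W := ball x0 r.
have surj x1 (s : R) y : 0 < s -> [set x | `|x - x1| <= s] `<=` W ->
    b * `|y - phi x1| <= s / 2 -> exists2 x, W x & phi x = y.
  move=> s0 sW yb.
  pose D := [set x : 'cV[R]_n | `|x - x1| <= s].
  pose T x := k x + B *m y.
  have Dx1 : D x1 by rewrite /D /= subrr normr0 ltW.
  have TD : {homo T : x / D x >-> D x}.
    move=> x Dx; rewrite /D /=.
    have -> : T x - x1 = (k x - k x1) + B *m (y - phi x1).
      by rewrite /T /k mulmxBr; apply/colP => i; rewrite !mxE; ring.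
    apply: (le_trans (ler_normD _ _)).
    have := kc x x1 (sW _ Dx) (sW _ Dx1); have := Bb (y - phi x1).
    move: Dx; rewrite /D /=; lra.
  have cT : is_contraction (mkfun TD).
    exists (2^-1)%:nng; split => /=; first by rewrite invf_lt1 // ltr1n.
    move=> [x z] /= [Dx Dz]; rewrite /T opprD addrACA subrr addr0.
    by apply: kc; exact: sW.
  have cD : closed D.
    have -> : D = closed_ball x1 s.
      by rewrite closed_ballE //; apply/seteqP; split => x; rewrite /D /closed_ball_ /= distrC.
    exact: closed_ball_closed.
  have [x Dx xT] := banach_fixed_point cT cD (ex_intro _ x1 Dx1).
  exists x; first exact: sW.
  have E : B *m (y - phi x) = 0.
    have xT' : x = T x by exact: xT.
    have -> : B *m (y - phi x) = T x - x.
      by rewrite /T /k mulmxBr; apply/colP => i; rewrite !mxE; ring.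
    by rewrite -xT' subrr.
  have uB : B \in unitmx by rewrite unitmx_inv.
  have : invmx B *m (B *m (y - phi x)) = 0 by rewrite E mulmx0.
  by rewrite mulKmx // => /eqP; rewrite subr_eq0 => /eqP.
have oW : open (phi @` W).
  rewrite openE => _ [x1 Wx1 <-]; rewrite /interior.
  pose s := (r - `|x1 - x0|) / 2.
  have s0 : 0 < s by rewrite divr_gt0 // subr_gt0; move: Wx1; rewrite /W ballE.
  have sW : [set x | `|x - x1| <= s] `<=` W.
    move=> x /= xs; rewrite /W ballE -(subrKA x1).
    by apply: (le_lt_trans (ler_normD _ _)); move: s0 xs; rewrite /s; lra.
  have b1 : 0 < b + 1 by lra.
  have d0 : 0 < s / 2 / (b + 1) by rewrite divr_gt0 // divr_gt0.
  apply/nbhs_ballP; exists (s / 2 / (b + 1)) => //= y; rewrite ballE => yd.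
  have [|x Wx <-] := surj x1 s y s0 sW; last by exists x.
  have : `|y - phi x1| * (b + 1) <= s / 2 by rewrite -ler_pdivlMr // ltW.
  have := normr_ge0 (y - phi x1); lra.
have /choice[psi Hpsi] y : exists x, (phi @` W) y -> W x /\ phi x = y.
  have [[x Wx <-]|ny] := pselect ((phi @` W) y); first by exists x.
  by exists 0.
have psiK x : W x -> psi (phi x) = x.
  by move=> Wx; have [|Wp E] := Hpsi (phi x); [exists x|exact: inj].
exists W, psi; split => //; first exact: ball_open.
- exact: ballxx.
- by move=> x /H[].
have main x i : W x -> differentiable (fun y => psi y i 0) (phi x) /\
    forall j, partial j (fun y => psi y i 0) (phi x) = invmx (jacobian_mx phi x) i j.
  move=> Wx; have [Ux uJ _] := H x Wx.
  apply: differentiable_eps => e e0.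
  set J := jacobian_mx phi x in uJ *.
  have [b' b'0 Bb'] := mulmx_bound (invmx J).
  have c0 : 0 < e / (b' * (2 * b) + 1) by rewrite divr_gt0 // ltr_wpDl // !mulr_ge0.
  set cc := e / _ in c0.
  have E1 i' : \forall h \near (0 : 'cV[R]_n),
      `|phi (x + h) i' 0 - phi x i' 0 - dotl (fun j => partial j (fun y => phi y i' 0) x) h| <= cc * `|h|.
    exact: (eps_differentiable (smooth_diff (sphi i') Ux) c0).
  have := filter_forall (nbhs_filter (0 : 'cV[R]_n)) E1.
  move=> /nbhs_ballP[d /= d0 dP].
  have N1 : \forall l \near (0 : 'cV[R]_n), (phi @` W) (phi x + l).
    have : nbhs (phi x) (phi @` W) by apply: open_nbhs_nbhs; split => //; exists x.
    move=> /nbhs_ballP[d' /= d'0 d'P]; apply/nbhs_ballP; exists d' => //= l.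
    by rewrite ballE subr0 => ld; apply: d'P; rewrite ball_addE.
  have d2 : 0 < d / (2 * b + 1) by rewrite divr_gt0 // ltr_wpDl // mulr_ge0.
  have N2 : \forall l \near (0 : 'cV[R]_n), `|l| < d / (2 * b + 1) by exact: nbhs0_lt.
  apply: filterS2 N1 N2 => l Wl ld.
  have [Wp pl] := Hpsi _ Wl.
  rewrite psiK //; set h := psi (phi x + l) - x.
  have xh : psi (phi x + l) = x + h by rewrite /h [x + _]addrC subrK.
  have hl : `|h| <= 2 * b * `|l|.
    by have := Lip _ _ Wp Wx; rewrite pl -/h [phi x + l]addrC addrK.
  have hd : ball 0 d h.
    rewrite ballE subr0; apply: (le_lt_trans hl).
    have : `|l| * (2 * b + 1) < d by rewrite -ltr_pdivlMr // ltr_wpDl // mulr_ge0.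
    have := normr_ge0 l; lra.
  clearbody h; have R1 := dP h hd.
  (* [o] is the first order remainder of [phi], and the increment of [psi] is the inverse Jacobian
     applied to [l - o]. *)
  pose o := l - J *m h.
  have ob : `|o| <= cc * `|h|.
    apply: norm_cV_le => [|i']; first by rewrite mulr_ge0 // ltW.
    have := R1 i'; rewrite -xh pl !mxE [phi x i' 0 + _]addrC addrK.
    suff -> : dotl (fun j => partial j (fun y => phi y i' 0) x) h = \sum_j J i' j * h j 0 by [].
    by apply: eq_bigr => j _; rewrite mxE mulrC.
  have -> : psi (phi x + l) i 0 - x i 0 - dotl (fun j => invmx J i j) l = - (invmx J *m o) i 0.
    rewrite /o mulmxBr mulKmx // xh !mxE.
    have -> : dotl (fun j => invmx J i j) l = \sum_j invmx J i j * l j 0.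
      by apply: eq_bigr => j _; rewrite mulrC.
    ring.
  rewrite normrN; apply: (le_trans (norm_coord _ _)); apply: (le_trans (Bb' _)).
  apply: (@le_trans _ _ (b' * (cc * (2 * b * `|l|)))).
    by apply: ler_wpM2l => //; apply: (le_trans ob); apply: ler_wpM2l => //; exact: ltW.
  have -> : b' * (cc * (2 * b * `|l|)) = b' * (2 * b) * cc * `|l| by ring.
  apply: ler_wpM2r => //.
  have : (b' * (2 * b) + 1) * cc = e.
    by rewrite /cc mulrC divfK // lt0r_neq0 // ltr_wpDl // !mulr_ge0.
  lra.
split => // [x /H[]//|x i Wx|x i j Wx]; first by have [] := main x i Wx.
by have [_] := main x i Wx; exact.
Qed.

End InverseFunction.

(** * Eigenvalues, traces and ranks *)

Section Spectrum.
Context {R : realType}.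
Local Notation F := R[i].

Lemma char_poly_split n (A : 'M[F]_n) : exists r : seq F,
  [/\ char_poly A = \prod_(z <- r) ('X - z%:P), size r = n &
      forall z, eigenvalue A z = (z \in r)].
Proof.
have [r E] := closed_field_poly_normal (char_poly A).
rewrite (monicP (char_poly_monic A)) scale1r in E; exists r; split => //.
  by apply/eqP; rewrite -eqSS -(size_char_poly A) E size_prod_XsubC.
by move=> z; rewrite eigenvalue_root_char E root_prod_XsubC.
Qed.

Lemma trace_split n (A : 'M[F]_n) (r : seq F) :
  char_poly A = \prod_(z <- r) ('X - z%:P) -> size r = n -> \tr A = \sum_(z <- r) z.
Proof.
case: n A => [|n] A E sr.
  by rewrite /mxtrace big_ord0 (size0nil sr) big_nil.
apply: oppr_inj; rewrite -(char_poly_trace _ (ltn0Sn n)) E -coefPn_prod_XsubC ?sr //.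
Qed.

Lemma eigenvalue_exp n (A : 'M[F]_n) z k : eigenvalue A z -> eigenvalue (A ^+ k) (z ^+ k).
Proof.
move=> /eigenvalueP[v vA v0]; apply/eigenvalueP; exists v => //.
elim: k => [|k IH]; first by rewrite !expr0 scale1r mulmx1.
by rewrite exprSr -[A ^+ k * A]/(A ^+ k *m A) mulmxA IH -scalemxAl vA scalerA exprSr.
Qed.

Lemma nilpotent_trace n (A : 'M[F]_n) k : A ^+ k = 0 -> \tr A = 0.
Proof.
move=> A0; have [r [E sr er]] := char_poly_split A.
rewrite (trace_split E sr) big_seq big1 // => z zr.
have := @eigenvalue_exp n A z k; rewrite er => /(_ zr) /eigenvalueP[v].
rewrite A0 mulmx0 => /esym /eqP; rewrite scaler_eq0 expf_eq0 => /orP[/andP[_ /eqP]//|->//].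
Qed.

Lemma two_roots (w1 w2 : F) (r : seq F) : w1 != w2 -> {subset r <= [:: w1; w2]} ->
  [/\ (count_mem w1 r + count_mem w2 r = size r)%N,
      \sum_(z <- r) z = w1 *+ count_mem w1 r + w2 *+ count_mem w2 r &
      \prod_(z <- r) ('X - z%:P) = ('X - w1%:P) ^+ count_mem w1 r * ('X - w2%:P) ^+ count_mem w2 r].
Proof.
move=> w12; elim: r => [|z r IH] sub; first by rewrite !big_nil addr0 !expr0 mulr1.
have [|h1 h2 h3] := IH; first by move=> y yr; apply: sub; rewrite inE yr orbT.
rewrite !big_cons /= h2 h3 -h1.
have := sub z; rewrite !inE eqxx => /(_ isT) /orP[] /eqP ->.
  by rewrite eqxx (negbTE w12) !add0n !add1n mulrS exprS addrA mulrA.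
rewrite eqxx eq_sym (negbTE w12) !add0n !add1n addnS mulrS exprS addrCA mulrCA.
by [].
Qed.

Lemma CH_two n (A : 'M[F]_n) (w1 w2 : F) m1 m2 :
  char_poly A = ('X - w1%:P) ^+ m1 * ('X - w2%:P) ^+ m2 ->
  (A - w1%:M) ^+ m1 *m (A - w2%:M) ^+ m2 = 0.
Proof.
case: n A => [|n] A E; first by apply/matrixP => -[].
have := Cayley_Hamilton A; rewrite E rmorphM /= !rmorphXn /= !rmorphB /= !horner_mx_X !horner_mx_C.
by [].
Qed.

(** Sylvester's inequality: each further factor [N] loses at most one dimension. *)
Lemma rank_exp_ge n (N : 'M[F]_n) k : \rank N = n.-1 -> (n <= \rank (N ^+ k) + k)%N.
Proof.
move=> rN; elim: k => [|k IH]; first by rewrite expr0 mxrank1 addn0.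
have := mxrank_mul_min (N ^+ k) N; rewrite rN exprSr -[N ^+ k * N]/(N ^+ k *m N).
move: (\rank (N ^+ k *m N)) => b; move: (\rank (N ^+ k)) IH => a IH H; lia.
Qed.

End Spectrum.

(** * Jordan forms, Segre characteristics and the two spectral cases *)

Section Jordan.
Context {R : realType}.
Local Notation F := R[i].

Lemma rank_jordan_block (z : F) k : (0 < k)%N -> \rank (jordan_block z k) = if z == 0 then k.-1 else k.
Proof.
case: k => // k _.
have dJ : \det (jordan_block z k.+1) = z ^+ k.+1.
  rewrite -det_tr det_trig.
    rewrite (eq_bigr (fun=> z)) ?prodr_const ?card_ord // => i _.
    by rewrite !mxE eqxx.
  apply/is_trig_mxP => i j ij; rewrite !mxE -val_eqE /= gtn_eqF //.
  by rewrite gtn_eqF // ltnS ltnW.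
case: eqP => [z0|/eqP z0]; last first.
  by apply: mxrank_unit; rewrite unitmxE unitfE dJ expf_neq0.
apply/eqP; rewrite /= eqn_leq; apply/andP; split.
  rewrite -ltnS ltn_neqAle rank_leq_row andbT; apply/negP => rk.
  have : jordan_block z k.+1 \in unitmx by rewrite -row_free_unit.
  by rewrite unitmxE unitfE dJ z0 expr0n /= eqxx.
(* [X] and [Y] keep the first [k] rows and the last [k] columns, where the nilpotent block is the
   identity. *)
pose X : 'M[F]_(k, k.+1) := \matrix_(i, j) (i == j :> nat)%:R.
pose Y : 'M[F]_(k.+1, k) := \matrix_(i, j) (i == j.+1 :> nat)%:R.
have E : X *m jordan_block z k.+1 *m Y = 1%:M.
  apply/matrixP => i j; rewrite !mxE (bigD1 (lift ord0 j)) //= big1 ?addr0 => [|l lj].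
    rewrite !mxE /= /bump /= add1n eqxx mulr1.
    rewrite (bigD1 (widen_ord (leqnSn k) i)) //= big1 ?addr0 => [|l li].
      rewrite !mxE /= eqxx mul1r -val_eqE /= /bump /= add1n eqSS.
      rewrite z0; case: (eqVneq i j) => [->|ij]; first by rewrite ltn_eqF // eqxx.
      by case: eqP => // _; case: eqP => // e; case/eqP: ij; exact: val_inj.
    rewrite !mxE; case: eqP => [il|]; rewrite ?mul0r //.
    by case/eqP: li; apply: val_inj; rewrite /= il.
  rewrite [Y _ _]mxE; case: eqP => [lE|]; rewrite ?mulr0 //.
  by case/eqP: lj; apply: val_inj; rewrite /= /bump lE add1n.
rewrite -[X in (X <= _)%N](mxrank1 F k) -E.
exact: leq_trans (mxrankM_maxl _ _) (mxrankM_maxr _ _).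
Qed.

(** After subtraction of [w], each block belonging to [w] lacks exactly one dimension of rank and
    the other blocks are invertible. *)
Lemma jordan_rank n (A : 'M[R]_n) m (z : 'I_m -> F) k (w : F) : jordan_form A z k ->
  (\rank (complexify A - w%:M)%R + #|[pred i | z i == w]| = n)%N.
Proof.
move=> [k0 [P [Q [PQ QP AE]]]].
have nk : (\sum_(i < m) k i = n)%N.
  by apply/eqP; rewrite eqn_leq (mulmx1_min QP) (mulmx1_min PQ).
set D := \mxdiag_(i < m) _ in AE.
have E1 : complexify A - w%:M = P *m (D - w%:M) *m Q.
  by rewrite mulmxBr mulmxBl -AE mul_mx_scalar -scalemxAl PQ scalemx1.
have E2 : D - w%:M = Q *m (complexify A - w%:M) *m P.
  by rewrite E1 !mulmxA QP mul1mx -mulmxA QP mulmx1.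
have -> : \rank (complexify A - w%:M) = \rank (D - w%:M).
  apply/eqP; rewrite eqn_leq {1}E1 E2.
  by rewrite (leq_trans (mxrankM_maxl _ _) (mxrankM_maxr _ _))
     (leq_trans (mxrankM_maxl _ _) (mxrankM_maxr _ _)).
have -> : D - w%:M = \mxdiag_(i < m) jordan_block (z i - w) (k i).
  rewrite -mxdiagZ -mxdiagB; apply: eq_mxdiag => i; apply/matrixP => a b.
  by rewrite !mxE; case: eqP => _; rewrite ?mulr1n // mulr0n subr0.
rewrite rank_mxdiag -[RHS]nk -sum1_card [X in (_ + X)%N]big_mkcond -big_split /=.
apply: eq_bigr => i _; rewrite rank_jordan_block // subr_eq0.
by rewrite inE /=; case: ifP => _; rewrite ?addn0 // addn1 prednK.
Qed.

Lemma eigenvalue_rank n (A : 'M[F]_n) w : eigenvalue A w = (\rank (A - w%:M)%R < n)%N.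
Proof.
rewrite /eigenvalue /eigenspace -mxrank_eq0 mxrank_ker subn_eq0 -ltnNge.
by [].
Qed.

Lemma jordan_eigenvalue n (A : 'M[R]_n) m (z : 'I_m -> F) k w : jordan_form A z k ->
  eigenvalue (complexify A) w = (w \in codom z).
Proof.
move=> J; rewrite eigenvalue_rank -[X in (_ < X)%N](jordan_rank w J) -[X in (X < _)%N]addn0 ltn_add2l.
apply/card_gt0P/codomP => [[j]|[j ->]]; first by rewrite inE => /eqP <-; exists j.
by exists j; rewrite inE.
Qed.

Lemma gl_regular_rank n (A : 'M[R]_n) w : gl_regular A -> eigenvalue (complexify A) w ->
  \rank (complexify A - w%:M) = n.-1.
Proof.
move=> [m [z [k [J H]]]] ew; have := jordan_rank w J; rewrite (H w ew).
by rewrite addn1; move: (\rank _) => a; lia.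
Qed.

(** The length of the Segre characteristic counts the distinct eigenvalues; so algebraic genericity
    keeps their number constant near the point. *)
Lemma segre_spectrum n (A : 'M[R]_n) sigma : has_segre A sigma ->
  exists s : seq F, [/\ uniq s, size s = size sigma & has_spectrum A s].
Proof.
move=> [m [z [k [J /perm_size]]]]; rewrite /segre_list size_map => sz.
exists (undup (codom z)); split => //; first exact: undup_uniq.
by move=> w; rewrite (jordan_eigenvalue w J) mem_undup.
Qed.

Lemma spectrum_size n (A : 'M[R]_n) (s t : seq F) : has_spectrum A s -> has_spectrum A t ->
  uniq s -> uniq t -> size s = size t.
Proof.
move=> hs ht us ut; apply/eqP; rewrite eq_sym -(uniq_size_uniq us) // => w.
by rewrite -hs ht.
Qed.

Lemma eigenvalue_conj n (A : 'M[R]_n) (w : F) :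
  eigenvalue (complexify A) w -> eigenvalue (complexify A) (conjc w).
Proof.
rewrite !eigenvalue_root_char => rw.
have E : map_poly conjc (char_poly (complexify A)) = char_poly (complexify A).
  rewrite -!map_char_poly -map_poly_comp; apply: eq_map_poly => x /=.
  by rewrite /= oppr0.
by rewrite -E fmorph_root.
Qed.

(** By Cayley-Hamilton, Q = (A - w1)(A - w2) is nilpotent, and so is Q A since the factors commute.
    Their traces vanish, which gives the traces of A^2 and A^3. *)
Lemma two_eigenvalues n (A : 'M[R]_n) (w1 w2 : F) : w1 != w2 ->
  has_spectrum A [:: w1; w2] -> exists m1 m2 : nat,
  [/\ (0 < m1)%N, (0 < m2)%N & (m1 + m2 = n)%N] /\
  [/\ (\tr A)%:C%C = w1 *+ m1 + w2 *+ m2,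
      (\tr (A *m A))%:C%C = w1 ^+ 2 *+ m1 + w2 ^+ 2 *+ m2,
      (\tr (A *m A *m A))%:C%C = (w1 + w2) * (\tr (A *m A))%:C%C - w1 * w2 * (\tr A)%:C%C &
      (complexify A - w1%:M) ^+ m1 *m (complexify A - w2%:M) ^+ m2 = 0].
Proof.
move=> w12 sp; set Ac := complexify A.
have [r [E sr er]] := char_poly_split Ac.
have sub : {subset r <= [:: w1; w2]} by move=> z; rewrite -er sp.
have [h1 h2 h3] := two_roots w12 sub.
have c1 : (0 < count_mem w1 r)%N.
  by rewrite -has_count has_pred1 -er sp !inE eqxx.
have c2 : (0 < count_mem w2 r)%N.
  by rewrite -has_count has_pred1 -er sp !inE eqxx orbT.
exists (count_mem w1 r), (count_mem w2 r); split; first by rewrite h1.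
rewrite h3 in E; have CH := CH_two E.
have Tc : \tr Ac = w1 *+ count_mem w1 r + w2 *+ count_mem w2 r.
  by rewrite -h2; apply: trace_split => //; rewrite h3.
have trC (B : 'M[R]_n) : (\tr B)%:C%C = \tr (complexify B).
  by rewrite trace_map_mx.
suff [T2 T3] : \tr (Ac *m Ac) = w1 ^+ 2 *+ count_mem w1 r + w2 ^+ 2 *+ count_mem w2 r /\
    \tr (Ac *m Ac *m Ac) = (w1 + w2) * \tr (Ac *m Ac) - w1 * w2 * \tr Ac.
  by split => //; rewrite !trC /complexify ?map_mxM -/(complexify A).
pose Q := (Ac - w1%:M) * (Ac - w2%:M).
have com : GRing.comm (Ac - w1%:M) (Ac - w2%:M).
  by apply: commrB; [apply: commr_sym; apply: commrB => //|];
     rewrite /GRing.comm /GRing.mul /= ?scalar_mxC // mulmxBl mulmxBr scalar_mxC.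
set m1 := count_mem w1 r in h1 CH Tc *; set m2 := count_mem w2 r in h1 CH Tc *.
have Qn : Q ^+ (m2 + m1) = 0.
  rewrite /Q exprMn_comm // !exprD -mulrA [_ ^+ m1 * _]mulrA.
  by rewrite -[(Ac - w1%:M) ^+ m1 * _]/(_ *m _) CH mul0r mulr0.
have comA : GRing.comm Q Ac.
  have c1' w : GRing.comm (Ac - w%:M) Ac.
    by rewrite /GRing.comm /GRing.mul /= mulmxBl mulmxBr scalar_mxC.
  by apply: commr_sym; apply: commrM; apply: commr_sym.
have QAn : (Q * Ac) ^+ (m2 + m1) = 0 by rewrite exprMn_comm // Qn mul0r.
have QE : Q = Ac *m Ac - w2 *: Ac - (w1 *: Ac - (w1 * w2)%:M).
  by rewrite /Q /GRing.mul /= mulmxBl !mulmxBr -scalar_mxM !mul_scalar_mx mul_mx_scalar.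
have T3 : \tr (Ac *m Ac *m Ac) = (w1 + w2) * \tr (Ac *m Ac) - w1 * w2 * \tr Ac.
  have := nilpotent_trace QAn; rewrite QE -[_ * Ac]/(_ *m Ac) !mulmxBl -!scalemxAl mul_scalar_mx.
  rewrite !linearB /= !mxtraceZ => H.
  by apply/eqP; rewrite -subr_eq0 -[X in _ == X]H; apply/eqP; ring.
split => //.
have := nilpotent_trace Qn; rewrite QE !linearB /= !mxtraceZ mxtrace_scalar Tc.
move=> H; have {H} -> : \tr (Ac *m Ac) =
    (w1 + w2) * (w1 *+ m1 + w2 *+ m2) - (w1 * w2) *+ n.
  by apply/eqP; rewrite -subr_eq0 -[X in _ == X]H; apply/eqP; ring.
have -> : w1 * w2 *+ n = w1 * w2 *+ (m1 + m2)%N by rewrite h1 sr.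
ring.
Qed.

Lemma one_eigenvalue n (A : 'M[R]_n) (w : F) :
  gl_regular A -> has_spectrum A [:: w] ->
  [/\ (0 < n)%N, w = (\tr A / n%:R)%:C%C, \rank (complexify A - w%:M) = n.-1,
    (complexify A - w%:M) ^+ n = 0 & \tr (A *m A) = n%:R * (\tr A / n%:R) ^+ 2].
Proof.
move=> gl sp; set Ac := complexify A.
have ew : eigenvalue Ac w by rewrite sp inE eqxx.
have n0 : (0 < n)%N by move: ew; rewrite eigenvalue_rank; exact: leq_ltn_trans.
have [r [E sr er]] := char_poly_split Ac.
have rw z : z \in r -> z = w by rewrite -er sp inE => /eqP.
have rE : r = nseq n w.
  by rewrite -sr; elim: (r) rw => // z s IH H /=; rewrite (H z) ?inE ?eqxx // -IH // => y ys;
     apply: H; rewrite inE ys orbT.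
have nC : (n%:R : F) != 0 by rewrite pnatr_eq0 -lt0n.
have nR : (n%:R : R) != 0 by rewrite pnatr_eq0 -lt0n.
have trC (B : 'M[R]_n) : (\tr B)%:C%C = \tr (complexify B) by rewrite trace_map_mx.
have Tc : \tr Ac = w *+ n.
  by rewrite (trace_split E sr) rE big_nseq iter_addr addr0.
have wE : w = (\tr A / n%:R)%:C%C.
  by rewrite rmorphM fmorphV rmorph_nat /= trC Tc -[w *+ n]mulr_natr mulfK.
have CH : (Ac - w%:M) ^+ n = 0.
  have := @CH_two _ n Ac w w n 0; rewrite expr0 mulmx1; apply.
  by rewrite E rE big_nseq iter_mulr_1 mulr1.
split => //; first exact: gl_regular_rank.
have N2 : ((Ac - w%:M) *m (Ac - w%:M)) ^+ n = 0.
  by rewrite -[_ *m _]/((Ac - w%:M) * (Ac - w%:M)) exprMn_comm // CH mul0r.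
have := nilpotent_trace N2; rewrite mulmxBl !mulmxBr.
rewrite -scalar_mxM !mul_scalar_mx mul_mx_scalar !linearB /= !linearZ /= mxtrace_scalar Tc.
rewrite /GRing.scale /= => H; apply: (@complexI R); rewrite trC /complexify map_mxM -/(complexify A) -/Ac.
rewrite rmorphM rmorph_nat rmorphXn /= -wE.
by apply/eqP; rewrite -subr_eq0 -[X in _ == X]H; apply/eqP; ring.
Qed.

(** The trace is real, which forces equal multiplicities s. For the rank, the s-th powers of A - w
    and A - conj w have product zero, and each has rank at least n - s = s; Sylvester's inequality
    leaves exactly s. *)
Lemma conjugate_pair n (A : 'M[R]_n) (a0 b0 : R) : b0 != 0 ->
  has_spectrum A [:: (a0 +i* b0)%C; (a0 -i* b0)%C] ->
  exists2 s : nat, (0 < s)%N & [/\ n = (2 * s)%N, \tr A = n%:R * a0,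
    \tr (A *m A) = n%:R * (a0 ^+ 2 - b0 ^+ 2),
    \tr (A *m A *m A) = 2 * a0 * \tr (A *m A) - (a0 ^+ 2 + b0 ^+ 2) * \tr A &
    \rank (complexify A - (a0 +i* b0)%C%:M) = n.-1 ->
    \rank ((complexify A - (a0 +i* b0)%C%:M) ^+ s) = s].
Proof.
move=> b00 sp.
have w12 : (a0 +i* b0)%C != (a0 -i* b0)%C.
  by rewrite eq_complex /= eqxx /=; apply: contra b00 => /eqP; lra.
have [m1 [m2 [[c1 c2 mn] [T1 T2 T3 CH]]]] := two_eigenvalues w12 sp.
have ReMn (x : F) k : complex.Re (x *+ k) = complex.Re x *+ k.
  by elim: k => [|k IH]; rewrite ?mulr0n // !mulrS cReD IH.
have ImMn (x : F) k : complex.Im (x *+ k) = complex.Im x *+ k.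
  by elim: k => [|k IH]; rewrite ?mulr0n // !mulrS cImD IH.
have m12 : m1 = m2.
  have := congr1 (@complex.Im R) T1; rewrite cImD !ImMn /= => H.
  have : b0 * (m1%:R - m2%:R) = 0 by lra.
  by move=> /eqP; rewrite mulf_eq0 (negbTE b00) /= subr_eq0 eqr_nat => /eqP.
subst m2; exists m1 => //; have nE : n = (2 * m1)%N by rewrite -mn mul2n addnn.
have nm : (n%:R : R) = m1%:R + m1%:R by rewrite -natrD mn.
split => //.
- have := congr1 (@complex.Re R) T1; rewrite cReD !ReMn /= nm => ->; ring.
- have := congr1 (@complex.Re R) T2; rewrite cReD !ReMn /= nm => ->; ring.
- have := congr1 (@complex.Re R) T3; rewrite [complex.Re _]/= cReD cReN !cReM !cImM cReD cImD /= => ->; ring.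
move=> r1; set N1 := complexify A - _ in r1 CH *; set N2 := complexify A - _ in CH.
have r2 : \rank N2 = n.-1.
  have <- : map_mx (@conjc R) N1 = N2.
    apply/matrixP => i j; rewrite mxE /N1 /N2 !mxE.
    by rewrite rmorphB rmorphMn /= oppr0.
  by rewrite mxrank_map.
have g1 := rank_exp_ge m1 r1; have g2 := rank_exp_ge m1 r2.
have := mxrank_mul_min (N1 ^+ m1) (N2 ^+ m1); rewrite CH mxrank0.
by move: (\rank _) (\rank _) g1 g2 => a b; lia.
Qed.

(** If both eigenvalues were real, Cauchy-Schwarz would give (tr A)^2 <= n tr(A^2). If not,
    conjugation exchanges them. The strict inequality is an open condition, hence persists near the
    point. *)
Lemma spectrum_two_real n (A : 'M[R]_n) (w1 w2 : F) : w1 != w2 ->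
  has_spectrum A [:: w1; w2] -> n%:R * \tr (A *m A) < (\tr A) ^+ 2 ->
  exists a b : R, [/\ b != 0, w1 = (a +i* b)%C & w2 = (a -i* b)%C].
Proof.
move=> w12 sp dis.
have [m1 [m2 [[c1 c2 mn] [T1 T2 _ _]]]] := two_eigenvalues w12 sp.
case: w1 w2 w12 sp T1 T2 => [x1 y1] [x2 y2] w12 sp T1 T2.
have c1' : conjc (x1 +i* y1)%C \in [:: (x1 +i* y1)%C; (x2 +i* y2)%C].
  by rewrite -sp; apply: eigenvalue_conj; rewrite sp inE eqxx.
have c2' : conjc (x2 +i* y2)%C \in [:: (x1 +i* y1)%C; (x2 +i* y2)%C].
  by rewrite -sp; apply: eigenvalue_conj; rewrite sp !inE eqxx orbT.
have [y10|y10] := eqVneq y1 0; last first.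
  exists x1, y1; split => //; apply/eqP; move: c1'; rewrite !inE eq_complex /= eqxx /=.
  case/orP; first by move=> /eqP h; case/eqP: y10; lra.
  by rewrite eq_sym.
exfalso; subst y1.
have y20 : y2 = 0.
  move: c2'; rewrite !inE => /orP[] /eqP H; have /= h2 := congr1 (@complex.Im R) H; last by lra.
  by have /= h1 := congr1 (@complex.Re R) H; lra.
subst y2.
have E (x : R) : (x +i* 0)%C = x%:C%C by [].
rewrite !E -!rmorphXn -!rmorphMn -!rmorphD in T1 T2.
move: dis; rewrite (complexI T1) (complexI T2) -mn natrD.
have p : 0 <= (m1%:R * m2%:R : R) by rewrite mulr_ge0.
by have := mulr_ge0 p (sqr_ge0 (x1 - x2)); nra.
Qed.

End Jordan.

(** * Directional derivatives and the Nijenhuis identity *)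

Section Directional.
Context {R : realType} {n : nat}.
Local Notation C := R[i].
Implicit Types (f g : 'cV[R]_n -> C) (u v : 'cV[C]_n) (x : 'cV[R]_n).

Definition grad f x : 'rV[C]_n := \row_j cpartial j f x.

(** The differential extended C-linearly to complex directions, on which the complexified operator
    acts. *)
Definition cdir f v x : C := (grad f x *m v) 0 0.

Definition dmx p q (M : 'cV[R]_n -> 'M[C]_(p, q)) v x : 'M[C]_(p, q) :=
  \matrix_(i, j) cdir (fun y => M y i j) v x.

Definition mxdiff p q (M : 'cV[R]_n -> 'M[C]_(p, q)) x :=
  forall i j, cdiff (fun y => M y i j) x.

Lemma cdirE f v x : cdir f v x = \sum_j cpartial j f x * v j 0.
Proof. by rewrite /cdir mxE; apply: eq_bigr => j _; rewrite mxE. Qed.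

Lemma cdir_lin f a u v x : cdir f (a *: u + v) x = a * cdir f u x + cdir f v x.
Proof. by rewrite /cdir mulmxDr -scalemxAr !mxE. Qed.

Lemma grad_mulE f v x : grad f x *m v = (cdir f v x)%:M.
Proof. by rewrite [LHS]mx11_scalar. Qed.

Lemma dmx_lin p q (M : 'cV[R]_n -> 'M[C]_(p, q)) a u v x :
  dmx M (a *: u + v) x = a *: dmx M u x + dmx M v x.
Proof. by apply/matrixP => i j; rewrite !mxE cdir_lin. Qed.

Lemma cdir_cst (a : C) v x : cdir (fun=> a) v x = 0.
Proof. by rewrite cdirE big1 // => j _; rewrite cpartial_cst mul0r. Qed.

Lemma cdirD f g v x : cdiff f x -> cdiff g x ->
  cdir (fun y => f y + g y) v x = cdir f v x + cdir g v x.
Proof.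
by move=> df dg; rewrite !cdirE -big_split; apply: eq_bigr => j _; rewrite cpartialD // mulrDl.
Qed.

Lemma cdirN f v x : cdiff f x -> cdir (fun y => - f y) v x = - cdir f v x.
Proof.
by move=> df; rewrite !cdirE -sumrN; apply: eq_bigr => j _; rewrite cpartialN // mulNr.
Qed.

Lemma cdirM f g v x : cdiff f x -> cdiff g x ->
  cdir (fun y => f y * g y) v x = cdir f v x * g x + f x * cdir g v x.
Proof.
move=> df dg; rewrite !cdirE mulr_suml mulr_sumr -big_split; apply: eq_bigr => j _.
by rewrite cpartialM //=; ring.
Qed.

Lemma cdir_exp f v x : cdiff f x -> cdir (fun y => cexp (f y)) v x = cexp (f x) * cdir f v x.
Proof.
by move=> df; rewrite !cdirE mulr_sumr; apply: eq_bigr => j _; rewrite cpartial_exp // mulrA.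
Qed.

Lemma cdir_sum (I : Type) (r : seq I) (P : pred I) (G : I -> 'cV[R]_n -> C) v x :
  (forall i, cdiff (G i) x) ->
  cdir (fun y => \sum_(i <- r | P i) G i y) v x = \sum_(i <- r | P i) cdir (G i) v x.
Proof.
move=> dG; rewrite cdirE; under eq_bigr do rewrite cpartial_sum // mulr_suml.
by rewrite exchange_big; apply: eq_bigr => i _; rewrite cdirE.
Qed.

Lemma grad_on U f g x : open U -> U x -> (forall y, U y -> f y = g y) -> grad f x = grad g x.
Proof. by move=> oU Ux fg; apply/rowP => j; rewrite !mxE; exact: (@cpartial_on _ _ U). Qed.

Lemma cdir_on U f g v x : open U -> U x -> (forall y, U y -> f y = g y) ->
  cdir f v x = cdir g v x.
Proof. by move=> oU Ux fg; rewrite /cdir (@grad_on U f g). Qed.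

Lemma mxdiffM p q k (M : 'cV[R]_n -> 'M[C]_(p, q)) (P : 'cV[R]_n -> 'M[C]_(q, k)) x :
  mxdiff M x -> mxdiff P x -> mxdiff (fun y => M y *m P y) x.
Proof.
move=> dM dP i j; have -> : (fun y => (M y *m P y) i j) = fun y => \sum_l M y i l * P y l j.
  by apply: funext => y; rewrite mxE.
by apply: cdiff_sum => l; exact: cdiffM.
Qed.

Lemma dmxM p q k (M : 'cV[R]_n -> 'M[C]_(p, q)) (P : 'cV[R]_n -> 'M[C]_(q, k)) v x :
  mxdiff M x -> mxdiff P x ->
  dmx (fun y => M y *m P y) v x = dmx M v x *m P x + M x *m dmx P v x.
Proof.
move=> dM dP; apply/matrixP => i j; rewrite !mxE.
have -> : (fun y => (M y *m P y) i j) = fun y => \sum_l M y i l * P y l j.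
  by apply: funext => y; rewrite mxE.
rewrite cdir_sum => [|l]; last exact: cdiffM.
by rewrite -big_split; apply: eq_bigr => l _; rewrite cdirM // !mxE.
Qed.

Lemma dmx_on U p q (M P : 'cV[R]_n -> 'M[C]_(p, q)) v x : open U -> U x ->
  (forall y, U y -> M y = P y) -> dmx M v x = dmx P v x.
Proof.
move=> oU Ux MP; apply/matrixP => i j; rewrite !mxE.
by apply: (@cdir_on U) => // y Uy; rewrite MP.
Qed.

Lemma cdir_tr p (M : 'cV[R]_n -> 'M[C]_p) v x : mxdiff M x ->
  cdir (fun y => \tr (M y)) v x = \tr (dmx M v x).
Proof.
move=> dM; rewrite /mxtrace cdir_sum => [|i]; last exact: dM.
by apply: eq_bigr => i _; rewrite mxE.
Qed.

(* the matrix of [v |-> D_v M u] *)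
Definition dmxr p (M : 'cV[R]_n -> 'M[C]_(p, n)) u x : 'M[C]_(p, n) :=
  \matrix_(i, j) (dmx M (delta_mx j 0) x *m u) i 0.

Lemma dmx_sum p q (M : 'cV[R]_n -> 'M[C]_(p, q)) v x :
  dmx M v x = \sum_j v j 0 *: dmx M (delta_mx j 0) x.
Proof.
have E : v = \sum_j v j 0 *: delta_mx j 0.
  by rewrite [LHS]matrix_sum_delta; apply: eq_bigr => i _; rewrite big_ord1.
rewrite {1}E; apply: (big_ind2 (fun a b => dmx M a x = b)) => [|a b c d <- <-|j _].
- by apply/matrixP => i j; rewrite !mxE cdirE big1 // => l _; rewrite mxE mulr0.
- by rewrite -[a]scale1r dmx_lin !scale1r.
by rewrite -[_ *: delta_mx _ _ in LHS]addr0 dmx_lin; apply/matrixP => i l;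
   rewrite !mxE [X in _ + X]cdirE [X in _ + X]big1 ?addr0 // => m _; rewrite mxE mulr0.
Qed.

Lemma dmxrE p (M : 'cV[R]_n -> 'M[C]_(p, n)) u v x : dmxr M u x *m v = dmx M v x *m u.
Proof.
apply/colP => i; rewrite dmx_sum mulmx_suml summxE mxE; apply: eq_bigr => j _.
by rewrite -scalemxAl !mxE mulrC.
Qed.

End Directional.

Lemma cdirEgrad {R : realType} {n : nat} (f : 'cV[R]_n -> R[i]) v x :
  cdir f v x = (grad f x *m v) 0 0.
Proof. by []. Qed.

Lemma dmxE {R : realType} {n p q : nat} (M : 'cV[R]_n -> 'M[R[i]]_(p, q)) v x i j :
  dmx M v x i j = cdir (fun y => M y i j) v x.
Proof. by rewrite mxE. Qed.

(* the folded forms keep unification away from the underlying sums *)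
Opaque cdir dmx.

(** * Trace identities from the torsion and the unity *)

Section NijenhuisTraces.
Context {R : realType} {n : nat}.
Local Notation C := R[i].
Implicit Types (A N : 'cV[R]_n -> 'M[C]_n) (e : 'cV[R]_n -> 'cV[C]_n) (mu : 'cV[R]_n -> C).

(** The vanishing torsion on constant fields, for which the brackets reduce to derivatives of
    [A]. *)
Definition nijenhuis_at A x := forall u v : 'cV[C]_n,
  dmx A (A x *m u) x *m v - dmx A (A x *m v) x *m u =
  A x *m (dmx A u x *m v - dmx A v x *m u).

Definition unity_at e A x := forall v : 'cV[C]_n,
  dmx A (e x) x *m v - dmx e (A x *m v) x + A x *m dmx e v x = v.

Lemma mulmx_ext p q (B D : 'M[C]_(p, q)) : (forall v : 'cV[C]_q, B *m v = D *m v) -> B = D.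
Proof.
move=> H; apply/matrixP => i j; have := congr1 (fun M : 'cV[C]_p => M i 0) (H (delta_mx j 0)).
by rewrite -!colE !mxE.
Qed.

(** Read as a function of its second argument, the torsion identity becomes one between matrices:
    D_(Au) A is A D_u A plus a commutator with A. Traces against powers of A lose the commutator,
    and this yields the relations between the differentials of tr A, tr A^2 and tr A^3. *)
Lemma nijenhuis_mx A x u : nijenhuis_at A x ->
  dmx A (A x *m u) x = dmxr A u x *m A x + A x *m dmx A u x - A x *m dmxr A u x.
Proof.
move=> H; apply: mulmx_ext => v; rewrite mulmxBl mulmxDl -!mulmxA !dmxrE -addrA -mulmxBr -H.
by rewrite addrC subrK.
Qed.

Lemma nijenhuis_tr1 A x u : nijenhuis_at A x -> mxdiff A x ->
  cdir (fun y => \tr (A y)) (A x *m u) x = \tr (A x *m dmx A u x).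
Proof.
move=> H dA; rewrite cdir_tr // nijenhuis_mx // linearB linearD /=.
by rewrite [X in X + _ - _]mxtrace_mulC addrC addrA addNr add0r.
Qed.

Lemma nijenhuis_tr2 A x u : nijenhuis_at A x ->
  \tr (A x *m dmx A (A x *m u) x) = \tr (A x *m A x *m dmx A u x).
Proof.
move=> H; rewrite nijenhuis_mx // mulmxBr mulmxDr linearB linearD /=.
rewrite mulmxA [X in X + _ - _]mxtrace_mulC addrC addrA !mulmxA addNr add0r.
by [].
Qed.

Lemma cdir_tr2 A x u : mxdiff A x ->
  cdir (fun y => \tr (A y *m A y)) u x = 2%:R * \tr (A x *m dmx A u x).
Proof.
move=> dA; rewrite cdir_tr ?dmxM //; last exact: mxdiffM.
by rewrite linearD /= mxtrace_mulC mulr_natl mulr2n.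
Qed.

Lemma cdir_tr3 A x u : mxdiff A x ->
  cdir (fun y => \tr (A y *m A y *m A y)) u x = 3%:R * \tr (A x *m A x *m dmx A u x).
Proof.
move=> dA; have dAA : mxdiff (fun y => A y *m A y) x by exact: mxdiffM.
rewrite cdir_tr ?dmxM //; last exact: mxdiffM.
set D := dmx A u x; rewrite mulmxDl 2!linearD /=.
have -> : \tr (D *m A x *m A x) = \tr (A x *m A x *m D) by rewrite -mulmxA mxtrace_mulC.
have -> : \tr (A x *m D *m A x) = \tr (A x *m A x *m D) by rewrite mxtrace_mulC mulmxA.
ring.
Qed.

Lemma nijenhuis_d1 A x u : nijenhuis_at A x -> mxdiff A x ->
  2%:R * cdir (fun y => \tr (A y)) (A x *m u) x = cdir (fun y => \tr (A y *m A y)) u x.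
Proof. by move=> H dA; rewrite nijenhuis_tr1 // cdir_tr2. Qed.

Lemma nijenhuis_d2 A x u : nijenhuis_at A x -> mxdiff A x ->
  3%:R * cdir (fun y => \tr (A y *m A y)) (A x *m u) x =
  2%:R * cdir (fun y => \tr (A y *m A y *m A y)) u x.
Proof. by move=> H dA; rewrite cdir_tr2 // nijenhuis_tr2 // cdir_tr3 //; ring. Qed.

Definition dcv e x : 'M[C]_n := \matrix_(i, j) dmx e (delta_mx j 0) x i 0.

Lemma dcvE e x v : dcv e x *m v = dmx e v x.
Proof.
apply/colP => i; rewrite [in RHS]dmx_sum summxE mxE; apply: eq_bigr => j _.
by rewrite !mxE mulrC.
Qed.

Lemma unity_mx e A x : unity_at e A x -> dmx A (e x) x - dcv e x *m A x + A x *m dcv e x = 1%:M.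
Proof.
by move=> H; apply: mulmx_ext => v; rewrite mulmxDl mulmxBl -!mulmxA !dcvE H mul1mx.
Qed.

(** The Lie derivative differs from D_e A by a commutator of A with the Jacobian of e, which has no
    trace. *)
Lemma unity_tr1 e A x : unity_at e A x -> mxdiff A x ->
  cdir (fun y => \tr (A y)) (e x) x = n%:R.
Proof.
move=> H dA; rewrite cdir_tr // -(mxtrace1 C n) -(unity_mx H) linearD linearB /=.
by rewrite [X in _ - X]mxtrace_mulC subrK.
Qed.

Lemma unity_tr2 e A x : unity_at e A x -> mxdiff A x ->
  cdir (fun y => \tr (A y *m A y)) (e x) x = 2%:R * \tr (A x).
Proof.
move=> H dA; rewrite cdir_tr2 // -[in RHS](mulmx1 (A x)) -(unity_mx H).
rewrite mulmxDr mulmxBr linearD linearB /= [in X in _ - X]mulmxA.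
by rewrite [X in _ - X]mxtrace_mulC mulmxA subrK.
Qed.

End NijenhuisTraces.

(** * Torsion and exterior derivatives after subtracting the eigenvalue *)

Section ColumnAlgebra.
Context {K : comNzRingType} {n : nat}.
Implicit Types (N D : 'M[K]_n) (p q u v : 'cV[K]_n) (t : 'rV[K]_n).

(** This identity and the next two are the linear algebra of [nijenhuis_shift], [unity_shift] and
    [om_transport], with all derivatives replaced by independent matrices and columns. *)
Lemma shift_alg N p q p1 q1 u v (m a b : K) :
  m *: (p + a *: v) + p1 - (m *: (q + b *: u) + q1) =
    m *: (p + a *: v - (q + b *: u)) + N *m (p + a *: v - (q + b *: u)) ->
  p1 - q1 = N *m (p - q) + a *: (N *m v) - b *: (N *m u).
Proof.
rewrite [N *m (p - q)]mulmxBr mulmxBr !mulmxDr -!scalemxAr.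
move: (N *m p) (N *m q) (N *m u) (N *m v) => c1 c2 c3 c4 E.
apply/colP => i; have := congr1 (fun c : 'cV[K]_n => c i 0) E; rewrite !mxE => /eqP.
rewrite -subr_eq0 => /eqP E'.
by apply/eqP; rewrite -subr_eq0 -[X in _ == X]E'; apply/eqP; ring.
Qed.

Lemma unity_alg p q r s v (m : K) :
  p + v - (m *: r + q) + (m *: r + s) = v -> p = q - s.
Proof.
move=> E; apply/colP => i; have := congr1 (fun c : 'cV[K]_n => c i 0) E; rewrite !mxE => /eqP.
rewrite -subr_eq0 => /eqP E'.
by apply/eqP; rewrite -subr_eq0 -[X in _ == X]E'; apply/eqP; ring.
Qed.

Lemma om_alg N Du Dv D1 D2 t t1 t2 tu tv u v (a b : K) :
  D1 *m v - D2 *m u = N *m (Du *m v - Dv *m u) + a *: (N *m v) - b *: (N *m u) ->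
  (t1 *m (N *m v)) 0 0 - (t2 *m (N *m u)) 0 0 =
  (((tu *m N + t *m Du) *m (N *m v)) 0 0 - ((t2 *m N + t *m D2) *m u) 0 0)
  + (((t1 *m N + t *m D1) *m v) 0 0 - ((tv *m N + t *m Dv) *m (N *m u)) 0 0)
  - ((((tu *m N + t *m Du) *m N + t *m N *m Du) *m v) 0 0
     - (((tv *m N + t *m Dv) *m N + t *m N *m Dv) *m u) 0 0)
  - (a * (t *m N *m v) 0 0 - b * (t *m N *m u) 0 0).
Proof.
move=> T; have := congr1 (fun c : 'cV[K]_n => (t *m c) 0 0) T.
rewrite !(mulmxDl, mulmxDr, mulmxN) -!scalemxAr !mulmxA.
have mE (x y : 'M[K]_1) : (x + y) 0 0 = x 0 0 + y 0 0 by rewrite mxE.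
have nE (x : 'M[K]_1) : (- x) 0 0 = - x 0 0 by rewrite mxE.
have zE k (x : 'M[K]_1) : (k *: x) 0 0 = k * x 0 0 by rewrite mxE.
rewrite !(mE, nE, zE) => /eqP; rewrite -subr_eq0 => /eqP E.
apply/eqP; rewrite -subr_eq0 -[X in _ == X]oppr0 -[X in _ == - X]E; apply/eqP; ring.
Qed.

End ColumnAlgebra.

Section Omega.
Context {R : realType} {n : nat}.
Local Notation C := R[i].
Implicit Types (A N : 'cV[R]_n -> 'M[C]_n) (e : 'cV[R]_n -> 'cV[C]_n) (mu : 'cV[R]_n -> C)
  (al be th : 'cV[R]_n -> 'rV[C]_n) (u v w : 'cV[C]_n).

Definition shift_op A mu : 'cV[R]_n -> 'M[C]_n := fun y => A y - (mu y)%:M.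

Lemma dmx_shift A mu v x : mxdiff A x -> cdiff mu x ->
  dmx (shift_op A mu) v x = dmx A v x - (cdir mu v x)%:M.
Proof.
move=> dA dmu; apply/matrixP => i j; rewrite dmxE [in RHS]mxE dmxE !mxE.
have -> : (fun y => shift_op A mu y i j) = fun y => A y i j + (- (mu y)) *+ (i == j).
  by apply: funext => y; rewrite !mxE mulNrn.
have dmu' : cdiff (fun y => - mu y *+ (i == j)) x.
  by case: eqP => _; [exact: cdiffN|exact: cdiff_cst].
rewrite cdirD //.
by case: eqP => _; rewrite ?mulr1n ?mulr0n ?oppr0 ?cdirN ?cdir_cst.
Qed.

Lemma shift_opE A mu x p (w : 'M[C]_(n, p)) :
  A x *m w = mu x *: w + shift_op A mu x *m w.
Proof. by rewrite mulmxBl mul_scalar_mx addrC subrK. Qed.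

Lemma shift_opB A mu x : shift_op A mu x = A x - (mu x)%:M. Proof. by []. Qed.

Opaque shift_op.

(* vanishing of the torsion of N + mu, simplified by [grad mu x *m N x = 0] *)
Definition shifted_torsion N mu x := forall u v,
  dmx N (N x *m u) x *m v - dmx N (N x *m v) x *m u =
  N x *m (dmx N u x *m v - dmx N v x *m u)
    + cdir mu u x *: (N x *m v) - cdir mu v x *: (N x *m u).

Lemma nijenhuis_shift A mu x : mxdiff A x -> cdiff mu x -> nijenhuis_at A x ->
  grad mu x *m shift_op A mu x = 0 -> shifted_torsion (shift_op A mu) mu x.
Proof.
move=> dA dmu H g0 u v; apply: (@shift_alg _ _ _ _ _ _ _ _ _ (mu x)).
have mu0 w : cdir mu (shift_op A mu x *m w) x = 0 by rewrite cdirEgrad mulmxA g0 mul0mx mxE.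
have dE w1 w2 : dmx A w1 x *m w2 = dmx (shift_op A mu) w1 x *m w2 + cdir mu w1 x *: w2.
  by rewrite dmx_shift // mulmxBl mul_scalar_mx subrK.
have E w1 w2 : dmx A (A x *m w1) x *m w2 =
    mu x *: (dmx (shift_op A mu) w1 x *m w2 + cdir mu w1 x *: w2)
    + dmx (shift_op A mu) (shift_op A mu x *m w1) x *m w2.
  by rewrite [A x *m w1](shift_opE A mu) dmx_lin mulmxDl -scalemxAl !dE mu0 scale0r addr0.
by rewrite -!E H [LHS](shift_opE A mu) !dE.
Qed.

(* the exterior derivative of the 1-form th, evaluated on u and v *)
Definition om th u v x : C := (dmx th u x *m v) 0 0 - (dmx th v x *m u) 0 0.

(** Expresses d theta on im N through theta N and theta N^2 alone. When theta N is prescribed, the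
    right side is known before theta is. *)
Lemma om_transport th N mu x u v : mxdiff th x -> mxdiff N x -> shifted_torsion N mu x ->
  om th (N x *m u) (N x *m v) x =
    om (fun y => th y *m N y) u (N x *m v) x + om (fun y => th y *m N y) (N x *m u) v x
    - om (fun y => th y *m N y *m N y) u v x
    - (cdir mu u x * (th x *m N x *m v) 0 0 - cdir mu v x * (th x *m N x *m u) 0 0).
Proof.
move=> dth dN T.
have d2 : mxdiff (fun y => th y *m N y) x by exact: mxdiffM.
by rewrite /om !dmxM //; exact: om_alg (T u v).
Qed.

Lemma unity_shift e A mu x : mxdiff A x -> cdiff mu x -> unity_at e A x -> cdir mu (e x) x = 1 ->
  forall v, dmx (shift_op A mu) (e x) x *m v = dmx e (shift_op A mu x *m v) x
    - shift_op A mu x *m dmx e v x.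
Proof.
move=> dA dmu H m1 v; have := H v.
rewrite [A x *m v](shift_opE A mu) [A x *m dmx _ _ _](shift_opE A mu) dmx_lin.
have -> : dmx A (e x) x *m v = dmx (shift_op A mu) (e x) x *m v + v.
  by rewrite dmx_shift // m1 mulmxBl mul1mx subrK.
exact: unity_alg.
Qed.

End Omega.

(** * Chains of covectors *)

Section Frames.
Context {K : fieldType} {n : nat}.
Implicit Types (N B : 'M[K]_n) (v w rho al : 'rV[K]_n) (e : 'cV[K]_n) (d : nat -> 'rV[K]_n).

Lemma rank_mul_exp_ge m (B : 'M[K]_(m, n)) N k : \rank N = n.-1 ->
  (\rank B <= \rank (B *m N ^+ k) + k)%N.
Proof.
move=> rN; elim: k => [|k IH]; first by rewrite expr0 mulmx1 addn0.
have := mxrank_mul_min (B *m N ^+ k) N; rewrite rN -mulmxA -[_ ^+ k *m N]/(N ^+ k * N) -exprSr.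
have := rank_leq_col (B *m N ^+ k).
move: (\rank (B *m N ^+ k.+1)) => b; move: (\rank (B *m N ^+ k)) IH => a IH H1 H2; lia.
Qed.

Lemma rank_exp N s j : \rank N = n.-1 -> (\rank (N ^+ s) + s = n)%N -> (j <= s)%N ->
  (\rank (N ^+ j) + j = n)%N.
Proof.
move=> rN rs js.
have h1 := rank_mul_exp_ge (N ^+ j) (s - j) rN.
rewrite -[_ ^+ j *m _]/(N ^+ j * _) -exprD subnKC // in h1.
have := rank_mul_exp_ge 1%:M j rN; rewrite mul1mx mxrank1.
move: (\rank (N ^+ s)) (\rank (N ^+ j)) rs h1 => a b; lia.
Qed.

(** For j <= s the left kernel of N^j has dimension j. Multiplication by N maps the kernel of
    N^(i+1) into that of N^i and loses at most one dimension, so it is onto. This is the solvability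
    condition for theta N = dz_i. *)
Lemma kermx_exp_sub N s i : \rank N = n.-1 -> (\rank (N ^+ s) + s = n)%N -> (i < s)%N ->
  (kermx (N ^+ i) <= N)%MS.
Proof.
move=> rN rs i_s.
have rk j : (j <= s)%N -> \rank (kermx (N ^+ j)) = j.
  by move=> js; rewrite mxrank_ker -[X in (X - _)%N](rank_exp rN rs js) addKn.
have sub : (kermx (N ^+ i.+1) *m N <= kermx (N ^+ i))%MS.
  by apply/sub_kermxP; rewrite -mulmxA -[N *m _]/(N * N ^+ i) -exprS mulmx_ker.
apply: submx_trans (submxMl (kermx (N ^+ i.+1)) N).
rewrite -(geq_leqif (mxrank_leqif_sup sub)) rk ?(ltnW i_s) //.
by have := rank_mul_exp_ge (kermx (N ^+ i.+1)) 1 rN; rewrite rk // expr1 addn1.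
Qed.

(** The equations for the differentials [d i] of the coordinates [z i]; the correction along [d 0]
    comes from the first column of the normal form. *)
Definition chain N d (z : nat -> K) s := d 0%N *m N = 0 /\
  forall i, (i.+1 < s)%N -> d i.+1 *m N = d i - (i%:R * z i.+1) *: d 0%N.

(** The corrections are multiples of [d 0], which [N] kills, and the one in [d 1 *m N] has
    coefficient zero. *)
Lemma chain_exp N d z s i : chain N d z s -> (i < s)%N -> d i *m N ^+ i = d 0%N.
Proof.
move=> [d0 dS]; elim: i => [|i IH] i_s; first by rewrite expr0 mulmx1.
rewrite exprS -[N * _]/(N *m _) mulmxA dS // mulmxBl IH ?(ltnW i_s) //.
case: i {IH i_s} => [|i]; first by rewrite mul0r scale0r mul0mx subr0.
by rewrite exprS -[N * _]/(N *m _) -scalemxAl mulmxA d0 mul0mx scaler0 subr0.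
Qed.

Lemma chain_exp0 N d z s i k : chain N d z s -> (i < s)%N -> (i < k)%N -> d i *m N ^+ k = 0.
Proof.
move=> ch i_s ik; rewrite -(subnKC ik) exprD exprSr -[_ * _ * _]/(N ^+ i *m N *m _).
by rewrite !mulmxA (chain_exp ch i_s) ch.1 mul0mx.
Qed.

(** Applying N^i to a relation kills the terms of index below i and turns d_i into d_0; the
    coefficients are shown to vanish from the top index down. *)
Lemma chain_free N d z s (a : 'I_s -> K) : chain N d z s -> d 0%N != 0 ->
  \sum_(i < s) a i *: d i = 0 -> forall i, a i = 0.
Proof.
move=> ch d0 S; suff H k (i : 'I_s) : (s - i <= k)%N -> a i = 0 by move=> i; exact: (H s i (leq_subr _ _)).
elim: k i => [|k IH] i ik; first by move: ik; rewrite leqn0 subn_eq0 leqNgt ltn_ord.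
have := congr1 (mulmx^~ (N ^+ i)) S; rewrite mul0mx mulmx_suml (bigD1 i) //= big1 ?addr0.
  rewrite -scalemxAl (chain_exp ch (ltn_ord i)) => /eqP; rewrite scaler_eq0 (negbTE d0) orbF.
  by move=> /eqP.
move=> j ji; rewrite -scalemxAl; have [jlt|jge] := ltnP j i.
  by rewrite (chain_exp0 ch (ltn_ord j) jlt) scaler0.
rewrite IH ?scale0r //; have : (j != i :> nat) by [].
by move: (ltn_ord i) (ltn_ord j) ik jge; lia.
Qed.

(* N is nilpotent and N + t is invertible on the span of w *)
Lemma shifted_kernel N (t : K) k s w : t != 0 -> w *m N ^+ k = 0 -> w *m (N + t%:M) ^+ s = 0 -> w = 0.
Proof.
move=> t0; elim: k w => [|k IH] w; first by rewrite expr0 mulmx1.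
move=> wk ws; have com : GRing.comm N (N + t%:M).
  by apply: commrD => //; rewrite /GRing.comm /GRing.mul /= scalar_mxC.
have wN : w *m N = 0.
  apply: IH; first by rewrite -mulmxA -[N *m _]/(N * N ^+ k) -exprS.
  rewrite -mulmxA -[N *m _]/(N * (N + t%:M) ^+ s) (commrX s com) -[_ * N]/(_ *m N).
  by rewrite mulmxA ws mul0mx.
have : t ^+ s *: w = 0.
  rewrite -ws; elim: (s) => [|j IHs]; first by rewrite !expr0 scale1r mulmx1.
  rewrite !exprS -scalerA IHs -[(N + t%:M) * _]/((N + t%:M) *m _) mulmxA mulmxDr wN add0r.
  by rewrite mul_mx_scalar -scalemxAl.
by move/eqP; rewrite scaler_eq0 expf_eq0 (negbTE t0) andbF => /eqP.
Qed.

Lemma row_notin N : \rank N = n.-1 -> (0 < n)%N -> exists rho : 'rV[K]_n, ~~ (rho <= N)%MS.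
Proof.
move=> rN n0; have : ~~ (1%:M <= N)%MS.
  by apply/negP => /mxrankS; rewrite mxrank1 rN leqNgt prednK // leqnn.
by move=> /row_subPn[i Hi]; exists (row i 1%:M).
Qed.

(** The left kernel of [N] is the line spanned by [d0], and [d0] does not vanish on [e]. *)
Lemma frame_kernel N (d0 w : 'rV[K]_n) e : \rank N = n.-1 -> (0 < n)%N -> d0 *m N = 0 ->
  d0 *m e = 1%:M -> w *m N = 0 -> w *m e = 0 -> w = 0.
Proof.
move=> rN n0 dN de wN we.
have d00 : d0 != 0 by apply: contra_eqN de => /eqP ->; rewrite mul0mx eq_sym oner_neq0.
have rk : \rank (kermx N) = 1%N by rewrite mxrank_ker rN; lia.
have dk : (d0 <= kermx N)%MS by apply/sub_kermxP.
have kd : (kermx N <= d0)%MS.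
  by rewrite -(geq_leqif (mxrank_leqif_sup dk)) rk lt0n mxrank_eq0.
have /sub_rVP[a wE] : (w <= d0)%MS by apply: submx_trans kd; apply/sub_kermxP.
move: we; rewrite wE -scalemxAl de => /eqP; rewrite scaler_eq0 oner_eq0 orbF => /eqP ->.
by rewrite scale0r.
Qed.

Lemma frame_unit N (d0 rho : 'rV[K]_n) e : \rank N = n.-1 -> (0 < n)%N -> d0 *m N = 0 ->
  d0 *m e = 1%:M -> ~~ (rho <= N)%MS -> N + e *m rho \in unitmx.
Proof.
move=> rN n0 dN de rhoN; rewrite -row_free_unit -kermx_eq0; apply/rowV0P => w /sub_kermxP.
rewrite mulmxDr mulmxA [w *m e]mx11_scalar mul_scalar_mx => wE.
have we : (w *m e) 0 0 = 0.
  apply/eqP; apply: contraR rhoN => a0; rewrite -(eqmx_scale _ a0).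
  by rewrite -[_ *: rho]opprK -(addr0_eq wE) opprK eqmx_opp submxMl.
move: wE; rewrite we scale0r addr0 => wN.
by apply: (frame_kernel rN n0 dN de wN); rewrite [w *m e]mx11_scalar we raddf0.
Qed.

Lemma frame_solve N (d0 rho al : 'rV[K]_n) e : N + e *m rho \in unitmx -> d0 *m N = 0 ->
  d0 *m e = 1%:M -> (al <= N)%MS ->
  al *m invmx (N + e *m rho) *m N = al /\ al *m invmx (N + e *m rho) *m e = 0.
Proof.
move=> uB dN de /submxP[t tE].
pose t' := t - (t *m e) 0 0 *: d0.
have t'N : t' *m N = al by rewrite mulmxBl -scalemxAl dN scaler0 subr0.
have t'e : t' *m e = 0 by rewrite mulmxBl -scalemxAl de scalemx1 -mx11_scalar subrr.
have -> : al *m invmx (N + e *m rho) = t'.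
  by rewrite -[RHS](mulmxK uB) mulmxDr mulmxA t'e mul0mx addr0 t'N.
by [].
Qed.

End Frames.

Lemma mx11D {K : nmodType} (a b : 'M[K]_1) : (a + b) 0 0 = a 0 0 + b 0 0.
Proof. exact: mxE. Qed.
Lemma mx11Z {K : pzRingType} (k : K) (a : 'M[K]_1) : (k *: a) 0 0 = k * a 0 0.
Proof. exact: mxE. Qed.
Lemma mx11N {K : zmodType} (a : 'M[K]_1) : (- a) 0 0 = - a 0 0.
Proof. exact: mxE. Qed.

(** * Closedness of the 1-forms to be integrated *)

Section Forms.
Context {R : realType} {n : nat}.
Local Notation C := R[i].
Implicit Types (U : set 'cV[R]_n) (f g h : 'cV[R]_n -> C) (N : 'cV[R]_n -> 'M[C]_n)
  (e : 'cV[R]_n -> 'cV[C]_n) (al be th : 'cV[R]_n -> 'rV[C]_n) (u v w : 'cV[C]_n).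

Definition mxreg c U p q (M : 'cV[R]_n -> 'M[C]_(p, q)) := forall i j, regC c U (fun y => M y i j).

Lemma mxreg_diff c U p q (M : 'cV[R]_n -> 'M[C]_(p, q)) x : mxreg c U M -> U x -> mxdiff M x.
Proof. by move=> rM Ux i j; exact: regC_diff (rM i j) Ux. Qed.

Lemma mxregM c U p q k (M : 'cV[R]_n -> 'M[C]_(p, q)) (P : 'cV[R]_n -> 'M[C]_(q, k)) : open U ->
  mxreg c U M -> mxreg c U P -> mxreg c U (fun y => M y *m P y).
Proof. by move=> oU rM rP i j; exact: regC_mulmx. Qed.

Lemma mxregD c U p q (M P : 'cV[R]_n -> 'M[C]_(p, q)) : open U ->
  mxreg c U M -> mxreg c U P -> mxreg c U (fun y => M y + P y).
Proof.
move=> oU rM rP i j; have -> : (fun y => (M y + P y) i j) = fun y => M y i j + P y i j.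
  by apply: funext => y; rewrite mxE.
exact: regCD.
Qed.

Lemma mxregZ c U p q h (M : 'cV[R]_n -> 'M[C]_(p, q)) : open U ->
  regC c U h -> mxreg c U M -> mxreg c U (fun y => h y *: M y).
Proof.
move=> oU rh rM i j; have -> : (fun y => (h y *: M y) i j) = fun y => h y * M y i j.
  by apply: funext => y; rewrite mxE.
exact: regCM.
Qed.

Lemma mxreg_grad c U f : regC c U f -> mxreg c U (grad f).
Proof.
move=> rf i j; have -> : (fun y => grad f y i j) = cpartial j f.
  by apply: funext => y; rewrite mxE.
exact: regC_partial.
Qed.

Lemma gradM f g x : cdiff f x -> cdiff g x ->
  grad (fun y => f y * g y) x = g x *: grad f x + f x *: grad g x.
Proof. by move=> df dg; apply/rowP => j; rewrite !mxE cpartialM // mulrC. Qed.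

Lemma gradD f g x : cdiff f x -> cdiff g x ->
  grad (fun y => f y + g y) x = grad f x + grad g x.
Proof. by move=> df dg; apply/rowP => j; rewrite !mxE cpartialD. Qed.

Lemma grad_cst (a : C) x : grad (fun=> a) x = 0 :> 'rV[C]_n.
Proof. by apply/rowP => j; rewrite !mxE cpartial_cst. Qed.

Lemma grad_scale (a : C) f x : cdiff f x -> grad (fun y => a * f y) x = a *: grad f x.
Proof.
by move=> df; rewrite gradM ?grad_cst ?scaler0 ?add0r //; exact: cdiff_cst.
Qed.

Lemma grad_exp f x : cdiff f x -> grad (fun y => cexp (f y)) x = cexp (f x) *: grad f x.
Proof. by move=> df; apply/rowP => j; rewrite !mxE cpartial_exp. Qed.

Lemma dmxZ p q h (M : 'cV[R]_n -> 'M[C]_(p, q)) v x : cdiff h x -> mxdiff M x ->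
  dmx (fun y => h y *: M y) v x = cdir h v x *: M x + h x *: dmx M v x.
Proof.
move=> dh dM; apply/matrixP => i j; rewrite dmxE 3!mxE dmxE.
have -> : (fun y => (h y *: M y) i j) = fun y => h y * M y i j.
  by apply: funext => y; rewrite mxE.
by rewrite cdirM ?[in RHS]mxE.
Qed.

Lemma dmxD p q (M P : 'cV[R]_n -> 'M[C]_(p, q)) v x : mxdiff M x -> mxdiff P x ->
  dmx (fun y => M y + P y) v x = dmx M v x + dmx P v x.
Proof.
move=> dM dP; apply/matrixP => i j; rewrite [in RHS]mxE !dmxE.
have -> : (fun y => (M y + P y) i j) = fun y => M y i j + P y i j.
  by apply: funext => y; rewrite mxE.
by rewrite cdirD.
Qed.

Lemma hess_sym c U f u v x : open U -> regC c U f -> U x ->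
  dmx (grad f) u x *m v = dmx (grad f) v x *m u.
Proof.
move=> oU rf Ux; rewrite [LHS]mx11_scalar [RHS]mx11_scalar !mxE; congr (_%:M).
have E i (z : 'cV[C]_n) : dmx (grad f) z x 0 i = \sum_j cpartial j (cpartial i f) x * z j 0.
  rewrite dmxE; have -> : (fun y => grad f y 0 i) = cpartial i f.
    by apply: funext => y; rewrite mxE.
  exact: cdirE.
under eq_bigr do rewrite E mulr_suml.
under [RHS]eq_bigr do rewrite E mulr_suml.
rewrite exchange_big; apply: eq_bigr => i _; apply: eq_bigr => j _ /=.
by rewrite (cpartialC _ _ oU rf Ux) mulrAC.
Qed.

Lemma om_scale c U h f u v x : open U -> regC c U h -> regC c U f -> U x ->
  om (fun y => h y *: grad f y) u v x = cdir h u x * cdir f v x - cdir h v x * cdir f u x.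
Proof.
move=> oU rh rf Ux; have dg := mxreg_diff (mxreg_grad rf) Ux.
have dh := regC_diff rh Ux; rewrite /om !dmxZ // !mulmxDl -!scalemxAl (hess_sym u v oU rf Ux).
by rewrite !cdirEgrad !mx11D !mx11Z opprD addrACA subrr addr0.
Qed.

Lemma omD al be u v x : mxdiff al x -> mxdiff be x ->
  om (fun y => al y + be y) u v x = om al u v x + om be u v x.
Proof.
by move=> da db; rewrite /om !dmxD // !mulmxDl !mx11D opprD addrACA.
Qed.

Lemma om_on U al be u v x : open U -> U x -> (forall y, U y -> al y = be y) ->
  om al u v x = om be u v x.
Proof. by move=> oU Ux ab; rewrite /om !(@dmx_on _ _ U _ _ al be). Qed.

Lemma om_lin al a u1 u2 v x : om al (a *: u1 + u2) v x = a * om al u1 v x + om al u2 v x.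
Proof.
by rewrite /om dmx_lin mulmxDl mulmxDr -scalemxAl -scalemxAr !mx11D !mx11Z mulrBr opprD addrACA.
Qed.

Lemma om_anti al u v x : om al u v x = - om al v u x.
Proof. by rewrite /om opprB. Qed.

(* the Lie derivative along [e] of [h df], when [df e] is constant *)
Lemma lie_scale_grad c U h f e (a : C) v x : open U -> regC c U h -> regC c U f -> mxreg c U e ->
  (forall y, U y -> grad f y *m e y = a%:M) -> U x ->
  dmx (fun y => h y *: grad f y) (e x) x *m v + h x *: grad f x *m dmx e v x =
  cdir h (e x) x *: (grad f x *m v).
Proof.
move=> oU rh rf re fe Ux; have dg := mxreg_diff (mxreg_grad rf) Ux.
have de := mxreg_diff re Ux; have dh := regC_diff rh Ux.
rewrite dmxZ // mulmxDl -!scalemxAl -addrA -scalerDr (hess_sym _ _ oU rf Ux) -dmxM //.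
rewrite (@dmx_on _ _ U _ _ _ (fun=> a%:M)) //.
have -> : dmx (fun _ : 'cV[R]_n => a%:M : 'M[C]_1) v x = 0.
  by apply/matrixP => i j; rewrite dmxE cdir_cst mxE.
by rewrite scaler0 addr0.
Qed.

Definition lie_zero e al x := forall v, dmx al (e x) x *m v + al x *m dmx e v x = 0.

Definition unity_shifted e N x := forall v,
  dmx N (e x) x *m v = dmx e (N x *m v) x - N x *m dmx e v x.

(* Since N x + e x *m rho is invertible, the tangent space is spanned by e and im N. *)
Lemma theta_closed c U N mu e al th x (rho : 'rV[C]_n) : open U -> mxreg c U N -> mxreg c U e ->
  mxreg c U th -> U x -> shifted_torsion N mu x -> unity_shifted e N x ->
  N x + e x *m rho \in unitmx ->
  (forall y, U y -> th y *m N y = al y) -> (forall y, U y -> th y *m e y = 0) ->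
  lie_zero e al x ->
  (forall u v, om al u (N x *m v) x + om al (N x *m u) v x - om (fun y => al y *m N y) u v x =
     cdir mu u x * (al x *m v) 0 0 - cdir mu v x * (al x *m u) 0 0) ->
  forall u v, om th u v x = 0.
Proof.
move=> oU rN re rth Ux T UN uB thN the La clo.
have dN := mxreg_diff rN Ux; have de := mxreg_diff re Ux; have dth := mxreg_diff rth Ux.
(* On im N: the forms theta N and theta N^2 in [om_transport] are [al] and [al N], and [clo] is the
   resulting cancellation. *)
have NN u v : om th (N x *m u) (N x *m v) x = 0.
  rewrite (om_transport _ _ dth dN T) !(@om_on U (fun y => th y *m N y) al) //.
  rewrite (@om_on U (fun y => th y *m N y *m N y) (fun y => al y *m N y)) // => [|y Uy].
    by rewrite thN // clo subrr.
  by rewrite thN.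
have Le v : dmx th v x *m e x + th x *m dmx e v x = 0.
  rewrite -dmxM // (@dmx_on _ _ U _ _ _ (fun=> 0)) //.
  by apply/matrixP => i j; rewrite dmxE; under eq_fun do rewrite mxE; rewrite cdir_cst mxE.
(* Cartan's formula: theta(e) = 0, and the Lie derivatives along e of al = theta N and of N both
   vanish. *)
have eN v : om th (e x) (N x *m v) x = 0.
  have := La v; rewrite -(@dmx_on _ _ U _ _ (fun y => th y *m N y)) // dmxM // mulmxDl.
  rewrite -!mulmxA UN mulmxBr -thN // -mulmxA -addrA subrK => /(congr1 (fun M : 'M[C]_1 => M 0 0)).
  have /eqP := Le (N x *m v); rewrite addr_eq0 => /eqP H.
  rewrite /om H mx11N opprK -mx11D => ->; exact: mxE.
have ee : om th (e x) (e x) x = 0 by rewrite /om subrr.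
have dec v : exists a w, v = a *: e x + N x *m w.
  exists ((rho *m (invmx (N x + e x *m rho) *m v)) 0 0), (invmx (N x + e x *m rho) *m v).
  rewrite -[LHS](mulKVmx uB) mulmxDl addrC -[e x *m rho *m _]mulmxA.
  by rewrite [in LHS](mx11_scalar (rho *m _)) mul_mx_scalar.
move=> u v; have [a [u' ->]] := dec u; have [b [v' ->]] := dec v.
rewrite om_lin [om th (e x) _ x]om_anti [om th (N x *m u') _ x]om_anti !om_lin.
by rewrite ee NN [om th (N x *m v') _ x]om_anti eN [om th (e x) (N x *m u') x]eN !(mulr0, oppr0, addr0).
Qed.

End Forms.

Lemma chain_form_alg (K : comNzRingType) (j : nat) (h zi z0u z0v z1u z1v ziu ziv zmu zmv : K) :
  (j.+1%:R * h * z1u * (zmv - j%:R * zi * z0v) - j.+1%:R * h * z0v * ziu)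
  + (j.+1%:R * h * z0u * ziv - j.+1%:R * h * z1v * (zmu - j%:R * zi * z0u))
  - ((j.+1%:R * h * z1u * zmv - j.+1%:R * h * z1v * zmu)
     + (- (j%:R * (j.+1%:R * h * z1u * zi + h * ziu)) * z0v
        - - (j%:R * (j.+1%:R * h * z1v * zi + h * ziv)) * z0u))
  = z0u * (h * ziv) - z0v * (h * ziu).
Proof. rewrite -[j.+1]addn1 natrD; ring. Qed.

(** * The system satisfied by normal coordinates *)

Section LocalSystem.
Context {R : realType} {n : nat}.
Local Notation C := R[i].
Variables (c : category).
Implicit Types (U V : set 'cV[R]_n) (N : 'cV[R]_n -> 'M[C]_n) (e : 'cV[R]_n -> 'cV[C]_n)
  (mu : 'cV[R]_n -> C) (z : nat -> 'cV[R]_n -> C) (x : 'cV[R]_n) (s k : nat).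

Definition solution U N e z k := (forall i, (i < k)%N -> regC c U (z i)) /\
  forall x, U x -> [/\ chain (N x) (fun i => grad (z i) x) (fun i => z i x) k,
    grad (z 0%N) x *m e x = 1%:M &
    forall i, (0 < i < k)%N -> grad (z i) x *m e x = 0].

Lemma solution_sub U V N e z k : V `<=` U -> solution U N e z k -> solution V N e z k.
Proof.
move=> VU [rz H]; split => [i ik|x Vx]; first exact: regC_sub VU (rz i ik).
exact: H (VU x Vx).
Qed.

(** Covers both cases: [s = n] with N nilpotent for a real eigenvalue, and [n = 2 s] with the s-th
    power of N of rank s for a complex one. *)
Record local_data U N e mu s : Prop := LocalData {
  ld_open : open U;
  ld_N : mxreg c U N;
  ld_e : mxreg c U e;
  ld_mu : regC c U mu;
  ld_tor : forall x, U x -> shifted_torsion N mu x;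
  ld_uni : forall x, U x -> unity_shifted e N x;
  ld_muN : forall x, U x -> grad mu x *m N x = 0;
  ld_mue : forall x, U x -> grad mu x *m e x = 1%:M;
  ld_rank : forall x, U x -> \rank (N x) = n.-1;
  ld_ranks : forall x, U x -> (\rank (N x ^+ s) + s = n)%N;
  ld_n : (0 < n)%N
}.

Lemma local_data_sub U V N e mu s : open V -> V `<=` U ->
  local_data U N e mu s -> local_data V N e mu s.
Proof.
move=> oV VU [oU rN re rmu h1 h2 h3 h4 h5 h6 h7]; split => //.
- by move=> i j; exact: regC_sub VU (rN i j).
- by move=> i j; exact: regC_sub VU (re i j).
- exact: regC_sub VU rmu.
all: by move=> x /VU; auto.
Qed.

(** Here d al = k exp(k z_1) dz_1 wedge dz_k, and the chain equations give the values of all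
    differentials on im N, so the condition of [theta_closed] becomes the polynomial identity
    [chain_form_alg]. The function [zeta] stands for z_1, which is not yet constructed when [k = 0];
    its coefficient is then zero. *)
Lemma alpha_closed U N e mu s z k zeta x u v : local_data U N e mu s -> solution U N e z k.+1 ->
  (k.+1 < s)%N -> (forall y, U y -> grad (z 0%N) y = grad mu y) ->
  regC c U zeta -> ((0 < k)%N -> zeta = z 1%N) -> U x ->
  let al y := cexp (k%:R * zeta y) *: grad (z k) y in
  om al u (N x *m v) x + om al (N x *m u) v x - om (fun y => al y *m N y) u v x =
     cdir mu u x * (al x *m v) 0 0 - cdir mu v x * (al x *m u) 0 0.
Proof.
move=> [oU rN re rmu _ _ muN _ _ _ _] [rz Hz] ks z0mu rzeta zeta1 Ux al.
pose h y := cexp (k%:R * zeta y).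
have rh : regC c U h by apply: regC_exp => //; apply: regCM => //; exact: regC_const.
have dmu w : cdir mu w x = cdir (z 0%N) w x by rewrite !cdirEgrad z0mu.
have dh w : cdir h w x = k%:R * h x * cdir zeta w x.
  rewrite cdir_exp; last by apply: cdiffM; [exact: cdiff_cst|exact: regC_diff rzeta Ux].
  rewrite cdirM; [|exact: cdiff_cst|exact: regC_diff rzeta Ux].
  by rewrite cdir_cst mul0r add0r mulrA [_ * k%:R]mulrC.
have rzk := rz k (ltnSn k).
have omal w1 w2 : om al w1 w2 x = cdir h w1 x * cdir (z k) w2 x - cdir h w2 x * cdir (z k) w1 x.
  exact: (om_scale w1 w2 oU rh rzk Ux).
have alE w : (al x *m w) 0 0 = h x * cdir (z k) w x by rewrite -scalemxAl mx11Z cdirEgrad.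
rewrite !omal !alE !dmu.
case: k => [|j] in ks zeta1 h al rz Hz rzk rh dh omal alE *.
  rewrite !dh !mul0r subrr !add0r.
  have -> : om (fun y => al y *m N y) u v x = 0.
    rewrite (@om_on _ _ U _ (fun=> 0)) //; last first.
      by move=> y Uy; have [[c0 _] _ _] := Hz y Uy; rewrite -scalemxAl c0 scaler0.
    have D0 w : dmx (fun=> 0 : 'rV[C]_n) w x = 0.
      by apply/matrixP => a b; rewrite dmxE [RHS]mxE; under eq_fun do rewrite mxE; rewrite cdir_cst.
    by rewrite /om !D0 !mul0mx subrr.
  by rewrite /h mul0r cexp0 !mul1r mulrC subrr oppr0.
rewrite zeta1 // in dh.
have ch i w : (i.+1 < j.+2)%N -> cdir (z i.+1) (N x *m w) x =
    cdir (z i) w x - i%:R * z i.+1 x * cdir (z 0%N) w x.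
  move=> ij; have [[_ cS] _ _] := Hz x Ux.
  by rewrite !cdirEgrad mulmxA cS // mulmxBl -scalemxAl mx11D mx11N mx11Z.
have ch1 w : cdir (z 1%N) (N x *m w) x = cdir (z 0%N) w x by rewrite ch // !mul0r subr0.
pose g y := - (j%:R * (h y * z j.+1 y)).
have rj := rz j (ltnW (ltnSn j.+1)); have r0 := rz 0%N (ltn0Sn _).
have rhz : regC c U (fun y => h y * z j.+1 y) by apply: regCM.
have rg : regC c U g by apply: regCN => //; apply: regCM => //; exact: regC_const.
have dg w : cdir g w x = - (j%:R * (j.+1%:R * h x * cdir (z 1%N) w x * z j.+1 x
    + h x * cdir (z j.+1) w x)).
  rewrite cdirN; last by apply: cdiffM; [exact: cdiff_cst|exact: regC_diff rhz Ux].
  rewrite cdirM; [|exact: cdiff_cst|exact: regC_diff rhz Ux].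
  by rewrite cdir_cst mul0r add0r cdirM ?dh //; [exact: regC_diff rh Ux|exact: regC_diff rzk Ux].
have -> : om (fun y => al y *m N y) u v x =
    om (fun y => h y *: grad (z j) y + g y *: grad (z 0%N) y) u v x.
  apply: (@om_on _ _ U) => // y Uy; have [[_ cS] _ _] := Hz y Uy.
  by rewrite -scalemxAl cS // scalerBr scalerA /g scaleNr mulrCA -/(h y).
rewrite omD; first last.
- exact: mxreg_diff (mxregZ oU rg (mxreg_grad r0)) Ux.
- exact: mxreg_diff (mxregZ oU rh (mxreg_grad rj)) Ux.
rewrite (om_scale u v oU rh rj Ux) (om_scale u v oU rg r0 Ux) !dg !dh !ch1 !ch //.
exact: chain_form_alg.
Qed.

Lemma cdir_basis (f : 'cV[R]_n -> C) j x : cdir f (delta_mx j 0) x = cpartial j f x.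
Proof. by rewrite cdirEgrad -colE !mxE. Qed.

Lemma gradN (f : 'cV[R]_n -> C) x : cdiff f x -> grad (fun y => - f y) x = - grad f x.
Proof. by move=> df; apply/rowP => j; rewrite !mxE cpartialN. Qed.

Lemma cpoincare x (r : R) (th : 'cV[R]_n -> 'rV[C]_n) : 0 < r -> mxreg c (ball x r) th ->
  (forall u v y, ball x r y -> om th u v y = 0) ->
  exists r' : R, [/\ 0 < r', r' <= r & exists w : 'cV[R]_n -> C,
    [/\ w x = 0, regC c (ball x r') w & forall y, ball x r' y -> grad w y = th y]].
Proof.
move=> r0 rth clo.
have clo' i j y : ball x r y ->
    cpartial i (fun y => th y 0 j) y = cpartial j (fun y => th y 0 i) y.
  move=> xy; have := clo (delta_mx i 0) (delta_mx j 0) y xy; rewrite /om -!colE => /eqP.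
  by rewrite subr_eq0 => /eqP; rewrite [LHS]mxE [RHS]mxE !dmxE !cdir_basis.
have sR j : smooth_on (ball x r) (fun y => complex.Re (th y 0 j)) by apply: reg_smooth (rth 0 j).1.
have sI j : smooth_on (ball x r) (fun y => complex.Im (th y 0 j)) by apply: reg_smooth (rth 0 j).2.
have [r1 [r10 r1r [F1 [F10 HF1]]]] := poincare r0 sR
  (fun i j y xy => congr1 (@complex.Re R) (clo' i j y xy)).
have [r2 [r20 r2r [F2 [F20 HF2]]]] := poincare r0 sI
  (fun i j y xy => congr1 (@complex.Im R) (clo' i j y xy)).
have m0 : 0 < Num.min r1 r2 by rewrite lt_min r10 r20.
have s1 : ball x (Num.min r1 r2) `<=` ball x r1 by apply: le_ball; rewrite ge_min lexx.
have s2 : ball x (Num.min r1 r2) `<=` ball x r2 by apply: le_ball; rewrite ge_min lexx orbT.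
have sr : ball x (Num.min r1 r2) `<=` ball x r by move=> y /s1; exact: le_ball.
exists (Num.min r1 r2); split => //; first by rewrite ge_min r1r.
exists (fun y => (F1 y +i* F2 y)%C); split.
- by rewrite F10 F20.
- split.
    apply: (@reg_prim _ _ c _ _ (fun j y => complex.Re (th y 0 j))).
    + exact: ball_open.
    + by move=> y /s1 /HF1[].
    + by move=> j y /s1 /HF1[_]; apply.
    + by move=> j; apply: reg_sub sr (rth 0 j).1.
  apply: (@reg_prim _ _ c _ _ (fun j y => complex.Im (th y 0 j))).
    + exact: ball_open.
    + by move=> y /s2 /HF2[].
    + by move=> j y /s2 /HF2[_]; apply.
    + by move=> j; apply: reg_sub sr (rth 0 j).2.
- move=> y xy; apply/rowP => j; rewrite mxE; apply: eq_ReIm => /=.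
    by case: (HF1 _ (s1 _ xy)) => _ ->.
  by case: (HF2 _ (s2 _ xy)) => _ ->.
Qed.

(** Solve theta N = exp(k z_1) dz_k and theta e = 0, integrate theta to [w] and put z_(k+1) = w
    exp(-k z_1). Since dz_1 N = dz_0, differentiating the second factor produces the term -k z_(k+1)
    dz_0. *)
Lemma solution_step N e mu s z k x (r : R) (rho : 'rV[C]_n) : 0 < r ->
  local_data (ball x r) N e mu s -> solution (ball x r) N e z k.+1 -> (k.+1 < s)%N ->
  (forall y, ball x r y -> grad (z 0%N) y = grad mu y) ->
  (forall y, ball x r y -> N y + e y *m rho \in unitmx) ->
  exists r' : R, [/\ 0 < r', r' <= r & exists z' : nat -> 'cV[R]_n -> C,
    [/\ forall i, (i < k.+1)%N -> z' i = z i, z' k.+1 x = 0 & solution (ball x r') N e z' k.+2]].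
Proof.
move=> r0 ld sol ks z0mu uB; have oB : open (ball x r) by exact: ball_open.
have [rz Hz] := sol.
pose zeta := if k is 0%N then (fun=> 0) else z 1%N.
have rzeta : regC c (ball x r) zeta.
  by rewrite /zeta; case: (k) rz => [|j] rz; [exact: regC_const|exact: rz].
have zeta1 : (0 < k)%N -> zeta = z 1%N by rewrite /zeta; case: (k).
pose h y := cexp (k%:R * zeta y).
have rkz : regC c (ball x r) (fun y => k%:R * zeta y) by apply: regCM => //; exact: regC_const.
have rh : regC c (ball x r) h by exact: regC_exp.
have rzk := rz k (ltnSn k).
pose al y := h y *: grad (z k) y.
pose th y := al y *m invmx (N y + e y *m rho).
have ral : mxreg c (ball x r) al by exact: mxregZ rh (mxreg_grad rzk).
have rth : mxreg c (ball x r) th.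
  apply: mxregM => // i j; apply: regC_invmx => // i' j'.
  have rr : mxreg c (ball x r) (fun=> rho) by move=> a b; exact: regC_const.
  exact: (mxregD oB (ld_N ld) (mxregM oB (ld_e ld) rr)).
have thNe y : ball x r y -> th y *m N y = al y /\ th y *m e y = 0.
  move=> xy; have [ch0 de _] := Hz y xy.
  apply: (frame_solve (d0 := grad (z 0%N) y)) => //; first exact: uB.
    exact: ch0.1.
  (* Solvability: dz_k is killed by N^(k+1), and k+1 < s. *)
  apply: scalemx_sub; apply: submx_trans (kermx_exp_sub (ld_rank ld xy) (ld_ranks ld xy) ks).
  by apply/sub_kermxP; exact: chain_exp0 ch0 _ _.
have thc u v y : ball x r y -> om th u v y = 0.
  move=> xy; apply: (theta_closed (U := ball x r) (c := c) (N := N) (mu := mu) (e := e) (al := al) (rho := rho)) => //.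
  - exact: ld_N ld.
  - exact: ld_e ld.
  - exact: ld_tor ld _ xy.
  - exact: ld_uni ld _ xy.
  - exact: uB.
  - by move=> y' /thNe[].
  - by move=> y' /thNe[].
  - move=> v'; have [a aE] : exists a : C, forall y', ball x r y' -> grad (z k) y' *m e y' = a%:M.
      case: (k) Hz => [|j] H; first by exists 1 => y' /H[].
      by exists 0 => y' /H[_ _ H']; rewrite H' ?ltnS ?leqnn // raddf0.
    rewrite (lie_scale_grad _ oB rh rzk (ld_e ld) aE xy).
    have dkz := regC_diff rkz xy.
    rewrite cdir_exp // cdirM; [|exact: cdiff_cst|exact: regC_diff rzeta xy].
    rewrite cdir_cst mul0r add0r.
    have -> : k%:R * cdir zeta (e y) y = 0.
      case: (posnP k) => [->|k0]; first by rewrite mul0r.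
      rewrite zeta1 // cdirEgrad; have [_ _ H'] := Hz y xy.
      by rewrite H' ?ltnS // mxE mulr0.
    by rewrite mulr0 scale0r.
  - by move=> u' v'; exact: (alpha_closed _ _ ld sol ks z0mu rzeta zeta1 xy).
have [r' [r'0 r'r [w [w0 rw Hw]]]] := cpoincare r0 rth thc.
have sub : ball x r' `<=` ball x r by exact: le_ball.
exists r'; split => //.
pose g y := cexp (- (k%:R * zeta y)).
have rg : regC c (ball x r') g.
  apply: regC_exp; first exact: ball_open.
  by apply: regCN; [exact: ball_open|exact: regC_sub sub rkz].
exists (fun i => if i == k.+1 then fun y => w y * g y else z i); split.
- by move=> i ik; rewrite ltn_eqF.
- by rewrite eqxx w0 mul0r.
have rwg : regC c (ball x r') (fun y => w y * g y) by apply: regCM => //; exact: ball_open.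
have gw y : ball x r' y -> grad (fun y => w y * g y) y =
    g y *: th y - (k%:R * (w y * g y)) *: grad zeta y.
  move=> xy; have dw := regC_diff rw xy; have dg := regC_diff rg xy.
  have dz := regC_diff rzeta (sub _ xy); have dkz := regC_diff rkz (sub _ xy).
  rewrite gradM // Hw // grad_exp; last exact: cdiffN.
  have -> : grad (fun y => - (k%:R * zeta y)) y = - (k%:R *: grad zeta y).
    by rewrite gradN // grad_scale.
  by rewrite !scalerN !scalerA -/(g y); congr (_ - _ *: _); rewrite mulrC mulrA.
split.
  move=> i; rewrite ltnS leq_eqVlt; case: (eqVneq i k.+1) => [//|ik] /= ik'.
  exact: regC_sub sub (rz i ik').
move=> y xy; have [[c0 cS] de He] := Hz y (sub _ xy).
have [thN the] := thNe y (sub _ xy).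
have zN : (k%:R *: grad zeta y) *m N y = k%:R *: grad (z 0%N) y.
  case: (posnP k) => [->|k0]; first by rewrite !scale0r mul0mx.
  by rewrite zeta1 // -scalemxAl cS ?ltnS // mul0r scale0r subr0.
have ze : (k%:R *: grad zeta y) *m e y = 0.
  case: (posnP k) => [->|k0]; first by rewrite !scale0r mul0mx.
  by rewrite zeta1 // -scalemxAl He ?ltnS // scaler0.
have kwg p (X : 'M[C]_(n, p)) : ((k%:R * (w y * g y)) *: grad zeta y) *m X =
    (w y * g y) *: ((k%:R *: grad zeta y) *m X).
  by rewrite -!scalemxAl scalerA [_ * k%:R]mulrC.
have wgN : grad (fun y => w y * g y) y *m N y =
    grad (z k) y - (k%:R * (w y * g y)) *: grad (z 0%N) y.
  rewrite gw // mulmxBl.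
  rewrite kwg.
  rewrite zN.
  rewrite -(scalemxAl (g y)) thN.
  have -> : g y *: al y = grad (z k) y by rewrite /al scalerA cexpN scale1r.
  by rewrite scalerA [_ * k%:R]mulrC.
have wge : grad (fun y => w y * g y) y *m e y = 0.
  by rewrite gw // mulmxBl kwg ze -scalemxAl the !scaler0 subr0.
split.
- split; first exact: c0.
  move=> i; rewrite ltnS leq_eqVlt eqSS => /orP[/eqP ->|ik]; last first.
    have -> : (i == k) = false by apply: ltn_eqF.
    have -> : (i == k.+1) = false by apply: ltn_eqF; exact: ltnW.
    by rewrite /=; exact: cS.
  by rewrite eqxx (ltn_eqF (ltnSn k)).
- exact: de.
move=> i /andP[i0]; rewrite ltnS leq_eqVlt => /orP[/eqP ->|ik]; last first.
  by rewrite ltn_eqF //; apply: He; rewrite i0.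
by rewrite eqxx.
Qed.

Lemma local_existence N e mu s x (r : R) : 0 < r -> (0 < s)%N -> local_data (ball x r) N e mu s ->
  exists r' : R, [/\ 0 < r', r' <= r & exists z : nat -> 'cV[R]_n -> C,
    [/\ z 0%N = (fun y => mu y - mu x), forall i, (i < s)%N -> z i x = 0 &
        solution (ball x r') N e z s]].
Proof.
move=> r0 s0 ld; have oB : open (ball x r) by exact: ball_open.
have bx : ball x r x by exact: ballxx.
have [rho rhoN] := row_notin (ld_rank ld bx) (ld_n ld).
have rr : mxreg c (ball x r) (fun=> rho) by move=> a b; exact: regC_const.
have rB := mxregD oB (ld_N ld) (mxregM oB (ld_e ld) rr).
have uBx := frame_unit (ld_rank ld bx) (ld_n ld) (ld_muN ld bx) (ld_mue ld bx) rhoN.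
(* The covector [rho] chosen at [x] keeps serving near [x], so one choice suffices for all steps. *)
have nuB : nbhs x (ball x r `&` [set y | N y + e y *m rho \in unitmx]).
  by apply: filterI; [exact: open_nbhs_nbhs|exact: near_unitmx oB bx rB uBx].
have [r1 /= r10 b1] := (nbhs_ballP _ _).1 nuB.
pose r2 := Num.min r r1; have r20 : 0 < r2 by rewrite lt_min r0.
have s2 : ball x r2 `<=` ball x r by apply: le_ball; rewrite ge_min lexx.
have u2 y : ball x r2 y -> N y + e y *m rho \in unitmx.
  move=> xy; suff /b1[] : ball x r1 y by [].
  by move: xy; apply: le_ball; rewrite ge_min lexx orbT.
have z0mu y : ball x r y -> grad (fun y => mu y - mu x) y = grad mu y.
  move=> xy; rewrite gradD; [|exact: regC_diff (ld_mu ld) xy|exact: cdiff_cst].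
  by rewrite grad_cst addr0.
have oB2 q : open (ball x q) by exact: ball_open.
suff H k : (k < s)%N -> exists r' : R, [/\ 0 < r', r' <= r2 & exists z : nat -> 'cV[R]_n -> C,
    [/\ z 0%N = (fun y => mu y - mu x), forall i, (i < k.+1)%N -> z i x = 0 &
        solution (ball x r') N e z k.+1]].
  have [|r' [r'0 r'r [z [z0 zx sz]]]] := H s.-1; first by rewrite prednK.
  rewrite prednK // in zx sz; exists r'; split => //; last by exists z.
  by apply: le_trans r'r _; rewrite ge_min lexx.
elim: k => [_|k IH ks].
  exists r2; split => //; exists (fun _ y => mu y - mu x); split => //.
    by move=> i _; rewrite subrr.
  split => [i _|y xy].
    by apply: regCD => //; [exact: regC_sub s2 (ld_mu ld)|exact: regC_const].
  have xy' := s2 _ xy; rewrite z0mu //; split; [|exact: ld_mue ld _ xy'|by move=> [|i]].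
  by split; [exact: ld_muN ld _ xy'|move=> i; rewrite ltnS].
have [r' [r'0 r'r [z [z0 zx sz]]]] := IH (ltnW ks).
have s' : ball x r' `<=` ball x r2 by exact: le_ball.
have s'' : ball x r' `<=` ball x r by move=> y /s' /s2.
have z0mu' y : ball x r' y -> grad (z 0%N) y = grad mu y by move=> /s'' xy; rewrite z0 z0mu.
have [r3 [r30 r3r [z' [zz' z'x sz']]]] :=
  solution_step r'0 (local_data_sub (oB2 r') s'' ld) sz ks z0mu' (fun y xy => u2 y (s' _ xy)).
exists r3; split => //; first exact: le_trans r3r r'r.
exists z'; split => //; first by rewrite zz'.
move=> i; rewrite ltnS leq_eqVlt => /orP[/eqP -> //|ik].
by rewrite zz' // zx.
Qed.

(** The difference w of two candidates for z_(i+1) satisfies dw N = -i w dz_0 and dw e = 0. Hence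
    d(w exp(i z_1)) kills im N and e, so it is zero, and w vanishes with its value at [x]. *)
Lemma local_uniqueness N e mu s x (r : R) z z' : 0 < r -> local_data (ball x r) N e mu s ->
  solution (ball x r) N e z s -> solution (ball x r) N e z' s ->
  (forall y, ball x r y -> z 0%N y = z' 0%N y) -> (forall i, (i < s)%N -> z i x = z' i x) ->
  forall i y, (i < s)%N -> ball x r y -> z i y = z' i y.
Proof.
move=> r0 ld [rz Hz] [rz' Hz'] z0 zx; elim=> [|i IH] y i_s; first exact: z0.
have oB : open (ball x r) by exact: ball_open.
have s1 : (1 < s)%N by exact: leq_ltn_trans i_s.
pose w y := z i.+1 y - z' i.+1 y.
have rw : regC c (ball x r) w by apply: regCD => //; [|apply: regCN => //]; [exact: rz|exact: rz'].
have ri1 : regC c (ball x r) (fun y => i%:R * z 1%N y).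
  by apply: regCM => //; [exact: regC_const|exact: rz].
have rh : regC c (ball x r) (fun y => cexp (i%:R * z 1%N y)) by exact: regC_exp.
have g0 y' : ball x r y' -> grad (fun y => w y * cexp (i%:R * z 1%N y)) y' = 0.
  move=> xy; have [[c0 cS] de He] := Hz _ xy; have [[c0' cS'] de' He'] := Hz' _ xy.
  have dw := regC_diff rw xy; have dh := regC_diff rh xy; have d1 := regC_diff (rz 1%N s1) xy.
  have gwE : grad w y' = grad (z i.+1) y' - grad (z' i.+1) y'.
    have d2 := regC_diff (rz' _ i_s) xy; rewrite gradD ?gradN //; last exact: cdiffN.
    exact: regC_diff (rz _ i_s) xy.
  have g0E : grad (z 0%N) y' = grad (z' 0%N) y' by apply: grad_on oB xy _ => y0; exact: z0.
  have giE : grad (z i) y' = grad (z' i) y'.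
    by apply: grad_on oB xy _ => y0; exact: IH (ltnW i_s).
  apply: (frame_kernel (ld_rank ld xy) (ld_n ld) c0 de).
    rewrite gradM // grad_exp ?grad_scale //; last exact: regC_diff ri1 xy.
    rewrite mulmxDl -!scalemxAl gwE mulmxBl cS // cS' // cS // mul0r scale0r subr0 -g0E giE.
    rewrite opprD opprK addrACA subrr add0r -scaleNr -scalerDl !scalerA -scalerDl /w.
    by rewrite [X in X *: _](_ : _ = 0) ?scale0r //; ring.
  rewrite gradM // grad_exp ?grad_scale //; last exact: regC_diff ri1 xy.
  by rewrite mulmxDl -!scalemxAl gwE mulmxBl He // He' // He // subrr !scaler0 addr0.
move=> xy; have bx : ball x r x by exact: ballxx.
have rp : regC c (ball x r) (fun y => w y * cexp (i%:R * z 1%N y)) by exact: regCM.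
have p0 : w y * cexp (i%:R * z 1%N y) = 0.
  have E : w x * cexp (i%:R * z 1%N x) = 0 by rewrite /w zx // subrr mul0r.
  rewrite -[RHS]E; apply: eq_ReIm.
    apply: (const_ball (f := fun y => complex.Re (w y * cexp (i%:R * z 1%N y)))) xy bx.
      by move=> y0 xy0; exact: (regC_diff rp xy0).1.
    move=> y0 j xy0; have := congr1 (fun M : 'rV[C]_n => complex.Re (M 0 j)) (g0 y0 xy0).
    by rewrite !mxE.
  apply: (const_ball (f := fun y => complex.Im (w y * cexp (i%:R * z 1%N y)))) xy bx.
    by move=> y0 xy0; exact: (regC_diff rp xy0).2.
  move=> y0 j xy0; have := congr1 (fun M : 'rV[C]_n => complex.Im (M 0 j)) (g0 y0 xy0).
  by rewrite !mxE.
move/eqP: p0; rewrite mulf_eq0 (negbTE (cexp_neq0 _)) orbF subr_eq0 => /eqP.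
by [].
Qed.

End LocalSystem.

(** Here mu = al + i be; a', b' are the values of d al, d be on u, and A', B' those on L u. The
    relations for the traces of L, L^2 and L^3 amount to dmu.L = mu dmu, split into real and
    imaginary parts. *)
Lemma pair_alg (K : idomainType) (m al be a' b' A' B' : K) : m != 0 -> (2%:R : K) != 0 -> (3%:R : K) != 0 ->
  be != 0 ->
  2%:R * (m * A') = m * (2%:R * (al * a' - be * b')) ->
  3%:R * (m * (2%:R * (al * A' - be * B'))) =
    2%:R * (m * (3%:R * (al * al * a' - be * be * a' - 2%:R * (al * be * b')))) ->
  A' = al * a' - be * b' /\ B' = be * a' + al * b'.
Proof.
move=> m0 n2 n3 be0 E1 E2.
have H1 : A' = al * a' - be * b'.
  by apply: (mulfI m0); apply: (mulfI n2); rewrite E1; ring.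
split => //; apply: (mulfI be0).
have : al * A' - be * B' = al * al * a' - be * be * a' - 2%:R * (al * be * b').
  apply: (mulfI m0); apply: (mulfI n2); apply: (mulfI n3).
  transitivity (3%:R * (m * (2%:R * (al * A' - be * B')))); first by ring.
  by rewrite E2; ring.
rewrite H1 => E3; have -> : be * B' = al * (al * a' - be * b') - (al * (al * a' - be * b') - be * B') by ring.
rewrite E3; ring.
Qed.

(** * The eigenvalue as a function of the point *)

Section SpectralData.
Context {R : realType} {n : nat}.
Local Notation C := R[i].
Variables (c : category).
Implicit Types (U : set 'cV[R]_n) (A : 'cV[R]_n -> 'M[R]_n) (E : 'cV[R]_n -> 'cV[R]_n)
  (mu : 'cV[R]_n -> C) (x : 'cV[R]_n).

Definition cx p q (M : 'cV[R]_n -> 'M[R]_(p, q)) : 'cV[R]_n -> 'M[C]_(p, q) :=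
  fun y => map_mx (real_complex R) (M y).

Lemma mxreg_cx U p q (M : 'cV[R]_n -> 'M[R]_(p, q)) :
  (forall i j, reg c U (fun y => M y i j)) -> mxreg c U (cx M).
Proof.
move=> rM i j; have -> : (fun y => cx M y i j) = fun y => (M y i j)%:C%C.
  by apply: funext => y; rewrite mxE.
exact: regC_real.
Qed.

Lemma mxreg_shift U (A : 'cV[R]_n -> 'M[C]_n) mu : open U -> mxreg c U A -> regC c U mu ->
  mxreg c U (shift_op A mu).
Proof.
move=> oU rA rmu i j.
have -> : (fun y => shift_op A mu y i j) = fun y => A y i j + (- (mu y)) *+ (i == j).
  by apply: funext => y; rewrite shift_opB !mxE mulNrn.
by apply: regCD => //; case: eqP => _; [exact: regCN|exact: regC_const].
Qed.

Lemma local_data_shift U A E mu s : open U -> (0 < n)%N ->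
  (forall i j, reg c U (fun y => A y i j)) -> (forall i j, reg c U (fun y => E y i j)) ->
  regC c U mu -> (forall x, U x -> nijenhuis_at (cx A) x) ->
  (forall x, U x -> unity_at (cx E) (cx A) x) ->
  (forall x u, U x -> cdir mu (cx A x *m u) x = mu x * cdir mu u x) ->
  (forall x, U x -> cdir mu (cx E x) x = 1) ->
  (forall x, U x -> \rank (shift_op (cx A) mu x) = n.-1 /\
     (\rank (shift_op (cx A) mu x ^+ s) + s = n)%N) ->
  local_data c U (shift_op (cx A) mu) (cx E) mu s.
Proof.
move=> oU n0 rA rE rmu nA uE muA muE rk.
have rcA := mxreg_cx rA; have rcE := mxreg_cx rE.
have muN x : U x -> grad mu x *m shift_op (cx A) mu x = 0.
  move=> Ux; apply: mulmx_ext => u; rewrite mul0mx -mulmxA [LHS]mx11_scalar -cdirEgrad.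
  rewrite (_ : shift_op (cx A) mu x *m u = (- mu x) *: u + cx A x *m u).
    by rewrite cdir_lin muA // mulNr addNr raddf0.
  by rewrite (shift_opE (cx A) mu) scaleNr addKr.
split => //.
- exact: mxreg_shift.
- move=> x Ux; apply: nijenhuis_shift => //; first exact: mxreg_diff rcA Ux.
    exact: regC_diff rmu Ux.
  exact: nA. exact: muN.
- move=> x Ux v; apply: unity_shift; first exact: mxreg_diff rcA Ux.
  + exact: regC_diff rmu Ux.
  + exact: uE.
  + exact: muE.
- by move=> x Ux; rewrite grad_mulE muE.
- by move=> x /rk[].
- by move=> x /rk[].
Qed.

Lemma cx_tr A y : \tr (cx A y) = (\tr (A y))%:C%C.
Proof. by rewrite trace_map_mx. Qed.

Lemma cx_tr2 A y : \tr (cx A y *m cx A y) = (\tr (A y *m A y))%:C%C.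
Proof. by rewrite -map_mxM trace_map_mx. Qed.

Lemma cx_tr3 A y : \tr (cx A y *m cx A y *m cx A y) = (\tr (A y *m A y *m A y))%:C%C.
Proof. by rewrite -!map_mxM trace_map_mx. Qed.

Lemma reg_tr U A : open U -> (forall i j, reg c U (fun y => A y i j)) -> reg c U (fun y => \tr (A y)).
Proof. by move=> oU rA; apply: reg_sum. Qed.

Lemma reg_tr2 U A : open U -> (forall i j, reg c U (fun y => A y i j)) ->
  reg c U (fun y => \tr (A y *m A y)).
Proof.
move=> oU rA; apply: (@reg_tr _ (fun y => A y *m A y)) => // i j.
have -> : (fun y => (A y *m A y) i j) = fun y => \sum_k A y i k * A y k j.
  by apply: funext => y; rewrite mxE.
by apply: reg_sum => // k; exact: regM.
Qed.

(** With a single eigenvalue everywhere nearby, [mu] is the mean trace and tr L^2 = n mu^2, so the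
    first trace identity reads dmu.L = mu dmu. *)
Lemma spectral_real U A E x0 sigma (lambda0 : R) : open U -> U x0 ->
  (forall i j, reg c U (fun y => A y i j)) -> (forall i j, reg c U (fun y => E y i j)) ->
  (forall x, U x -> nijenhuis_at (cx A) x) -> (forall x, U x -> unity_at (cx E) (cx A) x) ->
  (forall x, U x -> gl_regular (A x)) -> (forall x, U x -> has_segre (A x) sigma) ->
  has_spectrum (A x0) [:: (lambda0 +i* 0)%C] ->
  let mu y := (\tr (A y) / n%:R)%:C%C in
  [/\ local_data c U (shift_op (cx A) mu) (cx E) mu n, mu x0 = lambda0%:C%C, (0 < n)%N &
     forall x w, U x -> eigenvalue (cx A x) w -> w = mu x].
Proof.
move=> oU Ux0 rA rE nA uE gl seg sp0 mu.
have sz : size sigma = 1%N.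
  have [s [us ss hs]] := segre_spectrum (seg x0 Ux0).
  by rewrite -ss (spectrum_size hs sp0).
have sp x : U x -> exists w, has_spectrum (A x) [:: w].
  move=> Ux; have [s [us ss hs]] := segre_spectrum (seg x Ux); rewrite sz in ss.
  by case: s ss hs {us} => [|w []] // _ hs; exists w.
have muE x w : U x -> has_spectrum (A x) [:: w] -> w = mu x.
  by move=> Ux sx; have [_ -> _ _ _] := one_eigenvalue (gl x Ux) sx.
have one x : U x -> [/\ (0 < n)%N, has_spectrum (A x) [:: mu x], \rank (complexify (A x) - (mu x)%:M) = n.-1,
    (complexify (A x) - (mu x)%:M) ^+ n = 0 & \tr (A x *m A x) = n%:R * (\tr (A x) / n%:R) ^+ 2].
  move=> Ux; have [w hw] := sp x Ux; have wE := muE x w Ux hw; rewrite wE in hw.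
  by have [h1 h2 h3 h4 h5] := one_eigenvalue (gl x Ux) hw.
have n0 : (0 < n)%N by case: (one x0 Ux0).
have nC : (n%:R : C) != 0 by rewrite pnatr_eq0 -lt0n.
have nR : (n%:R : R) != 0 by rewrite pnatr_eq0 -lt0n.
have two0 : (2%:R : C) != 0 by rewrite pnatr_eq0.
have rmu : regC c U mu.
  apply: regC_real; apply: regM => //; [exact: reg_tr|exact: reg_const].
have trE : (fun y => \tr (cx A y)) = fun y => n%:R * mu y.
  apply: funext => y; rewrite cx_tr /mu -(rmorph_nat (real_complex R)) -rmorphM /=.
  by rewrite mulrCA divff // mulr1.
have dtr x u : U x -> cdir (fun y => \tr (cx A y)) u x = n%:R * cdir mu u x.
  move=> Ux; rewrite trE cdirM; [|exact: cdiff_cst|exact: regC_diff rmu Ux].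
  by rewrite cdir_cst mul0r add0r.
have dtr2 x u : U x -> cdir (fun y => \tr (cx A y *m cx A y)) u x = n%:R * (2%:R * (mu x * cdir mu u x)).
  move=> Ux; have dmu := regC_diff rmu Ux; rewrite (@cdir_on _ _ U _ (fun y => n%:R * (mu y * mu y))) //.
    rewrite cdirM; [|exact: cdiff_cst|exact: cdiffM].
    rewrite cdir_cst.
    rewrite mul0r add0r.
    rewrite cdirM //.
    by congr (_ * _); rewrite [cdir mu u x * _]mulrC mulr_natl mulr2n.
  move=> y Uy; rewrite cx_tr2; have [_ _ _ _ ->] := one y Uy.
  by rewrite rmorphM rmorph_nat rmorphXn /= expr2.
have rcA := mxreg_cx rA.
split => //.
- apply: local_data_shift => //.
  + move=> x u Ux; have := nijenhuis_d1 u (nA x Ux) (mxreg_diff rcA Ux).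
    by rewrite dtr // dtr2 // mulrCA => /(mulfI nC) /(mulfI two0).
  + move=> x Ux; have := unity_tr1 (uE x Ux) (mxreg_diff rcA Ux).
    by rewrite dtr // -[RHS]mulr1 => /(mulfI nC).
  + move=> x Ux; rewrite shift_opB; have [_ _ h1 h2 _] := one x Ux; split => //.
    by rewrite -/(complexify (A x)) h2 mxrank0.
- by rewrite -(muE _ _ Ux0 sp0).
move=> x w Ux; have [_ hs _ _ _] := one x Ux.
by rewrite [eigenvalue _ _]hs inE => /eqP.
Qed.

Lemma pair_sign m (B : 'M[R]_m) (a b b0 : R) : b != 0 -> b0 != 0 ->
  has_spectrum B [:: (a +i* b)%C; (a -i* b)%C] ->
  exists2 b', 0 < b' * b0 & has_spectrum B [:: (a +i* b')%C; (a -i* b')%C].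
Proof.
move=> bn b0n hs; have : b * b0 != 0 by rewrite mulf_neq0.
rewrite neq_lt => /orP[bb|bb]; last by exists b.
exists (- b); first by rewrite mulNr oppr_gt0.
by move=> w; rewrite hs opprK !inE orbC.
Qed.

(** For a pair a + ib, a - ib one has (tr L)^2 - n tr L^2 = (n b)^2. This discriminant stays
    positive near the point, so [be] is a regular square root, with the sign of [b0] choosing the
    branch. [pair_alg] gives dmu.L = mu dmu, and the unity gives d al.e = 1 and be d be.e = 0. *)
Lemma spectral_complex U A E x0 sigma (a0 b0 : R) : b0 != 0 -> open U -> U x0 ->
  (forall i j, reg c U (fun y => A y i j)) -> (forall i j, reg c U (fun y => E y i j)) ->
  (forall x, U x -> nijenhuis_at (cx A) x) -> (forall x, U x -> unity_at (cx E) (cx A) x) ->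
  (forall x, U x -> gl_regular (A x)) -> (forall x, U x -> has_segre (A x) sigma) ->
  has_spectrum (A x0) [:: (a0 +i* b0)%C; (a0 -i* b0)%C] ->
  exists s mu (r : R), [/\ (0 < s)%N, n = (2 * s)%N, 0 < r, ball x0 r `<=` U &
    [/\ local_data c (ball x0 r) (shift_op (cx A) mu) (cx E) mu s, mu x0 = (a0 +i* b0)%C,
     forall x, ball x0 r x -> 0 < complex.Im (mu x) * b0 &
     forall x w, ball x0 r x -> eigenvalue (cx A x) w -> 0 < complex.Im w * b0 -> w = mu x]].
Proof.
move=> b0n oU Ux0 rA rE nA uE gl seg sp0.
have [s s0 [ns tr0 tr20 _ _]] := conjugate_pair b0n sp0.
have n0 : (0 < n)%N by rewrite ns mul2n double_gt0.
have nC : (n%:R : C) != 0 by rewrite pnatr_eq0 -lt0n.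
have nR : (n%:R : R) != 0 by rewrite pnatr_eq0 -lt0n.
have w12 (b : R) : b != 0 -> (a0 +i* b)%C != (a0 -i* b)%C.
  by move=> bn; rewrite eq_complex /= eqxx /=; apply: contra bn => /eqP; lra.
have sz : size sigma = 2%N.
  have [t [us ss hs]] := segre_spectrum (seg x0 Ux0).
  by rewrite -ss (spectrum_size hs sp0) //= inE w12.
pose de y := (\tr (A y)) ^+ 2 - n%:R * \tr (A y *m A y).
have rde : reg c U de.
  apply: regB => //; first by apply: (regM oU); exact: reg_tr.
  by apply: regM => //; [exact: reg_const|exact: reg_tr2].
have de0 : 0 < de x0.
  rewrite /de tr0 tr20 (_ : _ - _ = (n%:R * b0) ^+ 2); last by ring.
  by rewrite exprn_even_gt0 //= mulf_neq0.
have nde : nbhs x0 (U `&` [set y | 0 < de y]).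
  apply: filterI; first exact: open_nbhs_nbhs.
  apply: near_gt0 => //; apply: differentiable_continuous; exact: smooth_diff (reg_smooth rde) Ux0.
have [r /= r0 br] := (nbhs_ballP _ _).1 nde.
have bU : ball x0 r `<=` U by move=> y /br[].
pose V := ball x0 r; have oV : open V by exact: ball_open.
pose al y := \tr (A y) / n%:R.
pose be y := Num.sg b0 * Num.sqrt (de y) / n%:R.
pose mu y : C := (al y +i* be y)%C.
have pt x : V x -> [/\ 0 < be x * b0, has_spectrum (A x) [:: mu x; (al x -i* be x)%C],
   \tr (A x *m A x) = n%:R * (al x ^+ 2 - be x ^+ 2),
   \tr (A x *m A x *m A x) = n%:R * (al x ^+ 3 - 3%:R * (al x * be x ^+ 2)) &
   \rank (complexify (A x) - (mu x)%:M) = n.-1 /\ \rank ((complexify (A x) - (mu x)%:M) ^+ s) = s].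
  move=> Vx; have [Ux dx] := br x Vx.
  have [t [ut st ht]] := segre_spectrum (seg x Ux); rewrite sz in st.
  case: t st ut ht => [|w1 [|w2 []]] // _ /=; rewrite inE andbT => w12' ht.
  have dx' : n%:R * \tr (A x *m A x) < (\tr (A x)) ^+ 2 by move: dx; rewrite /de /= subr_gt0.
  have [a [b [bn E1 E2]]] := spectrum_two_real w12' ht dx'; rewrite E1 E2 in ht.
  have [b' bb hs] := pair_sign bn b0n ht.
  have b'n : b' != 0 by apply: contraTN bb => /eqP ->; rewrite mul0r ltxx.
  have [s' s'0 [ns' T1 T2 T3 rk]] := conjugate_pair b'n hs.
  have ss : s' = s by apply/eqP; rewrite -(eqn_pmul2l (isT : (0 < 2)%N)) -ns' -ns.
  have alE : al x = a by rewrite /al T1 mulrC mulKf.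
  have deE : de x = (n%:R * b') ^+ 2 by rewrite /de T1 T2; ring.
  have beE : be x = b'.
    rewrite /be deE sqrtr_sqr normrM normr_nat [_ * `|b'|]mulrC mulrA mulfK //.
    case: (ltgtP b0 0) b0n => // h _.
      have h' : b' < 0 by nra.
      by rewrite ltr0_sg // ltr0_norm // mulN1r opprK.
    have h' : 0 < b' by nra.
    by rewrite gtr0_sg // gtr0_norm // mul1r.
  have muE : mu x = (a +i* b')%C by rewrite /mu alE beE.
  have rk1 : \rank (complexify (A x) - (mu x)%:M) = n.-1.
    by apply: gl_regular_rank (gl x Ux) _; rewrite hs muE inE eqxx.
  rewrite alE beE muE; split => //.
  - by rewrite T3 T1 T2; ring.
  - by rewrite muE in rk1; split => //; rewrite -ss; exact: rk.
have ral : reg c V al.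
  by apply: regM => //; [apply: reg_sub bU _; exact: reg_tr|exact: reg_const].
have rbe : reg c V be.
  apply: regM => //; last exact: reg_const.
  apply: regM => //; first exact: reg_const.
  by apply: reg_sqrt => //; [exact: reg_sub bU rde|move=> x /br[]].
have rmu : regC c V mu by split.
exists s, mu, r; split => //.
have rcA := mxreg_cx rA; have rcAV : mxreg c V (cx A) by move=> i j; exact: regC_sub bU (rcA i j).
pose aC y : C := (al y)%:C%C; pose bC y : C := (be y)%:C%C.
have raC : regC c V aC by exact: regC_real. have rbC : regC c V bC by exact: regC_real.
have trE : (fun y => \tr (cx A y)) = fun y => n%:R * aC y.
  apply: funext => y; rewrite cx_tr /aC -(rmorph_nat (real_complex R)) -rmorphM /=.
  by rewrite /al mulrCA divff // mulr1.
have dtr x u : V x -> cdir (fun y => \tr (cx A y)) u x = n%:R * cdir aC u x.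
  move=> Vx; rewrite trE cdirM; [|exact: cdiff_cst|exact: regC_diff raC Vx].
  by rewrite cdir_cst mul0r add0r.
have dsc (k : C) f u x : cdiff f x -> cdir (fun y => k * f y) u x = k * cdir f u x.
  by move=> df; rewrite cdirM ?cdir_cst ?mul0r ?add0r //; exact: cdiff_cst.
have dtr2 x u : V x -> cdir (fun y => \tr (cx A y *m cx A y)) u x =
    n%:R * (2%:R * (aC x * cdir aC u x - bC x * cdir bC u x)).
  move=> Vx; have da := regC_diff raC Vx; have db := regC_diff rbC Vx.
  rewrite (@cdir_on _ _ V _ (fun y => n%:R * (aC y * aC y + - (bC y * bC y)))) //.
    have dbb : cdiff (fun y => - (bC y * bC y)) x by apply: cdiffN; exact: cdiffM.
    have daa : cdiff (fun y => aC y * aC y) x by exact: cdiffM.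
    rewrite dsc; last exact: cdiffD.
    rewrite cdirD // cdirN; last exact: cdiffM.
    rewrite !cdirM //; congr (_ * _).
    by move: (cdir aC u x) (cdir bC u x) (aC x) (bC x) => k1 k2 k3 k4; ring.
  move=> y Vy; rewrite cx_tr2; have [_ _ -> _ _] := pt y Vy.
  by rewrite rmorphM rmorph_nat rmorphB !rmorphXn /= !expr2.
have dtr3 x u : V x -> cdir (fun y => \tr (cx A y *m cx A y *m cx A y)) u x =
    n%:R * (3%:R * (aC x * aC x * cdir aC u x - bC x * bC x * cdir aC u x
       - 2%:R * (aC x * bC x * cdir bC u x))).
  move=> Vx; have da := regC_diff raC Vx; have db := regC_diff rbC Vx.
  rewrite (@cdir_on _ _ V _ (fun y => n%:R * (aC y * (aC y * aC y) + - (3%:R * (aC y * (bC y * bC y)))))) //.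
    have dbb : cdiff (fun y => bC y * bC y) x by exact: cdiffM.
    have daa : cdiff (fun y => aC y * aC y) x by exact: cdiffM.
    have dabb : cdiff (fun y => aC y * (bC y * bC y)) x by exact: cdiffM.
    have d3 : cdiff (fun y => 3%:R * (aC y * (bC y * bC y))) x by apply: cdiffM => //; exact: cdiff_cst.
    have daaa : cdiff (fun y => aC y * (aC y * aC y)) x by exact: cdiffM.
    have dn := cdiffN d3.
    rewrite dsc; last exact: cdiffD.
    rewrite cdirD // cdirN // dsc // !cdirM //; congr (_ * _).
    by move: (cdir aC u x) (cdir bC u x) (aC x) (bC x) => k1 k2 k3 k4; ring.
  move=> y Vy; rewrite cx_tr3; have [_ _ _ -> _] := pt y Vy.
  rewrite rmorphM rmorph_nat rmorphB /=; congr (_ * (_ - _)).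
    by rewrite rmorphXn /= !exprS expr0 mulr1.
  by rewrite (rmorphM (real_complex R)) rmorph_nat /= (rmorphM (real_complex R)) rmorphXn /= expr2.
have muaE : mu = fun y => aC y + 'i * bC y.
  apply: funext => y; rewrite /mu /aC /bC.
  by apply: eq_ReIm; rewrite ?cReD ?cImD ?cReM ?cImM /=; ring.
have dmu x u : V x -> cdir mu u x = cdir aC u x + 'i * cdir bC u x.
  move=> Vx; have da := regC_diff raC Vx; have db := regC_diff rbC Vx.
  by rewrite muaE cdirD ?dsc //; apply: cdiffM => //; exact: cdiff_cst.
have bC0 x : V x -> bC x != 0.
  move=> Vx; have [bb _ _ _ _] := pt x Vx.
  by rewrite /bC (fmorph_eq0 (real_complex R)); apply: contraTN bb => /eqP ->; rewrite mul0r ltxx.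
have two0 : (2%:R : C) != 0 by rewrite pnatr_eq0.
have three0 : (3%:R : C) != 0 by rewrite pnatr_eq0.
have i2 : 'i * 'i = -1 :> C by rewrite -expr2 sqrCi.
split.
- apply: local_data_shift => //.
  + by move=> i j; exact: reg_sub bU (rA i j).
  + by move=> i j; exact: reg_sub bU (rE i j).
  + by move=> x /bU; exact: nA.
  + by move=> x /bU; exact: uE.
  + move=> x u Vx; have dA := mxreg_diff rcAV Vx.
    have E1 := nijenhuis_d1 u (nA x (bU _ Vx)) dA; have E2 := nijenhuis_d2 u (nA x (bU _ Vx)) dA.
    rewrite dtr // dtr2 // in E1; rewrite dtr2 // dtr3 // in E2.
    have [H1 H2] := pair_alg nC two0 three0 (bC0 x Vx) E1 E2.
    rewrite !dmu // H1 H2 muaE.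
    rewrite [RHS]mulrDl !mulrDr mulrACA i2.
    by move: (cdir aC u x) (cdir bC u x) (aC x) (bC x) => k1 k2 k3 k4; ring.
  + move=> x Vx; have dA := mxreg_diff rcAV Vx.
    have E1 := unity_tr1 (uE x (bU _ Vx)) dA; have E2 := unity_tr2 (uE x (bU _ Vx)) dA.
    have H1 : cdir aC (cx E x) x = 1.
      by move: E1; rewrite dtr // -[RHS]mulr1 => /(mulfI nC).
    rewrite dmu // H1; rewrite dtr2 // H1 in E2.
    have H2 : cdir bC (cx E x) x = 0.
      move: E2; rewrite (congr1 (fun f => f x) trE) [RHS]mulrCA => /(mulfI nC) /(mulfI two0).
      move/eqP; rewrite mulr1 -subr_eq0 addrAC subrr add0r oppr_eq0 mulf_eq0 (negbTE (bC0 x Vx)).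
      by move=> /eqP.
    by rewrite H2 mulr0 addr0.
  + move=> x Vx; rewrite shift_opB; have [_ _ _ _ [h1 h2]] := pt x Vx; split => //.
    by rewrite -/(complexify (A x)) h2 ns mul2n addnn.
- have [bb hs _ _ _] := pt x0 (ballxx x0 r0).
  have : (a0 +i* b0)%C \in [:: mu x0; (al x0 -i* be x0)%C] by rewrite -hs sp0 inE eqxx.
  rewrite !inE => /orP[/eqP -> //|/eqP H].
  have /= h := congr1 (@complex.Im R) H; have : 0 < b0 * b0.
    by rewrite -expr2 exprn_even_gt0.
  by rewrite {1}h mulNr => h'; exfalso; move: bb h'; lra.
- by move=> x Vx; have [bb _ _ _ _] := pt x Vx.
move=> x w Vx; have [bb hs _ _ _] := pt x Vx; rewrite [eigenvalue _ _]hs !inE.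
by move=> /orP[/eqP -> //|/eqP ->] /= h'; exfalso; move: bb h'; rewrite mulNr; lra.
Qed.

End SpectralData.

(** * From real tensor identities to complex ones *)

Section TensorBridge.
Context {R : realType} {n : nat}.
Local Notation C := R[i].
Variables (c : category).
Implicit Types (U : set 'cV[R]_n) (A : 'cV[R]_n -> 'M[R]_n) (E : 'cV[R]_n -> 'cV[R]_n)
  (x : 'cV[R]_n).
Local Notation cm := (map_mx (real_complex R)).

Lemma cx_derive (F : 'cV[R]_n -> 'cV[R]_n) (v : 'cV[R]_n) x :
  (forall i, differentiable (fun y => F y i 0) x) ->
  cm ('D_v F x) = dmx (cx F) (cm v) x.
Proof.
move=> dF; have dFx : derivable F x v.
  by apply/derivable_mxP => i j; rewrite (ord1 j); exact/diff_derivable.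
apply/colP => i; rewrite dmxE derive_mx // mxE mxE derive_partialE // rmorph_sum /=.
rewrite cdirE; apply: eq_bigr => j _; rewrite mxE rmorphM mulrC /=; congr (_ * _).
rewrite -cpartial_real; congr cpartial; by apply: funext => y; rewrite mxE.
Qed.

Lemma mulmx_delta_ext p (M : 'M[C]_(p, n)) : (forall j, M *m delta_mx j 0 = 0 :> 'cV[C]_p) -> M = 0.
Proof.
move=> H; apply/matrixP => i j; have := congr1 (fun v : 'cV[C]_p => v i 0) (H j).
by rewrite -colE !mxE.
Qed.

Lemma regular_mx_cst U (v : 'cV[R]_n) : open U -> regular_mx c U (fun _ : 'cV[R]_n => v).
Proof. by move=> oU i j; apply/regularE => //; exact: reg_const. Qed.

Lemma cx_mul_cst A (v : 'cV[R]_n) x (u : 'cV[C]_n) : mxdiff (cx A) x ->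
  dmx (cx (fun y => A y *m v)) u x = dmx (cx A) u x *m cm v.
Proof.
move=> dA; have dv : mxdiff (fun _ : 'cV[R]_n => cm v) x by move=> i j; exact: cdiff_cst.
have -> : cx (fun y => A y *m v) = fun y => cx A y *m cm v.
  by apply: funext => y; rewrite /cx map_mxM.
rewrite dmxM // (_ : dmx (fun=> cm v) u x = 0) ?mulmx0 ?addr0 //.
by apply/matrixP => i j; rewrite dmxE cdir_cst mxE.
Qed.

Lemma cmB p q (M P : 'M[R]_(p, q)) : cm (M - P) = cm M - cm P. Proof. exact: map_mxB. Qed.
Lemma cmD p q (M P : 'M[R]_(p, q)) : cm (M + P) = cm M + cm P. Proof. exact: map_mxD. Qed.
Lemma cmM p q k (M : 'M[R]_(p, q)) (P : 'M[R]_(q, k)) : cm (M *m P) = cm M *m cm P.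
Proof. exact: map_mxM. Qed.

Lemma cm_torsion (d1 d2 d3 d4 : 'cV[R]_n) (M : 'M[R]_n) : d1 - d2 - M *m (d3 - d4) = 0 ->
  forall c1 c2 c3 c4, cm d1 = c1 -> cm d2 = c2 -> cm d3 = c3 -> cm d4 = c4 ->
  c1 - c2 - cm M *m (c3 - c4) = 0.
Proof. by move/(congr1 cm); rewrite !(cmB, cmM) map_mx0 => H c1 c2 c3 c4 <- <- <- <-. Qed.

Lemma cm_unity (d1 d2 d3 b : 'cV[R]_n) (M : 'M[R]_n) : d1 - d2 + M *m d3 = b ->
  forall c1 c2 c3, cm d1 = c1 -> cm d2 = c2 -> cm d3 = c3 -> c1 - c2 + cm M *m c3 = cm b.
Proof. by move/(congr1 cm); rewrite cmD cmB cmM => H c1 c2 c3 <- <- <-. Qed.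

Lemma cm_delta (j : 'I_n) : cm (basis_vec j) = delta_mx j 0 :> 'cV[C]_n.
Proof. by rewrite map_delta_mx. Qed.

Lemma diff_mul_cst A (v : 'cV[R]_n) x i : (forall i j, differentiable (fun y => A y i j) x) ->
  differentiable (fun y => (A y *m v) i 0) x.
Proof.
move=> dA; have -> : (fun y => (A y *m v) i 0) = \sum_j (fun y => A y i j * v j 0).
  by apply: funext => y; rewrite mxE fct_sumE.
by apply: differentiable_sum => j; apply: differentiableM => //; exact: differentiable_cst.
Qed.

Lemma cx_derive_app A (v w : 'cV[R]_n) x : (forall i j, differentiable (fun y => A y i j) x) ->
  mxdiff (cx A) x -> cm ('D_v (fun y => A y *m w) x) = dmx (cx A) (cm v) x *m cm w.
Proof.
by move=> dA dcA; rewrite cx_derive ?cx_mul_cst // => k; exact: diff_mul_cst.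
Qed.

Lemma lie_bracket_cst (F : 'cV[R]_n -> 'cV[R]_n) (a : 'cV[R]_n) x :
  (lie_bracket (fun=> a) F x = 'D_a F x) * (lie_bracket F (fun=> a) x = - 'D_a F x).
Proof.
have D0 (k v : 'cV[R]_n) : 'D_v (fun _ : 'cV[R]_n => k) x = 0 by exact: derive_cst.
by rewrite /lie_bracket D0 subr0 sub0r.
Qed.

Lemma torsion_cst A (a b : 'cV[R]_n) x : nijenhuis_torsion A (fun=> a) (fun=> b) x =
  'D_(A x *m a) (fun y => A y *m b) x - 'D_(A x *m b) (fun y => A y *m a) x
  - A x *m ('D_a (fun y => A y *m b) x - 'D_b (fun y => A y *m a) x).
Proof.
have D0 (k v : 'cV[R]_n) : 'D_v (fun _ : 'cV[R]_n => k) x = 0 by exact: derive_cst.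
rewrite /nijenhuis_torsion /op_app !lie_bracket_cst D0 /lie_bracket !mulmx0 addr0.
by rewrite mulmxN opprK mulmxBr opprB [_ + A x *m _]addrC addrA [A x *m _ + _]addrC addrAC addrA.
Qed.

(** Testing on constant coordinate fields gives the identity on basis vectors; both arguments enter
    C-linearly, so it extends to all complex columns. *)
Lemma nijenhuis_bridge U A x : open U -> (forall i j, reg c U (fun y => A y i j)) ->
  (forall X Y : 'cV[R]_n -> 'cV[R]_n, regular_mx c U X -> regular_mx c U Y ->
     forall x, U x -> nijenhuis_torsion A X Y x = 0) ->
  U x -> nijenhuis_at (cx A) x.
Proof.
move=> oU rA H Ux.
have dA i j : differentiable (fun y => A y i j) x by exact: smooth_diff (reg_smooth (rA i j)) Ux.
have dcA := mxreg_diff (mxreg_cx rA) Ux.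
pose dl (j : 'I_n) : 'cV[C]_n := delta_mx j 0.
have K i j : dmx (cx A) (cx A x *m dl i) x *m dl j
    - dmx (cx A) (cx A x *m dl j) x *m dl i
    - cx A x *m (dmx (cx A) (dl i) x *m dl j - dmx (cx A) (dl j) x *m dl i) = 0.
  have := H _ _ (regular_mx_cst (basis_vec i) oU) (regular_mx_cst (basis_vec j) oU) x Ux.
  rewrite torsion_cst => /cm_torsion H'.
  have := H' _ _ _ _ (cx_derive_app _ _ dA dcA) (cx_derive_app _ _ dA dcA)
    (cx_derive_app _ _ dA dcA) (cx_derive_app _ _ dA dcA).
  by rewrite !cmM !cm_delta => {}H'; exact: H'.

pose T (u v : 'cV[C]_n) := dmx (cx A) (cx A x *m u) x *m v - dmx (cx A) (cx A x *m v) x *m u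
    - cx A x *m (dmx (cx A) u x *m v - dmx (cx A) v x *m u).
have TM u v : T u v = (dmx (cx A) (cx A x *m u) x - dmxr (cx A) u x *m cx A x
    - cx A x *m (dmx (cx A) u x - dmxr (cx A) u x)) *m v.
  by rewrite !mulmxBl -!mulmxA dmxrE mulmxBl dmxrE.
have anti u v : T u v = - T v u by rewrite /T !(opprB, opprD, mulmxBr) addrC.
have T0 v j : T v (delta_mx j 0) = 0.
  rewrite anti TM (_ : (_ - _ - _) = 0) ?mul0mx ?oppr0 //.
  by apply: mulmx_delta_ext => i; rewrite -TM; exact: K.
move=> u v; apply/eqP; rewrite -subr_eq0; apply/eqP; rewrite -/(T u v) TM.
rewrite (_ : (_ - _ - _) = 0) ?mul0mx //.
by apply: mulmx_delta_ext => i; rewrite -TM.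
Qed.

Lemma unity_bridge U A E x : open U -> (forall i j, reg c U (fun y => A y i j)) ->
  (forall i j, reg c U (fun y => E y i j)) ->
  (forall X : 'cV[R]_n -> 'cV[R]_n, regular_mx c U X ->
     forall x, U x -> lie_derivative_op E A X x = X x) ->
  U x -> unity_at (cx E) (cx A) x.
Proof.
move=> oU rA rE H Ux.
have dA i j : differentiable (fun y => A y i j) x by exact: smooth_diff (reg_smooth (rA i j)) Ux.
have dE i : differentiable (fun y => E y i 0) x by exact: smooth_diff (reg_smooth (rE i 0)) Ux.
have dcA := mxreg_diff (mxreg_cx rA) Ux.
pose dl (j : 'I_n) : 'cV[C]_n := delta_mx j 0.
have K j : dmx (cx A) (cx E x) x *m dl j - dmx (cx E) (cx A x *m dl j) x
    + cx A x *m dmx (cx E) (dl j) x = dl j.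
  have := H _ (regular_mx_cst (basis_vec j) oU) x Ux.
  rewrite /lie_derivative_op /op_app lie_bracket_cst /lie_bracket mulmxN opprK => /cm_unity H'.
  have := H' _ _ _ (cx_derive_app _ _ dA dcA) (cx_derive _ dE) (cx_derive _ dE).
  by rewrite cmM !cm_delta => {}H'; exact: H'.
have KM v : dmx (cx A) (cx E x) x *m v - dmx (cx E) (cx A x *m v) x + cx A x *m dmx (cx E) v x - v =
   (dmx (cx A) (cx E x) x - dcv (cx E) x *m cx A x + cx A x *m dcv (cx E) x - 1%:M) *m v.
  by rewrite [in RHS]mulmxBl mulmxDl mulmxBl -!mulmxA !dcvE mul1mx.
move=> v; apply/eqP; rewrite -subr_eq0 KM (_ : (_ - _ + _ - _) = 0) ?mul0mx //.
by apply: mulmx_delta_ext => j; rewrite -KM K subrr.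
Qed.

End TensorBridge.

(** * Normal forms as chains *)

Section NormalFormAlgebra.
Context {K : fieldType} {k : nat}.
Implicit Types (w : nat -> K) (r : nat -> 'rV[K]_k).

(** Scalar model of both normal forms: over the complex numbers an entry stands for a 2 by 2
    block. *)
Definition nf_entry mu0 w p q : K :=
  if p == q then w 0%N + mu0 else if p == q.+1 then 1
  else if (q == 0%N) && (2 <= p)%N then - (p.-1)%:R * w p else 0.

Lemma nf_sum mu0 w r s p : (p < s)%N -> \sum_(q < s) nf_entry mu0 w p q *: r q =
  (w 0%N + mu0) *: r p + (if p is j.+1 then r j - (j%:R * w p) *: r 0%N else 0).
Proof.
move=> ps; rewrite (bigD1 (Ordinal ps)) //= {1}/nf_entry eqxx; congr (_ + _).
have ne (q : 'I_s) : q != Ordinal ps -> (p == q) = false.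
  by move=> h; apply/negbTE; apply: contraNneq h => pq; apply/eqP/val_inj.
case: p ps ne => [|j] ps ne.
  by rewrite big1 // => q qp; rewrite /nf_entry ne //= andbF scale0r.
have js : (j < s)%N by exact: ltnW.
rewrite (bigD1 (Ordinal js)) /=; last by rewrite -val_eqE /= ltn_eqF.
rewrite {1}/nf_entry gtn_eqF // eqxx scale1r; congr (_ + _).
case: j ps js ne => [|j] ps js ne.
  rewrite mul0r scale0r oppr0 big1 // => q /andP[q1 q0]; rewrite /nf_entry ne //.
  by rewrite eqSS andbF eq_sym (negbTE (_ : q != 0%N :> nat)) ?scale0r //; apply: contraNneq q0 => e; apply/eqP/val_inj.
have s0 : (0 < s)%N by exact: leq_ltn_trans (leq0n _) js.
rewrite (bigD1 (Ordinal s0)) //= big1 ?addr0.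
  by rewrite /nf_entry /= mulNr scaleNr.
move=> q /andP[/andP[q1 q2] q3]; rewrite /nf_entry ne // eqSS.
have -> : (j.+1 == q) = false by apply/negbTE; apply: contraNneq q2 => e; apply/eqP/val_inj.
have -> : (q == 0%N :> nat) = false by apply/negbTE; apply: contraNneq q3 => e; apply/eqP/val_inj.
by rewrite scale0r.
Qed.

End NormalFormAlgebra.

(** Row p of the normal form equation, with its diagonal term moved to the other side, is equation
    number p of the chain. *)
Lemma chain_nf {K : fieldType} {n : nat} (A : 'M[K]_n) mu0 (w : nat -> K) (r : nat -> 'rV[K]_n) s :
  (0 < s)%N ->
  chain (A - (w 0%N + mu0)%:M) r w s <->
  (forall p, (p < s)%N -> \sum_(q < s) nf_entry mu0 w p q *: r q = r p *m A).
Proof.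
move=> s0; have AE p : r p *m (A - (w 0%N + mu0)%:M) = r p *m A - (w 0%N + mu0) *: r p.
  by rewrite mulmxBr mul_mx_scalar.
split=> [[c0 cS] [|p] ps|H].
- by rewrite nf_sum // addr0; apply/eqP; rewrite eq_sym -subr_eq0 -AE c0.
- by rewrite nf_sum // -cS // AE addrC subrK.
split; first by rewrite AE -H // nf_sum // addr0 subrr.
by move=> p ps; rewrite AE -H // nf_sum // [_ + (_ - _)]addrC addrK.
Qed.

(** * Reading real coordinates as complex ones *)

Section Reading.
Context {R : realType} {n : nat}.
Local Notation C := R[i].
Local Notation cm := (map_mx (real_complex R)).

Definition nrow k (M : 'M[R]_(n, k)) p : 'rV[R]_k := if insub p is Some i then row i M else 0.

Lemma nrowE k (M : 'M[R]_(n, k)) (i : 'I_n) : nrow M i = row i M.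
Proof. by rewrite /nrow; case: insubP => [j _ /val_inj ->|]; rewrite ?ltn_ord. Qed.

Lemma nrowM k l (X : 'M[R]_(n, k)) (Y : 'M[R]_(k, l)) p : nrow (X *m Y) p = nrow X p *m Y.
Proof. by rewrite /nrow; case: insubP => [i _ _|_]; rewrite ?row_mul ?mul0mx. Qed.

Lemma coord_nrow (y : 'cV[R]_n) p : Defs.coord y p = nrow y p 0 0.
Proof. by rewrite /Defs.coord /nrow; case: insubP => [i _ _|_]; rewrite mxE. Qed.

(* [p] numbers real rows when [b] is false; for [b] true it numbers complex rows, row [p] *)
(* being assembled from the real rows [2p] and [2p+1].                                    *)
Definition rd (b : bool) k (M : 'M[R]_(n, k)) p : 'rV[C]_k :=
  if b then cm (nrow M p.*2) + 'i%C *: cm (nrow M p.*2.+1) else cm (nrow M p).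

Definition rdim (b : bool) s := if b then (2 * s)%N else s.

Lemma rdM b k l (X : 'M[R]_(n, k)) (Y : 'M[R]_(k, l)) p : rd b (X *m Y) p = rd b X p *m cm Y.
Proof. by rewrite /rd; case: b; rewrite !nrowM !map_mxM // mulmxDl scalemxAl. Qed.

Lemma cm_ReIm k (u v : 'rV[R]_k) (u' v' : 'rV[R]_k) :
  cm u + 'i%C *: cm v = cm u' + 'i%C *: cm v' -> u = u' /\ v = v'.
Proof.
move=> E; split; apply/rowP => j.
  have := congr1 (fun M : 'rV[C]_k => complex.Re (M 0 j)) E.
  by rewrite !mxE !cReD !cReM /= !(mul0r, mul1r, mulr0, subr0, addr0).
have := congr1 (fun M : 'rV[C]_k => complex.Im (M 0 j)) E.
by rewrite !mxE !cImD !cImM /= !(mul0r, mul1r, mulr0, add0r, addr0).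
Qed.

Lemma rd_inj b s k (X Y : 'M[R]_(n, k)) : n = rdim b s ->
  (forall p, (p < s)%N -> rd b X p = rd b Y p) -> X = Y.
Proof.
move=> ns H; apply/row_matrixP => i; rewrite -!nrowE.
case: b ns H => /= ns H; last by have := ltn_ord i; rewrite {2}ns => /H /map_mx_inj.
have ps : (i./2 < s)%N by rewrite ltn_half_double -mul2n -ns ltn_ord.
have [h1 h2] := cm_ReIm (H _ ps).
by rewrite -(odd_double_half i); case: (odd i); rewrite ?add1n ?add0n.
Qed.

Lemma rd_grad b c U (phi : 'cV[R]_n -> 'cV[R]_n) p x : (forall i, reg c U (fun y => phi y i 0)) -> U x ->
  grad (fun y => rd b (phi y) p 0 0) x = rd b (jacobian_mx phi x) p.
Proof.
move=> rphi Ux.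
have dn q : differentiable (fun y => nrow (phi y) q 0 0) x.
  rewrite /nrow; case: insubP => [i _ _|_].
    under eq_fun do rewrite mxE; exact: smooth_diff (reg_smooth (rphi i)) Ux.
  under eq_fun do rewrite mxE; exact: differentiable_cst.
have gn q : grad (fun y => (nrow (phi y) q 0 0)%:C%C) x = cm (nrow (jacobian_mx phi x) q).
  apply/rowP => j; rewrite mxE cpartial_real mxE; congr (_%:C%C).
  rewrite /nrow; case: insubP => [i _ _|_].
    by rewrite !mxE; under eq_fun do rewrite mxE.
  by under eq_fun do rewrite mxE; rewrite partial_cst mxE.
rewrite /rd; case: b; last first.
  by rewrite -gn; congr grad; apply: funext => y; rewrite mxE.
rewrite -!gn -grad_scale; last exact: cdiff_real.
rewrite -gradD; [|exact: cdiff_real|by apply: cdiffM; [exact: cdiff_cst|exact: cdiff_real]].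
by congr grad; apply: funext => y; rewrite !mxE.
Qed.

Lemma rd_reg b c U (phi : 'cV[R]_n -> 'cV[R]_n) p : open U -> (forall i, reg c U (fun y => phi y i 0)) ->
  regC c U (fun y => rd b (phi y) p 0 0).
Proof.
move=> oU rphi.
have rn q : regC c U (fun y => (nrow (phi y) q 0 0)%:C%C).
  apply: regC_real; rewrite /nrow; case: insubP => [i _ _|_].
    by under eq_fun do rewrite mxE; exact: rphi.
  by under eq_fun do rewrite mxE; exact: reg_const.
rewrite /rd; case: b; last by under eq_fun do rewrite mxE; exact: rn.
have -> : (fun y => (cm (nrow (phi y) p.*2) + 'i%C *: cm (nrow (phi y) p.*2.+1)) 0 0) =
    fun y => (nrow (phi y) p.*2 0 0)%:C%C + 'i%C * (nrow (phi y) p.*2.+1 0 0)%:C%C.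
  by apply: funext => y; rewrite !mxE.
by apply: regCD => //; apply: regCM => //; exact: regC_const.
Qed.

Definition nform (b : bool) (a0 b0 : R) : 'cV[R]_n -> 'M[R]_n :=
  if b then complex_normal_form a0 b0 else real_normal_form a0.

Definition mu0 (b : bool) (a0 b0 : R) : C := (a0 +i* (if b then b0 else 0))%C.

Lemma mul_sum_nrow m k (B : 'M[R]_(m, n)) (M : 'M[R]_(n, k)) i :
  row i (B *m M) = \sum_(j < n) B i j *: nrow M j.
Proof.
rewrite row_mul mulmx_sum_row; apply: eq_bigr => j _; by rewrite mxE nrowE.
Qed.

Lemma eq_sum_ord (V : nmodType) (F : nat -> V) m k : m = k -> \sum_(j < m) F j = \sum_(j < k) F j.
Proof. by move->. Qed.

Lemma sum_pairs (V : nmodType) (F : nat -> V) s :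
  \sum_(j < 2 * s) F j = \sum_(q < s) (F q.*2 + F q.*2.+1).
Proof.
rewrite -(big_mkord xpredT F) -(big_mkord xpredT (fun q => F q.*2 + F q.*2.+1)).
elim: s => [|s IH]; first by rewrite muln0 !big_geq.
by rewrite mulnS add2n !big_nat_recr //= IH mul2n addrA.
Qed.

(** The block with rows (a, -b) and (b, a) is multiplication by a + ib. *)
Lemma normal_blockE a0 b0 (y : 'cV[R]_n) p q :
  let be := nf_entry (a0 +i* b0)%C (fun p => rd true y p 0 0) p q in
  normal_block a0 b0 y p q = cblock (complex.Re be) (complex.Im be).
Proof.
have rE j : rd true y j 0 0 = (Defs.coord y j.*2 +i* Defs.coord y j.*2.+1)%C.
  rewrite /rd !mxE -!coord_nrow; apply: eq_ReIm; rewrite ?cReD ?cImD ?cReM ?cImM /=; ring.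
rewrite /normal_block /nf_entry /= !rE /Cmx; case: ifP => _.
  by apply/matrixP => i j; rewrite !mxE /=; case: ifP => // _; case: ifP => // _; rewrite opprD.
case: ifP => _.
  by apply/matrixP => i j; rewrite !mxE /=; case: ifP => //= _; case: ifP => _; rewrite ?oppr0.
case: ifP => _; last by apply/matrixP => i j; rewrite !mxE /=; case: ifP => //= _; case: ifP => _; rewrite ?oppr0.
have ReN (m : nat) : complex.Re (- (m%:R : C)) = - m%:R by rewrite cReN -(rmorph_nat (real_complex R)).
have ImN (m : nat) : complex.Im (- (m%:R : C)) = 0.
  by rewrite cImN -(rmorph_nat (real_complex R)) /= oppr0.
apply/matrixP => i j; rewrite !mxE cReM cImM ReN ImN /= !mul0r subr0 addr0.
by case: ifP => _ //; case: ifP => _ //; rewrite mulrN.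
Qed.

Lemma rd_nform b a0 b0 s (y : 'cV[R]_n) k (M : 'M[R]_(n, k)) p : n = rdim b s -> (p < s)%N ->
  rd b (nform b a0 b0 y *m M) p =
  \sum_(q < s) nf_entry (mu0 b a0 b0) (fun p => rd b y p 0 0) p q *: rd b M q.
Proof.
case: b => /= ns ps; last first.
  have pn : (p < n)%N by rewrite ns.
  rewrite /rd -[p]/(val (Ordinal pn)) nrowE mul_sum_nrow raddf_sum /=.
  rewrite -(big_mkord xpredT (fun q => nf_entry (mu0 false a0 b0) (fun p => cm (nrow y p) 0 0) p q *: cm (nrow M q))).
  rewrite -ns big_mkord; apply: eq_bigr => j _; rewrite map_mxZ; congr (_ *: _).
  rewrite mxE /nf_entry -val_eqE /= /mu0 !mxE -!coord_nrow.
  case: ifP => _; first by apply: eq_ReIm; rewrite ?cReD ?cImD /= ?addr0.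
  case: ifP => // _; case: ifP => // _.
  by rewrite rmorphM rmorphN rmorph_nat.
have i0 : (p.*2 < n)%N by rewrite ns mul2n ltn_double.
have i1 : (p.*2.+1 < n)%N by rewrite ns mul2n ltn_Sdouble.
pose nb q (a b : nat) : R := normal_block a0 b0 y p q (inord a) (inord b).
pose g j : C := (nb j./2 0%N (odd j) +i* nb j./2 1%N (odd j))%C.
rewrite /rd -[p.*2]/(val (Ordinal i0)) -[p.*2.+1]/(val (Ordinal i1)) !nrowE !mul_sum_nrow.
have cms (F : 'I_n -> 'rV[R]_k) : cm (\sum_j F j) = \sum_j cm (F j) by exact: raddf_sum.
rewrite !cms scaler_sumr -big_split /=.
rewrite (eq_bigr (fun j : 'I_n => g j *: cm (nrow M j))); last first.
  move=> j _; rewrite !map_mxZ scalerA -scalerDl; congr (_ *: _).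
  rewrite !mxE /= doubleK uphalf_double odd_double /= /g /nb.
  by apply: eq_ReIm; rewrite ?cReD ?cImD ?cReM ?cImM /=; ring.
rewrite (eq_sum_ord (fun j => g j *: cm (nrow M j)) ns).
rewrite (sum_pairs (fun j => g j *: cm (nrow M j))); apply: eq_bigr => q _.
set be := nf_entry _ _ _ _.
(* In row 2p plus i times row 2p+1, columns 2q and 2q+1 carry [be] and i [be]: together they read
   the complex row q. *)
have gE (t : bool) : g (t + q.*2)%N = be * (if t then 'i%C else 1).
  rewrite /g half_bit_double oddD odd_double addbF oddb /nb normal_blockE -/be.
  have ib (a : bool) : inord a = (if a then ord_max else ord0) :> 'I_2.
    by apply: val_inj; rewrite /= inordK; case: a.
  rewrite ib (ib false) (ib true) /=.
  by case: t; rewrite !mxE /=; apply: eq_ReIm; rewrite ?cReM ?cImM /=; ring.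
have := gE false; have := gE true; rewrite add0n add1n => -> ->.
by rewrite mulr1 scalerDr scalerA.
Qed.

Lemma rd_first b s p : n = rdim b s -> (p < s)%N -> rd b (d_first : 'cV[R]_n) p = (p == 0%N)%:R%:M.
Proof.
have E q : (q < n)%N -> nrow (d_first : 'cV[R]_n) q = (q == 0%N)%:R%:M.
  by move=> qn; rewrite -[q]/(val (Ordinal qn)) nrowE; apply/rowP => j; rewrite !mxE (ord1 j) /= mulr1n; case: eqP.
case: b => /= ns ps; rewrite /rd.
  rewrite !E ?ns ?mul2n ?ltn_double ?ltn_Sdouble // double_eq0 /= map_scalar_mx /= rmorph_nat.
  by rewrite raddf0 raddf0 scaler0 addr0.
by rewrite E ?ns // map_scalar_mx /= rmorph_nat.
Qed.

End Reading.

Section ReadingInverse.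
Context {R : realType} {n : nat}.
Local Notation C := R[i].
Local Notation cm := (map_mx (real_complex R)).

Definition of_rd (b : bool) (z : nat -> C) : 'cV[R]_n :=
  \col_k (if b && odd k then complex.Im (z k./2) else complex.Re (z (if b then k./2 else k))).

Lemma rd_of_rd b s z p : n = rdim b s -> (p < s)%N -> (b = false -> complex.Im (z p) = 0) ->
  rd b (of_rd b z) p 0 0 = z p.
Proof.
case: b => /= ns ps H; rewrite /rd.
  have i0 : (p.*2 < n)%N by rewrite ns mul2n ltn_double.
  have i1 : (p.*2.+1 < n)%N by rewrite ns mul2n ltn_Sdouble.
  rewrite -[p.*2]/(val (Ordinal i0)) -[p.*2.+1]/(val (Ordinal i1)) !nrowE !mxE /=.
  rewrite doubleK uphalf_double odd_double /=.
  by apply: eq_ReIm; rewrite ?cReD ?cImD ?cReM ?cImM /=; ring.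
have pn : (p < n)%N by rewrite ns.
rewrite -[p]/(val (Ordinal pn)) nrowE !mxE /=.
by apply: eq_ReIm; rewrite //= H.
Qed.

Lemma map_mx_conj_exp (N : 'M[C]_n) k : map_mx (@conjc R) (N ^+ k) = (map_mx (@conjc R) N) ^+ k.
Proof.
elim: k => [|k IH]; first by rewrite !expr0 -[1]/(1%:M) map_scalar_mx rmorph1.
by rewrite !exprS -[N * _]/(N *m _) map_mxM IH.
Qed.

(* A real relation between the rows of J reads X + conj X = 0 with X in the span of *)
(* the complex rows; X is killed by powers of both N and its conjugate N + t.         *)
Lemma rd_free_complex s (A J : 'M[R]_n) (mu : C) w (y : 'cV[R]_n) : n = rdim true s ->
  chain (cm A - mu%:M) (rd true J) w s -> rd true J 0%N != 0 -> complex.Im mu != 0 ->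
  y^T *m J = 0 -> y = 0.
Proof.
move=> ns ch d0 im yJ; set N := cm A - mu%:M in ch.
pose cf p := rd true y p 0 0.
have cfE p : cf p = (Defs.coord y p.*2 +i* Defs.coord y p.*2.+1)%C.
  by rewrite /cf /rd !mxE -!coord_nrow; apply: eq_ReIm; rewrite ?cReD ?cImD ?cReM ?cImM /=; ring.
pose X := \sum_(p < s) conjc (cf p) *: rd true J p.
have XN : X *m N ^+ s = 0.
  rewrite mulmx_suml big1 // => p _; rewrite -scalemxAl.
  by rewrite (chain_exp0 ch (ltn_ord p) (ltn_ord p)) scaler0.
have reX j : complex.Re (X 0 j) = 0.
  have E : \sum_(k < n) Defs.coord y k * nrow J k 0 j = 0.
    have := congr1 (fun M : 'rV[R]_n => M 0 j) yJ; rewrite !mxE => yJ'; rewrite -[RHS]yJ'.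
    by apply: eq_bigr => k _; rewrite coord_nrow !nrowE !mxE.
  have {}E : \sum_(k < 2 * s) Defs.coord y k * nrow J k 0 j = 0.
    by rewrite -[RHS]E; apply: (eq_sum_ord (fun k => Defs.coord y k * nrow J k 0 j)); exact: esym ns.
  rewrite (sum_pairs (fun k => Defs.coord y k * nrow J k 0 j)) in E.
  rewrite -[RHS]E summxE; apply: (big_ind2 (fun (a : C) (b : R) => complex.Re a = b)) => //.
    by move=> a1 a2 b1 b2 <- <-; rewrite cReD.
  move=> p _; rewrite mxE cReM cfE /rd !mxE cReD cImD cReM cImM /=; ring.
have Xc : X = - map_mx (@conjc R) X.
  apply/rowP => j; rewrite !mxE; apply: eq_ReIm; rewrite ?cReN ?cImN; move: (reX j).
    by case: (X 0 j) => a b /= ->; rewrite oppr0.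
  by case: (X 0 j) => a b /= _; rewrite opprK.
pose t := mu - conjc mu.
have t0 : t != 0.
  apply: contra im => /eqP /(congr1 (@complex.Im R)); rewrite /t; case: (mu) => a b /= h.
  by apply/eqP; lra.
have Nc : map_mx (@conjc R) N = N + t%:M.
  apply/matrixP => i j; rewrite mxE !mxE rmorphB rmorphMn /= oppr0 /t mulrnBl addrA subrK.
  by [].
have XNt : X *m (N + t%:M) ^+ s = 0.
  by rewrite Xc -Nc -map_mx_conj_exp mulNmx -map_mxM XN map_mx0 oppr0.
have X0 := shifted_kernel t0 XN XNt.
have c0 := chain_free ch d0 X0.
apply: (@rd_inj _ _ true s) => // p ps; apply/rowP => j; rewrite (ord1 j) -/(cf p).
have -> : cf p = 0.
  by apply/eqP; rewrite -(conjc_eq0 (cf p)); apply/eqP; exact: c0 (Ordinal ps).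
rewrite /rd /nrow; case: insubP => [i _ _|_]; case: insubP => [i' _ _|_]; rewrite !mxE /=; apply: eq_ReIm; rewrite ?cReD ?cImD ?cReM ?cImM /=; ring.
Qed.

Lemma rd_unit b s (A J : 'M[R]_n) (mu : C) w : n = rdim b s ->
  chain (cm A - mu%:M) (rd b J) w s -> rd b J 0%N != 0 -> (b -> complex.Im mu != 0) ->
  J \in unitmx.
Proof.
move=> ns ch d0 im; rewrite -row_free_unit -kermx_eq0; apply/rowV0P => v /sub_kermxP vJ.
rewrite -[v]trmxK; apply/eqP; rewrite trmx_eq0; apply/eqP.
case: b ns ch d0 im => ns ch d0 im.
  by apply: (rd_free_complex ns ch d0 (im isT)); rewrite trmxK.
rewrite /= in ns; subst s.
have S : \sum_(i < n) (v 0 i)%:C%C *: rd false J i = 0.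
  transitivity (cm (v *m J)); last by rewrite vJ map_mx0.
  rewrite mulmx_sum_row raddf_sum; apply: eq_bigr => i _ /=.
  by rewrite map_mxZ /rd nrowE.
have H := chain_free ch d0 S.
apply/colP => i; rewrite !mxE; exact: complexI (H i).
Qed.

(** For a real eigenvalue N and e are real, and so is dz_0; taking real parts therefore commutes
    even with the product z_(i+1) dz_0. *)
Lemma solution_re c U (A : 'cV[R]_n -> 'M[R]_n) (E : 'cV[R]_n -> 'cV[R]_n) (al : 'cV[R]_n -> R) z s :
  open U -> solution c U (shift_op (cx A) (fun y => (al y)%:C%C)) (cx E) z s -> (0 < s)%N ->
  (forall x, U x -> complex.Im (z 0%N x) = 0) ->
  solution c U (shift_op (cx A) (fun y => (al y)%:C%C)) (cx E) (fun i x => (complex.Re (z i x))%:C%C) s.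
Proof.
move=> oU [rz Hz] s0 im; pose re := map_mx (@complex.Re R).
have reM k l (g : 'M[C]_(k, n)) (M : 'M[R]_(n, l)) : map_mx (@complex.Re R) (g *m cm M) = map_mx (@complex.Re R) g *m M.
  apply/matrixP => i j; rewrite !mxE; apply: (big_ind2 (fun (a : C) (b : R) => complex.Re a = b)) => //.
    by move=> a1 a2 b1 b2 <- <-; rewrite cReD.
  by move=> q _; rewrite !mxE cReM /= mulr0 subr0.
have gE i x : grad (fun y => (complex.Re (z i y))%:C%C) x = cm (map_mx (@complex.Re R) (grad (z i) x)).
  by apply/rowP => j; rewrite !mxE cpartial_real.
split=> [i ik|x Ux]; first by apply: regC_real; exact: (rz i ik).1.
have [[c0 cS] de He] := Hz x Ux.
have NE : shift_op (cx A) (fun y => (al y)%:C%C) x = cm (A x - (al x)%:M).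
  by rewrite shift_opB map_mxB map_scalar_mx.
rewrite NE in c0 cS *.
have g0E : grad (z 0%N) x = cm (map_mx (@complex.Re R) (grad (z 0%N) x)).
  rewrite -gE; apply: grad_on oU Ux _ => y Uy; apply: eq_ReIm => //=; exact: im.
split.
- split; first by rewrite gE -map_mxM -reM c0; apply/rowP => j; rewrite !mxE.
  move=> i ik; rewrite !gE -map_mxM -reM cS // {1}g0E.
  apply/rowP => j; rewrite !mxE; apply: eq_ReIm.
    rewrite /= cReD cReN cReM /= !mulr0 !subr0; rewrite cReM -(rmorph_nat (real_complex R)) /=; ring.
  by rewrite /= cImD cImN cImM cImM -(rmorph_nat (real_complex R)) /=; ring.
- by rewrite gE -g0E.
by move=> i ik; rewrite gE -map_mxM -reM He //; apply/matrixP => a b; rewrite !mxE.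
Qed.

End ReadingInverse.

(** * Existence and uniqueness inside one chart *)

Section LocalChart.
Context {R : realType} {n : nat}.
Local Notation C := R[i].
Local Notation cm := (map_mx (real_complex R)).
Variables (c : category) (b : bool) (a0 b0 : R).
Implicit Types (U : set 'cV[R]_n) (A : 'cV[R]_n -> 'M[R]_n) (E : 'cV[R]_n -> 'cV[R]_n)
  (mu : 'cV[R]_n -> C) (x : 'cV[R]_n) (phi : 'cV[R]_n -> 'cV[R]_n).

Definition spectrum_at : seq C :=
  if b then [:: (a0 +i* b0)%C; (a0 -i* b0)%C] else [:: (a0 +i* 0)%C].

(** [sd_im] and [sd_eig] tell the eigenvalue from its conjugate by the sign of the imaginary
    part. *)
Record spectral_data (B : set 'cV[R]_n) A E x0 s mu : Prop := SpectralData {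
  sd_s : (0 < s)%N;
  sd_n : n = rdim b s;
  sd_ld : local_data c B (shift_op (cx A) mu) (cx E) mu s;
  sd_x0 : mu x0 = mu0 b a0 b0;
  sd_re : b = false -> exists al, mu = fun y => (al y)%:C%C;
  sd_im : b -> b0 != 0 /\ forall x, B x -> 0 < complex.Im (mu x) * b0;
  sd_eig : forall x w, B x -> eigenvalue (cx A x) w -> (b -> 0 < complex.Im w * b0) -> w = mu x
}.

Lemma spectral_dataP U A E x0 sigma : (b -> b0 != 0) -> open U -> U x0 ->
  (forall i j, reg c U (fun y => A y i j)) -> (forall i j, reg c U (fun y => E y i j)) ->
  (forall x, U x -> nijenhuis_at (cx A) x) -> (forall x, U x -> unity_at (cx E) (cx A) x) ->
  (forall x, U x -> gl_regular (A x)) -> (forall x, U x -> has_segre (A x) sigma) ->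
  has_spectrum (A x0) spectrum_at ->
  exists s mu (r : R), [/\ 0 < r, ball x0 r `<=` U & spectral_data (ball x0 r) A E x0 s mu].
Proof.
rewrite /spectrum_at; case: b spectral_data SpectralData => sd SD b0n oU Ux0 rA rE nA uE gl seg sp.
  have [s [mu [r [s0 ns r0 rU [ld mux0 im eig]]]]] := spectral_complex (b0n isT) oU Ux0 rA rE nA uE gl seg sp.
  exists s, mu, r; split => //; apply: SD => //.
    by move=> _; split => //; exact: b0n.
  by move=> x w xy ew h; apply: eig => //; exact: h.
have [ld mux0 n0 eig] := spectral_real oU Ux0 rA rE nA uE gl seg sp.
have [r r0 rU] := open_ballP oU Ux0.
exists n, (fun y => (\tr (A y) / n%:R)%:C%C), r; split => //; apply: SD => //.
- by apply: local_data_sub rU ld; exact: ball_open.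
- by move=> _; eexists.
- by move=> x w /rU xy ew _; exact: eig.
Qed.

Definition nf_chart (B : set 'cV[R]_n) A E phi := [/\ forall i, reg c B (fun y => phi y i 0),
  forall x, B x -> nform b a0 b0 (phi x) *m jacobian_mx phi x = jacobian_mx phi x *m A x &
  forall x, B x -> jacobian_mx phi x *m E x = d_first].

Lemma local_chart A E x0 s mu (r : R) : 0 < r -> spectral_data (ball x0 r) A E x0 s mu ->
  exists (r' : R) phi, [/\ 0 < r', r' <= r, phi x0 = 0 & nf_chart (ball x0 r') A E phi /\
     forall x, ball x0 r' x -> jacobian_mx phi x \in unitmx].
Proof.
move=> r0 [s0 ns ld mux0 mure muim eig].
have [r' [r'0 r'r [z [z0 zx0 sol]]]] := local_existence r0 s0 ld.
have oB : open (ball x0 r') by exact: ball_open.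
have sub : ball x0 r' `<=` ball x0 r by exact: le_ball.
(* When the eigenvalue is real the imaginary parts of the solution are discarded, as the coordinates
   must be real. *)
have {z z0 zx0 sol} [z [z0 zx0 sol zre]] : exists z : nat -> 'cV[R]_n -> C,
    [/\ forall y, z 0%N y = mu y - mu x0, forall i, (i < s)%N -> z i x0 = 0,
      solution c (ball x0 r') (shift_op (cx A) mu) (cx E) z s &
      b = false -> forall i y, complex.Im (z i y) = 0].
  have [bT|bF] := boolP b; first by exists z; split => //; rewrite ?bT ?z0.
  have [al muE] := mure (negbTE bF).
  exists (fun i x => (complex.Re (z i x))%:C%C); split => //.
  - by move=> y; rewrite z0 muE; apply: eq_ReIm; rewrite /= ?subrr.
  - by move=> i i_s; rewrite zx0.
  rewrite muE in sol *; apply: solution_re => // x _.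
  by rewrite z0 muE /= subrr.
have [rz Hz] := sol.
pose phi y := of_rd b (fun i => z i y) : 'cV[R]_n.
have rdphi p y : (p < s)%N -> rd b (phi y) p 0 0 = z p y.
  by move=> ps; apply: rd_of_rd ns ps _ => bF; exact: zre.
have rphi i : reg c (ball x0 r') (fun y => phi y i 0).
  have -> : (fun y => phi y i 0) = fun y => if b && odd i then complex.Im (z i./2 y)
      else complex.Re (z (if b then i./2 else i) y) by apply: funext => y; rewrite mxE.
  have := ltn_ord i; rewrite [X in (_ < X)%N]ns /rdim; case: (b) => /= h.
    have h2 : (i./2 < s)%N by rewrite ltn_half_double -mul2n.
    by case: (odd i); [exact: (rz _ h2).2|exact: (rz _ h2).1].
  exact: (rz _ h).1.
have gphi p x : ball x0 r' x -> (p < s)%N -> grad (z p) x = rd b (jacobian_mx phi x) p.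
  move=> xy ps; rewrite -(rd_grad b p rphi xy); congr grad.
  by apply: funext => y; rewrite rdphi.
exists r', phi; split => //.
  apply: (@rd_inj _ _ b s) => // p ps; apply/rowP => j; rewrite (ord1 j) rdphi // zx0 //.
  by rewrite /rd /nrow; case: (b); rewrite !mxE /=; do 2?case: insubP => [? _ _|_]; rewrite ?mxE /= ?mulr0 ?addr0.
have ch x : ball x0 r' x -> chain (cm (A x) - (rd b (phi x) 0%N 0 0 + mu0 b a0 b0)%:M)
    (rd b (jacobian_mx phi x)) (fun p => rd b (phi x) p 0 0) s.
  move=> xy; have [[c0 cS] _ _] := Hz x xy.
  rewrite rdphi // z0 -mux0 subrK -[cm (A x)]/(cx A x) -shift_opB.
  split; first by rewrite -gphi.
  by move=> i ik; rewrite -!gphi ?(ltnW ik) // cS // rdphi.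
split; first split => // x xy.
- apply: (@rd_inj _ _ b s) => // p ps.
  rewrite (rd_nform _ _ _ _ ns ps) rdM.
  exact: ((chain_nf _ _ _ _ s0).1 (ch x xy)).
- apply: (@rd_inj _ _ b s) => // p ps; rewrite rdM (rd_first ns ps) -gphi //.
  have [_ de He] := Hz x xy; case: p ps => [|p] ps; first by rewrite de.
  by rewrite He // raddf0.
move=> x xy; apply: (rd_unit ns (ch x xy)).
  rewrite -gphi //; have [_ de _] := Hz x xy.
  by apply: contra_eqN de => /eqP ->; rewrite mul0mx eq_sym oner_neq0.
move=> bT; rewrite rdphi // z0 -mux0 subrK; have [b0n im] := muim bT.
by have := im x (sub _ xy); apply: contraTN => /eqP ->; rewrite mul0r ltxx.
Qed.

(** In normal coordinates the differential dz_0 is a left eigenvector, so z_0 plus its constant is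
    an eigenvalue. In the complex case its imaginary part has the sign of [b0] near the point, hence
    it is [mu] and not the conjugate; this fixes z_0 and makes the z_i a solution. *)
Lemma chart_solution A E x0 s mu (r : R) phi : 0 < r -> spectral_data (ball x0 r) A E x0 s mu ->
  nf_chart (ball x0 r) A E phi -> phi x0 = 0 ->
  exists r' : R, [/\ 0 < r', r' <= r,
    solution c (ball x0 r') (shift_op (cx A) mu) (cx E) (fun p y => rd b (phi y) p 0 0) s &
    forall y, ball x0 r' y -> rd b (phi y) 0%N 0 0 + mu0 b a0 b0 = mu y].
Proof.
move=> r0 [s0 ns ld mux0 mure muim eig] [rphi nf fst] phi0.
have oB (q : R) : open (ball x0 q) by exact: ball_open.
have bx : ball x0 r x0 by exact: ballxx.
have rz p := rd_reg b p (oB r) rphi.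
have rd0 p : rd b (phi x0) p 0 0 = 0.
  by rewrite phi0 /rd /nrow; case: (b); rewrite !mxE /=; do 2?case: insubP => [? _ _|_]; rewrite ?mxE /= ?mulr0 ?addr0.
pose mu' y := rd b (phi y) 0%N 0 0 + mu0 b a0 b0.
have ch x : ball x0 r x -> chain (cm (A x) - (mu' x)%:M)
    (rd b (jacobian_mx phi x)) (fun p => rd b (phi x) p 0 0) s.
  move=> xy; apply/chain_nf => // p ps; rewrite -rdM -nf //.
  by rewrite (rd_nform _ _ _ _ ns ps).
have de x p : ball x0 r x -> (p < s)%N -> rd b (jacobian_mx phi x) p *m cx E x = (p == 0%N)%:R%:M.
  by move=> xy ps; rewrite -rdM fst // (rd_first ns ps).
have eig' x : ball x0 r x -> eigenvalue (cx A x) (mu' x).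
  move=> xy; apply/eigenvalueP; exists (rd b (jacobian_mx phi x) 0%N).
    have [/eqP c0 _] := ch x xy; move: c0; rewrite mulmxBr mul_mx_scalar subr_eq0 => /eqP.
    by [].
  by apply: contra_eqN (de x _ xy s0) => /eqP ->; rewrite mul0mx eq_sym oner_neq0.
have [r' [r'0 r'r Hmu]] : exists r' : R, [/\ 0 < r', r' <= r &
    forall y, ball x0 r' y -> mu' y = mu y].
  have [bT|bF] := boolP b; last first.
    by exists r; split => // y xy; apply: eig => //; [exact: eig'|rewrite (negbTE bF)].
  have [b0n _] := muim bT.
  have imx : 0 < complex.Im (mu' x0) * b0.
    by rewrite /mu' rd0 add0r /mu0 bT /= -expr2 exprn_even_gt0.
  have rmu' : regC c (ball x0 r) mu' by apply: regCD => //; exact: regC_const.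
  have ri : reg c (ball x0 r) (fun y => complex.Im (mu' y) * b0).
    by apply: regM => //; [exact: rmu'.2|exact: reg_const].
  have ni : nbhs x0 (ball x0 r `&` [set y | 0 < complex.Im (mu' y) * b0]).
    apply: filterI; first exact: open_nbhs_nbhs.
    apply: near_gt0 => //; apply: differentiable_continuous; exact: smooth_diff (reg_smooth ri) bx.
  have [r1 /= r10 b1] := (nbhs_ballP _ _).1 ni.
  exists (Num.min r r1); split; [by rewrite lt_min r0|by rewrite ge_min lexx|move=> y xy].
  have [yr yi] : (ball x0 r `&` [set y | 0 < complex.Im (mu' y) * b0]) y.
    by apply: b1; move: xy; apply: le_ball; rewrite ge_min lexx orbT.
  by apply: eig => //; exact: eig'.
have sub : ball x0 r' `<=` ball x0 r by exact: le_ball.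
exists r'; split => //; split=> [p ps|x xy]; first exact: regC_sub sub (rz p).
have xr := sub _ xy; have gE p := rd_grad b p rphi xr.
have [c0 cS] := ch x xr.
have NE : shift_op (cx A) mu x = cm (A x) - (mu' x)%:M by rewrite shift_opB Hmu.
split.
- rewrite NE; split; first by rewrite gE.
  by move=> i ik; rewrite !gE cS.
- by rewrite gE de.
by move=> i /andP[i0 ik]; rewrite gE de // (gtn_eqF i0) raddf0.
Qed.

Lemma chart_unique A E x0 s mu (r : R) phi1 phi2 : 0 < r -> spectral_data (ball x0 r) A E x0 s mu ->
  nf_chart (ball x0 r) A E phi1 -> phi1 x0 = 0 -> nf_chart (ball x0 r) A E phi2 -> phi2 x0 = 0 ->
  exists2 r' : R, 0 < r' & forall y, ball x0 r' y -> phi1 y = phi2 y.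
Proof.
move=> r0 sd nf1 p1 nf2 p2.
have [r1 [r10 r1r sol1 m1]] := chart_solution r0 sd nf1 p1.
have [r2 [r20 r2r sol2 m2]] := chart_solution r0 sd nf2 p2.
have ns := sd_n sd.
pose r3 := Num.min r1 r2; have r30 : 0 < r3 by rewrite lt_min r10.
have s1 : ball x0 r3 `<=` ball x0 r1 by apply: le_ball; rewrite ge_min lexx.
have s2 : ball x0 r3 `<=` ball x0 r2 by apply: le_ball; rewrite ge_min lexx orbT.
have s3 : ball x0 r3 `<=` ball x0 r by move=> y /s1; exact: le_ball.
have oB3 : open (ball x0 r3) by exact: ball_open.
have ld3 := local_data_sub oB3 s3 (sd_ld sd).
exists r3 => // y xy; apply: (@rd_inj _ _ b s) => // p ps; apply/rowP => j; rewrite (ord1 j).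
apply: (local_uniqueness r30 ld3 (solution_sub s1 sol1) (solution_sub s2 sol2)) => //.
  by move=> y' xy'; apply: (addIr (mu0 b a0 b0)); rewrite m1 ?m2 //; [exact: s2|exact: s1].
by move=> i _; rewrite p1 p2.
Qed.

End LocalChart.

(** * Charts *)

Section Charts.
Context {R : realType} {T : topologicalType} {n : nat}.
Implicit Types (u v : chart R T n) (q : T) (x : 'cV[R]_n).

Lemma chart_open u : open (cdom u). Proof. by case: u. Qed.
Lemma cimg_open u : open (cimg u). Proof. by case: u. Qed.
Lemma chartK u q : cdom u q -> cinv u (u q) = q. Proof. by case: u => /= ? ? ? ? ? H ? ?; exact: H. Qed.
Lemma chart_continuous u q : cdom u q -> {for q, continuous u}.
Proof. by case: u => /= ? ? ? ? ? ? H ?; exact: H. Qed.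
Lemma cinv_continuous u x : cimg u x -> {for x, continuous (cinv u)}.
Proof. by case: u => /= ? ? ? ? ? ? ? H; exact: H. Qed.

Lemma cimg_chart u q : cdom u q -> cimg u (u q). Proof. by move=> uq; exists q. Qed.

Lemma cinvK u x : cimg u x -> cdom u (cinv u x) /\ u (cinv u x) = x.
Proof. by move=> [q uq <-]; rewrite chartK. Qed.

Lemma chart_image_open u (O : set T) : open O -> open (u @` (O `&` cdom u)).
Proof.
move=> oO; rewrite openE => x [q [Oq uq] ux]; rewrite /interior.
have ix : cimg u x by exists q.
have nO : nbhs x (cinv u @^-1` O).
  by apply: (cinv_continuous ix); rewrite -ux chartK //; exact: open_nbhs_nbhs.
have nI : nbhs x (cimg u) by apply: open_nbhs_nbhs; split => //; exact: cimg_open.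
apply: filterS2 nO nI => y Oy iy; have [dy yE] := cinvK iy.
by exists (cinv u y).
Qed.

Lemma chart_preimage_open u (W : set 'cV[R]_n) : open W -> open (cdom u `&` u @^-1` W).
Proof.
move=> oW; rewrite openE => q [uq Wq]; rewrite /interior; apply: filterI.
  by apply: open_nbhs_nbhs; split => //; exact: chart_open.
by apply: (chart_continuous uq); exact: open_nbhs_nbhs.
Qed.

Lemma regular_mxE c U (F : 'cV[R]_n -> 'cV[R]_n) : open U ->
  regular_mx c U F <-> forall i, reg c U (fun x => F x i 0).
Proof.
move=> oU; split => H i; first by apply/regularE => //; exact: H.
by move=> j; rewrite (ord1 j); apply/regularE.
Qed.

End Charts.

(** * From functions in a chart to coordinate systems on the manifold *)

Section NewCoordinates.
Context {R : realType} {c : category} {n : nat} (M : manifold R c n).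

Lemma manifold_cover (q : M) : exists2 u : chart R M n, atlas u & cdom u q.
Proof. by case: M q => /= ? ? ? ? H ? q; exact: H. Qed.

Lemma atlas_coords (u : chart R M n) : atlas u -> coords u.
Proof. by case: M u => /= ? ? ? ? ? H u uA v vA; exact (H _ _ uA vA). Qed.

(* Compatibility with the atlas: the partial derivatives of psi are the entries of *)
(* (jacobian_mx phi)^-1 evaluated at psi, so [reg_flow] applies.                    *)
Lemma make_coords (u0 : chart R M n) (W : set 'cV[R]_n) (phi psi : 'cV[R]_n -> 'cV[R]_n) :
  coords u0 -> open W -> W `<=` cimg u0 -> (forall i, reg c W (fun y => phi y i 0)) ->
  open (phi @` W) -> (forall x, W x -> psi (phi x) = x) ->
  (forall x, W x -> jacobian_mx phi x \in unitmx) ->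
  (forall x i, W x -> differentiable (fun y => psi y i 0) (phi x)) ->
  (forall x i j, W x -> partial j (fun y => psi y i 0) (phi x) = invmx (jacobian_mx phi x) i j) ->
  exists v : chart R M n, [/\ coords v, cdom v = cdom u0 `&` u0 @^-1` W &
    forall q, v q = phi (u0 q)].
Proof.
move=> cu0 oW Wu rphi oI psiK uJ dpsi ppsi.
pose D := cdom u0 `&` u0 @^-1` W; pose f q := phi (u0 q); pose g x := cinv u0 (psi x).
have oD : open D by exact: chart_preimage_open.
have fD : f @` D = phi @` W.
  apply/seteqP; split=> y; first by move=> [q [_ Wq] <-]; exists (u0 q).
  move=> [x Wx <-]; have [dx xE] := cinvK (Wu x Wx).
  by exists (cinv u0 x); [split => //=; rewrite xE|rewrite /f xE].
have oID : open (f @` D) by rewrite fD.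
have gf q : D q -> g (f q) = q by move=> [dq Wq]; rewrite /g /f psiK // chartK.
have phic x : W x -> {for x, continuous phi}.
  move=> Wx; apply: continuous_coords => i; apply: differentiable_continuous.
  exact: smooth_diff (reg_smooth (rphi i)) Wx.
have fc q : D q -> {for q, continuous f}.
  move=> [dq Wq]; apply: continuous_comp; first exact: chart_continuous dq.
  exact: phic.
have gc y : (f @` D) y -> {for y, continuous g}.
  rewrite fD => -[x Wx <-]; apply: continuous_comp.
    by apply: continuous_coords => i; apply: differentiable_continuous; exact: dpsi.
  by rewrite psiK //; apply: cinv_continuous; exact: Wu.
pose v := @Chart R M n D f g oD oID gf fc gc.
exists v; split => // w wA.
have [tr1 tr2] := cu0 w wA.
have oO1 : open (u0 @` (cdom u0 `&` cdom w)) by rewrite setIC; apply: chart_image_open; exact: chart_open.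
have oO2 : open (w @` (cdom u0 `&` cdom w)) by apply: chart_image_open; exact: chart_open.
have r1 := (regular_mxE c (transition u0 w) oO1).1 tr1.
have r2 := (regular_mxE c (transition w u0) oO2).1 tr2.
have oV : open (v @` (cdom v `&` cdom w)).
  by rewrite setIC; apply: (chart_image_open (u := v)); exact: chart_open.
have oV2 : open (w @` (cdom v `&` cdom w)) by apply: chart_image_open.
have oX : open (u0 @` (D `&` cdom w)).
  have -> : D `&` cdom w = (D `&` cdom w) `&` cdom u0.
    by apply/seteqP; split => q; [move=> [[? ?] ?]|move=> []].
  by apply: chart_image_open; apply: openI => //; exact: chart_open.
split.
  apply/regular_mxE => // i.
  have XW : u0 @` (D `&` cdom w) `<=` W by move=> x [q [[_ Wq] _] <-].
  have rG j k : reg c (u0 @` (D `&` cdom w)) (fun z => invmx (jacobian_mx phi z) k j).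
    apply: reg_invmx => // [i' j'|x /XW]; last exact: uJ.
    have -> : (fun x => jacobian_mx phi x i' j') = partial j' (fun y => phi y i' 0).
      by apply: funext => x; rewrite mxE.
    by apply: reg_partial; exact: reg_sub XW (rphi i').
  have rH : reg c (u0 @` (D `&` cdom w)) (fun x => transition u0 w x i 0).
    by apply: reg_sub (r1 i) => x [q [[dq _] wq] <-]; exists q.
  have VE y : (v @` (cdom v `&` cdom w)) y -> exists2 q, (D `&` cdom w) q & y = phi (u0 q).
    by move=> [q Dq <-]; exists q.
  have psiV y : (v @` (cdom v `&` cdom w)) y -> (u0 @` (D `&` cdom w)) (psi y).
    by move=> /VE[q [[dq Wq] wq] ->]; rewrite psiK //; exists q.
  apply: (@reg_flow R n n c _ _ psi oV oX psiV (fun j k z => invmx (jacobian_mx phi z) k j)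
    _ _ (fun x => transition u0 w x i 0)) => //.
    by move=> k y /VE[q [[_ Wq] _] ->]; exact: dpsi.
  by move=> k j y /VE[q [[_ Wq] _] ->]; rewrite ppsi // psiK.
apply/regular_mxE => // i.
have WE y : (w @` (cdom v `&` cdom w)) y -> W (transition w u0 y).
  by move=> [q [[dq Wq] wq] <-]; rewrite /transition /= chartK.
have rT k : reg c (w @` (cdom v `&` cdom w)) (fun y => transition w u0 y k 0).
  by apply: reg_sub (r2 k) => x [q [[dq _] wq] <-]; exists q.
exact: (reg_comp oV2 oW WE rT (rphi i)).
Qed.

Lemma vcomp_reg (e : vector_field M) u : coords u -> regular_mx c (cimg u) (e u).
Proof. by case: e => /= f H _; exact: H. Qed.

Lemma vcomp_trans (e : vector_field M) u v q : coords u -> coords v -> cdom u q -> cdom v q ->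
  e v (v q) = jacobian_mx (transition u v) (u q) *m e u (u q).
Proof. by case: e => /= f _ H cu cv; exact: H. Qed.

Lemma ocomp_reg (L : operator_field M) u : coords u -> regular_mx c (cimg u) (L u).
Proof. by case: L => /= f H _; exact: H. Qed.

Lemma ocomp_trans (L : operator_field M) u v q : coords u -> coords v -> cdom u q -> cdom v q ->
  L v (v q) *m jacobian_mx (transition u v) (u q) = jacobian_mx (transition u v) (u q) *m L u (u q).
Proof. by case: L => /= f _ H cu cv; exact: H. Qed.

Lemma jacobian_near (f g : 'cV[R]_n -> 'cV[R]_n) x : (\forall y \near x, f y = g y) ->
  jacobian_mx f x = jacobian_mx g x.
Proof.
move=> fg; apply/matrixP => i j; rewrite !mxE; apply: partial_near.
by apply: filterS fg => y ->.
Qed.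

(** All data are read in one atlas chart [u0] around the point. Existence turns the local solution
    into a chart by the inverse function theorem; uniqueness compares the transition maps from [u0]
    to two normal coordinate systems. *)
Lemma normal_coordsP (b : bool) (a0 b0 : R) (L : operator_field M) (e : vector_field M) (p : M) :
  is_nijenhuis L -> is_unity L e -> gl_regular_field L -> algebraically_generic L p ->
  (b -> b0 != 0) -> at_point L p (has_spectrum^~ (spectrum_at b a0 b0)) ->
  (exists s, n = rdim b s) /\ unique_normal_coords L e p (nform b a0 b0).
Proof.
move=> nij uni regL [sigma gen] b0n sp.
have [u0 u0A u0p] := manifold_cover p; have cu0 := atlas_coords u0A.
pose x0 := u0 p; have ix0 : cimg u0 x0 by exact: cimg_chart.
have oI : open (cimg u0) by exact: cimg_open.
have rL i j : reg c (cimg u0) (fun y => L u0 y i j) by apply/regularE => //; exact: ocomp_reg.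
have rE i j : reg c (cimg u0) (fun y => e u0 y i j) by apply/regularE => //; exact: vcomp_reg.
have nseg : nbhs x0 (cimg u0 `&` [set x | has_segre (L u0 x) sigma]).
  have n1 : nbhs x0 (cimg u0) by exact: open_nbhs_nbhs.
  have n2 : nbhs x0 (cinv u0 @^-1` [set q | at_point L q (has_segre^~ sigma)]).
    by apply: (cinv_continuous ix0); rewrite /x0 chartK.
  apply: filterS2 n1 n2 => x ix /= H; split => //=.
  by have [dx xE] := cinvK ix; rewrite -[in L u0 x]xE; exact: H.
have [r /= r0 br] := (nbhs_ballP _ _).1 nseg.
have oB (q : R) : open (ball x0 q) by exact: ball_open.
have sub : ball x0 r `<=` cimg u0 by move=> x /br[].
have rLr i j := reg_sub sub (rL i j); have rEr i j := reg_sub sub (rE i j).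
have [s [mu [r1 [r10 r1r sd]]]] : exists s mu (r1 : R), [/\ 0 < r1, ball x0 r1 `<=` ball x0 r &
    spectral_data c b a0 b0 (ball x0 r1) (L u0) (e u0) x0 s mu].
  apply: (@spectral_dataP _ _ _ _ _ _ _ _ _ _ sigma) => //.
  - exact: ballxx.
  - by move=> x /sub ix; apply: (nijenhuis_bridge oI rL) => // X Y rX rY y iy; exact: nij.
  - by move=> x /sub ix; apply: (unity_bridge oI rL rE) => // X rX y iy; exact: uni.
  - by move=> x /sub[q dq <-]; exact: regL.
  - by move=> x /br[].
  - exact: sp.
split; first by exists s; exact: sd_n sd.
split.
  have [r2 [phi [r20 r2r phi0 [[rphi nf fst] uJ]]]] := local_chart r10 sd.
  have bx : ball x0 r2 x0 by exact: ballxx.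
  have [W [psi [oW Wx0 Wb oIW [psiK uJW dpsi ppsi]]]] :=
    inverse_function (oB r2) bx (fun i => reg_smooth (rphi i)) (uJ x0 bx).
  have Wu : W `<=` cimg u0.
    by move=> x /Wb xy; apply: sub; apply: r1r; move: xy; exact: le_ball.
  have [v [cv dv vE]] := make_coords cu0 oW Wu (fun i => reg_sub Wb (rphi i)) oIW psiK uJW dpsi ppsi.
  have JE x : W x -> jacobian_mx (transition u0 v) x = jacobian_mx phi x.
    move=> Wx; apply: jacobian_near; apply: filterS (open_nbhs_nbhs (conj oW Wx)) => y Wy.
    by rewrite /transition /= vE; have [_ ->] := cinvK (Wu y Wy).
  have dvq q : cdom v q -> cdom u0 q /\ W (u0 q) by rewrite dv.
  exists v; split => //.
  - by rewrite dv.
  - by rewrite vE.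
  - move=> _ [q vq <-]; have [dq Wq] := dvq q vq.
    by rewrite (vcomp_trans _ cu0 cv dq vq) JE // fst //; exact: Wb.
  move=> _ [q vq <-]; have [dq Wq] := dvq q vq.
  have := ocomp_trans L cu0 cv dq vq; rewrite JE // -nf; last exact: Wb.
  by rewrite vE => /(can_inj (mulmxK (uJW _ Wq))).
move=> u v [cu up u0' fu Nu] [cv vp v0' fv Nv].
(* Read in [u0], a normal coordinate system is a transition map, and the transformation laws of [L]
   and [e] become the equations of [nf_chart]. *)
have chartNF w : coords w -> cdom w p -> (forall x, cimg w x -> e w x = d_first) ->
    (forall x, cimg w x -> L w x = nform b a0 b0 x) ->
    exists2 O : set 'cV[R]_n, nbhs x0 O & O `<=` cimg u0 /\
      (forall V, V `<=` O -> nf_chart c b a0 b0 V (L u0) (e u0) (transition u0 w)).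
  move=> cw wp fw Nw; exists (u0 @` (cdom w `&` cdom u0)).
    by apply: open_nbhs_nbhs; split; [apply: chart_image_open; exact: chart_open|exists p].
  split=> [x [q [_ dq] <-]|V VO]; first exact: cimg_chart.
  have [_ tr] := cw u0 u0A.
  have oO : open (u0 @` (cdom w `&` cdom u0)) by apply: chart_image_open; exact: chart_open.
  have rT := (regular_mxE c (transition u0 w) oO).1 tr.
  split=> [i|x /VO[q [wq dq] <-]|x /VO[q [wq dq] <-]]; first exact: reg_sub VO (rT i).
    rewrite -(ocomp_trans L cu0 cw dq wq) /transition /= chartK // Nw //; exact: cimg_chart.
  by rewrite -(vcomp_trans e cu0 cw dq wq) fw //; exact: cimg_chart.
have [Ou nOu [_ NFu]] := chartNF u cu up fu Nu.
have [Ov nOv [_ NFv]] := chartNF v cv vp fv Nv.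
have nO : nbhs x0 (Ou `&` Ov `&` ball x0 r1).
  by apply: filterI; [exact: filterI|apply: open_nbhs_nbhs; split => //; exact: ballxx].
have [r3 /= r30 b3] := (nbhs_ballP _ _).1 nO.
have b31 : ball x0 r3 `<=` ball x0 r1 by move=> x /b3[].
have sd3 : spectral_data c b a0 b0 (ball x0 r3) (L u0) (e u0) x0 s mu.
  case: sd => h1 h2 h3 h4 h5 h6 h7; split => //.
  - exact: local_data_sub (oB r3) b31 h3.
  - by move=> /h6[h8 h9]; split => // x /b31; exact: h9.
  - by move=> x w /b31; exact: h7.
have t0 w : coords w -> w p = 0 -> transition u0 w x0 = 0 by move=> _ wp; rewrite /transition /= chartK.
have [r4 r40 eq4] := chart_unique r30 sd3
  (NFu _ (fun x bx => (b3 x bx).1.1)) (t0 u cu u0') (NFv _ (fun x bx => (b3 x bx).1.2)) (t0 v cv v0').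
have n1 : nbhs p (cdom u0) by apply: open_nbhs_nbhs; split => //; exact: chart_open.
have n2 : nbhs p (u0 @^-1` ball x0 r4).
  by apply: (chart_continuous u0p); exact: nbhsx_ballx.
apply: filterS2 n1 n2 => q dq /eq4.
by rewrite /transition /= chartK.
Qed.

End NewCoordinates.

Theorem theorem2p2 (R : realType) (c : category) (n : nat) (M : manifold R c n)
    (L : operator_field M) (e : vector_field M) (p : M)
    (nijL : is_nijenhuis L) (unit_e : is_unity L e)
    (regL : gl_regular_field L) (genp : algebraically_generic L p) :
  (forall lambda0 : R,
     at_point L p (fun A => has_spectrum A [:: (lambda0 +i* 0)%C]) ->
     unique_normal_coords L e p (real_normal_form lambda0))
  /\
  (forall a0 b0 : R, b0 != 0 ->
     at_point L p (fun A => has_spectrum A [:: (a0 +i* b0)%C; (a0 -i* b0)%C]) ->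
     exists2 s : nat, n = (2 * s)%N &
       unique_normal_coords L e p (complex_normal_form a0 b0)).
Proof.
split=> [lambda0 sp|a0 b0 b0n sp].
  (* In the real case the condition on [b0] is vacuous, so 0 is supplied. *)
  by have [] := @normal_coordsP R c n M false lambda0 0 L e p nijL unit_e regL genp (fun h => False_ind _ (notF h)) sp.
by have [[s ns] H] := @normal_coordsP R c n M true a0 b0 L e p nijL unit_e regL genp (fun _ => b0n) sp; exists s.
Qed.
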